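(* (i) Let $\Lambda$ be a selfdual lattice of rank $24$ with $\sigma(\Lambda)=16$. Then for every $m=2\cdot4^a$ ($a\ge0$), each of the shells $\Lambda_m$ and $\mathrm{Sh}(\Lambda)_m$ that is nonempty is a spherical $3$-design. (ii) Let $\Lambda=\mathbb Z^3\oplus W_8$. Then for every $m=4^a(8b+7)$ ($a,b\ge0$), the shell $\Lambda_m$ is a spherical $3$-design.
   Context: A selfdual lattice is an integral lattice equal to its dual. Shadow: $\mathrm{Sh}(\Lambda)=\Lambda$ if $\Lambda$ is even; otherwise $\mathrm{Sh}(\Lambda)=\Lambda_0^\sharp\setminus\Lambda$ where $\Lambda_0$ is the sublattice of vectors of even norm. $\sigma(\Lambda)=4\min\{\langle x,x\rangle:x\in\mathrm{Sh}(\Lambda)\}$. Shell $A_m=\{x\in A:\langle x,x\rangle=m\}$. $\mathbb Z^3$ is the cubic lattice and $W_8=\{x\in\mathbb R^8:2x_i\in\mathbb Z,\ x_i-x_1\in\mathbb Z,\ \sum x_i\in2\mathbb Z\}$. A nonempty finite antipodal set $X$ on a sphere centred at $0$ is a spherical $3$-design iff $\sum_{x\in X}P(x)=0$ for every homogeneous harmonic polynomial $P$ of degree $2$. *)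

(* Defs.v *)
From HB Require Import structures.
From mathcomp Require Import all_boot all_order all_algebra.
From mathcomp Require Import boolp classical_sets cardinality fsbigop reals.
From mathcomp Require Import mpoly.
Set Implicit Arguments. Unset Strict Implicit. Unset Printing Implicit Defensive.
Import Order.TTheory GRing.Theory Num.Theory.
Local Open Scope classical_set_scope.
Local Open Scope ring_scope.

Section Lattices.
Variable R : realType.
Variable n : nat.
Notation vec := 'rV[R]_n.

Definition dot (x y : vec) : R := \sum_(i < n) x ord0 i * y ord0 i.

Definition is_lattice (L : set vec) : Prop :=
  exists B : 'M[R]_n, B \in unitmx /\
    L = [set x | exists c : 'rV[int]_n, x = map_mx (fun z : int => z%:~R) c *m B].

Definition integral (L : set vec) : Prop :=
  forall x y, L x -> L y -> dot x y \is a Num.int.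

Definition dual (L : set vec) : set vec :=
  [set y | forall x, L x -> dot x y \is a Num.int].

Definition selfdual_lattice (L : set vec) : Prop :=
  is_lattice L /\ integral L /\ L = dual L.

Definition even_norm (x : vec) : Prop := (dot x x / 2) \is a Num.int.

Definition even_lattice (L : set vec) : Prop := forall x, L x -> even_norm x.

Definition even_sublattice (L : set vec) : set vec := [set x | L x /\ even_norm x].

Definition shadow (L : set vec) : set vec :=
  if `[< even_lattice L >] then L else dual (even_sublattice L) `\` L.

Definition sigma_is (L : set vec) (s : R) : Prop :=
  (exists x, shadow L x /\ 4 * dot x x = s) /\
  (forall x, shadow L x -> s <= 4 * dot x x).

Definition shell (A : set vec) (m : R) : set vec := [set x | A x /\ dot x x = m].

Definition peval (P : {mpoly R[n]}) (x : vec) : R :=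
  P.@[fun i => x ord0 i].

Definition harmonic2 (P : {mpoly R[n]}) : Prop :=
  P \is 2.-homog /\
  \sum_(i < n) mderiv i (mderiv i P) = 0.

(** Spherical 3-design for a nonempty finite antipodal set on a sphere
    centred at 0 (characterisation given in the paper). *)
Definition spherical_3design (X : set vec) : Prop :=
  X !=set0 /\ finite_set X /\ (forall x, X x -> X (- x)) /\
  (exists r : R, forall x, X x -> dot x x = r) /\
  (forall P, harmonic2 P -> \sum_(x \in X) peval P x = 0).

End Lattices.

Definition Zlat (R : realType) (k : nat) : set 'rV[R]_k :=
  [set x | forall i, x ord0 i \is a Num.int].

Definition W8 (R : realType) : set 'rV[R]_8 :=
  [set x | (forall i, 2 * x ord0 i \is a Num.int) /\
           (forall i, x ord0 i - x ord0 ord0 \is a Num.int) /\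
           ((\sum_(i < 8) x ord0 i) / 2 \is a Num.int)].

Definition Z3W8 (R : realType) : set 'rV[R]_(3 + 8) :=
  [set x | @Zlat R 3 (lsubmx x) /\ @W8 R (rsubmx x)].

(* Main.v *)
(** Part (i).  In an even unimodular lattice of rank 24 with an orthogonal frame
    [a_i], the weighted theta series with weight [(x, a_i) (x, a_j)], [i <> j], is
    a cusp form of weight 14, hence its coefficient at norm 2 vanishes.  This is
    proved on the arc [exp (i phi)], [|phi| <= pi / 6], of the fundamental domain:
    Poisson summation gives [Re (a f / eta ^ 24) = 0] there ([a = exp (i phi)]),
    and integrating over the arc isolates the coefficient.  Changing the frame,
    all norm 2 shells are designs.  Double counting over the 2-neighbours of a
    lattice yields a Hecke-type recursion from norm [m] to [4 m]; it is applied to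
    all even unimodular lattices and to the even sublattice of [Lambda], whose
    dual is the union of [Lambda] and its shadow.

    Part (ii).  By symmetry only the polynomial [8 |x|^2 - 3 |y|^2] matters.  With
    [A], [B] the theta series of the even and odd integers, [s = A + B] and
    [t = A - B], its generating series is
    [24 s^3 t^4 (2 t^4 - s^4) A B (A^2 + B^2)].  The terms with exponent 3 mod 4
    are even in [B^4] up to the factor [B^3], so exponents 7 mod 8 do not occur,
    and the terms with exponent 0 mod 4 reproduce the series in [q^4], times 64. *)

(* An orthogonal frame inside the lattice makes it a finite union of cosets of an orthogonal sum of
   rank 1 lattices. Characters cut out these cosets, sums over boxes in frame coordinates factor,
   and Poisson summation is applied in one variable at a time. On the unit circle [1/a] is the
   conjugate of [a], so it relates a theta value to its own conjugate. The Gaussian integral [K]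
   stays symbolic: [f] and [eta ^ 24] both pick up [K ^ 24], and what remains is a factor [k > 0];
   from [u = - k u] follows [u = 0]. The quotient is a uniform limit of polynomials in [q], whose
   constant coefficient is an integer, so a bound below 1 makes it vanish. Only this integer
   identity leaves the analysis, which lives on one model of the reals, whereas the theorem is about
   every [realType]. The recursion uses the norms [m] and [m / 4] to reach [4 m]. For the even
   sublattice it starts because [sigma = 16] keeps the shadow at norm 4 or more: at norm 2 the
   sublattice has the same shell as an even unimodular lattice containing it. In part (ii) the
   shells must also be nonempty, which rests on the four-square theorem. *)
From Stdlib Require Reals.
From Stdlib Require Lra.
From Stdlib Require Lia.
From Stdlib Require ZArith.
From Coquelicot Require Coquelicot.

(** * Fourier uniqueness at one point, by powers of a peaked trigonometric polynomial *)

Module FourierUniqueness.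
From Stdlib Require Import Reals Lra Lia ZArith.
From Coquelicot Require Import Coquelicot.
Open Scope R_scope.

Lemma ex_RInt_cont (f : R -> R) a b : a <= b ->
  (forall u, a <= u <= b -> continuous f u) -> ex_RInt f a b.
Proof.
intros hab h; apply (ex_RInt_continuous (V := R_CompleteNormedModule)).
now rewrite Rmin_left, Rmax_right by lra.
Qed.

Lemma continuous_cos_lin w u : continuous (fun x => cos (w * x)) u.
Proof.
apply (ex_derive_continuous (V := R_NormedModule)); auto_derive; auto.
Qed.

(** This is [cos (pi u) ^ 2]. On the period [[-1/2, 1/2]] it is nonnegative and decreases in [|u|]
    from its maximum 1 at 0, so its powers concentrate at 0 while remaining trigonometric
    polynomials. *)
Definition hat (u : R) : R := (1 + cos (2 * PI * u)) / 2.

Lemma continuous_hat u : continuous hat u.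
Proof. apply (ex_derive_continuous (V := R_NormedModule)); unfold hat; auto_derive; auto. Qed.

Lemma continuous_hat_pow N u : continuous (fun x => hat x ^ N) u.
Proof.
apply (ex_derive_continuous (V := R_NormedModule)); unfold hat; auto_derive; auto.
Qed.

(** A factor [hat] only shifts frequencies: [hat u * cos (2 pi n u)] is half of the frequency [n]
    plus a quarter of each of [n + 1] and [n - 1]. The claim for all [n] at once is therefore stable
    under [N -> N + 1]. *)
Lemma hat_moments (D : R -> R) :
  (forall n : Z, is_RInt (fun u => D u * cos (2 * PI * IZR n * u)) (- / 2) (/ 2) 0) ->
  forall N (n : Z),
  is_RInt (fun u => D u * hat u ^ N * cos (2 * PI * IZR n * u)) (- / 2) (/ 2) 0.
Proof.
intros H N; induction N as [|N IH]; intros n.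
- apply is_RInt_ext with (2 := H n); intros x _; simpl; ring.
- assert (K := is_RInt_plus _ _ _ _ _ _ (is_RInt_scal _ _ _ (/ 2) _ (IH n))
    (is_RInt_scal _ _ _ (/ 4) _ (is_RInt_plus _ _ _ _ _ _ (IH (n + 1)%Z) (IH (n - 1)%Z)))).
  replace (0 : R) with (plus (scal (/ 2) 0) (scal (/ 4) (plus 0 0)) : R)
    by (unfold plus, scal; simpl; unfold mult; simpl; ring).
  apply is_RInt_ext with (2 := K); intros x _.
  unfold plus, scal; simpl; unfold mult; simpl.
  rewrite plus_IZR, minus_IZR.
  replace (2 * PI * (IZR n + 1) * x) with (2 * PI * IZR n * x + 2 * PI * x) by ring.
  replace (2 * PI * (IZR n - 1) * x) with (2 * PI * IZR n * x - 2 * PI * x) by ring.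
  rewrite cos_plus, cos_minus; unfold hat; field.
Qed.

Lemma hat_le u v : 0 <= u <= Rabs v -> Rabs v <= / 2 -> hat v <= hat u.
Proof.
intros hu hv; unfold hat.
assert (cos (2 * PI * v) <= cos (2 * PI * u)); [|lra].
replace (cos (2 * PI * v)) with (cos (2 * PI * Rabs v)).
- pose proof PI_RGT_0; apply cos_decr_1; nra.
- unfold Rabs; destruct (Rcase_abs v); auto.
  replace (2 * PI * - v) with (- (2 * PI * v)) by ring; apply cos_neg.
Qed.

Lemma hat_ge0 u : 0 <= hat u.
Proof. unfold hat; pose proof (COS_bound (2 * PI * u)); lra. Qed.

Lemma bounded_on (f : R -> R) a b : a <= b ->
  (forall u, a <= u <= b -> continuous f u) ->
  exists M, 0 < M /\ forall u, a <= u <= b -> Rabs (f u) <= M.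
Proof.
intros hab hc.
destruct (continuity_ab_maj (fun x => Rabs (f x)) a b hab) as [m [hm _]].
- intros c hcab; apply continuity_pt_filterlim.
  apply (continuous_comp f Rabs); [now apply hc | apply continuous_Rabs].
- exists (Rabs (f m) + 1); split; [pose proof (Rabs_pos (f m)); lra|].
  intros u hu; pose proof (hm u hu); simpl in *; lra.
Qed.

Lemma pow_ratio_absurd A B p q : 0 < A -> 0 < q -> q < p -> (forall N : nat, A * p ^ N <= B * q ^ N) -> False.
Proof.
intros hA hq hpq H.
destruct (Pow_x_infinity (p / q)) with (b := B / A + 1) as [N hN].
- rewrite Rabs_right; [|apply Rle_ge, Rlt_le, Rdiv_lt_0_compat; lra].
  apply Rmult_lt_reg_r with q; auto; field_simplify; lra.
- specialize (hN N (Nat.le_refl _)); specialize (H N).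
  assert (0 < q ^ N) by (apply pow_lt; auto).
  rewrite Rabs_right in hN; [|apply Rle_ge, pow_le, Rlt_le, Rdiv_lt_0_compat; lra].
  unfold Rdiv in hN at 1; rewrite Rpow_mult_distr, pow_inv in hN.
  assert (B / A + 1 <= B / A); [|lra].
  apply Rle_trans with (p ^ N * / q ^ N); [lra|].
  apply Rmult_le_reg_r with (A * q ^ N); [nra|].
  replace (p ^ N * / q ^ N * (A * q ^ N)) with (A * p ^ N) by (field; lra).
  replace (B / A * (A * q ^ N)) with (B * q ^ N) by (field; lra); auto.
Qed.

(** Near 0, for [|u| <= e], [D] is at least [D 0 / 2]. In the vanishing integral of [D * hat ^ N]
    the part [|u| <= e / 2] gains a multiple of [hat (e / 2) ^ N], and the rest loses at most a
    multiple of [hat e ^ N]; as [hat e < hat (e / 2)], this fails for large [N]. Continuity is asked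
    on [|u| < 1] so that both ends of the period are interior points. *)
Lemma fourier_unique_pos (D : R -> R) :
  (forall u, Rabs u < 1 -> continuous D u) ->
  (forall n : Z, is_RInt (fun u => D u * cos (2 * PI * IZR n * u)) (- / 2) (/ 2) 0) ->
  0 < D 0 -> False.
Proof.
intros hD H D0.
assert (Hc : forall u, - / 2 <= u <= / 2 -> continuous D u)
  by (intros; apply hD; apply Rabs_def1; lra).
destruct (bounded_on D (- / 2) (/ 2)) as [M [M0 hM]]; [lra|auto|].
destruct (proj1 (filterlim_locally (F := locally 0) D (D 0)) (hD 0 ltac:(rewrite Rabs_R0; lra))
  (mkposreal (D 0 / 2) ltac:(lra))) as [[d hd] Hd].
(* The bound 1/8 keeps [2 pi e] in the range where the cosine is positive and decreasing. *)
set (e := Rmin (d / 2) (/ 8)).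
assert (he : 0 < e) by (unfold e; apply Rmin_glb_lt; simpl in *; lra).
assert (he2 : e <= / 8) by apply Rmin_r.
assert (hed : e < d) by (pose proof (Rmin_l (d / 2) (/ 8)); unfold e in *; simpl in *; lra).
assert (hDe : forall u, Rabs u <= e -> D 0 / 2 <= D u).
{ intros u hu; assert (K : ball (D 0) (D 0 / 2) (D u)).
  { apply Hd; unfold ball; simpl; unfold AbsRing_ball, abs, minus, plus, opp; simpl.
    rewrite Ropp_0, Rplus_0_r; lra. }
  unfold ball in K; simpl in K; unfold AbsRing_ball, abs, minus, plus, opp in K; simpl in K.
  apply Rabs_def2 in K; lra. }
pose proof PI_RGT_0.
assert (hq : 0 < hat e).
{ unfold hat; assert (0 < cos (2 * PI * e)); [|lra].
  apply cos_gt_0; nra. }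
assert (hpq : hat e < hat (e / 2)).
{ unfold hat; assert (cos (2 * PI * e) < cos (2 * PI * (e / 2))); [|lra].
  apply cos_decreasing_1; nra. }
apply (pow_ratio_absurd (e * (D 0 / 2)) M (hat (e / 2)) (hat e)); auto; [nra|].
intros N.
assert (I0 := hat_moments D H N 0%Z).
apply is_RInt_ext with (g := fun u => D u * hat u ^ N) in I0.
2:{ intros; rewrite Rmult_0_r, Rmult_0_l, cos_0; simpl; ring. }
assert (cf : forall u, - / 2 <= u <= / 2 -> continuous (fun u => D u * hat u ^ N) u).
{ intros; apply (continuous_mult D (fun u => hat u ^ N)); [auto|apply continuous_hat_pow]. }
assert (qN : 0 < hat e ^ N) by (now apply pow_lt).
assert (low : forall u, - / 2 <= u <= / 2 -> - (M * hat e ^ N) <= D u * hat u ^ N).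
{ intros u hu; pose proof (pow_le _ N (hat_ge0 u)).
  destruct (Rle_dec (Rabs u) e) as [h|h].
  - pose proof (hDe u h); nra.
  - assert (hat u ^ N <= hat e ^ N).
    { apply pow_incr; split; [apply hat_ge0|apply hat_le; [lra|]].
      apply Rabs_le; lra. }
    pose proof (hM u hu) as hMu; apply Rabs_le_between in hMu; nra. }
assert (J1 : - (M * hat e ^ N) * (/ 2 - e / 2) <= RInt (fun u => D u * hat u ^ N) (- / 2) (- (e / 2))).
{ replace (- (M * hat e ^ N) * (/ 2 - e / 2)) with (RInt (fun _ => - (M * hat e ^ N)) (- / 2) (- (e / 2)))
    by (rewrite RInt_const; unfold scal; simpl; unfold mult; simpl; field).
  apply RInt_le; [lra|apply ex_RInt_const|apply ex_RInt_cont; [lra|intros; apply cf; lra]|].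
  intros; apply low; lra. }
assert (J3 : - (M * hat e ^ N) * (/ 2 - e / 2) <= RInt (fun u => D u * hat u ^ N) (e / 2) (/ 2)).
{ replace (- (M * hat e ^ N) * (/ 2 - e / 2)) with (RInt (fun _ => - (M * hat e ^ N)) (e / 2) (/ 2))
    by (rewrite RInt_const; unfold scal; simpl; unfold mult; simpl; field).
  apply RInt_le; [lra|apply ex_RInt_const|apply ex_RInt_cont; [lra|intros; apply cf; lra]|].
  intros; apply low; lra. }
assert (J2 : D 0 / 2 * hat (e / 2) ^ N * e <= RInt (fun u => D u * hat u ^ N) (- (e / 2)) (e / 2)).
{ replace (D 0 / 2 * hat (e / 2) ^ N * e) with (RInt (fun _ => D 0 / 2 * hat (e / 2) ^ N) (- (e / 2)) (e / 2))
    by (rewrite RInt_const; unfold scal; simpl; unfold mult; simpl; field).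
  apply RInt_le; [lra|apply ex_RInt_const|apply ex_RInt_cont; [lra|intros; apply cf; lra]|].
  intros u hu.
  assert (hau : Rabs u <= e / 2) by (apply Rabs_le; lra).
  pose proof (hDe u ltac:(lra)).
  assert (hat (e / 2) ^ N <= hat u ^ N).
  { apply pow_incr; split; [apply hat_ge0|].
    replace (hat u) with (hat (Rabs u)).
    - apply hat_le; rewrite (Rabs_right (e / 2)) by lra; [split; [apply Rabs_pos|lra]|lra].
    - unfold hat, Rabs; destruct (Rcase_abs u); auto.
      replace (2 * PI * - u) with (- (2 * PI * u)) by ring; now rewrite cos_neg. }
  pose proof (pow_le _ N (hat_ge0 (e / 2))); nra. }
apply (is_RInt_unique (V := R_CompleteNormedModule)) in I0.
rewrite <- (RInt_Chasles _ (- / 2) (- (e / 2)) (/ 2)) in I0;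
  [|apply ex_RInt_cont; [lra|intros; apply cf; lra]
   |apply ex_RInt_cont; [lra|intros; apply cf; lra]].
rewrite <- (RInt_Chasles _ (- (e / 2)) (e / 2) (/ 2)) in I0;
  [|apply ex_RInt_cont; [lra|intros; apply cf; lra]
   |apply ex_RInt_cont; [lra|intros; apply cf; lra]].
unfold plus in I0; simpl in I0.
assert (e * (M * hat e ^ N) >= 0) by (apply Rle_ge, Rmult_le_pos; nra).
nra.
Qed.

(** Cosines suffice: the odd part of [D], which they do not see, vanishes at 0 anyway. *)
Lemma fourier_unique (D : R -> R) :
  (forall u, Rabs u < 1 -> continuous D u) ->
  (forall n : Z, is_RInt (fun u => D u * cos (2 * PI * IZR n * u)) (- / 2) (/ 2) 0) ->
  D 0 = 0.
Proof.
intros hD H.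
destruct (Rtotal_order (D 0) 0) as [h|[h|h]]; auto; exfalso.
- apply (fourier_unique_pos (fun u => - D u)); [| |lra].
  + intros; apply (continuous_opp D); auto.
  + intros n; assert (K := is_RInt_opp _ _ _ _ (H n)).
    replace (0 : R) with (opp 0 : R) by (unfold opp; simpl; ring).
    apply is_RInt_ext with (2 := K); intros; unfold opp; simpl; ring.
- now apply (fourier_unique_pos D).
Qed.
End FourierUniqueness.

(** * Poisson summation in cosine form for functions of exponential decay *)

Module PoissonSummation.
From Stdlib Require Import Reals Lra Lia ZArith.
From Coquelicot Require Import Coquelicot.
Import FourierUniqueness.
Open Scope R_scope.

(** Pairing [k] with [- k] makes the partial sums range over [|k| <= K], the same windows as the
    boxes used for lattices later. *)
Fixpoint ssum (f : Z -> R) (K : nat) : R :=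
  match K with
  | O => f 0%Z
  | S K' => ssum f K' + (f (Z.of_nat K) + f (- Z.of_nat K)%Z)
  end.

Definition Ssum (f : Z -> R) : R := real (Lim_seq (ssum f)).

Definition geom_bd (f : Z -> R) (C r : R) : Prop :=
  0 <= C /\ 0 < r < 1 /\ forall k : nat, Rabs (f (Z.of_nat k)) <= C * r ^ k /\ Rabs (f (- Z.of_nat k)%Z) <= C * r ^ k.

Lemma ssum_ext f g K : (forall k, f k = g k) -> ssum f K = ssum g K.
Proof. intros H; induction K; simpl; rewrite ?IHK, ?H; auto. Qed.

Lemma ssum_plus f g K : ssum (fun k => f k + g k) K = ssum f K + ssum g K.
Proof. induction K; simpl; rewrite ?IHK; lra. Qed.

Lemma ssum_scal c f K : ssum (fun k => c * f k) K = c * ssum f K.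
Proof. induction K; simpl; rewrite ?IHK; lra. Qed.

Lemma ssum_tail f C r : geom_bd f C r -> forall K p,
  Rabs (ssum f (K + p) - ssum f K) <= 2 * C / (1 - r) * r ^ K.
Proof.
intros [hC [hr H]] K p.
(* The factor [1 - r ^ p] records the partial geometric sum, so that the induction on [p] closes. *)
assert (Hp : Rabs (ssum f (K + p) - ssum f K) <= 2 * C / (1 - r) * r ^ K * (1 - r ^ p)).
{ induction p as [|p IH].
  - rewrite Nat.add_0_r, Rminus_diag_eq, Rabs_R0 by auto; simpl; lra.
  - rewrite Nat.add_succ_r; cbn [ssum].
    destruct (H (S (K + p))) as [h1 h2].
    replace (ssum f (K + p) + (f (Z.of_nat (S (K + p))) + f (- Z.of_nat (S (K + p)))%Z) - ssum f K)
      with ((ssum f (K + p) - ssum f K) + (f (Z.of_nat (S (K + p))) + f (- Z.of_nat (S (K + p)))%Z)) by ring.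
    eapply Rle_trans; [apply Rabs_triang|].
    pose proof (Rabs_triang (f (Z.of_nat (S (K + p)))) (f (- Z.of_nat (S (K + p)))%Z)).
    assert (r ^ S (K + p) = r * r ^ K * r ^ p) as E by (simpl; rewrite pow_add; ring).
    rewrite E in *.
    assert (0 < r ^ K * r ^ p) by (apply Rmult_lt_0_compat; apply pow_lt; lra).
    assert (E2 : 2 * C / (1 - r) * r ^ K * (1 - r ^ S p) = 2 * C / (1 - r) * r ^ K * (1 - r ^ p) + 2 * (C * (r ^ K * r ^ p))).
    { simpl; field; lra. }
    rewrite E2.
    assert (C * (r * r ^ K * r ^ p) <= C * (r ^ K * r ^ p)).
    { apply Rmult_le_compat_l; auto. rewrite Rmult_assoc. nra. }
    lra. }
eapply Rle_trans; [exact Hp|].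
assert (0 < r ^ p) by (apply pow_lt; lra).
assert (0 <= 2 * C / (1 - r) * r ^ K).
{ apply Rmult_le_pos; [apply Rmult_le_pos; [lra|apply Rlt_le, Rinv_0_lt_compat; lra]|apply pow_le; lra]. }
nra.
Qed.

Lemma geom_lim0 A r : 0 < r < 1 -> is_lim_seq (fun K => A * r ^ K) 0.
Proof.
intros hr; replace (Finite 0) with (Rbar_mult A 0) by (simpl; f_equal; ring).
apply (is_lim_seq_scal_l (fun K => r ^ K)), is_lim_seq_geom; rewrite Rabs_right; lra.
Qed.

Lemma ssum_cv f C r : geom_bd f C r -> is_lim_seq (ssum f) (Ssum f).
Proof.
intros H; pose proof (ssum_tail f C r H) as T.
assert (E : ex_finite_lim_seq (ssum f)).
{ apply ex_lim_seq_cauchy_corr; intros eps.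
  destruct H as [hC [hr H]].
  destruct (proj2 (is_lim_seq_spec _ _) (geom_lim0 (2 * C / (1 - r)) r hr) (mkposreal (eps / 2) ltac:(destruct eps; simpl; lra))) as [N hN].
  exists N; intros n m hn hm.
  assert (hh : forall n, (N <= n)%nat -> Rabs (ssum f n - ssum f N) < eps / 2).
  { intros k hk; replace k with (N + (k - N))%nat by lia.
    eapply Rle_lt_trans; [apply T|].
    specialize (hN N (Nat.le_refl _)); simpl in hN; rewrite Rminus_0_r in hN.
    eapply Rle_lt_trans; [apply Rle_abs|exact hN]. }
  pose proof (hh n hn) as a1; pose proof (hh m hm) as a2.
  apply Rabs_def2 in a1; apply Rabs_def2 in a2; apply Rabs_def1; lra. }
destruct E as [l hl]; unfold Ssum; now rewrite (is_lim_seq_unique _ _ hl).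
Qed.

Lemma Ssum_tail f C r : geom_bd f C r -> forall K,
  Rabs (Ssum f - ssum f K) <= 2 * C / (1 - r) * r ^ K.
Proof.
intros H K; pose proof (ssum_tail f C r H) as T; pose proof (ssum_cv f C r H) as L.
apply (is_lim_seq_incr_n _ K) in L.
assert (L2 : is_lim_seq (fun p => Rabs (ssum f (p + K) - ssum f K)) (Rabs (Ssum f - ssum f K))).
{ apply (is_lim_seq_abs _ (Finite (Ssum f - ssum f K))).
  apply is_lim_seq_minus'; [exact L|apply is_lim_seq_const]. }
apply (is_lim_seq_le _ _ (Finite (Rabs (Ssum f - ssum f K))) (Finite (2 * C / (1 - r) * r ^ K))) with (2 := L2) (3 := is_lim_seq_const _).
intros p; rewrite Nat.add_comm; apply T.
Qed.

Section Uniform.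
Variables (F : nat -> R -> R) (f : R -> R) (e : nat -> R).
Hypothesis he : is_lim_seq e 0.
Hypothesis hF : forall K u, Rabs u < 1 -> continuous (F K) u.
Hypothesis hu : forall K u, Rabs u < 1 -> Rabs (f u - F K u) <= e K.

Lemma unif_cont u : Rabs u < 1 -> continuous f u.
Proof.
intros hu1; apply filterlim_locally; intros eps.
destruct (proj2 (is_lim_seq_spec _ _) he (mkposreal (eps / 4) ltac:(destruct eps; simpl; lra))) as [N hN].
specialize (hN N (Nat.le_refl _)); simpl in hN; rewrite Rminus_0_r in hN.
assert (eN : e N < eps / 4) by (eapply Rle_lt_trans; [apply Rle_abs|exact hN]).
assert (C := proj1 (filterlim_locally (F := locally u) (F N) (F N u)) (hF N u hu1) (mkposreal (eps / 4) ltac:(destruct eps; simpl; lra))).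
assert (O : locally u (fun x => Rabs x < 1)).
{ assert (hd : 0 < 1 - Rabs u) by lra.
  exists (mkposreal _ hd); intros y hy.
  unfold ball in hy; simpl in hy; unfold AbsRing_ball, abs, minus, plus, opp in hy; simpl in hy.
  replace y with ((y + - u) + u) by ring; eapply Rle_lt_trans; [apply Rabs_triang|lra]. }
generalize (filter_and _ _ C O); apply filter_imp; intros y [h1 h2].
unfold ball in *; simpl in *; unfold AbsRing_ball, abs, minus, plus, opp in *; simpl in *.
pose proof (hu N u hu1) as a1; pose proof (hu N y h2) as a2.
apply Rabs_le_between in a1; apply Rabs_le_between in a2; apply Rabs_def2 in h1.
destruct eps as [eps heps]; simpl in *.
apply Rabs_def1; lra.
Qed.

Lemma unif_int (h : R -> R) : (forall u, continuous h u) -> (forall u, Rabs (h u) <= 1) ->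
  is_lim_seq (fun K => RInt (fun u => F K u * h u) (- / 2) (/ 2)) (RInt (fun u => f u * h u) (- / 2) (/ 2)).
Proof.
intros hh hb.
apply is_lim_seq_le_le with (u := fun K => RInt (fun u => f u * h u) (- / 2) (/ 2) - e K) (w := fun K => RInt (fun u => f u * h u) (- / 2) (/ 2) + e K).
2:{ replace (Finite (RInt (fun u => f u * h u) (- / 2) (/ 2))) with (Finite (RInt (fun u => f u * h u) (- / 2) (/ 2) - 0)) by (f_equal; ring).
    apply is_lim_seq_minus'; [apply is_lim_seq_const|auto]. }
2:{ replace (Finite (RInt (fun u => f u * h u) (- / 2) (/ 2))) with (Finite (RInt (fun u => f u * h u) (- / 2) (/ 2) + 0)) by (f_equal; ring).
    apply is_lim_seq_plus'; [apply is_lim_seq_const|auto]. }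
intros K.
assert (i1 : ex_RInt (fun u => F K u * h u) (- / 2) (/ 2)).
{ apply ex_RInt_cont; [lra|]; intros; apply (continuous_mult (F K) h); auto; apply hF; apply Rabs_def1; lra. }
assert (i2 : ex_RInt (fun u => f u * h u) (- / 2) (/ 2)).
{ apply ex_RInt_cont; [lra|]; intros; apply (continuous_mult f h); auto; apply unif_cont; apply Rabs_def1; lra. }
assert (ic : ex_RInt (fun _ => e K) (- / 2) (/ 2)) by apply ex_RInt_const.
assert (Ec : RInt (fun _ => e K) (- / 2) (/ 2) = e K).
{ rewrite RInt_const; unfold scal; simpl; unfold mult; simpl; field. }
assert (pt : forall u, - / 2 < u < / 2 -> Rabs (f u * h u - F K u * h u) <= e K).
{ intros u h1; rewrite <- Rmult_minus_distr_r, Rabs_mult.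
  pose proof (hu K u ltac:(apply Rabs_def1; lra)); pose proof (hb u).
  pose proof (Rabs_pos (h u)); pose proof (Rabs_pos (f u - F K u)); nra. }
split.
- assert (A : RInt (fun u => f u * h u) (- / 2) (/ 2) <= RInt (fun u => plus (F K u * h u) (e K)) (- / 2) (/ 2)).
  { apply RInt_le; [lra|auto|apply (ex_RInt_plus (V := R_NormedModule)); auto|].
    intros u h1; specialize (pt u h1); apply Rabs_le_between in pt; unfold plus; simpl; lra. }
  rewrite (RInt_plus (V := R_CompleteNormedModule)) in A; auto; rewrite Ec in A; unfold plus in A; simpl in A; lra.
- assert (A : RInt (fun u => F K u * h u) (- / 2) (/ 2) <= RInt (fun u => plus (f u * h u) (e K)) (- / 2) (/ 2)).
  { apply RInt_le; [lra|auto|apply (ex_RInt_plus (V := R_NormedModule)); auto|].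
    intros u h1; specialize (pt u h1); apply Rabs_le_between in pt; unfold plus; simpl; lra. }
  rewrite (RInt_plus (V := R_CompleteNormedModule)) in A; auto; rewrite Ec in A; unfold plus in A; simpl in A; lra.
Qed.

End Uniform.

Definition c0 (j : Z) : R := if Z.eq_dec j 0 then 1 else 0.

Lemma is_RInt_cos (j : Z) : is_RInt (fun u => cos (2 * PI * IZR j * u)) (- / 2) (/ 2) (c0 j).
Proof.
unfold c0; destruct (Z.eq_dec j 0) as [->|hj].
- apply is_RInt_ext with (f := fun _ => 1).
  { intros; rewrite Rmult_0_r, Rmult_0_l, cos_0; auto. }
  assert (X := is_RInt_const (V := R_NormedModule) (- / 2) (/ 2) 1).
  unfold scal in X; simpl in X; unfold mult in X; simpl in X.
  replace ((/ 2 - - / 2) * 1) with 1 in X by field.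
  exact X.
- pose proof PI_RGT_0; assert (hz : IZR j <> 0) by (now apply not_0_IZR).
  set (G := fun u => sin (2 * PI * IZR j * u) / (2 * PI * IZR j)).
  replace 0 with (minus (G (/ 2)) (G (- / 2))).
  + apply (is_RInt_derive (V := R_CompleteNormedModule) G).
    * intros; unfold G; auto_derive; auto; field; split; auto; lra.
    * intros; apply continuous_cos_lin.
  + unfold G, minus, plus, opp; simpl.
    replace (2 * PI * IZR j * / 2) with (IZR j * PI) by field.
    replace (2 * PI * IZR j * - / 2) with (- (IZR j * PI)) by field.
    rewrite sin_neg, (sin_eq_0_1 (IZR j * PI)); [field; split; auto; lra|now exists j].
Qed.

Lemma is_RInt_coscos (n m : Z) :
  is_RInt (fun u => cos (2 * PI * IZR n * u) * cos (2 * PI * IZR m * u)) (- / 2) (/ 2) (/ 2 * (c0 (n - m) + c0 (n + m))).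
Proof.
assert (K := is_RInt_scal _ _ _ (/ 2) _ (is_RInt_plus _ _ _ _ _ _ (is_RInt_cos (n - m)) (is_RInt_cos (n + m)))).
apply is_RInt_ext with (2 := K); intros u _; unfold scal, plus; simpl; unfold mult; simpl.
rewrite plus_IZR, minus_IZR.
replace (2 * PI * (IZR n + IZR m) * u) with (2 * PI * IZR n * u + 2 * PI * IZR m * u) by ring.
replace (2 * PI * (IZR n - IZR m) * u) with (2 * PI * IZR n * u - 2 * PI * IZR m * u) by ring.
rewrite cos_plus, cos_minus; field.
Qed.

Lemma ssum_c0 (b : Z -> R) m K : ssum (fun n => b n * c0 (n - m)) K = if Z_le_dec (Z.abs m) (Z.of_nat K) then b m else 0.
Proof.
induction K as [|K IH]; cbn [ssum].
- unfold c0; destruct (Z_le_dec _ _) as [h|h]; destruct (Z.eq_dec _ _) as [h'|h']; try lia.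
  + replace m with 0%Z by lia; lra.
  + lra.
- rewrite IH; unfold c0.
  destruct (Z_le_dec (Z.abs m) (Z.of_nat K)); destruct (Z_le_dec (Z.abs m) (Z.of_nat (S K)));
  destruct (Z.eq_dec (Z.of_nat (S K) - m) 0); destruct (Z.eq_dec (- Z.of_nat (S K) - m) 0); try lia; try lra.
  + replace m with (Z.of_nat (S K)) by lia; lra.
  + replace m with (- Z.of_nat (S K))%Z by lia; lra.
Qed.

Lemma cos_2PI_Z (n k : Z) x : cos (2 * PI * IZR n * (x + IZR k)) = cos (2 * PI * IZR n * x).
Proof.
replace (2 * PI * IZR n * (x + IZR k)) with (2 * PI * IZR n * x + 2 * IZR (n * k) * PI)
  by (rewrite mult_IZR; ring).
destruct (Z_le_dec 0 (n * k)) as [h|h].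
- rewrite <- (Z2Nat.id (n * k)) by auto; rewrite <- INR_IZR_INZ; apply cos_period.
- rewrite <- (cos_period (2 * PI * IZR n * x + 2 * IZR (n * k) * PI) (Z.to_nat (- (n * k)))).
  rewrite INR_IZR_INZ, Z2Nat.id by lia; rewrite opp_IZR; f_equal; ring.
Qed.

Section Poisson.
Variables (g : R -> R) (M : R) (al : Z -> R) (C r : R).
Hypothesis gc : forall x, continuous g x.
Hypothesis gM : forall x, Rabs (g x) <= M * exp (- Rabs x).
Hypothesis alb : geom_bd al C r.
Hypothesis alE : forall n,
  is_lim_seq (fun K => RInt (fun x => g x * cos (2 * PI * IZR n * x)) (- (INR K + / 2)) (INR K + / 2)) (al n).

Lemma exp_INR (k : nat) : exp (- INR k) = exp (- 1) ^ k.
Proof.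
induction k; [simpl; now rewrite Ropp_0, exp_0|].
rewrite S_INR; replace (- (INR k + 1)) with (- 1 + - INR k) by ring; rewrite exp_plus, IHk; reflexivity.
Qed.

Lemma M_ge0 : 0 <= M.
Proof.
pose proof (gM 0) as h; rewrite Rabs_R0, Ropp_0, exp_0 in h; pose proof (Rabs_pos (g 0)); lra.
Qed.

Lemma exp_m1 : 0 < exp (- 1) < 1.
Proof. split; [apply exp_pos|]. rewrite <- exp_0; apply exp_increasing; lra. Qed.

Lemma g_bd u : Rabs u <= 1 -> geom_bd (fun k => g (IZR k + u)) (M * exp 1) (exp (- 1)).
Proof.
intros hu; pose proof M_ge0; pose proof (exp_pos 1).
split; [nra|split; [apply exp_m1|]].
assert (H1 : forall k z, Rabs z = INR k -> Rabs (g (z + u)) <= M * exp 1 * exp (- 1) ^ k).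
{ intros k z hz; eapply Rle_trans; [apply gM|].
  rewrite <- exp_INR, Rmult_assoc, <- exp_plus; apply Rmult_le_compat_l; auto.
  assert (- Rabs (z + u) <= 1 + - INR k).
  { pose proof (Rabs_triang (z + u) (- u)) as h; rewrite Rabs_Ropp in h.
    replace (z + u + - u) with z in h by ring; lra. }
  destruct (Rle_lt_or_eq_dec _ _ H1) as [h|h]; [apply Rlt_le, exp_increasing; auto|rewrite h; lra]. }
intros k; split; apply H1.
- rewrite <- INR_IZR_INZ; apply Rabs_right, Rle_ge, pos_INR.
- rewrite opp_IZR, Rabs_Ropp, <- INR_IZR_INZ; apply Rabs_right, Rle_ge, pos_INR.
Qed.

Lemma al_bd u : geom_bd (fun n => al n * cos (2 * PI * IZR n * u)) C r.
Proof.
destruct alb as [hC [hr H]]; split; [auto|split; [auto|]].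
intros k; destruct (H k) as [h1 h2].
split; rewrite Rabs_mult;
match goal with |- Rabs ?a * Rabs (cos ?b) <= _ =>
  assert (Rabs (cos b) <= 1) by (apply Rabs_le; apply COS_bound);
  pose proof (Rabs_pos a); pose proof (Rabs_pos (cos b)); nra end.
Qed.

Lemma ssum_continuous (F : Z -> R -> R) K u : (forall k, continuous (F k) u) ->
  continuous (fun u => ssum (fun k => F k u) K) u.
Proof.
intros H; induction K; simpl; auto.
apply (continuous_plus (fun u => ssum (fun k => F k u) K)); auto.
apply (continuous_plus (F (Z.pos _))); auto.
Qed.

Lemma is_RInt_ssum (F : Z -> R -> R) (v : Z -> R) K a b :
  (forall k, is_RInt (F k) a b (v k)) -> is_RInt (fun u => ssum (fun k => F k u) K) a b (ssum v K).
Proof.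
intros H; induction K; simpl; auto.
apply (is_RInt_plus (V := R_NormedModule) (fun u => ssum (fun k => F k u) K)); auto.
apply (is_RInt_plus (V := R_NormedModule) (F (Z.pos _)) (F (Z.neg _))); auto.
Qed.

Lemma gcos_cont (m : Z) x : continuous (fun x => g x * cos (2 * PI * IZR m * x)) x.
Proof. apply (continuous_mult g); [auto|apply continuous_cos_lin]. Qed.

Lemma gcos_shift (m k : Z) : is_RInt (fun u => g (IZR k + u) * cos (2 * PI * IZR m * u)) (- / 2) (/ 2)
   (RInt (fun x => g x * cos (2 * PI * IZR m * x)) (IZR k - / 2) (IZR k + / 2)).
Proof.
set (h := fun x => g x * cos (2 * PI * IZR m * x)).
assert (I : is_RInt h (1 * - / 2 + IZR k) (1 * / 2 + IZR k) (RInt h (IZR k - / 2) (IZR k + / 2))).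
{ replace (1 * - / 2 + IZR k) with (IZR k - / 2) by ring; replace (1 * / 2 + IZR k) with (IZR k + / 2) by ring.
  apply (RInt_correct (V := R_CompleteNormedModule)), ex_RInt_cont; [lra|]; intros; apply gcos_cont. }
apply (is_RInt_comp_lin (V := R_NormedModule)) in I.
apply is_RInt_ext with (2 := I); intros u _; unfold scal; simpl; unfold mult; simpl; unfold h.
rewrite cos_2PI_Z; replace (1 * u + IZR k) with (IZR k + u) by ring.
rewrite <- (cos_2PI_Z m k u); rewrite (Rplus_comm u), (Rplus_comm (IZR k)), cos_2PI_Z.
replace (IZR k + u) with (u + IZR k) by ring; rewrite ?Rmult_1_l; auto.
Qed.

(** Unit intervals centred at the integers [|k| <= K] tile the window. This is why truncated
    transforms are taken between the half-integers [- (INR K + / 2)] and [INR K + / 2]. *)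
Lemma gcos_chain (m : Z) K :
  ssum (fun k => RInt (fun x => g x * cos (2 * PI * IZR m * x)) (IZR k - / 2) (IZR k + / 2)) K =
  RInt (fun x => g x * cos (2 * PI * IZR m * x)) (- (INR K + / 2)) (INR K + / 2).
Proof.
set (h := fun x => g x * cos (2 * PI * IZR m * x)).
assert (ex : forall a b, ex_RInt h a b)
  by (intros; apply (ex_RInt_continuous (V := R_CompleteNormedModule)); intros; apply gcos_cont).
induction K as [|K IH]; cbn [ssum].
- f_equal; simpl; ring.
- rewrite IH.
  rewrite <- (RInt_Chasles h (- (INR (S K) + / 2)) (- (INR K + / 2)) (INR (S K) + / 2)) by auto.
  rewrite <- (RInt_Chasles h (- (INR K + / 2)) (INR K + / 2) (INR (S K) + / 2)) by auto.
  rewrite opp_IZR, <- INR_IZR_INZ, S_INR; unfold plus; simpl.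
  replace (- (INR K + 1) - / 2) with (- (INR K + 1 + / 2)) by ring.
  replace (- (INR K + 1) + / 2) with (- (INR K + / 2)) by field.
  replace (INR K + 1 - / 2) with (INR K + / 2) by field.
  ring.
Qed.

(** [Phi] is the periodisation of [g], [Psi] the cosine series with coefficients [al]. Both are
    uniform limits of continuous functions with the same cosine coefficients, so [fourier_unique]
    makes them agree at 0, which is the claim. *)
Theorem poisson : Ssum (fun k => g (IZR k)) = Ssum al.
Proof.
pose (Phi := fun u => Ssum (fun k => g (IZR k + u))).
pose (Psi := fun u => Ssum (fun n => al n * cos (2 * PI * IZR n * u))).
assert (he1 := geom_lim0 (2 * (M * exp 1) / (1 - exp (- 1))) (exp (- 1)) exp_m1).
assert (hr : 0 < r < 1) by (destruct alb as [? [? ?]]; auto).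
assert (he2 := geom_lim0 (2 * C / (1 - r)) r hr).
assert (uP := fun K u (hu : Rabs u < 1) => Ssum_tail _ _ _ (g_bd u (Rlt_le _ _ hu)) K).
assert (uQ := fun K u (hu : Rabs u < 1) => Ssum_tail _ _ _ (al_bd u) K).
assert (cP : forall K u, Rabs u < 1 -> continuous (fun u => ssum (fun k => g (IZR k + u)) K) u).
{ intros; apply ssum_continuous; intros; apply (continuous_comp (fun u => IZR k + u) g); auto.
  apply (continuous_plus (fun _ => IZR k) (fun u => u)); [apply continuous_const|apply continuous_id]. }
assert (cQ : forall K u, Rabs u < 1 -> continuous (fun u => ssum (fun n => al n * cos (2 * PI * IZR n * u)) K) u).
{ intros; apply ssum_continuous; intros; apply (continuous_mult (fun _ => al k)); [apply continuous_const|apply continuous_cos_lin]. }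
assert (cPhi := unif_cont _ Phi _ he1 cP uP).
assert (cPsi := unif_cont _ Psi _ he2 cQ uQ).
assert (D0 : Phi 0 - Psi 0 = 0).
{ apply (fourier_unique (fun u => Phi u - Psi u)).
  { intros; apply (continuous_minus Phi Psi); auto. }
  intros m.
  assert (cc : forall u, continuous (fun u => cos (2 * PI * IZR m * u)) u) by (intros; apply continuous_cos_lin).
  assert (cb : forall u, Rabs (cos (2 * PI * IZR m * u)) <= 1) by (intros; apply Rabs_le, COS_bound).
  assert (L1 := unif_int _ Phi _ he1 cP uP _ cc cb).
  assert (L2 := unif_int _ Psi _ he2 cQ uQ _ cc cb).
  assert (E1 : RInt (fun u => Phi u * cos (2 * PI * IZR m * u)) (- / 2) (/ 2) = al m).
  { apply is_lim_seq_unique in L1; assert (A := alE m); apply is_lim_seq_unique in A.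
    rewrite (Lim_seq_ext _ (fun K => RInt (fun x => g x * cos (2 * PI * IZR m * x)) (- (INR K + / 2)) (INR K + / 2))) in L1.
    - rewrite A in L1; now inversion L1.
    - intros K; rewrite <- gcos_chain.
      apply (is_RInt_unique (V := R_CompleteNormedModule)).
      apply is_RInt_ext with (2 := is_RInt_ssum _ _ K _ _ (gcos_shift m)).
      intros u _; rewrite (Rmult_comm (ssum _ _)), <- ssum_scal; apply ssum_ext; intros; ring. }
  (* [Psi] sums over all integers, so the frequency [m] appears at [m] and at [- m]; [E3] identifies
     the two coefficients. *)
  assert (E2 : RInt (fun u => Psi u * cos (2 * PI * IZR m * u)) (- / 2) (/ 2) = (al m + al (- m)%Z) / 2).
  { apply is_lim_seq_unique in L2.
    rewrite (Lim_seq_ext_loc _ (fun K => (al m + al (- m)%Z) / 2)) in L2.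
    - rewrite Lim_seq_const in L2; now inversion L2.
    (* From [K >= |m|] on the partial sum contains both frequencies and its coefficient no longer
       changes. *)
    - exists (Z.to_nat (Z.abs m)); intros K hK.
      transitivity (ssum (fun n => al n * (/ 2 * (c0 (n - m) + c0 (n + m)))) K).
      + apply (is_RInt_unique (V := R_CompleteNormedModule)).
        assert (X := is_RInt_ssum _ _ K (- / 2) (/ 2) (fun n => is_RInt_scal _ _ _ (al n) _ (is_RInt_coscos n m))).
        unfold scal in X; simpl in X; unfold mult in X; simpl in X.
        apply is_RInt_ext with (2 := X).
        intros u _; rewrite (Rmult_comm (ssum _ _)), <- ssum_scal; apply ssum_ext; intros; ring.
      + rewrite (ssum_ext _ (fun n => (/ 2 * al n) * c0 (n - m) + (/ 2 * al n) * c0 (n - (- m)))).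
        * rewrite ssum_plus, !ssum_c0.
          destruct (Z_le_dec _ _); destruct (Z_le_dec _ _); try lia; field.
        * intros; replace (k - - m)%Z with (k + m)%Z by ring; ring. }
  assert (E3 : al (- m)%Z = al m).
  { assert (A := alE (- m)%Z); assert (B := alE m); apply is_lim_seq_unique in A; apply is_lim_seq_unique in B.
    rewrite (Lim_seq_ext _ (fun K => RInt (fun x => g x * cos (2 * PI * IZR m * x)) (- (INR K + / 2)) (INR K + / 2))) in A.
    - rewrite A in B; now inversion B.
    - intros K; apply RInt_ext; intros x _; rewrite opp_IZR.
      replace (2 * PI * - IZR m * x) with (- (2 * PI * IZR m * x)) by ring; now rewrite cos_neg. }
  rewrite E3 in E2.
  assert (iP : is_RInt (fun u => Phi u * cos (2 * PI * IZR m * u)) (- / 2) (/ 2) (al m)).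
  { rewrite <- E1; apply (RInt_correct (V := R_CompleteNormedModule)), ex_RInt_cont; [lra|].
    intros; apply (continuous_mult Phi); auto; apply cPhi, Rabs_def1; lra. }
  assert (iQ : is_RInt (fun u => Psi u * cos (2 * PI * IZR m * u)) (- / 2) (/ 2) (al m)).
  { replace (al m) with ((al m + al m) / 2) by field; rewrite <- E2; apply (RInt_correct (V := R_CompleteNormedModule)), ex_RInt_cont; [lra|].
    intros; apply (continuous_mult Psi); auto; apply cPsi, Rabs_def1; lra. }
  assert (iD := is_RInt_minus _ _ _ _ _ _ iP iQ).
  replace 0 with (minus (al m) (al m)) by (unfold minus, plus, opp; simpl; ring).
  apply is_RInt_ext with (2 := iD); intros u _; unfold minus, plus, opp; simpl; ring. }
unfold Phi, Psi in D0.
replace (Ssum (fun k => g (IZR k))) with (Ssum (fun k => g (IZR k + 0))).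
2:{ unfold Ssum; f_equal; apply Lim_seq_ext; intros; apply ssum_ext; intros; f_equal; ring. }
replace (Ssum al) with (Ssum (fun n => al n * cos (2 * PI * IZR n * 0))); [lra|].
unfold Ssum; f_equal; apply Lim_seq_ext; intros; apply ssum_ext; intros; rewrite Rmult_0_r, cos_0; ring.
Qed.

End Poisson.
End PoissonSummation.

(** * Fourier transform of complex Gaussians, by a differential equation in the frequency *)

Module GaussianTransform.
From Stdlib Require Import Reals Lra Lia ZArith.
From Coquelicot Require Import Coquelicot.
Import FourierUniqueness PoissonSummation.
Open Scope R_scope.

Lemma exp_le_exp x y : x <= y -> exp x <= exp y.
Proof. intros [h| ->]; [apply Rlt_le, exp_increasing; auto|lra]. Qed.

Section Tail.
Variables (g : R -> R) (M : R).
Hypothesis gc : forall x, continuous g x.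
Hypothesis gM : forall x, Rabs (g x) <= M * exp (- Rabs x).

Lemma ex_RInt_g a b : ex_RInt g a b.
Proof. apply (ex_RInt_continuous (V := R_CompleteNormedModule)); auto. Qed.

Lemma RInt_exp_bd a b : 0 <= a <= b -> RInt (fun x => M * exp (- x)) a b <= M * exp (- a).
Proof.
intros h.
assert (I : is_RInt (fun x => M * exp (- x)) a b (minus (- M * exp (- b)) (- M * exp (- a)))).
{ apply (is_RInt_derive (V := R_CompleteNormedModule) (fun x => - M * exp (- x))).
  - intros; auto_derive; auto; ring.
  - intros; apply (ex_derive_continuous (V := R_NormedModule)); auto_derive; auto. }
apply (is_RInt_unique (V := R_CompleteNormedModule)) in I; rewrite I.
unfold minus, plus, opp; simpl.
pose proof (M_ge0 g M gM); pose proof (exp_pos (- b)); nra.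
Qed.

Lemma RInt_tail_r a b : 0 <= a <= b -> Rabs (RInt g a b) <= M * exp (- a).
Proof.
intros h; eapply Rle_trans; [|apply (RInt_exp_bd a b h)].
apply (norm_RInt_le (V := R_NormedModule) g (fun x => M * exp (- x)) a b).
- lra.
- intros x hx; rewrite <- (Rabs_right x) at 2 by lra; apply gM.
- apply (RInt_correct (V := R_CompleteNormedModule)), ex_RInt_g.
- apply (RInt_correct (V := R_CompleteNormedModule)), (ex_RInt_continuous (V := R_CompleteNormedModule)).
  intros; apply (ex_derive_continuous (V := R_NormedModule)); auto_derive; auto.
Qed.
End Tail.

Section Tail2.
Variables (g : R -> R) (M : R).
Hypothesis gc : forall x, continuous g x.
Hypothesis gM : forall x, Rabs (g x) <= M * exp (- Rabs x).

Lemma RInt_tail a b : 0 <= a <= b -> Rabs (RInt g (- b) b - RInt g (- a) a) <= 2 * M * exp (- a).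
Proof.
intros h.
rewrite <- (RInt_Chasles g (- b) (- a) b) by (apply ex_RInt_g; auto).
rewrite <- (RInt_Chasles g (- a) a b) by (apply ex_RInt_g; auto).
unfold plus; simpl.
replace (RInt g (- b) (- a) + (RInt g (- a) a + RInt g a b) - RInt g (- a) a)
  with (RInt g (- b) (- a) + RInt g a b) by ring.
eapply Rle_trans; [apply Rabs_triang|].
pose proof (RInt_tail_r g M gc gM a b h).
assert (E : RInt g (- b) (- a) = RInt (fun x => g (- x)) a b).
{ assert (I : is_RInt g (- b) (- a) (RInt g (- b) (- a))) by (apply (RInt_correct (V := R_CompleteNormedModule)), ex_RInt_g; auto).
  apply (is_RInt_swap (V := R_NormedModule)) in I.
  replace (- a) with (-1 * a + 0) in I at 1 by ring; replace (- b) with (-1 * b + 0) in I at 1 by ring.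
  apply (is_RInt_comp_lin (V := R_NormedModule)), (is_RInt_scal (V := R_NormedModule)) with (k := -1) in I.
  symmetry; apply (is_RInt_unique (V := R_CompleteNormedModule)).
  replace (RInt g (- b) (- a)) with (scal (-1) (opp (RInt g (- b) (- a)))) by (unfold scal, opp; simpl; unfold mult; simpl; ring).
  apply is_RInt_ext with (2 := I); intros; unfold scal; simpl; unfold mult; simpl.
  replace (-1 * x + 0) with (- x) by ring; ring. }
rewrite E.
assert (Rabs (RInt (fun x => g (- x)) a b) <= M * exp (- a)); [|lra].
apply RInt_tail_r; auto.
- intros; apply (continuous_comp (fun x => - x) g); auto.
  apply (ex_derive_continuous (V := R_NormedModule)); auto_derive; auto.
- intros; rewrite <- (Rabs_Ropp x); apply gM.
Qed.

(** The improper integral does not depend on the windows that exhaust the line. A change of variable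
    rescales the half-integer windows, see [scale_gen], so this freedom is needed. *)
Lemma RInt_cv (T : nat -> R) : (forall K, 0 <= T K) -> is_lim_seq T p_infty ->
  is_lim_seq (fun K => RInt g (- T K) (T K)) (real (Lim_seq (fun K => RInt g (- (INR K + / 2)) (INR K + / 2)))).
Proof.
intros hT0 hT.
assert (hM := M_ge0 g M gM).
assert (small : forall eps, 0 < eps -> exists N : nat, 2 * M * exp (- INR N) < eps).
{ intros eps he.
  destruct (proj2 (is_lim_seq_spec _ _) (geom_lim0 (2 * M) (exp (- 1)) exp_m1) (mkposreal eps he)) as [N hN].
  exists N; specialize (hN N (Nat.le_refl _)); simpl in hN; rewrite Rminus_0_r, <- exp_INR in hN.
  eapply Rle_lt_trans; [apply Rle_abs|exact hN]. }
assert (cau : forall a b N, INR N <= a -> INR N <= b ->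
  Rabs (RInt g (- a) a - RInt g (- b) b) <= 2 * (2 * M * exp (- INR N))).
{ intros a b N ha hb; pose proof (pos_INR N).
  pose proof (RInt_tail (INR N) a ltac:(lra)) as h1; pose proof (RInt_tail (INR N) b ltac:(lra)) as h2.
  apply Rabs_le_between in h1; apply Rabs_le_between in h2; apply Rabs_le; lra. }
assert (E : ex_finite_lim_seq (fun K => RInt g (- (INR K + / 2)) (INR K + / 2))).
{ apply ex_lim_seq_cauchy_corr; intros [eps he].
  destruct (small (eps / 2) ltac:(lra)) as [N hN]; exists N; intros n m hn hm.
  eapply Rle_lt_trans; [apply (cau _ _ N); apply le_INR in hn; apply le_INR in hm; lra|simpl; lra]. }
destruct E as [l hl]; rewrite (is_lim_seq_unique _ _ hl); simpl.
apply is_lim_seq_spec; intros [eps he].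
apply is_lim_seq_spec in hl; apply is_lim_seq_spec in hT.
destruct (small (eps / 4) ltac:(lra)) as [N hN].
destruct (hl (mkposreal (eps / 2) ltac:(lra))) as [N1 h1].
destruct (hT (INR N)) as [N2 h2].
exists N2; intros n hn; simpl.
specialize (h1 (N1 + N)%nat ltac:(lia)); simpl in h1.
pose proof (cau (T n) (INR (N1 + N) + / 2) N ltac:(apply Rlt_le, h2; auto) ltac:(rewrite plus_INR; pose proof (pos_INR N1); lra)) as h3.
apply Rabs_le_between in h3; apply Rabs_def2 in h1; apply Rabs_def1; lra.
Qed.

Lemma RInt_cvK : is_lim_seq (fun K => RInt g (- (INR K + / 2)) (INR K + / 2))
  (real (Lim_seq (fun K => RInt g (- (INR K + / 2)) (INR K + / 2)))).
Proof.
apply RInt_cv.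
- intros K; pose proof (pos_INR K); lra.
- apply is_lim_seq_le_p_loc with (u := INR); [|apply is_lim_seq_INR].
  exists O; intros; lra.
Qed.
End Tail2.

Lemma ex_derive_continuity_pt (f : R -> R) x : ex_derive f x -> continuity_pt f x.
Proof. intros h; apply continuity_pt_filterlim; now apply (ex_derive_continuous (V := R_NormedModule) f). Qed.

(* [gR + i gI] is [exp (-pi (p + i q) x^2 + 2 pi i xi x)]. *)
Definition gR p q xi x := exp (- PI * p * (x * x)) * cos (2 * PI * xi * x + - (PI * q * (x * x))).
Definition gI p q xi x := exp (- PI * p * (x * x)) * sin (2 * PI * xi * x + - (PI * q * (x * x))).

(** Combine [1 + |x| <= exp |x|] with [k (|x| - 1/k)^2 >= 0]. The factor [1 + |x|] lets the same
    bound serve the sums weighted by [x]. *)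
Lemma gauss_bd k x : 0 < k -> exp (- k * (x * x)) * (1 + Rabs x) <= exp (/ k) * exp (- Rabs x).
Proof.
intros hk.
assert (1 + Rabs x <= exp (Rabs x)) by (apply exp_ineq1_le).
apply Rle_trans with (exp (- k * (x * x)) * exp (Rabs x)).
{ apply Rmult_le_compat_l; [apply Rlt_le, exp_pos|auto]. }
rewrite <- !exp_plus; apply exp_le_exp.
assert (E : x * x = Rabs x ^ 2) by (rewrite pow2_abs; ring); rewrite E.
assert (0 <= k * (Rabs x - / k) ^ 2) by (apply Rmult_le_pos; [lra|apply pow2_ge_0]).
replace (k * (Rabs x - / k) ^ 2) with (k * Rabs x ^ 2 - 2 * Rabs x + / k) in H0 by (field; lra).
lra.
Qed.

Section Gauss.
Variables (p q : R).
Hypothesis hp : 0 < p.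
Let M := exp (/ (PI * p)).
Let Pp : 0 < PI * p. Proof. pose proof PI_RGT_0; nra. Qed.
Let n2 := p ^ 2 + q ^ 2.
Let n2p : 0 < n2. Proof. unfold n2; nra. Qed.
(** [tr + i ti] is the inverse of [p + i q], the parameter of the transformed Gaussian. *)
Let tr := p / n2.
Let ti := - q / n2.
Let trp : 0 < tr. Proof. unfold tr; apply Rdiv_lt_0_compat; auto. Qed.

Lemma gR_cont xi x : continuous (gR p q xi) x.
Proof. apply (ex_derive_continuous (V := R_NormedModule)); unfold gR; auto_derive; auto. Qed.
Lemma gI_cont xi x : continuous (gI p q xi) x.
Proof. apply (ex_derive_continuous (V := R_NormedModule)); unfold gI; auto_derive; auto. Qed.
Lemma xgR_cont xi x : continuous (fun x => x * gR p q xi x) x.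
Proof. apply (ex_derive_continuous (V := R_NormedModule)); unfold gR; auto_derive; auto. Qed.
Lemma xgI_cont xi x : continuous (fun x => x * gI p q xi x) x.
Proof. apply (ex_derive_continuous (V := R_NormedModule)); unfold gI; auto_derive; auto. Qed.

Lemma gauss_mult_bd x w c : Rabs w <= 1 + Rabs x -> Rabs c <= 1 ->
  Rabs (w * (exp (- PI * p * (x * x)) * c)) <= M * exp (- Rabs x).
Proof.
intros hw hc; eapply Rle_trans; [|apply (gauss_bd (PI * p) x Pp)].
replace (- (PI * p) * (x * x)) with (- PI * p * (x * x)) by ring.
rewrite !Rabs_mult, (Rabs_right (exp _)) by (apply Rle_ge, Rlt_le, exp_pos).
pose proof (exp_pos (- PI * p * (x * x))).
assert (exp (- PI * p * (x * x)) * Rabs c <= exp (- PI * p * (x * x))) by nra.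
rewrite (Rmult_comm (exp _) (1 + _)); apply Rmult_le_compat; auto; try apply Rabs_pos.
apply Rmult_le_pos; [lra|apply Rabs_pos].
Qed.

Lemma gR_bd xi x : Rabs (gR p q xi x) <= M * exp (- Rabs x).
Proof.
unfold gR; rewrite <- (Rmult_1_l (_ * _)); apply gauss_mult_bd; [rewrite Rabs_R1; pose proof (Rabs_pos x); lra|apply Rabs_le, COS_bound].
Qed.
Lemma gI_bd xi x : Rabs (gI p q xi x) <= M * exp (- Rabs x).
Proof.
unfold gI; rewrite <- (Rmult_1_l (_ * _)); apply gauss_mult_bd; [rewrite Rabs_R1; pose proof (Rabs_pos x); lra|apply Rabs_le, SIN_bound].
Qed.
Lemma xgR_bd xi x : Rabs (x * gR p q xi x) <= M * exp (- Rabs x).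
Proof. unfold gR; apply gauss_mult_bd; [lra|apply Rabs_le, COS_bound]. Qed.
Lemma xgI_bd xi x : Rabs (x * gI p q xi x) <= M * exp (- Rabs x).
Proof. unfold gI; apply gauss_mult_bd; [lra|apply Rabs_le, SIN_bound]. Qed.

(** [AT + i BT] is the transform cut off at [T], and [XR + i XI] the same with an additional factor
    [x]. The cut-off allows differentiation in [xi] under a proper integral. *)
Definition AT T xi : R := RInt (gR p q xi) (- T) T.
Definition BT T xi : R := RInt (gI p q xi) (- T) T.
Definition XR T xi : R := RInt (fun x => x * gR p q xi x) (- T) T.
Definition XI T xi : R := RInt (fun x => x * gI p q xi x) (- T) T.

Lemma exR xi T : ex_RInt (gR p q xi) (- T) T.
Proof. apply ex_RInt_g, gR_cont. Qed.
Lemma exI xi T : ex_RInt (gI p q xi) (- T) T.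
Proof. apply ex_RInt_g, gI_cont. Qed.
Lemma exXR xi T : ex_RInt (fun x => x * gR p q xi x) (- T) T.
Proof. apply ex_RInt_g, xgR_cont. Qed.
Lemma exXI xi T : ex_RInt (fun x => x * gI p q xi x) (- T) T.
Proof. apply ex_RInt_g, xgI_cont. Qed.

Lemma cont2_lin (a b c : R) xi t : continuity_2d_pt (fun u v => a * u * v + - (b * (v * v))) xi t.
Proof.
apply (continuity_2d_pt_plus (fun u v => a * u * v) (fun u v => - (b * (v * v)))).
- apply (continuity_2d_pt_mult (fun u v => a * u) (fun u v => v)).
  + apply (continuity_2d_pt_mult (fun u v => a) (fun u v => u)); [apply continuity_2d_pt_const|apply continuity_2d_pt_id1].
  + apply continuity_2d_pt_id2.
- apply (continuity_1d_2d_pt_comp (fun v => - (b * (v * v))) (fun u v => v)); [|apply continuity_2d_pt_id2].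
  apply ex_derive_continuity_pt; auto_derive; auto.
Qed.

Lemma AT_derive T xi : is_derive (AT T) xi (- 2 * PI * XI T xi).
Proof.
replace (- 2 * PI * XI T xi) with (RInt (fun t => Derive (fun u => gR p q u t) xi) (- T) T).
2:{ transitivity (RInt (fun t => scal (- 2 * PI) (t * gI p q xi t)) (- T) T).
    - apply RInt_ext; intros t _; apply is_derive_unique; unfold gR, gI; auto_derive; auto.
      unfold scal, Hierarchy.mult; simpl; unfold mult; simpl; ring.
    - rewrite (RInt_scal (V := R_CompleteNormedModule)); [reflexivity|apply exXI]. }
unfold AT; apply (is_derive_RInt_param (fun xi t => gR p q xi t)).
- exists (mkposreal 1 Rlt_0_1); intros; unfold gR; auto_derive; auto.
- intros t _.
  apply continuity_2d_pt_ext with (f := fun u v => (- 2 * PI * v * exp (- PI * p * (v * v))) * sin (2 * PI * u * v + - (PI * q * (v * v)))).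
  { intros u v; symmetry; apply is_derive_unique; unfold gR; auto_derive; auto; ring. }
  apply (continuity_2d_pt_mult (fun u v => - 2 * PI * v * exp (- PI * p * (v * v))) (fun u v => sin (2 * PI * u * v + - (PI * q * (v * v))))).
  + apply (continuity_1d_2d_pt_comp (fun v => - 2 * PI * v * exp (- PI * p * (v * v))) (fun u v => v)); [|apply continuity_2d_pt_id2].
    apply ex_derive_continuity_pt; auto_derive; auto.
  + apply (continuity_1d_2d_pt_comp sin); [apply continuity_sin|apply cont2_lin; exact 0].
- exists (mkposreal 1 Rlt_0_1); intros; apply exR.
Qed.

Lemma BT_derive T xi : is_derive (BT T) xi (2 * PI * XR T xi).
Proof.
replace (2 * PI * XR T xi) with (RInt (fun t => Derive (fun u => gI p q u t) xi) (- T) T).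
2:{ transitivity (RInt (fun t => scal (2 * PI) (t * gR p q xi t)) (- T) T).
    - apply RInt_ext; intros t _; apply is_derive_unique; unfold gR, gI; auto_derive; auto.
      unfold scal, Hierarchy.mult; simpl; unfold mult; simpl; ring.
    - rewrite (RInt_scal (V := R_CompleteNormedModule)); [reflexivity|apply exXR]. }
unfold BT; apply (is_derive_RInt_param (fun xi t => gI p q xi t)).
- exists (mkposreal 1 Rlt_0_1); intros; unfold gI; auto_derive; auto.
- intros t _.
  apply continuity_2d_pt_ext with (f := fun u v => (2 * PI * v * exp (- PI * p * (v * v))) * cos (2 * PI * u * v + - (PI * q * (v * v)))).
  { intros u v; symmetry; apply is_derive_unique; unfold gI; auto_derive; auto; ring. }
  apply (continuity_2d_pt_mult (fun u v => 2 * PI * v * exp (- PI * p * (v * v))) (fun u v => cos (2 * PI * u * v + - (PI * q * (v * v))))).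
  + apply (continuity_1d_2d_pt_comp (fun v => 2 * PI * v * exp (- PI * p * (v * v))) (fun u v => v)); [|apply continuity_2d_pt_id2].
    apply ex_derive_continuity_pt; auto_derive; auto.
  + apply (continuity_1d_2d_pt_comp cos); [apply continuity_cos|apply cont2_lin; exact 0].
- exists (mkposreal 1 Rlt_0_1); intros; apply exI.
Qed.

Let dR T xi := gR p q xi T - gR p q xi (- T).
Let dI T xi := gI p q xi T - gI p q xi (- T).

(** The integrand [g] satisfies [g' = (2 pi i xi - 2 pi (p + i q) x) g]; this is the real part of
    its integral over [[-T, T]], and [parts_I] is the imaginary part. [dR] and [dI] are the boundary
    values. *)
Lemma parts_R T xi : dR T xi = - 2 * PI * p * XR T xi - 2 * PI * xi * BT T xi + 2 * PI * q * XI T xi.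
Proof.
assert (I : is_RInt (fun x => - 2 * PI * p * (x * gR p q xi x) - 2 * PI * xi * gI p q xi x + 2 * PI * q * (x * gI p q xi x)) (- T) T (dR T xi)).
{ apply (is_RInt_derive (V := R_CompleteNormedModule) (gR p q xi)).
  - intros; unfold gR, gI; auto_derive; auto; ring.
  - intros; apply (ex_derive_continuous (V := R_NormedModule)); unfold gR, gI; auto_derive; auto. }
apply (is_RInt_unique (V := R_CompleteNormedModule)) in I; rewrite <- I.
apply (is_RInt_unique (V := R_CompleteNormedModule)).
assert (a1 := RInt_correct (V := R_CompleteNormedModule) _ _ _ (exXR xi T)).
assert (a2 := RInt_correct (V := R_CompleteNormedModule) _ _ _ (exI xi T)).
assert (a3 := RInt_correct (V := R_CompleteNormedModule) _ _ _ (exXI xi T)).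
apply (is_RInt_plus (V := R_NormedModule)); [apply (is_RInt_minus (V := R_NormedModule))|].
- apply (is_RInt_scal (V := R_NormedModule)) with (1 := a1).
- apply (is_RInt_scal (V := R_NormedModule)) with (1 := a2).
- apply (is_RInt_scal (V := R_NormedModule)) with (1 := a3).
Qed.

Lemma parts_I T xi : dI T xi = - 2 * PI * p * XI T xi + 2 * PI * xi * AT T xi - 2 * PI * q * XR T xi.
Proof.
assert (I : is_RInt (fun x => - 2 * PI * p * (x * gI p q xi x) + 2 * PI * xi * gR p q xi x - 2 * PI * q * (x * gR p q xi x)) (- T) T (dI T xi)).
{ apply (is_RInt_derive (V := R_CompleteNormedModule) (gI p q xi)).
  - intros; unfold gR, gI; auto_derive; auto; ring.
  - intros; apply (ex_derive_continuous (V := R_NormedModule)); unfold gR, gI; auto_derive; auto. }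
apply (is_RInt_unique (V := R_CompleteNormedModule)) in I; rewrite <- I.
apply (is_RInt_unique (V := R_CompleteNormedModule)).
assert (a1 := RInt_correct (V := R_CompleteNormedModule) _ _ _ (exXI xi T)).
assert (a2 := RInt_correct (V := R_CompleteNormedModule) _ _ _ (exR xi T)).
assert (a3 := RInt_correct (V := R_CompleteNormedModule) _ _ _ (exXR xi T)).
apply (is_RInt_minus (V := R_NormedModule)); [apply (is_RInt_plus (V := R_NormedModule))|].
- apply (is_RInt_scal (V := R_NormedModule)) with (1 := a1).
- apply (is_RInt_scal (V := R_NormedModule)) with (1 := a2).
- apply (is_RInt_scal (V := R_NormedModule)) with (1 := a3).
Qed.

(** The two relations from integration by parts are linear in [XR] and [XI], with determinant a
    multiple of [n2]. The solution is the expected main term plus boundary terms that decay with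
    [T]. *)
Lemma XR_eq T xi : XR T xi = - xi * (tr * BT T xi + ti * AT T xi) - (tr * dR T xi - ti * dI T xi) / (2 * PI).
Proof.
pose proof PI_RGT_0; rewrite parts_R, parts_I; unfold tr, ti, n2; field; split; [|lra].
apply Rgt_not_eq; apply n2p.
Qed.

Lemma XI_eq T xi : XI T xi = xi * (tr * AT T xi - ti * BT T xi) - (tr * dI T xi + ti * dR T xi) / (2 * PI).
Proof.
pose proof PI_RGT_0; rewrite parts_R, parts_I; unfold tr, ti, n2; field; split; [|lra].
apply Rgt_not_eq; apply n2p.
Qed.

(** [P + i Q = exp (pi (tr + i ti) xi^2)], the inverse of the expected transform up to a
    constant. *)
Let P xi := exp (PI * tr * (xi * xi)) * cos (PI * ti * (xi * xi)).
Let Q xi := exp (PI * tr * (xi * xi)) * sin (PI * ti * (xi * xi)).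

(** Multiplying [AT + i BT] by the integrating factor [P + i Q] cancels the main terms of the
    derivative and leaves boundary terms. *)
Lemma U_derive T xi :
  is_derive (fun xi => AT T xi * P xi - BT T xi * Q xi) xi
    ((tr * dI T xi + ti * dR T xi) * P xi + (tr * dR T xi - ti * dI T xi) * Q xi) /\
  is_derive (fun xi => AT T xi * Q xi + BT T xi * P xi) xi
    ((tr * dI T xi + ti * dR T xi) * Q xi - (tr * dR T xi - ti * dI T xi) * P xi).
Proof.
assert (a := AT_derive T xi); assert (b := BT_derive T xi).
assert (dP : is_derive P xi (2 * PI * xi * (tr * P xi - ti * Q xi))) by (unfold P, Q; auto_derive; auto; ring).
assert (dQ : is_derive Q xi (2 * PI * xi * (ti * P xi + tr * Q xi))) by (unfold P, Q; auto_derive; auto; ring).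
pose proof PI_RGT_0.
split.
- replace ((tr * dI T xi + ti * dR T xi) * P xi + (tr * dR T xi - ti * dI T xi) * Q xi) with
    (minus (plus (mult (- 2 * PI * XI T xi) (P xi)) (mult (AT T xi) (2 * PI * xi * (tr * P xi - ti * Q xi))))
           (plus (mult (2 * PI * XR T xi) (Q xi)) (mult (BT T xi) (2 * PI * xi * (ti * P xi + tr * Q xi))))).
  + apply (is_derive_minus (fun xi => AT T xi * P xi) (fun xi => BT T xi * Q xi));
      apply (is_derive_mult (K := R_AbsRing)); auto; intros; apply Rmult_comm.
  + unfold minus, plus, opp, mult; simpl; rewrite XR_eq, XI_eq; field; lra.
- replace ((tr * dI T xi + ti * dR T xi) * Q xi - (tr * dR T xi - ti * dI T xi) * P xi) with
    (plus (plus (mult (- 2 * PI * XI T xi) (Q xi)) (mult (AT T xi) (2 * PI * xi * (ti * P xi + tr * Q xi))))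
           (plus (mult (2 * PI * XR T xi) (P xi)) (mult (BT T xi) (2 * PI * xi * (tr * P xi - ti * Q xi))))).
  + apply (is_derive_plus (fun xi => AT T xi * Q xi) (fun xi => BT T xi * P xi));
      apply (is_derive_mult (K := R_AbsRing)); auto; intros; apply Rmult_comm.
  + unfold minus, plus, opp, mult; simpl; rewrite XR_eq, XI_eq; field; lra.
Qed.

Lemma dRI_bd T xi : 0 <= T -> Rabs (dR T xi) <= 2 * M * exp (- T) /\ Rabs (dI T xi) <= 2 * M * exp (- T).
Proof.
intros hT; unfold dR, dI; split; eapply Rle_trans; try apply Rabs_triang; rewrite Rabs_Ropp.
- pose proof (gR_bd xi T) as h1; pose proof (gR_bd xi (- T)) as h2; rewrite Rabs_Ropp in h2.
  rewrite (Rabs_right T) in h1, h2 by lra; lra.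
- pose proof (gI_bd xi T) as h1; pose proof (gI_bd xi (- T)) as h2; rewrite Rabs_Ropp in h2.
  rewrite (Rabs_right T) in h1, h2 by lra; lra.
Qed.

Lemma comb_bd a b c d m e : Rabs a <= e -> Rabs b <= e -> Rabs c <= m -> Rabs d <= m ->
  Rabs ((tr * a + ti * b) * c + (tr * b - ti * a) * d) <= 2 * (tr + Rabs ti) * m * e.
Proof.
intros ha hb hc hd.
assert (T1 : forall x y z, Rabs x <= e -> Rabs y <= m -> Rabs (z * x * y) <= Rabs z * (m * e)).
{ intros x y z hx hy; rewrite !Rabs_mult, Rmult_assoc; apply Rmult_le_compat_l; [apply Rabs_pos|].
  rewrite Rmult_comm; apply Rmult_le_compat; auto; apply Rabs_pos. }
pose proof (T1 a c tr ha hc) as h1; pose proof (T1 b c ti hb hc) as h2.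
pose proof (T1 b d tr hb hd) as h3; pose proof (T1 a d ti ha hd) as h4.
rewrite (Rabs_right tr) in h1, h3 by (apply Rle_ge, Rlt_le, trp).
apply Rabs_le_between in h1; apply Rabs_le_between in h2; apply Rabs_le_between in h3; apply Rabs_le_between in h4.
apply Rabs_le.
replace (2 * (tr + Rabs ti) * m * e) with (2 * (tr * (m * e) + Rabs ti * (m * e))) by ring.
replace ((tr * a + ti * b) * c + (tr * b - ti * a) * d) with (tr * a * c + ti * b * c + tr * b * d - ti * a * d) by ring.
lra.
Qed.

Lemma exp_cos_bd xi m : Rabs xi <= m -> Rabs (P xi) <= exp (PI * tr * (m * m)) /\ Rabs (Q xi) <= exp (PI * tr * (m * m)).
Proof.
intros h; unfold P, Q.
assert (h2 : exp (PI * tr * (xi * xi)) <= exp (PI * tr * (m * m))).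
{ apply exp_le_exp; pose proof PI_RGT_0; apply Rmult_le_compat_l; [apply Rlt_le, Rmult_lt_0_compat; auto|].
  unfold Rabs in h; destruct (Rcase_abs xi); nra. }
pose proof (exp_pos (PI * tr * (xi * xi))).
split; rewrite Rabs_mult, (Rabs_right (exp _)) by lra; (eapply Rle_trans; [|exact h2]).
- assert (Rabs (cos (PI * ti * (xi * xi))) <= 1) by (apply Rabs_le, COS_bound); nra.
- assert (Rabs (sin (PI * ti * (xi * xi))) <= 1) by (apply Rabs_le, SIN_bound); nra.
Qed.

(** At [xi = 0] the number [LA + i LB] is the Gaussian integral; it is kept symbolic from here
    on. *)
Definition LA xi := real (Lim_seq (fun K => AT (INR K + / 2) xi)).
Definition LB xi := real (Lim_seq (fun K => BT (INR K + / 2) xi)).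

Lemma LA_cv xi : is_lim_seq (fun K => AT (INR K + / 2) xi) (LA xi).
Proof. exact (RInt_cvK _ _ (gR_cont xi) (gR_bd xi)). Qed.
Lemma LB_cv xi : is_lim_seq (fun K => BT (INR K + / 2) xi) (LB xi).
Proof. exact (RInt_cvK _ _ (gI_cont xi) (gI_bd xi)). Qed.

Lemma lim0_exp A : is_lim_seq (fun K => A * exp (- (INR K + / 2))) 0.
Proof.
apply is_lim_seq_ext with (fun K => (A * exp (- / 2)) * exp (- 1) ^ K).
- intros K; rewrite <- exp_INR, Rmult_assoc, <- exp_plus; do 2 f_equal; ring.
- apply geom_lim0, exp_m1.
Qed.

Lemma lim0_sq (u v : nat -> R) : (forall K, Rabs (u K) <= v K) -> is_lim_seq v 0 -> is_lim_seq u 0.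
Proof.
intros h hv; apply is_lim_seq_le_le with (u := fun K => - v K) (w := v); auto.
- intros K; specialize (h K); apply Rabs_le_between in h; lra.
- replace (Finite 0) with (Finite (- 0)) by (f_equal; ring); now apply (is_lim_seq_opp v (Finite 0)).
Qed.

Lemma lim_plus (u v : nat -> R) (a b c d : R) : is_lim_seq u a -> is_lim_seq v b ->
  is_lim_seq (fun K => u K * c + v K * d) (a * c + b * d).
Proof.
intros hu hv; apply is_lim_seq_plus'; apply is_lim_seq_mult'; auto; apply is_lim_seq_const.
Qed.

Lemma lim_minus (u v : nat -> R) (a b c d : R) : is_lim_seq u a -> is_lim_seq v b ->
  is_lim_seq (fun K => u K * c - v K * d) (a * c - b * d).
Proof.
intros hu hv; apply is_lim_seq_minus'; apply is_lim_seq_mult'; auto; apply is_lim_seq_const.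
Qed.

(** By the mean value theorem between 0 and [xi], the product varies by at most a constant times
    [exp (- T)] at cut-off [T], hence not at all in the limit. *)
Lemma U_lim xi : LA xi * P xi - LB xi * Q xi = LA 0 * P 0 - LB 0 * Q 0 /\
  LA xi * Q xi + LB xi * P xi = LA 0 * Q 0 + LB 0 * P 0.
Proof.
assert (K1 : forall T, 0 <= T -> forall U dU, (forall y, is_derive U y (dU y)) ->
   (forall y, Rabs y <= Rabs xi -> Rabs (dU y) <= 2 * (tr + Rabs ti) * exp (PI * tr * (Rabs xi * Rabs xi)) * (2 * M * exp (- T))) ->
   Rabs (U xi - U 0) <= (2 * (tr + Rabs ti) * exp (PI * tr * (Rabs xi * Rabs xi)) * (2 * M) * Rabs xi) * exp (- T)).
{ intros T hT U dU hU hb.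
  destruct (MVT_gen U 0 xi dU) as [c [hc E]].
  - intros; apply hU.
  - intros; apply continuity_pt_filterlim, (ex_derive_continuous (V := R_NormedModule)); now exists (dU x).
  - rewrite E, Rminus_0_r, Rabs_mult.
    assert (hcx : Rabs c <= Rabs xi).
    { unfold Rmin, Rmax in hc; destruct (Rle_dec 0 xi); unfold Rabs; destruct (Rcase_abs c); destruct (Rcase_abs xi); lra. }
    specialize (hb c hcx); pose proof (Rabs_pos xi); nra. }
split.
- assert (L : is_lim_seq (fun K => (AT (INR K + / 2) xi * P xi - BT (INR K + / 2) xi * Q xi) -
     (AT (INR K + / 2) 0 * P 0 - BT (INR K + / 2) 0 * Q 0)) ((LA xi * P xi - LB xi * Q xi) - (LA 0 * P 0 - LB 0 * Q 0))).
  { apply is_lim_seq_minus'; (apply lim_minus; [apply LA_cv|apply LB_cv]). }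
  assert (L0 := lim0_sq _ _ (fun K => K1 (INR K + / 2) ltac:(pose proof (pos_INR K); lra) _ _
    (fun y => proj1 (U_derive (INR K + / 2) y)) (fun y hy =>
       let d := dRI_bd (INR K + / 2) y ltac:(pose proof (pos_INR K); lra) in
       let e := exp_cos_bd y _ hy in
       comb_bd _ _ _ _ _ _ (proj2 d) (proj1 d) (proj1 e) (proj2 e))) (lim0_exp _)).
  apply is_lim_seq_unique in L; apply is_lim_seq_unique in L0.
  cbv beta in L0; rewrite L in L0; apply Rminus_diag_uniq; now injection L0.
- assert (L : is_lim_seq (fun K => (AT (INR K + / 2) xi * Q xi + BT (INR K + / 2) xi * P xi) -
     (AT (INR K + / 2) 0 * Q 0 + BT (INR K + / 2) 0 * P 0)) ((LA xi * Q xi + LB xi * P xi) - (LA 0 * Q 0 + LB 0 * P 0))).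
  { apply is_lim_seq_minus'; (apply lim_plus; [apply LA_cv|apply LB_cv]). }
  assert (hb : forall K y, Rabs y <= Rabs xi -> Rabs ((tr * dI (INR K + / 2) y + ti * dR (INR K + / 2) y) * Q y - (tr * dR (INR K + / 2) y - ti * dI (INR K + / 2) y) * P y) <= 2 * (tr + Rabs ti) * exp (PI * tr * (Rabs xi * Rabs xi)) * (2 * M * exp (- (INR K + / 2)))).
  { intros K y hy.
    destruct (dRI_bd (INR K + / 2) y ltac:(pose proof (pos_INR K); lra)) as [d1 d2].
    destruct (exp_cos_bd y _ hy) as [e1 e2].
    replace ((tr * dI (INR K + / 2) y + ti * dR (INR K + / 2) y) * Q y - (tr * dR (INR K + / 2) y - ti * dI (INR K + / 2) y) * P y)
      with ((tr * dI (INR K + / 2) y + ti * dR (INR K + / 2) y) * Q y + (tr * dR (INR K + / 2) y - ti * dI (INR K + / 2) y) * - P y) by ring.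
    apply comb_bd; auto; rewrite Rabs_Ropp; auto. }
  assert (L0 := lim0_sq _ _ (fun K => K1 (INR K + / 2) ltac:(pose proof (pos_INR K); lra) _ _
    (fun y => proj2 (U_derive (INR K + / 2) y)) (hb K)) (lim0_exp _)).
  apply is_lim_seq_unique in L; apply is_lim_seq_unique in L0.
  cbv beta in L0; rewrite L in L0; apply Rminus_diag_uniq; now injection L0.
Qed.

Definition ER xi := exp (- PI * tr * (xi * xi)) * cos (PI * ti * (xi * xi)).
Definition EI xi := - exp (- PI * tr * (xi * xi)) * sin (PI * ti * (xi * xi)).

(** Multiply [U_lim] by [ER + i EI], the inverse of [P + i Q], and use [P 0 = 1], [Q 0 = 0]. *)
Lemma LAB_eq xi : LA xi = LA 0 * ER xi - LB 0 * EI xi /\ LB xi = LA 0 * EI xi + LB 0 * ER xi.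
Proof.
destruct (U_lim xi) as [h1 h2].
assert (P0 : P 0 = 1) by (unfold P; rewrite !Rmult_0_r, exp_0, cos_0; ring).
assert (Q0 : Q 0 = 0) by (unfold Q; rewrite !Rmult_0_r, exp_0, sin_0; ring).
rewrite P0, Q0 in h1, h2.
assert (e1 : ER xi * P xi - EI xi * Q xi = 1 /\ ER xi * Q xi + EI xi * P xi = 0).
{ unfold ER, EI, P, Q.
  assert (E : exp (- PI * tr * (xi * xi)) * exp (PI * tr * (xi * xi)) = 1)
    by (rewrite <- exp_plus; rewrite <- exp_0; f_equal; ring).
  assert (C := sin2_cos2 (PI * ti * (xi * xi))); unfold Rsqr in C.
  split; [|ring].
  transitivity ((exp (- PI * tr * (xi * xi)) * exp (PI * tr * (xi * xi))) * (sin (PI * ti * (xi * xi)) * sin (PI * ti * (xi * xi)) + cos (PI * ti * (xi * xi)) * cos (PI * ti * (xi * xi)))); [ring|].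
  rewrite E, C; ring. }
destruct e1 as [e1 e2].
split.
- transitivity (LA xi * (ER xi * P xi - EI xi * Q xi) - LB xi * (ER xi * Q xi + EI xi * P xi)); [rewrite e1, e2; ring|].
  transitivity ((LA xi * P xi - LB xi * Q xi) * ER xi - (LA xi * Q xi + LB xi * P xi) * EI xi); [ring|rewrite h1, h2; ring].
- transitivity (LB xi * (ER xi * P xi - EI xi * Q xi) + LA xi * (ER xi * Q xi + EI xi * P xi)); [rewrite e1, e2; ring|].
  transitivity ((LA xi * P xi - LB xi * Q xi) * EI xi + (LA xi * Q xi + LB xi * P xi) * ER xi); [ring|rewrite h1, h2; ring].
Qed.

Lemma XR_cv xi : is_lim_seq (fun K => XR (INR K + / 2) xi) (- xi * (tr * LB xi + ti * LA xi)).
Proof.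
apply is_lim_seq_ext with (fun K => - xi * (tr * BT (INR K + / 2) xi + ti * AT (INR K + / 2) xi) - (tr * dR (INR K + / 2) xi - ti * dI (INR K + / 2) xi) / (2 * PI)).
{ intros; symmetry; apply XR_eq. }
replace (- xi * (tr * LB xi + ti * LA xi)) with (- xi * (tr * LB xi + ti * LA xi) - 0) by ring.
assert (hd := fun K => dRI_bd (INR K + / 2) xi ltac:(pose proof (pos_INR K); lra)).
assert (z1 := lim0_sq _ _ (fun K => proj1 (hd K)) (lim0_exp (2 * M))).
assert (z2 := lim0_sq _ _ (fun K => proj2 (hd K)) (lim0_exp (2 * M))).
apply is_lim_seq_minus'.
- apply is_lim_seq_mult'; [apply is_lim_seq_const|].
  apply is_lim_seq_plus'; (apply is_lim_seq_mult'; [apply is_lim_seq_const|]); [apply LB_cv|apply LA_cv].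
- unfold Rdiv; replace 0 with ((tr * 0 - ti * 0) * / (2 * PI)) by ring.
  apply is_lim_seq_mult'; [|apply is_lim_seq_const].
  apply is_lim_seq_minus'; (apply is_lim_seq_mult'; [apply is_lim_seq_const|auto]).
Qed.

Lemma XI_cv xi : is_lim_seq (fun K => XI (INR K + / 2) xi) (xi * (tr * LA xi - ti * LB xi)).
Proof.
apply is_lim_seq_ext with (fun K => xi * (tr * AT (INR K + / 2) xi - ti * BT (INR K + / 2) xi) - (tr * dI (INR K + / 2) xi + ti * dR (INR K + / 2) xi) / (2 * PI)).
{ intros; symmetry; apply XI_eq. }
replace (xi * (tr * LA xi - ti * LB xi)) with (xi * (tr * LA xi - ti * LB xi) - 0) by ring.
assert (hd := fun K => dRI_bd (INR K + / 2) xi ltac:(pose proof (pos_INR K); lra)).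
assert (z1 := lim0_sq _ _ (fun K => proj1 (hd K)) (lim0_exp (2 * M))).
assert (z2 := lim0_sq _ _ (fun K => proj2 (hd K)) (lim0_exp (2 * M))).
apply is_lim_seq_minus'.
- apply is_lim_seq_mult'; [apply is_lim_seq_const|].
  apply is_lim_seq_minus'; (apply is_lim_seq_mult'; [apply is_lim_seq_const|]); [apply LA_cv|apply LB_cv].
- unfold Rdiv; replace 0 with ((tr * 0 + ti * 0) * / (2 * PI)) by ring.
  apply is_lim_seq_mult'; [|apply is_lim_seq_const].
  apply is_lim_seq_plus'; (apply is_lim_seq_mult'; [apply is_lim_seq_const|auto]).
Qed.

End Gauss.
End GaussianTransform.

(** * Poisson summation for Gaussian families, and sums over residue classes *)

Module ThetaSeries.
From Stdlib Require Import Reals Lra Lia ZArith.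
From Coquelicot Require Import Coquelicot.
Import FourierUniqueness PoissonSummation GaussianTransform.
Open Scope R_scope.

Lemma Ssum_ext f g : (forall k, f k = g k) -> Ssum f = Ssum g.
Proof. intros H; unfold Ssum; f_equal; apply Lim_seq_ext; intros; now apply ssum_ext. Qed.

Lemma Ssum_lin a b f g Cf rf Cg rg : geom_bd f Cf rf -> geom_bd g Cg rg ->
  Ssum (fun k => a * f k + b * g k) = a * Ssum f + b * Ssum g.
Proof.
intros hf hg; apply ssum_cv in hf; apply ssum_cv in hg.
assert (L : is_lim_seq (ssum (fun k => a * f k + b * g k)) (a * Ssum f + b * Ssum g)).
{ apply is_lim_seq_ext with (fun K => a * ssum f K + b * ssum g K).
  - intros; now rewrite ssum_plus, !ssum_scal.
  - apply is_lim_seq_plus'; apply is_lim_seq_mult'; auto; apply is_lim_seq_const. }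
unfold Ssum at 1; now rewrite (is_lim_seq_unique _ _ L).
Qed.

Section Fam.
Variables (G : R -> R -> R) (F : R -> R) (M C k : R).
Hypothesis hk : 0 < k.
Hypothesis hC : 0 <= C.
Hypothesis Gc : forall xi x, continuous (G xi) x.
Hypothesis GM : forall xi x, Rabs (G xi x) <= M * exp (- Rabs x).
Hypothesis Gcos : forall xi n x, G xi x * cos (2 * PI * IZR n * x) = / 2 * (G (xi + IZR n) x + G (xi - IZR n) x).
Hypothesis Fcv : forall xi, is_lim_seq (fun K => RInt (G xi) (- (INR K + / 2)) (INR K + / 2)) (F xi).
Hypothesis FM : forall xi, Rabs (F xi) <= C * (exp (- k * (xi * xi)) * (1 + Rabs xi)).

Lemma F_bd xi : geom_bd (fun n => F (xi + IZR n)) (C * exp (/ k) * exp (Rabs xi)) (exp (- 1)).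
Proof.
pose proof (exp_pos (/ k)); pose proof (exp_pos (Rabs xi)).
split; [apply Rmult_le_pos; [apply Rmult_le_pos; lra|lra]|split; [apply exp_m1|]].
assert (H1 : forall j z, Rabs z = INR j -> Rabs (F (xi + z)) <= C * exp (/ k) * exp (Rabs xi) * exp (- 1) ^ j).
{ intros j z hz; eapply Rle_trans; [apply FM|].
  rewrite !Rmult_assoc; apply Rmult_le_compat_l; auto.
  eapply Rle_trans; [apply gauss_bd; auto|].
  apply Rmult_le_compat_l; [lra|].
  rewrite <- exp_INR, <- exp_plus; apply exp_le_exp.
  pose proof (Rabs_triang (xi + z) (- xi)) as h; rewrite Rabs_Ropp in h.
  replace (xi + z + - xi) with z in h by ring; lra. }
intros j; split; apply H1.
- rewrite <- INR_IZR_INZ; apply Rabs_right, Rle_ge, pos_INR.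
- rewrite opp_IZR, Rabs_Ropp, <- INR_IZR_INZ; apply Rabs_right, Rle_ge, pos_INR.
Qed.

(** Multiplication by [cos (2 pi n x)] shifts the frequency by [n] and by [- n], so the cosine
    transform at [n] is the mean of [F (xi + n)] and [F (xi - n)]. The symmetric sum over [n] undoes
    the mean. *)
Lemma poisson_fam xi : Ssum (fun n => G xi (IZR n)) = Ssum (fun n => F (xi + IZR n)).
Proof.
transitivity (Ssum (fun n => / 2 * (F (xi + IZR n) + F (xi - IZR n)))).
- destruct (F_bd xi) as [h1 [h2 h3]].
  apply (poisson (G xi) M _ (C * exp (/ k) * exp (Rabs xi)) (exp (- 1))); auto.
  + split; [auto|split; [auto|]].
    intros j; destruct (h3 j) as [a b]; rewrite opp_IZR in *.
    replace (xi - - IZR (Z.of_nat j)) with (xi + IZR (Z.of_nat j)) by ring.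
    unfold Rminus; split; apply Rabs_le; apply Rabs_le_between in a; apply Rabs_le_between in b; lra.
  + intros n.
    apply is_lim_seq_ext with (fun K => / 2 * (RInt (G (xi + IZR n)) (- (INR K + / 2)) (INR K + / 2) + RInt (G (xi - IZR n)) (- (INR K + / 2)) (INR K + / 2))).
    * intros K; symmetry; apply (is_RInt_unique (V := R_CompleteNormedModule)).
      assert (a1 := RInt_correct (V := R_CompleteNormedModule) _ _ _ (ex_RInt_g _ (Gc (xi + IZR n)) (- (INR K + / 2)) (INR K + / 2))).
      assert (a2 := RInt_correct (V := R_CompleteNormedModule) _ _ _ (ex_RInt_g _ (Gc (xi - IZR n)) (- (INR K + / 2)) (INR K + / 2))).
      assert (a3 := is_RInt_scal _ _ _ (/ 2) _ (is_RInt_plus _ _ _ _ _ _ a1 a2)).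
      apply is_RInt_ext with (2 := a3); intros x _; rewrite Gcos; reflexivity.
    * apply is_lim_seq_mult'; [apply is_lim_seq_const|apply is_lim_seq_plus'; apply Fcv].
- unfold Ssum; f_equal; apply Lim_seq_ext; intros K.
  induction K as [|K IH]; cbn [ssum].
  + rewrite Rminus_0_r, Rplus_0_r; field.
  + rewrite IH, opp_IZR; replace (xi - - IZR (Z.of_nat (S K))) with (xi + IZR (Z.of_nat (S K))) by ring.
    unfold Rminus; field.
Qed.
End Fam.

Section G4.
Variables (p q : R).
Hypothesis hp : 0 < p.
Let n2 := p ^ 2 + q ^ 2.
Let n2p : 0 < n2. Proof. unfold n2; nra. Qed.
Let tr := p / n2.
Let ti := - q / n2.
Let trp : 0 < tr. Proof. unfold tr; apply Rdiv_lt_0_compat; auto. Qed.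
Let k := PI * tr.
Let hk : 0 < k. Proof. pose proof PI_RGT_0; unfold k; apply Rmult_lt_0_compat; auto. Qed.
Let C0 := Rabs (LA p q 0) + Rabs (LB p q 0).
Let C0p : 0 <= C0. Proof. unfold C0; pose proof (Rabs_pos (LA p q 0)); pose proof (Rabs_pos (LB p q 0)); lra. Qed.

Lemma ER_bd xi : Rabs (ER p q xi) <= exp (- k * (xi * xi)) /\ Rabs (EI p q xi) <= exp (- k * (xi * xi)).
Proof.
unfold ER, EI; fold n2 tr ti.
assert (E : - PI * tr * (xi * xi) = - k * (xi * xi)) by (unfold k; ring).
fold n2; fold tr; fold ti; rewrite E; pose proof (exp_pos (- k * (xi * xi))).
split; rewrite Rabs_mult, ?Rabs_Ropp, (Rabs_right (exp _)) by lra.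
- assert (Rabs (cos (PI * ti * (xi * xi))) <= 1) by (apply Rabs_le, COS_bound); nra.
- assert (Rabs (sin (PI * ti * (xi * xi))) <= 1) by (apply Rabs_le, SIN_bound); nra.
Qed.

Lemma LAB_bd xi : Rabs (LA p q xi) <= C0 * exp (- k * (xi * xi)) /\ Rabs (LB p q xi) <= C0 * exp (- k * (xi * xi)).
Proof.
destruct (ER_bd xi) as [h1 h2]; destruct (LAB_eq p q hp xi) as [e1 e2].
assert (T : forall a b, Rabs b <= exp (- k * (xi * xi)) -> Rabs (a * b) <= Rabs a * exp (- k * (xi * xi))).
{ intros; rewrite Rabs_mult; apply Rmult_le_compat_l; [apply Rabs_pos|auto]. }
rewrite e1, e2; unfold C0.
pose proof (T (LA p q 0) _ h1) as a1; pose proof (T (LB p q 0) _ h2) as a2.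
pose proof (T (LA p q 0) _ h2) as a3; pose proof (T (LB p q 0) _ h1) as a4.
apply Rabs_le_between in a1; apply Rabs_le_between in a2; apply Rabs_le_between in a3; apply Rabs_le_between in a4.
split; apply Rabs_le; lra.
Qed.

Lemma gcosR xi n x : gR p q xi x * cos (2 * PI * IZR n * x) = / 2 * (gR p q (xi + IZR n) x + gR p q (xi - IZR n) x).
Proof.
unfold gR.
replace (2 * PI * (xi + IZR n) * x + - (PI * q * (x * x))) with ((2 * PI * xi * x + - (PI * q * (x * x))) + 2 * PI * IZR n * x) by ring.
replace (2 * PI * (xi - IZR n) * x + - (PI * q * (x * x))) with ((2 * PI * xi * x + - (PI * q * (x * x))) - 2 * PI * IZR n * x) by ring.
set (th := 2 * PI * xi * x + - (PI * q * (x * x))); rewrite cos_plus, cos_minus; field.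
Qed.
Lemma gcosI xi n x : gI p q xi x * cos (2 * PI * IZR n * x) = / 2 * (gI p q (xi + IZR n) x + gI p q (xi - IZR n) x).
Proof.
unfold gI.
replace (2 * PI * (xi + IZR n) * x + - (PI * q * (x * x))) with ((2 * PI * xi * x + - (PI * q * (x * x))) + 2 * PI * IZR n * x) by ring.
replace (2 * PI * (xi - IZR n) * x + - (PI * q * (x * x))) with ((2 * PI * xi * x + - (PI * q * (x * x))) - 2 * PI * IZR n * x) by ring.
set (th := 2 * PI * xi * x + - (PI * q * (x * x))); rewrite sin_plus, sin_minus; field.
Qed.

Lemma weak_bd c xi : Rabs c <= C0 * exp (- k * (xi * xi)) -> Rabs c <= C0 * (exp (- k * (xi * xi)) * (1 + Rabs xi)).
Proof.
intros h; eapply Rle_trans; [exact h|]; apply Rmult_le_compat_l; auto.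
pose proof (exp_pos (- k * (xi * xi))); pose proof (Rabs_pos xi); nra.
Qed.

Lemma poisson_gR xi : Ssum (fun n => gR p q xi (IZR n)) = Ssum (fun n => LA p q (xi + IZR n)).
Proof.
apply (poisson_fam (gR p q) (LA p q) (exp (/ (PI * p))) C0 k); auto.
- intros; apply gR_cont.
- intros; now apply gR_bd.
- apply gcosR.
- intros; now apply LA_cv.
- intros; apply weak_bd, (proj1 (LAB_bd _)).
Qed.
Lemma poisson_gI xi : Ssum (fun n => gI p q xi (IZR n)) = Ssum (fun n => LB p q (xi + IZR n)).
Proof.
apply (poisson_fam (gI p q) (LB p q) (exp (/ (PI * p))) C0 k); auto.
- intros; apply gI_cont.
- intros; now apply gI_bd.
- apply gcosI.
- intros; now apply LB_cv.
- intros; apply weak_bd, (proj2 (LAB_bd _)).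
Qed.

Let C1 := (tr + Rabs ti) * C0.
Let C1p : 0 <= C1. Proof. unfold C1; pose proof (Rabs_pos ti); apply Rmult_le_pos; lra. Qed.

Lemma x_bd a b xi : Rabs a <= C0 * exp (- k * (xi * xi)) -> Rabs b <= C0 * exp (- k * (xi * xi)) ->
  Rabs (xi * (tr * a + ti * b)) <= C1 * (exp (- k * (xi * xi)) * (1 + Rabs xi)).
Proof.
intros ha hb; rewrite Rabs_mult.
assert (h : Rabs (tr * a + ti * b) <= C1 * exp (- k * (xi * xi))).
{ eapply Rle_trans; [apply Rabs_triang|]; rewrite !Rabs_mult, (Rabs_right tr) by lra.
  unfold C1; pose proof (Rabs_pos ti).
  replace ((tr + Rabs ti) * C0 * exp (- k * (xi * xi))) with (tr * (C0 * exp (- k * (xi * xi))) + Rabs ti * (C0 * exp (- k * (xi * xi)))) by ring.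
  apply Rplus_le_compat; apply Rmult_le_compat_l; auto; lra. }
rewrite <- Rmult_assoc, (Rmult_comm (Rabs xi)).
apply Rmult_le_compat; try apply Rabs_pos; auto; lra.
Qed.

Lemma poisson_xR xi : Ssum (fun n => IZR n * gR p q xi (IZR n)) =
  Ssum (fun n => - (xi + IZR n) * (tr * LB p q (xi + IZR n) + ti * LA p q (xi + IZR n))).
Proof.
apply (poisson_fam (fun xi x => x * gR p q xi x) (fun xi => - xi * (tr * LB p q xi + ti * LA p q xi)) (exp (/ (PI * p))) C1 k); auto.
- intros; apply xgR_cont.
- intros; now apply xgR_bd.
- intros; rewrite Rmult_assoc, gcosR; field.
- intros; now apply XR_cv.
- intros; rewrite Ropp_mult_distr_l_reverse, Rabs_Ropp; apply x_bd; [apply (proj2 (LAB_bd _))|apply (proj1 (LAB_bd _))].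
Qed.
Lemma poisson_xI xi : Ssum (fun n => IZR n * gI p q xi (IZR n)) =
  Ssum (fun n => (xi + IZR n) * (tr * LA p q (xi + IZR n) - ti * LB p q (xi + IZR n))).
Proof.
apply (poisson_fam (fun xi x => x * gI p q xi x) (fun xi => xi * (tr * LA p q xi - ti * LB p q xi)) (exp (/ (PI * p))) C1 k); auto.
- intros; apply xgI_cont.
- intros; now apply xgI_bd.
- intros; rewrite Rmult_assoc, gcosI; field.
- intros; now apply XI_cv.
- intros; replace (tr * LA p q xi0 - ti * LB p q xi0) with (tr * LA p q xi0 + ti * - LB p q xi0) by ring.
  apply x_bd; rewrite ?Rabs_Ropp; [apply (proj1 (LAB_bd _))|apply (proj2 (LAB_bd _))].
Qed.

Lemma ER_gbd xi : exists C, geom_bd (fun n => ER p q (xi + IZR n)) C (exp (- 1)) /\ geom_bd (fun n => EI p q (xi + IZR n)) C (exp (- 1))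
  /\ geom_bd (fun n => (xi + IZR n) * ER p q (xi + IZR n)) C (exp (- 1)) /\ geom_bd (fun n => (xi + IZR n) * EI p q (xi + IZR n)) C (exp (- 1)).
Proof.
exists (1 * exp (/ k) * exp (Rabs xi)).
assert (W : forall F : R -> R, (forall x, Rabs (F x) <= exp (- k * (x * x)) * (1 + Rabs x)) -> geom_bd (fun n => F (xi + IZR n)) (1 * exp (/ k) * exp (Rabs xi)) (exp (- 1))).
{ intros F hF; apply F_bd; auto; [lra|intros; rewrite Rmult_1_l; auto]. }
assert (E1 : forall x, Rabs (ER p q x) <= exp (- k * (x * x)) * (1 + Rabs x) /\ Rabs (EI p q x) <= exp (- k * (x * x)) * (1 + Rabs x)
   /\ Rabs (x * ER p q x) <= exp (- k * (x * x)) * (1 + Rabs x) /\ Rabs (x * EI p q x) <= exp (- k * (x * x)) * (1 + Rabs x)).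
{ intros x; destruct (ER_bd x) as [h1 h2]; pose proof (Rabs_pos x); rewrite !Rabs_mult.
  pose proof (Rabs_pos (ER p q x)); pose proof (Rabs_pos (EI p q x)); repeat split; nra. }
split; [|split; [|split]].
- apply (W (ER p q)); intros; apply (proj1 (E1 x)).
- apply (W (EI p q)); intros; apply (proj1 (proj2 (E1 x))).
- apply (W (fun x => x * ER p q x)); intros; apply (proj1 (proj2 (proj2 (E1 x)))).
- apply (W (fun x => x * EI p q x)); intros; apply (proj2 (proj2 (proj2 (E1 x)))).
Qed.

Definition SER xi := Ssum (fun n => ER p q (xi + IZR n)).
Definition SEI xi := Ssum (fun n => EI p q (xi + IZR n)).
Definition SxER xi := Ssum (fun n => (xi + IZR n) * ER p q (xi + IZR n)).
Definition SxEI xi := Ssum (fun n => (xi + IZR n) * EI p q (xi + IZR n)).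

Lemma theta_R xi : Ssum (fun n => gR p q xi (IZR n)) = LA p q 0 * SER xi - LB p q 0 * SEI xi.
Proof.
destruct (ER_gbd xi) as [C [h1 [h2 [h3 h4]]]].
rewrite poisson_gR, (Ssum_ext _ (fun n => LA p q 0 * ER p q (xi + IZR n) + - LB p q 0 * EI p q (xi + IZR n))).
- rewrite (Ssum_lin _ _ _ _ _ _ _ _ h1 h2); unfold SER, SEI; ring.
- intros n; rewrite (proj1 (LAB_eq p q hp (xi + IZR n))); ring.
Qed.
Lemma theta_I xi : Ssum (fun n => gI p q xi (IZR n)) = LA p q 0 * SEI xi + LB p q 0 * SER xi.
Proof.
destruct (ER_gbd xi) as [C [h1 [h2 [h3 h4]]]].
rewrite poisson_gI, (Ssum_ext _ (fun n => LB p q 0 * ER p q (xi + IZR n) + LA p q 0 * EI p q (xi + IZR n))).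
- rewrite (Ssum_lin _ _ _ _ _ _ _ _ h1 h2); unfold SER, SEI; ring.
- intros n; rewrite (proj2 (LAB_eq p q hp (xi + IZR n))); ring.
Qed.
Lemma theta_xR xi : Ssum (fun n => IZR n * gR p q xi (IZR n)) =
  - (tr * (LA p q 0 * SxEI xi + LB p q 0 * SxER xi) + ti * (LA p q 0 * SxER xi - LB p q 0 * SxEI xi)).
Proof.
destruct (ER_gbd xi) as [C [h1 [h2 [h3 h4]]]].
rewrite poisson_xR, (Ssum_ext _ (fun n => - (tr * LB p q 0 + ti * LA p q 0) * ((xi + IZR n) * ER p q (xi + IZR n)) + - (tr * LA p q 0 - ti * LB p q 0) * ((xi + IZR n) * EI p q (xi + IZR n)))).
- rewrite (Ssum_lin _ _ _ _ _ _ _ _ h3 h4); unfold SxER, SxEI; ring.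
- intros n; rewrite (proj1 (LAB_eq p q hp (xi + IZR n))), (proj2 (LAB_eq p q hp (xi + IZR n))); ring.
Qed.
Lemma theta_xI xi : Ssum (fun n => IZR n * gI p q xi (IZR n)) =
  tr * (LA p q 0 * SxER xi - LB p q 0 * SxEI xi) - ti * (LA p q 0 * SxEI xi + LB p q 0 * SxER xi).
Proof.
destruct (ER_gbd xi) as [C [h1 [h2 [h3 h4]]]].
rewrite poisson_xI, (Ssum_ext _ (fun n => (tr * LA p q 0 - ti * LB p q 0) * ((xi + IZR n) * ER p q (xi + IZR n)) + - (tr * LB p q 0 + ti * LA p q 0) * ((xi + IZR n) * EI p q (xi + IZR n)))).
- rewrite (Ssum_lin _ _ _ _ _ _ _ _ h3 h4); unfold SxER, SxEI; ring.
- intros n; rewrite (proj1 (LAB_eq p q hp (xi + IZR n))), (proj2 (LAB_eq p q hp (xi + IZR n))); ring.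
Qed.

(** Substitution [x -> s x]; the windows of [g] become [(INR K + / 2) / s], which [RInt_cv]
    allows. *)
Lemma scale_gen (g h : R -> R) Mg Mh s : 0 < s -> (forall x, continuous g x) -> (forall x, continuous h x) ->
  (forall x, Rabs (g x) <= Mg * exp (- Rabs x)) -> (forall x, Rabs (h x) <= Mh * exp (- Rabs x)) ->
  (forall x, h (s * x) = g x) ->
  real (Lim_seq (fun K => RInt h (- (INR K + / 2)) (INR K + / 2))) = s * real (Lim_seq (fun K => RInt g (- (INR K + / 2)) (INR K + / 2))).
Proof.
intros hs cg ch bg bh E.
assert (L1 := RInt_cvK h Mh ch bh).
assert (hT : is_lim_seq (fun K => (INR K + / 2) / s) p_infty).
{ apply is_lim_seq_spec; intros A.
  destruct (proj2 (is_lim_seq_spec _ _) is_lim_seq_INR (s * A)) as [N hN].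
  exists N; intros n hn; specialize (hN n hn).
  apply Rmult_lt_reg_l with s; auto; replace (s * ((INR n + / 2) / s)) with (INR n + / 2) by (field; lra); lra. }
assert (hT0 : forall K, 0 <= (INR K + / 2) / s).
{ intros; apply Rmult_le_pos; [pose proof (pos_INR K); lra|apply Rlt_le, Rinv_0_lt_compat; auto]. }
assert (L2 := RInt_cv g Mg cg bg _ hT0 hT).
assert (L3 := is_lim_seq_scal_l _ s _ L2).
apply is_lim_seq_unique in L1; apply is_lim_seq_unique in L3.
rewrite (Lim_seq_ext _ (fun K => RInt h (- (INR K + / 2)) (INR K + / 2))) in L3.
- rewrite L1 in L3; simpl in L3; now injection L3.
- intros K; set (T := INR K + / 2).
  assert (I : is_RInt h (s * (- (T / s)) + 0) (s * (T / s) + 0) (RInt h (- T) T)).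
  { replace (s * - (T / s) + 0) with (- T) by (field; lra); replace (s * (T / s) + 0) with T by (field; lra).
    apply (RInt_correct (V := R_CompleteNormedModule)), ex_RInt_g; auto. }
  apply (is_RInt_comp_lin (V := R_NormedModule)) in I.
  symmetry; rewrite <- (is_RInt_unique (V := R_CompleteNormedModule) _ _ _ _ I).
  assert (E2 : forall x, scal s (h (s * x + 0)) = scal s (g x)) by (intros; now rewrite Rplus_0_r, E).
  rewrite (RInt_ext (V := R_CompleteNormedModule) _ (fun x => scal s (g x))) by (intros; apply E2).
  rewrite (RInt_scal (V := R_CompleteNormedModule)); [reflexivity|apply ex_RInt_g; auto].
Qed.

Lemma LA_scale s : 0 < s -> LA (p / (s * s)) (q / (s * s)) 0 = s * LA p q 0 /\ LB (p / (s * s)) (q / (s * s)) 0 = s * LB p q 0.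
Proof.
intros hs; assert (0 < p / (s * s)) by (apply Rdiv_lt_0_compat; nra).
split; unfold LA, LB.
- apply (scale_gen (gR p q 0) (gR (p / (s * s)) (q / (s * s)) 0) (exp (/ (PI * p))) (exp (/ (PI * (p / (s * s)))))); auto;
   intros; try apply gR_cont; try (now apply gR_bd).
  unfold gR; f_equal; f_equal; field; lra.
- apply (scale_gen (gI p q 0) (gI (p / (s * s)) (q / (s * s)) 0) (exp (/ (PI * p))) (exp (/ (PI * (p / (s * s)))))); auto;
   intros; try apply gI_cont; try (now apply gI_bd).
  unfold gI; f_equal; f_equal; field; lra.
Qed.

End G4.

Fixpoint psum (f : Z -> R) (n m : nat) : R :=
  match m with O => 0 | S m' => psum f n m' + f (Z.of_nat (n + m)) end.

Lemma ssum_psum f n m : ssum f (n + m) = ssum f n + psum f n m + psum (fun k => f (- k)%Z) n m.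
Proof.
induction m as [|m IH]; [rewrite Nat.add_0_r; simpl; ring|].
rewrite Nat.add_succ_r; cbn [ssum psum]; rewrite IH, Nat.add_succ_r; ring.
Qed.

Lemma psum_single f n m i : (1 <= i <= m)%nat -> (forall j, (1 <= j <= m)%nat -> j <> i -> f (Z.of_nat (n + j)) = 0) ->
  psum f n m = f (Z.of_nat (n + i)).
Proof.
assert (Z0 : forall m, (forall j, (1 <= j <= m)%nat -> f (Z.of_nat (n + j)) = 0) -> psum f n m = 0).
{ clear m; induction m as [|m IH]; intros H; cbn [psum]; auto; rewrite IH, H by (intros; try apply H; lia); ring. }
induction m as [|m IH]; intros hi H; [lia|]; cbn [psum].
destruct (Nat.eq_dec i (S m)) as [->|h].
- rewrite Z0; [ring|intros; apply H; lia].
- rewrite IH, (H (S m)); try lia; [ring|intros; apply H; lia].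
Qed.

Definition ind (d c : nat) (l : Z) : R := if Z.eq_dec ((l - Z.of_nat c) mod Z.of_nat d) 0 then 1 else 0.

Lemma ind_1 d c k : (0 < d)%nat -> ind d c (Z.of_nat c + Z.of_nat d * k) = 1.
Proof.
intros hd; unfold ind; destruct (Z.eq_dec _ _) as [h|h]; auto; exfalso; apply h.
replace (Z.of_nat c + Z.of_nat d * k - Z.of_nat c)%Z with (k * Z.of_nat d)%Z by ring; apply Z_mod_mult.
Qed.

Lemma ind_0 d c l : (0 < d)%nat -> (forall k, l <> Z.of_nat c + Z.of_nat d * k)%Z -> ind d c l = 0.
Proof.
intros hd H; unfold ind; destruct (Z.eq_dec _ _) as [h|h]; auto; exfalso.
apply (H ((l - Z.of_nat c) / Z.of_nat d)%Z).
pose proof (Z_div_mod_eq_full (l - Z.of_nat c) (Z.of_nat d)); lia.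
Qed.

(** For [|k| <= K] the numbers [c + d k] run through the class of [c] in [[- d K, d K]]. If [c > 0]
    they also reach [c + d K] outside that interval: this is the subtracted term. *)
Lemma ssum_ind (h : Z -> R) d c K : (c < d)%nat ->
  ssum (fun l => ind d c l * h l) (d * K) =
  ssum (fun k => h (Z.of_nat c + Z.of_nat d * k)%Z) K - (if Nat.eq_dec c 0 then 0 else h (Z.of_nat c + Z.of_nat d * Z.of_nat K)%Z).
Proof.
intros hc; induction K as [|K IH].
- rewrite Nat.mul_0_r; cbn [ssum]; destruct (Nat.eq_dec c 0) as [->|hc0].
  + replace (Z.of_nat 0 + Z.of_nat d * 0)%Z with 0%Z by lia.
    replace 0%Z with (Z.of_nat 0 + Z.of_nat d * 0)%Z at 1 by lia; rewrite ind_1 by lia; ring.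
  + rewrite ind_0; [|lia|]; [simpl (Z.of_nat 0); ring|].
    intros k hk; assert (k < 0 \/ k = 0 \/ k > 0)%Z by lia; nia.
- replace (d * S K)%nat with (d * K + d)%nat by lia.
  rewrite ssum_psum, IH; cbn [ssum].
  set (i := if Nat.eq_dec c 0 then d else c).
  assert (hi : (1 <= i <= d)%nat) by (unfold i; destruct (Nat.eq_dec c 0); lia).
  rewrite (psum_single _ _ _ i hi).
  2:{ intros j hj hji; rewrite ind_0; [ring|lia|]; intros k hk; unfold i in hji.
      assert (ht : exists t, (k = Z.of_nat K + t)%Z) by (exists (k - Z.of_nat K)%Z; lia); destruct ht as [t ->].
      assert (hk' : (Z.of_nat j = Z.of_nat c + Z.of_nat d * t)%Z) by lia.
      assert (hs : (t <= -1 \/ t = 0 \/ t = 1 \/ t >= 2)%Z) by lia; destruct hs as [ht|[->|[->|ht]]];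
      destruct (Nat.eq_dec c 0) as [->|]; try lia; nia. }
  rewrite (psum_single _ _ _ (d - c)%nat); [|lia|].
  2:{ intros j hj hji; rewrite ind_0; [ring|lia|]; intros k hk.
      assert (hs : (k <= - Z.of_nat K - 2 \/ k = - Z.of_nat K - 1 \/ k >= - Z.of_nat K)%Z) by lia; nia. }
  replace (- Z.of_nat (d * K + (d - c)))%Z with (Z.of_nat c + Z.of_nat d * - Z.of_nat (S K))%Z by lia.
  rewrite ind_1 by lia.
  unfold i; destruct (Nat.eq_dec c 0) as [->|hc0].
  + replace (Z.of_nat (d * K + d)) with (Z.of_nat 0 + Z.of_nat d * Z.of_nat (S K))%Z by lia.
    rewrite ind_1 by lia; ring.
  + replace (Z.of_nat (d * K + c)) with (Z.of_nat c + Z.of_nat d * Z.of_nat K)%Z by lia.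
    rewrite ind_1 by lia; ring.
Qed.

Lemma Ssum_ind (h : Z -> R) d c C r C' r' : (c < d)%nat -> geom_bd h C r -> geom_bd (fun k => h (Z.of_nat c + Z.of_nat d * k)%Z) C' r' ->
  Ssum (fun l => ind d c l * h l) = Ssum (fun k => h (Z.of_nat c + Z.of_nat d * k)%Z).
Proof.
intros hc hb hb'.
assert (hi : geom_bd (fun l => ind d c l * h l) C r).
{ destruct hb as [a [b H]]; split; [auto|split; [auto|]].
  assert (U : forall l x, Rabs (h l) <= x -> Rabs (ind d c l * h l) <= x).
  { intros l x hx; unfold ind; destruct (Z.eq_dec _ _); rewrite ?Rmult_1_l, ?Rmult_0_l, ?Rabs_R0; auto; pose proof (Rabs_pos (h l)); lra. }
  intros k; destruct (H k); split; apply U; auto. }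
assert (L1 := ssum_cv _ _ _ hi); assert (L2 := ssum_cv _ _ _ hb').
apply (is_lim_seq_subseq _ _ (fun K => d * K)%nat) in L1.
2:{ apply eventually_subseq; intros n; nia. }
assert (L3 : is_lim_seq (fun K => if Nat.eq_dec c 0 then 0 else h (Z.of_nat c + Z.of_nat d * Z.of_nat K)%Z) 0).
{ destruct (Nat.eq_dec c 0); [apply is_lim_seq_const|].
  destruct hb' as [a [b H]].
  apply lim0_sq with (fun K => C' * r' ^ K); [intros K; apply H|now apply geom_lim0]. }
assert (L4 := is_lim_seq_minus' _ _ _ _ L2 L3).
apply is_lim_seq_ext with (v := fun K => ssum (fun l => ind d c l * h l) (d * K)) in L4.
2:{ intros; now rewrite ssum_ind. }
apply is_lim_seq_unique in L1; apply is_lim_seq_unique in L4.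
rewrite L1 in L4; rewrite Rminus_0_r in L4; now injection L4.
Qed.
End ThetaSeries.

(** * Theta inversion on the unit circle: a theta value against its own conjugate *)

Module ThetaInversion.
From Stdlib Require Import Reals Lra Lia ZArith.
From Coquelicot Require Import Coquelicot.
Import FourierUniqueness PoissonSummation GaussianTransform ThetaSeries.
Open Scope R_scope.

(* [wr + i wi = exp (- pi a l^2 / d)] with [a = exp (i phi)]. *)
Definition wr (phi : R) (d : nat) (l : Z) : R :=
  exp (- PI * cos phi * (IZR l * IZR l) / INR d) * cos (PI * sin phi * (IZR l * IZR l) / INR d).
Definition wi (phi : R) (d : nat) (l : Z) : R :=
  - exp (- PI * cos phi * (IZR l * IZR l) / INR d) * sin (PI * sin phi * (IZR l * IZR l) / INR d).

(** The constant [exp (/ k)] of [gauss_bd] at [k = pi / (2 d)], the decay rate guaranteed by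
    [cos phi >= 1/2]. *)
Definition Cw (d : nat) : R := exp (/ (PI / (2 * INR d))).

Section Theta.
Variables (phi : R) (d : nat).
Hypothesis hphi : / 2 <= cos phi.
Hypothesis hd : (0 < d)%nat.
Let D := INR d.
Let Dp : 0 < D. Proof. now apply lt_0_INR. Qed.

Lemma w_exp_bd l : Rabs (wr phi d l) <= exp (- (PI / (2 * D)) * (IZR l * IZR l)) /\ Rabs (wi phi d l) <= exp (- (PI / (2 * D)) * (IZR l * IZR l)).
Proof.
assert (E : exp (- PI * cos phi * (IZR l * IZR l) / INR d) <= exp (- (PI / (2 * D)) * (IZR l * IZR l))).
{ apply exp_le_exp; fold D; pose proof PI_RGT_0.
  replace (- PI * cos phi * (IZR l * IZR l) / D) with (- (PI / D * (IZR l * IZR l) * cos phi)) by (field; lra).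
  replace (- (PI / (2 * D)) * (IZR l * IZR l)) with (- (PI / D * (IZR l * IZR l) * / 2)) by (field; lra).
  apply Ropp_le_contravar, Rmult_le_compat_l; auto.
  apply Rmult_le_pos; [apply Rlt_le, Rdiv_lt_0_compat; auto|nra]. }
unfold wr, wi; set (x := exp (- PI * cos phi * _ / _)) in *.
assert (0 < x) by apply exp_pos.
split; (eapply Rle_trans; [|exact E]); rewrite Rabs_mult, ?Rabs_Ropp, (Rabs_right x) by lra.
- assert (Rabs (cos (PI * sin phi * (IZR l * IZR l) / INR d)) <= 1) by (apply Rabs_le, COS_bound); nra.
- assert (Rabs (sin (PI * sin phi * (IZR l * IZR l) / INR d)) <= 1) by (apply Rabs_le, SIN_bound); nra.
Qed.

Lemma w_geom (v w : Z -> R) : (forall l, Rabs (v l) <= 1 + Rabs (IZR l)) ->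
  (forall l, Rabs (w l) <= exp (- (PI / (2 * D)) * (IZR l * IZR l))) ->
  geom_bd (fun l => v l * w l) (Cw d) (exp (- 1)).
Proof.
intros hv hw; unfold Cw; fold D; pose proof PI_RGT_0.
assert (K : 0 < PI / (2 * D)) by (apply Rdiv_lt_0_compat; lra).
split; [apply Rlt_le, exp_pos|split; [apply exp_m1|]].
assert (U : forall l, Rabs (v l * w l) <= exp (/ (PI / (2 * D))) * exp (- Rabs (IZR l))).
{ intros l; eapply Rle_trans; [|apply (gauss_bd (PI / (2 * D)) (IZR l) K)].
  rewrite Rabs_mult, Rmult_comm; apply Rmult_le_compat; try apply Rabs_pos; auto. }
intros k; rewrite <- exp_INR; split; (eapply Rle_trans; [apply U|]); right; do 3 f_equal.
- rewrite <- INR_IZR_INZ; apply Rabs_right, Rle_ge, pos_INR.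
- rewrite opp_IZR, Rabs_Ropp, <- INR_IZR_INZ; apply Rabs_right, Rle_ge, pos_INR.
Qed.

Let p := cos phi / D.
Let q := sin phi / D.
Let hp : 0 < p. Proof. unfold p; apply Rdiv_lt_0_compat; lra. Qed.

Lemma n2_eq : p ^ 2 + q ^ 2 = / (D * D).
Proof.
unfold p, q; pose proof (sin2_cos2 phi) as h; unfold Rsqr in h.
replace ((cos phi / D) ^ 2 + (sin phi / D) ^ 2) with ((sin phi * sin phi + cos phi * cos phi) / (D * D)) by (field; lra).
rewrite h; field; lra.
Qed.

Lemma tr_eq : p / (p ^ 2 + q ^ 2) = D * cos phi.
Proof. rewrite n2_eq; unfold p; field; lra. Qed.
Lemma ti_eq : - q / (p ^ 2 + q ^ 2) = - (D * sin phi).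
Proof. rewrite n2_eq; unfold q; field; lra. Qed.

Definition KR := LA (cos phi) (sin phi) 0.
Definition KI := LB (cos phi) (sin phi) 0.

(** The parameter [a / D] is [a] rescaled by [sqrt D]. Hence one constant [K = KR + i KI] serves
    every modulus [d], and it can cancel between the lattice and eta. *)
Lemma K_scale : LA p q 0 = sqrt D * KR /\ LB p q 0 = sqrt D * KI.
Proof.
assert (s0 : 0 < sqrt D) by (apply sqrt_lt_R0; auto).
destruct (LA_scale (cos phi) (sin phi) ltac:(lra) (sqrt D) s0) as [h1 h2].
rewrite sqrt_sqrt in h1, h2 by lra; split; auto.
Qed.

Variable c : nat.
Hypothesis hc : (c < d)%nat.
Let xi := INR c / D.

(** The inverse of [a / D] is [D] times the conjugate of [a], and
    [D (c / D + k)^2 = (c + D k)^2 / D]. So the transformed terms are the conjugates of the original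
    ones, taken over the residue class of [c]. *)
Lemma E_w k : ER p q (xi + IZR k) = wr phi d (Z.of_nat c + Z.of_nat d * k) /\
              EI p q (xi + IZR k) = - wi phi d (Z.of_nat c + Z.of_nat d * k).
Proof.
unfold ER, EI; rewrite tr_eq, ti_eq; unfold wr, wi; fold D.
rewrite plus_IZR, mult_IZR, <- !INR_IZR_INZ; fold D.
assert (e1 : - PI * (D * cos phi) * ((xi + IZR k) * (xi + IZR k)) = - PI * cos phi * ((INR c + D * IZR k) * (INR c + D * IZR k)) / D)
  by (unfold xi; field; lra).
assert (e2 : PI * - (D * sin phi) * ((xi + IZR k) * (xi + IZR k)) = - (PI * sin phi * ((INR c + D * IZR k) * (INR c + D * IZR k)) / D))
  by (unfold xi; field; lra).
rewrite e1, e2, cos_neg, sin_neg; split; ring.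
Qed.

Lemma lin_xi k : D * (xi + IZR k) = IZR (Z.of_nat c + Z.of_nat d * k).
Proof. rewrite plus_IZR, mult_IZR, <- !INR_IZR_INZ; fold D; unfold xi; field; lra. Qed.

Let Lw := fun v => Ssum (fun l => ind d c l * v l).

Lemma one_bd (l : Z) : Rabs ((fun _ => 1) l) <= 1 + Rabs (IZR l).
Proof. cbv beta; rewrite Rabs_R1; pose proof (Rabs_pos (IZR l)); lra. Qed.
Lemma id_bd (l : Z) : Rabs (IZR l) <= 1 + Rabs (IZR l).
Proof. lra. Qed.

Lemma geom_ext f g C r : (forall k, f k = g k) -> geom_bd f C r -> geom_bd g C r.
Proof. intros E [a [b H]]; split; [auto|split; [auto|]]; intros k; rewrite <- !E; auto. Qed.

Lemma geom_scal f C r a : geom_bd f C r -> geom_bd (fun k => a * f k) (Rabs a * C) r.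
Proof.
intros [h1 [b H]]; split; [apply Rmult_le_pos; [apply Rabs_pos|auto]|split; [auto|]].
intros k; destruct (H k); rewrite !Rabs_mult, !Rmult_assoc; split; apply Rmult_le_compat_l; auto; apply Rabs_pos.
Qed.

Lemma S_w : SER p q xi = Lw (wr phi d) /\ SEI p q xi = - Lw (wi phi d) /\
  SxER p q xi = / D * Lw (fun l => IZR l * wr phi d l) /\ SxEI p q xi = - / D * Lw (fun l => IZR l * wi phi d l).
Proof.
destruct (ER_gbd p q hp xi) as [C [g1 [g2 [g3 g4]]]].
assert (b1 := w_geom _ _ one_bd (fun l => proj1 (w_exp_bd l))).
assert (b2 := w_geom _ _ one_bd (fun l => proj2 (w_exp_bd l))).
assert (b3 := w_geom _ _ id_bd (fun l => proj1 (w_exp_bd l))).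
assert (b4 := w_geom _ _ id_bd (fun l => proj2 (w_exp_bd l))).
apply (geom_ext _ (wr phi d)) in b1; [|intros; ring].
apply (geom_ext _ (wi phi d)) in b2; [|intros; ring].
assert (scal : forall a f C r, geom_bd f C r -> Ssum (fun k => a * f k) = a * Ssum f).
{ intros a f C' r' hb; rewrite (Ssum_ext _ (fun k => a * f k + 0 * f k)) by (intros; ring).
  rewrite (Ssum_lin _ _ _ _ _ _ _ _ hb hb); ring. }
unfold SER, SEI, SxER, SxEI, Lw.
split; [|split; [|split]].
- rewrite (Ssum_ind _ _ _ _ _ C (exp (- 1)) hc b1).
  + apply Ssum_ext; intros k; apply E_w.
  + apply (geom_ext _ _ _ _ (fun k => proj1 (E_w k)) g1).
- assert (g2' : geom_bd (fun k => wi phi d (Z.of_nat c + Z.of_nat d * k)) (Rabs (-1) * C) (exp (- 1))).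
  { apply (geom_ext (fun n => -1 * EI p q (xi + IZR n))); [intros k; rewrite (proj2 (E_w k)); ring|now apply geom_scal]. }
  rewrite (Ssum_ind _ _ _ _ _ _ _ hc b2 g2').
  match goal with |- _ = - ?x => replace (- x) with (-1 * x) by ring end; rewrite <- (scal _ _ _ _ g2').
  apply Ssum_ext; intros k; rewrite (proj2 (E_w k)); ring.
- assert (g3' : geom_bd (fun k => IZR (Z.of_nat c + Z.of_nat d * k) * wr phi d (Z.of_nat c + Z.of_nat d * k)) (Rabs D * C) (exp (- 1))).
  { apply (geom_ext (fun n => D * ((xi + IZR n) * ER p q (xi + IZR n)))); [|now apply geom_scal].
    intros k; rewrite (proj1 (E_w k)), <- lin_xi; ring. }
  rewrite (Ssum_ind _ _ _ _ _ _ _ hc b3 g3'), <- (scal _ _ _ _ g3').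
  apply Ssum_ext; intros k; rewrite (proj1 (E_w k)), <- lin_xi; field; lra.
- assert (g4' : geom_bd (fun k => IZR (Z.of_nat c + Z.of_nat d * k) * wi phi d (Z.of_nat c + Z.of_nat d * k)) (Rabs (- D) * C) (exp (- 1))).
  { apply (geom_ext (fun n => - D * ((xi + IZR n) * EI p q (xi + IZR n)))); [|now apply geom_scal].
    intros k; rewrite (proj2 (E_w k)), <- lin_xi; ring. }
  rewrite (Ssum_ind _ _ _ _ _ _ _ hc b4 g4'), <- (scal _ _ _ _ g4').
  apply Ssum_ext; intros k; rewrite (proj2 (E_w k)), <- lin_xi; field; lra.
Qed.

Let ec n := cos (2 * PI * INR c * IZR n / D).
Let es n := sin (2 * PI * INR c * IZR n / D).

Lemma g_w n : gR p q xi (IZR n) = wr phi d n * ec n - wi phi d n * es n /\ gI p q xi (IZR n) = wr phi d n * es n + wi phi d n * ec n.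
Proof.
unfold gR, gI, wr, wi, ec, es; fold D.
replace (- PI * p * (IZR n * IZR n)) with (- PI * cos phi * (IZR n * IZR n) / D) by (unfold p; field; lra).
replace (2 * PI * xi * IZR n + - (PI * q * (IZR n * IZR n))) with (2 * PI * INR c * IZR n / D - PI * sin phi * (IZR n * IZR n) / D) by (unfold q, xi; field; lra).
rewrite cos_minus, sin_minus; split; ring.
Qed.

(** [theta_R] and [theta_I] rewritten with [S_w] and [K_scale]. In complex form: the sum of
    [w n * exp (2 pi i c n / d)] is [sqrt d * K] times the conjugate of the sum of [w] over the
    class of [c] modulo [d]. *)
Theorem theta_inv :
  Ssum (fun n => wr phi d n * ec n - wi phi d n * es n) = sqrt D * (KR * Lw (wr phi d) + KI * Lw (wi phi d)) /\
  Ssum (fun n => wr phi d n * es n + wi phi d n * ec n) = sqrt D * (KI * Lw (wr phi d) - KR * Lw (wi phi d)).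
Proof.
destruct S_w as [h1 [h2 [h3 h4]]]; destruct K_scale as [k1 k2].
rewrite (Ssum_ext _ (fun n => gR p q xi (IZR n))) by (intros; symmetry; apply g_w).
rewrite (Ssum_ext (fun n => _ + _) (fun n => gI p q xi (IZR n))) by (intros; symmetry; apply g_w).
rewrite (theta_R p q hp), (theta_I p q hp), h1, h2, k1, k2; split; ring.
Qed.

(** The weight [n] brings an extra factor [sin phi + i cos phi], that is [i] times the conjugate of
    [a]. Two weighted coordinates will produce the square of this factor. *)
Theorem theta_inv_x :
  let ZR := sqrt D * (KR * Lw (fun l => IZR l * wr phi d l) + KI * Lw (fun l => IZR l * wi phi d l)) in
  let ZI := sqrt D * (KI * Lw (fun l => IZR l * wr phi d l) - KR * Lw (fun l => IZR l * wi phi d l)) in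
  Ssum (fun n => IZR n * (wr phi d n * ec n - wi phi d n * es n)) = sin phi * ZR - cos phi * ZI /\
  Ssum (fun n => IZR n * (wr phi d n * es n + wi phi d n * ec n)) = sin phi * ZI + cos phi * ZR.
Proof.
intros ZR ZI; unfold ZR, ZI.
destruct S_w as [h1 [h2 [h3 h4]]]; destruct K_scale as [k1 k2].
rewrite (Ssum_ext _ (fun n => IZR n * gR p q xi (IZR n))) by (intros; f_equal; symmetry; apply g_w).
rewrite (Ssum_ext (fun n => _ * (_ + _)) (fun n => IZR n * gI p q xi (IZR n))) by (intros; f_equal; symmetry; apply g_w).
rewrite (theta_xR p q hp), (theta_xI p q hp), h3, h4, k1, k2, tr_eq, ti_eq; split; field; lra.
Qed.

End Theta.
End ThetaInversion.

(** * The arc of the fundamental domain, and the character modulo 12 behind eta *)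

Module ArcMeanValue.
From Stdlib Require Import Reals Lra Lia ZArith.
From Coquelicot Require Import Coquelicot.
Import FourierUniqueness PoissonSummation GaussianTransform ThetaSeries ThetaInversion.
Open Scope R_scope.

Fixpoint rsum (f : nat -> R) (n : nat) : R := match n with O => 0 | S m => rsum f m + f m end.

(** A primitive along the arc of the real part of [a q^k], where [q = exp (- 2 pi a)]. For [k >= 1]
    the sine vanishes at both ends because [sin (pi / 6) = 1/2]; for [k = 0] the increase over the
    arc is 1. *)
Definition uk (k : nat) (x : R) : R :=
  match k with O => sin x | _ => exp (- 2 * PI * INR k * cos x) * sin (2 * PI * INR k * sin x) / (2 * PI * INR k) end.

Lemma uk_derive k x : is_derive (uk k) x (exp (- 2 * PI * INR k * cos x) * cos (2 * PI * INR k * sin x - x)).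
Proof.
destruct k as [|k].
- unfold uk; simpl INR; auto_derive; auto.
  rewrite !Rmult_0_r, !Rmult_0_l, exp_0, Rminus_0_l, cos_neg; ring.
- unfold uk; set (m := INR (S k)).
  assert (hm : m <> 0) by (apply not_0_INR; lia); pose proof PI_neq0.
  auto_derive; auto; rewrite cos_minus; field; auto.
Qed.

Lemma rsum_uk_end (p : nat -> R) n s : s = PI / 6 \/ s = - (PI / 6) ->
  rsum (fun k => p k * uk k s) (S n) = p 0%nat * sin s.
Proof.
intros hs; induction n as [|n IH]; [simpl; ring|].
change (rsum (fun k => p k * uk k s) (S n) + p (S n) * uk (S n) s = p 0%nat * sin s).
rewrite IH; replace (uk (S n) s) with 0; [ring|].
unfold uk; set (m := INR (S n)).
replace (sin (2 * PI * m * sin s)) with 0; [unfold Rdiv; ring|].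
symmetry; destruct hs as [-> | ->]; rewrite ?sin_neg, sin_PI6.
- replace (2 * PI * m * (1 / 2)) with (IZR (Z.of_nat (S n)) * PI) by (unfold m; rewrite INR_IZR_INZ; field).
  apply sin_eq_0_1; now exists (Z.of_nat (S n)).
- replace (2 * PI * m * - (1 / 2)) with (IZR (- Z.of_nat (S n)) * PI) by (unfold m; rewrite opp_IZR, INR_IZR_INZ; field).
  apply sin_eq_0_1; now exists (- Z.of_nat (S n))%Z.
Qed.

(** Over an arc of length [pi / 3] the primitive increases by the constant coefficient, so its
    derivative somewhere equals [3 / pi] times that coefficient. A single point stands in for the
    integral, since the real part of the limit function vanishes on the whole arc. *)
Lemma arc_mvt (p : nat -> R) n : exists x, - (PI / 6) <= x <= PI / 6 /\
  p 0%nat * 3 / PI = rsum (fun k => p k * (exp (- 2 * PI * INR k * cos x) * cos (2 * PI * INR k * sin x - x))) (S n).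
Proof.
pose proof PI_RGT_0.
set (u := fun x => rsum (fun k => p k * uk k x) (S n)).
set (du := fun x => rsum (fun k => p k * (exp (- 2 * PI * INR k * cos x) * cos (2 * PI * INR k * sin x - x))) (S n)).
assert (hd : forall x, is_derive u x (du x)).
{ intros x; unfold u, du; generalize (S n); intros m; induction m as [|m IH]; cbn [rsum].
  - apply (is_derive_const (K := R_AbsRing) (V := R_NormedModule)).
  - apply (is_derive_plus (K := R_AbsRing) (V := R_NormedModule)); auto.
    apply (is_derive_scal (uk m)); apply uk_derive. }
destruct (MVT_gen u (- (PI / 6)) (PI / 6) du) as [c [hc E]].
- intros; apply hd.
- intros x _; apply ex_derive_continuity_pt; now exists (du x).
- rewrite Rmin_left, Rmax_right in hc by lra; exists c; split; auto.
  fold (du c).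
  assert (Eu : forall s, s = PI / 6 \/ s = - (PI / 6) -> u s = p 0%nat * sin s)
    by (intros s hs; now apply rsum_uk_end).
  rewrite (Eu (PI / 6)), (Eu (- (PI / 6))), sin_neg, sin_PI6 in E by auto.
  apply Rmult_eq_reg_r with (PI / 3); [|lra].
  transitivity (p 0%nat * (1 / 2) - p 0%nat * - (1 / 2)); [field; lra|rewrite E; field].
Qed.

Lemma arc_cos x : - (PI / 6) <= x <= PI / 6 -> / 2 <= cos x.
Proof.
intros h; pose proof PI_RGT_0.
replace (/ 2) with (cos (PI / 3)) by (rewrite cos_PI3; lra).
replace (cos x) with (cos (Rabs x)) by (unfold Rabs; destruct (Rcase_abs x); auto using cos_neg).
apply cos_decr_1; try lra; try apply Rabs_pos; unfold Rabs; destruct (Rcase_abs x); lra.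
Qed.

(** The even primitive character modulo 12, with values 1, -1, -1, 1 at 1, 5, 7, 11; [eta] is half
    the sum of [chi n * q^(n^2 / 24)]. Written with sines, its Gauss sum becomes an instance of the
    addition formulas. *)
Definition chi (n : Z) : R := 2 / sqrt 3 * (sin (PI * IZR n / 2) * sin (PI * IZR n / 3)).

Lemma sqrt3 : 1.7 < sqrt 3.
Proof. rewrite <- (sqrt_square 1.7) by lra; apply sqrt_lt_1; lra. Qed.

Lemma chi_bd n : Rabs (chi n) <= 6 / 5.
Proof.
unfold chi; pose proof sqrt3.
assert (2 / sqrt 3 <= 6 / 5) by (apply Rmult_le_reg_r with (sqrt 3); [lra|]; unfold Rdiv; rewrite Rmult_assoc, Rinv_l; lra).
assert (0 < 2 / sqrt 3) by (apply Rdiv_lt_0_compat; lra).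
rewrite !Rabs_mult, (Rabs_right (2 / sqrt 3)) by lra.
set (a := Rabs (sin (PI * IZR n / 2))); set (b := Rabs (sin (PI * IZR n / 3))).
assert (0 <= a <= 1) by (split; [apply Rabs_pos|apply Rabs_le, SIN_bound]).
assert (0 <= b <= 1) by (split; [apply Rabs_pos|apply Rabs_le, SIN_bound]).
assert (0 <= a * b <= 1) by (split; [apply Rmult_le_pos; lra|rewrite <- (Rmult_1_l 1); apply Rmult_le_compat; lra]).
nra.
Qed.

(** One sine kills the even [n], the other the multiples of 3; the remaining residues 1, 5, 7, 11
    modulo 12 have squares congruent to 1 modulo 24. *)
Lemma chi_supp n : chi n <> 0 -> exists k : nat, (n * n = 24 * Z.of_nat k + 1)%Z.
Proof.
intros h.
assert (h2 : ~ exists m, n = (2 * m)%Z).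
{ intros [m ->]; apply h; unfold chi.
  replace (PI * IZR (2 * m) / 2) with (IZR m * PI) by (rewrite mult_IZR; field).
  rewrite (sin_eq_0_1 (IZR m * PI)) by (now exists m); ring. }
assert (h3 : ~ exists m, n = (3 * m)%Z).
{ intros [m ->]; apply h; unfold chi.
  replace (PI * IZR (3 * m) / 3) with (IZR m * PI) by (rewrite mult_IZR; field).
  rewrite (sin_eq_0_1 (IZR m * PI)) by (now exists m); ring. }
assert (E := Z_div_mod_eq_full n 12); assert (B := Z.mod_pos_bound n 12 ltac:(lia)).
set (m := (n / 12)%Z) in *; set (r := (n mod 12)%Z) in *.
assert (hr : (r = 1 \/ r = 5 \/ r = 7 \/ r = 11)%Z).
{ assert (hs : (r = 0 \/ r = 1 \/ r = 2 \/ r = 3 \/ r = 4 \/ r = 5 \/ r = 6 \/ r = 7 \/ r = 8 \/ r = 9 \/ r = 10 \/ r = 11)%Z) by lia.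
  repeat (destruct hs as [hs|hs]); auto; exfalso; rewrite hs in E;
  first [apply h2; exists (6 * m + 0)%Z; lia | apply h2; exists (6 * m + 1)%Z; lia | apply h2; exists (6 * m + 2)%Z; lia | apply h2; exists (6 * m + 3)%Z; lia | apply h2; exists (6 * m + 4)%Z; lia | apply h2; exists (6 * m + 5)%Z; lia | apply h3; exists (4 * m + 0)%Z; lia | apply h3; exists (4 * m + 1)%Z; lia | apply h3; exists (4 * m + 2)%Z; lia | apply h3; exists (4 * m + 3)%Z; lia | lia]. }
assert (K : exists k, (n * n = 24 * k + 1)%Z).
{ destruct hr as [hr|[hr|[hr|hr]]]; rewrite hr in E; rewrite E;
  [exists (6 * m * m + m)%Z|exists (6 * m * m + 5 * m + 1)%Z|exists (6 * m * m + 7 * m + 2)%Z|exists (6 * m * m + 11 * m + 5)%Z]; ring. }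
destruct K as [k hk]; exists (Z.to_nat k); rewrite Z2Nat.id; auto.
assert (hn : (0 <= n * n)%Z) by nia; lia.
Qed.

Lemma chi_1 : chi 1 = 1 /\ chi (-1) = 1.
Proof.
pose proof sqrt3 as s3.
assert (e : 2 / sqrt 3 * (sqrt 3 / 2) = 1) by (field; lra).
unfold chi; split.
- replace (PI * 1 / 2) with (PI / 2) by field; replace (PI * 1 / 3) with (PI / 3) by field.
  rewrite sin_PI2, sin_PI3, Rmult_1_l; exact e.
- replace (PI * -1 / 2) with (- (PI / 2)) by field; replace (PI * -1 / 3) with (- (PI / 3)) by field.
  rewrite !sin_neg, sin_PI2, sin_PI3; transitivity (2 / sqrt 3 * (sqrt 3 / 2)); [ring|exact e].
Qed.

Lemma sin_period_Z x k : sin (x + 2 * IZR k * PI) = sin x.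
Proof.
destruct (Z_le_dec 0 k) as [h|h].
- rewrite <- (Z2Nat.id k) by auto; rewrite <- INR_IZR_INZ; apply sin_period.
- rewrite <- (sin_period (x + 2 * IZR k * PI) (Z.to_nat (- k))).
  rewrite INR_IZR_INZ, Z2Nat.id by lia; rewrite opp_IZR; f_equal; ring.
Qed.
Lemma cos_period_Z x k : cos (x + 2 * IZR k * PI) = cos x.
Proof.
destruct (Z_le_dec 0 k) as [h|h].
- rewrite <- (Z2Nat.id k) by auto; rewrite <- INR_IZR_INZ; apply cos_period.
- rewrite <- (cos_period (x + 2 * IZR k * PI) (Z.to_nat (- k))).
  rewrite INR_IZR_INZ, Z2Nat.id by lia; rewrite opp_IZR; f_equal; ring.
Qed.

Lemma chi_period n k : chi (n + 12 * k) = chi n.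
Proof.
unfold chi; rewrite plus_IZR, mult_IZR.
replace (PI * (IZR n + 12 * IZR k) / 2) with (PI * IZR n / 2 + 2 * IZR (3 * k) * PI) by (rewrite mult_IZR; field).
replace (PI * (IZR n + 12 * IZR k) / 3) with (PI * IZR n / 3 + 2 * IZR (2 * k) * PI) by (rewrite mult_IZR; field).
now rewrite !sin_period_Z.
Qed.

Definition cc (c n : Z) := cos (2 * PI * IZR c * IZR n / 12).
Definition ss (c n : Z) := sin (2 * PI * IZR c * IZR n / 12).

(** The Gauss sum of a primitive character. The classes [c] and [12 - c] pair up, which cancels the
    sines and doubles the cosines. *)
Lemma chi_gauss n :
  cc 1 n - cc 5 n - cc 7 n + cc 11 n = sqrt 12 * chi n /\ ss 1 n - ss 5 n - ss 7 n + ss 11 n = 0.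
Proof.
unfold cc, ss.
assert (E : sqrt 12 = 2 * sqrt 3).
{ replace 12 with (2 * 2 * 3) by ring; rewrite sqrt_mult, sqrt_square by lra; ring. }
replace (2 * PI * 11 * IZR n / 12) with (- (2 * PI * 1 * IZR n / 12) + 2 * IZR n * PI) by field.
replace (2 * PI * 7 * IZR n / 12) with (- (2 * PI * 5 * IZR n / 12) + 2 * IZR n * PI) by field.
rewrite !cos_period_Z, !sin_period_Z, !cos_neg, !sin_neg; split; [|ring].
unfold chi; rewrite E.
replace (2 * PI * 1 * IZR n / 12) with (PI * IZR n / 2 - PI * IZR n / 3) by field.
replace (2 * PI * 5 * IZR n / 12) with (PI * IZR n / 2 + PI * IZR n / 3) by field.
rewrite cos_minus, cos_plus; pose proof sqrt3; field; lra.
Qed.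

(** [|q| <= exp (- 3)] by [pi > 3], and [exp 3 >= 9] since [exp (1/2) >= 3/2] and [(3/2)^6 > 9]. *)
Lemma exp_arc x : / 2 <= cos x -> exp (- 2 * PI * cos x) <= / 9.
Proof.
intros h; pose proof PI2_3_2.
assert (hx : exp (- 2 * PI * cos x) <= exp (- (3))) by (apply exp_le_exp; nra).
eapply Rle_trans; [exact hx|].
rewrite exp_Ropp; apply Rinv_le_contravar; [lra|].
replace 3 with (/ 2 + / 2 + / 2 + / 2 + / 2 + / 2) by field; rewrite !exp_plus.
pose proof (exp_ineq1_le (/ 2)) as e1; set (y := exp (/ 2)) in *.
assert (hy : 1.5 <= y) by lra.
assert (2.25 <= y * y) by nra; assert (3.375 <= y * y * y) by nra; assert (5 <= y * y * y * y) by nra.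
assert (7.5 <= y * y * y * y * y) by nra; nra.
Qed.

Lemma chi_opp n : chi (- n) = chi n.
Proof.
unfold chi; rewrite opp_IZR.
replace (PI * - IZR n / 2) with (- (PI * IZR n / 2)) by field.
replace (PI * - IZR n / 3) with (- (PI * IZR n / 3)) by field.
rewrite !sin_neg; ring.
Qed.

Lemma chi_5 : chi 5 = - 1.
Proof.
pose proof sqrt3; unfold chi.
replace (PI * 5 / 2) with (PI / 2 + 2 * IZR 1 * PI) by field.
replace (PI * 5 / 3) with (- (PI / 3) + 2 * IZR 1 * PI) by field.
rewrite !sin_period_Z, sin_neg, sin_PI2, sin_PI3; field; lra.
Qed.

Lemma chi_0 n : (forall k : nat, (n * n <> 24 * Z.of_nat k + 1)%Z) -> chi n = 0.
Proof.
intros h; destruct (Req_dec (chi n) 0) as [|h']; auto.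
destruct (chi_supp n h') as [k hk]; exfalso; now apply (h k).
Qed.

Lemma ind_period d c l k : (0 < d)%nat -> ind d c (l + Z.of_nat d * k) = ind d c l.
Proof.
intros hd; unfold ind.
replace (l + Z.of_nat d * k - Z.of_nat c)%Z with (l - Z.of_nat c + k * Z.of_nat d)%Z by ring.
rewrite Z_mod_plus_full; reflexivity.
Qed.

Lemma chi_ind l : chi l = ind 12 1 l - ind 12 5 l - ind 12 7 l + ind 12 11 l.
Proof.
assert (E := Z_div_mod_eq_full l 12); assert (B := Z.mod_pos_bound l 12 ltac:(lia)).
set (m := (l / 12)%Z) in *; set (r := (l mod 12)%Z) in *.
replace l with (r + 12 * m)%Z by lia.
rewrite chi_period; change 12%Z with (Z.of_nat 12); rewrite !ind_period by lia.
assert (hs : (r = 0 \/ r = 1 \/ r = 2 \/ r = 3 \/ r = 4 \/ r = 5 \/ r = 6 \/ r = 7 \/ r = 8 \/ r = 9 \/ r = 10 \/ r = 11)%Z) by lia.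
clearbody r; clear E B m l.
destruct hs as [->|[->|[->|[->|[->|[->|[->|[->|[->|[->|[->| ->]]]]]]]]]]];
  try (rewrite chi_0 by (intros k; lia); unfold ind; simpl; ring).
- rewrite (proj1 chi_1); unfold ind; simpl; ring.
- rewrite chi_5; unfold ind; simpl; ring.
- change 7%Z with (- (5) + 12 * 1)%Z; rewrite chi_period, chi_opp, chi_5; unfold ind; simpl; ring.
- change 11%Z with (- (1) + 12 * 1)%Z; rewrite chi_period, chi_opp, (proj1 chi_1); unfold ind; simpl; ring.
Qed.

(* [wqr + i wqi = exp (- pi a s)] with [a = exp (i x)]. *)
Definition wqr (x s : R) : R := exp (- PI * cos x * s) * cos (PI * sin x * s).
Definition wqi (x s : R) : R := - exp (- PI * cos x * s) * sin (PI * sin x * s).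

Lemma wqr_plus x s u : wqr x (s + u) = wqr x s * wqr x u - wqi x s * wqi x u.
Proof. unfold wqr, wqi; rewrite !Rmult_plus_distr_l, exp_plus, cos_plus; ring. Qed.
Lemma wqi_plus x s u : wqi x (s + u) = wqr x s * wqi x u + wqi x s * wqr x u.
Proof. unfold wqr, wqi; rewrite !Rmult_plus_distr_l, exp_plus, sin_plus; ring. Qed.
Lemma wq_0 x : wqr x 0 = 1 /\ wqi x 0 = 0.
Proof. unfold wqr, wqi; rewrite !Rmult_0_r, exp_0, cos_0, sin_0; split; ring. Qed.

Lemma exp_neg_bd x s : 0 <= s -> exp (- PI * cos x * - s) <= exp (PI * s).
Proof.
intros hs; apply exp_le_exp; pose proof (COS_bound x); pose proof PI_RGT_0.
assert (0 <= PI * s) by (apply Rmult_le_pos; lra); nra.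
Qed.

Lemma geom_plus f g C1 C2 r : geom_bd f C1 r -> geom_bd g C2 r -> geom_bd (fun k => f k + g k) (C1 + C2) r.
Proof.
intros [a1 [b1 H1]] [a2 [_ H2]]; split; [lra|split; [auto|]].
intros k; destruct (H1 k), (H2 k); rewrite Rmult_plus_distr_r.
split; (eapply Rle_trans; [apply Rabs_triang|lra]).
Qed.

(** The switch between the weight [l], for the two frame vectors in the weight polynomial, and the
    weight 1 for the others. *)
Definition vb (b : bool) (l : Z) : R := if b then IZR l else 1.

Section SumsForPoisson.
Variables (x : R) (d c : nat) (b : bool).
Hypothesis hx : / 2 <= cos x.
Hypothesis hd : (0 < d)%nat.

Definition ecr (n : Z) := cos (2 * PI * INR c * IZR n / INR d).
Definition ecs (n : Z) := sin (2 * PI * INR c * IZR n / INR d).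
(** The two sides of the one-dimensional formula: [sgr + i sgi] is the term twisted by an additive
    character, [shr + i shi] the conjugate term restricted to a residue class. *)
Definition sgr (n : Z) := vb b n * (wr x d n * ecr n - wi x d n * ecs n).
Definition sgi (n : Z) := vb b n * (wr x d n * ecs n + wi x d n * ecr n).
Definition shr (n : Z) := ind d c n * (vb b n * wr x d n).
Definition shi (n : Z) := - (ind d c n * (vb b n * wi x d n)).

Lemma vb_bd u l : Rabs u <= 1 -> Rabs (u * vb b l) <= 1 + Rabs (IZR l).
Proof.
intros hu; rewrite Rabs_mult; unfold vb; pose proof (Rabs_pos (IZR l)); pose proof (Rabs_pos u).
destruct b; [nra|rewrite Rabs_R1; lra].
Qed.

Lemma cs_bd1 y : Rabs (cos y) <= 1 /\ Rabs (sin y) <= 1.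
Proof. split; apply Rabs_le; [apply COS_bound|apply SIN_bound]. Qed.
Lemma ind_bd1 l : Rabs (ind d c l) <= 1.
Proof. unfold ind; destruct (Z.eq_dec _ _); rewrite ?Rabs_R1, ?Rabs_R0; lra. Qed.

Lemma sg_bd : geom_bd sgr (Cw d + Cw d) (exp (- 1)) /\ geom_bd sgi (Cw d + Cw d) (exp (- 1)).
Proof.
assert (a1 := fun v hv => w_geom d hd v _ hv (fun l => proj1 (w_exp_bd x d hx hd l))).
assert (a2 := fun v hv => w_geom d hd v _ hv (fun l => proj2 (w_exp_bd x d hx hd l))).
split.
- apply (geom_ext (fun l => ecr l * vb b l * wr x d l + - ecs l * vb b l * wi x d l)).
  { intros; unfold sgr; ring. }
  apply geom_plus; [apply a1|apply a2]; intros; apply vb_bd; rewrite ?Rabs_Ropp; apply cs_bd1.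
- apply (geom_ext (fun l => ecs l * vb b l * wr x d l + ecr l * vb b l * wi x d l)).
  { intros; unfold sgi; ring. }
  apply geom_plus; [apply a1|apply a2]; intros; apply vb_bd; apply cs_bd1.
Qed.

Lemma sh_bd : geom_bd shr (Cw d) (exp (- 1)) /\ geom_bd shi (Cw d) (exp (- 1)).
Proof.
assert (a1 := fun v hv => w_geom d hd v _ hv (fun l => proj1 (w_exp_bd x d hx hd l))).
assert (a2 := fun v hv => w_geom d hd v _ hv (fun l => proj2 (w_exp_bd x d hx hd l))).
split.
- apply (geom_ext (fun l => ind d c l * vb b l * wr x d l)).
  { intros; unfold shr; ring. }
  apply a1; intros; apply vb_bd, ind_bd1.
- apply (geom_ext (fun l => - ind d c l * vb b l * wi x d l)).
  { intros; unfold shi; ring. }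
  apply a2; intros; apply vb_bd; rewrite Rabs_Ropp; apply ind_bd1.
Qed.

Lemma Ssum_opp f C r : geom_bd f C r -> Ssum (fun k => - f k) = - Ssum f.
Proof.
intros h; rewrite (Ssum_ext _ (fun k => -1 * f k + 0 * f k)) by (intros; ring).
rewrite (Ssum_lin _ _ _ _ _ _ _ _ h h); ring.
Qed.

Hypothesis hc : (c < d)%nat.

Lemma Ssum_shi : Ssum (fun l => ind d c l * (vb b l * wi x d l)) = - Ssum shi.
Proof.
rewrite <- (Ssum_opp shi (Cw d) (exp (- 1))) by apply sh_bd.
apply Ssum_ext; intros; unfold shi; ring.
Qed.
End SumsForPoisson.

Theorem poisson_sums x d c : / 2 <= cos x -> (c < d)%nat ->
  (Ssum (sgr x d c false) = sqrt (INR d) * (KR x * Ssum (shr x d c false) + KI x * - Ssum (shi x d c false)) /\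
   Ssum (sgi x d c false) = sqrt (INR d) * (KI x * Ssum (shr x d c false) - KR x * - Ssum (shi x d c false))) /\
  (let ZR := sqrt (INR d) * (KR x * Ssum (shr x d c true) + KI x * - Ssum (shi x d c true)) in
   let ZI := sqrt (INR d) * (KI x * Ssum (shr x d c true) - KR x * - Ssum (shi x d c true)) in
   Ssum (sgr x d c true) = sin x * ZR - cos x * ZI /\ Ssum (sgi x d c true) = sin x * ZI + cos x * ZR).
Proof.
intros hx hc; assert (hd : (0 < d)%nat) by lia.
destruct (theta_inv x d hx hd c hc) as [h1 h2]; destruct (theta_inv_x x d hx hd c hc) as [h3 h4].
rewrite <- !(Ssum_shi x d c _ hx hd).
assert (e : forall f g, (forall l, f l = g l) -> Ssum (fun l => ind d c l * f l) = Ssum (fun l => ind d c l * g l)).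
{ intros f g E; apply Ssum_ext; intros; now rewrite E. }
assert (E0 : forall f : Z -> R, Ssum (fun l => ind d c l * (vb false l * f l)) = Ssum (fun l => ind d c l * f l)) by (intros f; apply e; intros; simpl; ring).
unfold shr; rewrite !E0.
split; split.
- rewrite <- h1; apply Ssum_ext; intros n; unfold sgr, ecr, ecs, vb; ring.
- rewrite <- h2; apply Ssum_ext; intros n; unfold sgi, ecr, ecs, vb; ring.
- exact h3.
- exact h4.
Qed.
End ArcMeanValue.

From HB Require structures.
From mathcomp Require all_boot.
From mathcomp Require all_order.
From mathcomp Require all_algebra.
From mathcomp Require complex.
From mathcomp Require zify.
From mathcomp Require ring.
From mathcomp Require lra.
From mathcomp Require boolp.
From mathcomp Require Rstruct.
From mathcomp Require ssrZ.
Require Defs.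
From mathcomp Require classical_sets.
From mathcomp Require cardinality.
From mathcomp Require fsbigop.
From mathcomp Require reals.
From mathcomp Require mpoly.
From mathcomp Require perm.

(** * Uniform convergence of complex functions in the 1-norm *)

Module UniformLimits.
From HB Require Import structures.
From mathcomp Require Import all_boot all_order all_algebra.
From mathcomp Require Import complex zify ring lra.
Set Implicit Arguments. Unset Strict Implicit. Unset Printing Implicit Defensive.
Import Order.TTheory GRing.Theory Num.Theory.
Local Open Scope ring_scope.

Section Ucv.
Variables (R : rcfType) (T : Type).
Notation CC := (R[i]).

(** The 1-norm takes values in the ordered field [R] itself and is submultiplicative. The factors 2
    in later bounds come from [|cos| + |sin| <= 2]. *)
Definition cabs (z : CC) : R := `|complex.Re z| + `|complex.Im z|.

Lemma cabs_ge0 z : 0 <= cabs z. Proof. by rewrite addr_ge0. Qed.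
Lemma cabsD z w : cabs (z + w) <= cabs z + cabs w.
Proof.
case: z w => [a b] [c d]; rewrite /cabs /=.
by have := ler_normD a c; have := ler_normD b d; lra.
Qed.
Lemma cabsN z : cabs (- z) = cabs z.
Proof. by case: z => a b; rewrite /cabs /= !normrN. Qed.
Lemma cabsM z w : cabs (z * w) <= cabs z * cabs w.
Proof.
case: z w => [a b] [c d]; rewrite /cabs /=.
have h1 := ler_normB (a * c) (b * d); have h2 := ler_normD (a * d) (b * c).
rewrite !normrM in h1 h2; lra.
Qed.
Lemma cabs_conj z : cabs z^* = cabs z.
Proof. by case: z => a b; rewrite /cabs /= normrN. Qed.
Lemma cabs_eq0 z : cabs z <= 0 -> z = 0.
Proof.
case: z => a b; rewrite /cabs /= => h.
have a0 : a = 0 by apply/eqP; rewrite -normr_eq0 eq_le normr_ge0 andbT; have := normr_ge0 b; lra.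
have b0 : b = 0 by apply/eqP; rewrite -normr_eq0 eq_le normr_ge0 andbT; have := normr_ge0 a; lra.
by rewrite a0 b0.
Qed.
Lemma cabs_Re z : `|complex.Re z| <= cabs z.
Proof. by rewrite lerDl. Qed.
Lemma cabs1 : cabs 1 = 1. Proof. by rewrite /cabs /= normr1 normr0 addr0. Qed.
Lemma cabsX z n : cabs (z ^+ n) <= cabs z ^+ n.
Proof.
elim: n => [|n IH]; first by rewrite !expr0 cabs1.
rewrite !exprS; apply: le_trans (cabsM _ _) _; apply: ler_wpM2l => //; exact: cabs_ge0.
Qed.

(** Boundedness of the limit belongs to the notion, so that it is preserved by products. *)
Definition ucv (F : nat -> T -> CC) (f : T -> CC) : Prop :=
  (exists M : R, forall x, cabs (f x) <= M) /\
  forall e : R, 0 < e -> exists N, forall B x, (N <= B)%N -> cabs (F B x - f x) <= e.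

Lemma ucv_const (f : T -> CC) M : (forall x, cabs (f x) <= M) -> ucv (fun _ => f) f.
Proof.
move=> h; split; first by exists M.
by move=> e e0; exists 0%N => B x _; rewrite subrr /cabs /= !normr0 addr0 ltW.
Qed.

Lemma ucv_ext F G f g : (forall B x, F B x = G B x) -> (forall x, f x = g x) -> ucv F f -> ucv G g.
Proof.
move=> EF Ef [[M hM] h]; split; first by exists M => x; rewrite -Ef ?hM.
move=> e e0; case: (h e e0) => N hN; exists N => B x NB; rewrite -EF -Ef //; exact: hN.
Qed.

Lemma ucvD F G f g : ucv F f -> ucv G g -> ucv (fun B x => F B x + G B x) (fun x => f x + g x).
Proof.
move=> [[M hM] h] [[M' hM'] h']; split.
  by exists (M + M') => x; apply: le_trans (cabsD _ _) _; apply: lerD; [exact: hM|exact: hM'].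
move=> e e0; have e2 : 0 < e / 2 by lra.
case: (h _ e2) => N hN; case: (h' _ e2) => N' hN'; exists (maxn N N') => B x.
rewrite geq_max => /andP[a b].
have -> : F B x + G B x - (f x + g x) = (F B x - f x) + (G B x - g x) by ring.
apply: le_trans (cabsD _ _) _; have := hN B x a; have := hN' B x b; lra.
Qed.

Lemma ucvM F G f g : ucv F f -> ucv G g -> ucv (fun B x => F B x * G B x) (fun x => f x * g x).
Proof.
move=> [[M0 hM0] h] [[M0' hM0'] h'].
pose M := `|M0|; pose M' := `|M0'|.
have hM x : cabs (f x) <= M by apply: le_trans (hM0 x) (ler_norm _).
have hM' x : cabs (g x) <= M' by apply: le_trans (hM0' x) (ler_norm _).
have M_ge0 : 0 <= M by rewrite /M normr_ge0.
have M'_ge0 : 0 <= M' by rewrite /M' normr_ge0.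
split.
  exists (M * M') => x; apply: le_trans (cabsM _ _) _.
  by apply: ler_pM; rewrite ?cabs_ge0 ?hM ?hM'.
move=> e e0; pose s := 1 + M + M'; have s0 : 0 < s by rewrite /s; lra.
pose t := Num.min 1 (e / s); have t0 : 0 < t by rewrite lt_min ltr01 divr_gt0.
have t1 : t <= 1 by rewrite ge_min lexx.
have te : t * s <= e by rewrite -ler_pdivlMr // ge_min lexx orbT.
case: (h _ t0) => N hN; case: (h' _ t0) => N' hN'; exists (maxn N N') => B x.
rewrite geq_max => /andP[a b].
have -> : F B x * G B x - f x * g x = (F B x - f x) * (G B x - g x) + ((F B x - f x) * g x + f x * (G B x - g x)) by ring.
have a1 := hN B x a; have b1 := hN' B x b; have hf := hM x; have hg := hM' x.
have c1 := cabs_ge0 (F B x - f x); have c2 := cabs_ge0 (G B x - g x).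
have c3 := cabs_ge0 (f x); have c4 := cabs_ge0 (g x).
apply: le_trans (cabsD _ _) _.
have u1 : cabs ((F B x - f x) * (G B x - g x)) <= t * 1.
  by apply: le_trans (cabsM _ _) _; apply: ler_pM => //; apply: le_trans b1 t1.
have u2 : cabs ((F B x - f x) * g x) <= t * M' by apply: le_trans (cabsM _ _) _; apply: ler_pM.
have u3 : cabs (f x * (G B x - g x)) <= M * t by apply: le_trans (cabsM _ _) _; apply: ler_pM.
have u4 := cabsD ((F B x - f x) * g x) (f x * (G B x - g x)).
apply: le_trans te; rewrite /s; lra.
Qed.

Lemma ucv_conj F f : ucv F f -> ucv (fun B x => (F B x)^*) (fun x => (f x)^*).
Proof.
move=> [[M hM] h]; split; first by exists M => x; rewrite cabs_conj hM.
by move=> e e0; case: (h e e0) => N hN; exists N => B x NB; rewrite -rmorphB /= cabs_conj; exact: hN.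
Qed.

Lemma ucv_sum (I : Type) (s : seq I) (P : pred I) (F : I -> nat -> T -> CC) (f : I -> T -> CC) :
  (forall i, ucv (F i) (f i)) -> ucv (fun B x => \sum_(i <- s | P i) F i B x) (fun x => \sum_(i <- s | P i) f i x).
Proof.
move=> h; elim: s => [|i s IH].
  apply: (@ucv_ext (fun _ _ => 0) _ (fun=> 0)); last by apply: (@ucv_const _ 0) => x; rewrite /cabs /= !normr0 addr0.
    by move=> B x; rewrite big_nil.
  by move=> x; rewrite big_nil.
case Pi : (P i).
  apply: (ucv_ext _ _ (ucvD (h i) IH)) => [B x|x]; by rewrite big_cons Pi.
by apply: (ucv_ext _ _ IH) => [B x|x]; rewrite big_cons Pi.
Qed.

Lemma ucv_prod (I : Type) (s : seq I) (P : pred I) (F : I -> nat -> T -> CC) (f : I -> T -> CC) :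
  (forall i, ucv (F i) (f i)) -> ucv (fun B x => \prod_(i <- s | P i) F i B x) (fun x => \prod_(i <- s | P i) f i x).
Proof.
move=> h; elim: s => [|i s IH].
  apply: (@ucv_ext (fun _ _ => 1) _ (fun=> 1)); last by apply: (@ucv_const _ 1) => x; rewrite cabs1.
    by move=> B x; rewrite big_nil.
  by move=> x; rewrite big_nil.
case Pi : (P i).
  apply: (ucv_ext _ _ (ucvM (h i) IH)) => [B x|x]; by rewrite big_cons Pi.
by apply: (ucv_ext _ _ IH) => [B x|x]; rewrite big_cons Pi.
Qed.

Lemma ucv_exp F f n : ucv F f -> ucv (fun B x => F B x ^+ n) (fun x => f x ^+ n).
Proof.
move=> h; have := ucv_prod (index_enum 'I_n) xpredT (fun=> h).
by apply: ucv_ext => [B x|x]; rewrite prodr_const card_ord.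
Qed.

Lemma ucv_scal c F f : ucv F f -> ucv (fun B x => c * F B x) (fun x => c * f x).
Proof. by move=> h; apply: (ucvM _ h); apply: (@ucv_const _ (cabs c)). Qed.

Lemma ucv_unique F f g x : ucv F f -> ucv F g -> f x = g x.
Proof.
move=> [_ hf] [_ hg]; apply/eqP; rewrite -subr_eq0; apply/eqP; apply: cabs_eq0.
apply/ler_addgt0Pr => e e0; rewrite add0r.
have e2 : 0 < e / 2 by lra.
case: (hf _ e2) => N hN; case: (hg _ e2) => N' hN'.
have -> : f x - g x = - (F (maxn N N') x - f x) + (F (maxn N N') x - g x) by ring.
apply: le_trans (cabsD _ _) _; rewrite cabsN.
have := hN _ x (leq_maxl N N'); have := hN' _ x (leq_maxr N N'); lra.
Qed.


Lemma ucv_bound F f (A r M : R) : 0 <= A -> (forall e, 0 < e -> exists N, forall n, (N <= n)%N -> A * r ^+ n <= e) ->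
  (forall x, cabs (f x) <= M) -> (forall B x, cabs (F B x - f x) <= A * r ^+ B) -> ucv F f.
Proof.
move=> A0 hr hM h; split; first by exists M.
by move=> e /hr[N hN]; exists N => B x NB; apply: le_trans (h B x) (hN _ NB).
Qed.

Definition SB (B : nat) (f : int -> CC) : CC := \sum_(k < B.*2.+1) f (k%:Z - B%:Z).

Lemma SB_ReIm B f : SB B f = ((\sum_(k < B.*2.+1) complex.Re (f (k%:Z - B%:Z))) +i* (\sum_(k < B.*2.+1) complex.Im (f (k%:Z - B%:Z))))%C.
Proof.
rewrite /SB; elim/big_rec3: _ => // i y1 y2 y3 _ ->.
by case: (f _).
Qed.

Lemma ucvB F G f g : ucv F f -> ucv G g -> ucv (fun B x => F B x - G B x) (fun x => f x - g x).
Proof.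
move=> hF hG; apply: (ucv_ext _ _ (ucvD hF (ucv_scal (-1) hG))) => [B x|x]; by rewrite mulN1r.
Qed.

End Ucv.
End UniformLimits.

(** * Poisson summation for a selfdual lattice containing an orthogonal frame *)

Module LatticePoisson.
From HB Require Import structures.
From mathcomp Require Import all_boot all_order all_algebra.
From mathcomp Require Import complex zify ring lra boolp.
Import UniformLimits.
Set Implicit Arguments. Unset Strict Implicit. Unset Printing Implicit Defensive.
Import Order.TTheory GRing.Theory Num.Theory.
Local Open Scope ring_scope.

Section NDim.
Variables (r : nat) (d e : 'I_r -> nat) (D' : nat).
Let D := D'.+1.
Hypothesis hd : forall i, (d i * e i = D)%N.
Variable Gm : ('I_r -> int) -> bool.
(** A vector [x] is encoded by the integers [n i = (x, a i)] for an orthogonal frame with norms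
    [d i], and [Gm] describes the codes of lattice vectors. As [1 / d i = e i / D], the inner
    product is [pr / D]. Below, [Gper] reflects that the frame lies in the lattice, and [Gdual1],
    [Gdual2] that the lattice is selfdual. *)
Definition pr (l n : 'I_r -> int) : int := \sum_i l i * n i * (e i)%:Z.
Hypothesis Gper : forall n m, (forall i, ((d i)%:Z %| n i - m i)%Z) -> Gm n = Gm m.
Hypothesis Gsub : forall n m, Gm n -> Gm m -> Gm (fun i => n i - m i).
Hypothesis Gdual1 : forall n m, Gm n -> Gm m -> (D%:Z %| pr n m)%Z.
Hypothesis Gdual2 : forall n, (forall m, Gm m -> (D%:Z %| pr m n)%Z) -> Gm n.

Lemma d_gt0 i : (0 < d i)%N. Proof. by have := hd i; case: (d i). Qed.
Lemma e_gt0 i : (0 < e i)%N. Proof. by have := hd i; rewrite mulnC; case: (e i). Qed.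
Lemma d_dvd_D i : ((d i)%:Z %| D%:Z)%Z. Proof. by rewrite -(hd i) PoszM dvdz_mulr. Qed.

Lemma Gm0 : Gm (fun _ => 0).
Proof. by apply: Gdual2 => m _; rewrite /pr big1 // => i _; rewrite mulr0 mul0r. Qed.

Lemma Gopp n : Gm n -> Gm (fun i => - n i).
Proof.
by move=> h; have := Gsub Gm0 h; rewrite (@Gper _ (fun i => - n i)) // => i; rewrite add0r subrr.
Qed.

Lemma Gadd n m : Gm n -> Gm m -> Gm (fun i => n i + m i).
Proof.
move=> hn hm; have := Gsub hn (Gopp hm).
by rewrite (@Gper _ (fun i => n i + m i)) // => i; rewrite opprK subrr.
Qed.

(** Coordinates are reduced modulo the common multiple [D] of the [d i], which gives one index type
    for all of them. Each lattice class modulo the [d i] is then met [kap] times. *)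
Definition cidx := {ffun 'I_r -> 'I_D'.+1}.
Definition cv (c : cidx) (i : 'I_r) : int := (c i)%:Z.
Definition rz (n : 'I_r -> int) : cidx := [ffun i => inord `|(n i %% D%:Z)%Z|%N].

Lemma cv_rz n i : cv (rz n) i = (n i %% D%:Z)%Z.
Proof.
rewrite /cv ffunE inordK; first by rewrite gez0_abs // modz_ge0.
by have := @ltz_pmod (n i) D%:Z isT; have := @modz_ge0 (n i) D%:Z isT; lia.
Qed.

Lemma Gm_rz n : Gm (cv (rz n)) = Gm n.
Proof.
apply: Gper => i; rewrite cv_rz; apply: (dvdz_trans (d_dvd_D i)).
have {2}-> := divz_eq (n i) D%:Z.
by rewrite opprD addrCA subrr addr0 rpredN dvdz_mull.
Qed.

Definition cshift (g : 'I_r -> int) (c : cidx) : cidx := rz (fun i => cv c i + g i).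

Lemma cshiftK g : cancel (cshift g) (cshift (fun i => - g i)).
Proof.
move=> c; apply/ffunP => i; apply: val_inj.
have E : cv (cshift (fun i => - g i) (cshift g c)) i = cv c i.
  rewrite /cshift !cv_rz /cv modzDml addrK modz_small //.
  by have := ltn_ord (c i); rewrite /D; lia.
by move: E; rewrite /cv => -[].
Qed.

Lemma cshift_bij g : bijective (cshift g).
Proof.
exists (cshift (fun i => - g i)); first exact: cshiftK.
move=> c; have := cshiftK (fun i => - g i) c.
by congr (_ = _); apply/ffunP => i; apply: val_inj; rewrite /= !ffunE; congr (_ (inord _)); rewrite opprK.
Qed.

Lemma Gm_cshift g c : Gm g -> Gm (cv (cshift g c)) = Gm (cv c).
Proof.
move=> hg; rewrite Gm_rz; apply/idP/idP => h; last exact: Gadd.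
have := Gsub h hg; rewrite (@Gper _ (cv c)) // => i; rewrite addrK subrr; exact: dvdz0.
Qed.

Definition CX := [set c : cidx | Gm (cv c)].
Definition kap := #|[set c in CX | [forall i, ((d i)%:Z %| cv c i)%Z]]|.

Lemma CX0 : [ffun=> ord0] \in CX.
Proof. by rewrite inE (@Gper _ (fun=> 0)) ?Gm0 // => i; rewrite /cv ffunE subrr. Qed.

Lemma CX_gt0 : (0 < #|CX|)%N. Proof. by apply/card_gt0P; exists [ffun=> ord0]; exact: CX0. Qed.
Lemma kap_gt0 : (0 < kap)%N.
Proof.
apply/card_gt0P; exists [ffun=> ord0]; rewrite inE CX0; apply/forallP => i.
by rewrite /cv ffunE.
Qed.

(** Translation by [- n] carries the representatives congruent to [n] to those congruent to 0. *)
Lemma card_cong n : Gm n -> #|[set c in CX | [forall i, ((d i)%:Z %| n i - cv c i)%Z]]| = kap.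
Proof.
move=> hn; rewrite /kap -(card_imset _ (bij_inj (cshift_bij (fun i => - n i)))).
have hN := Gopp hn.
congr #|pred_of_set _|; apply/setP => c; apply/imsetP/idP.
  move=> [b]; rewrite !inE => /andP[hb /forallP h] ->; rewrite Gm_cshift // hb; apply/forallP => i.
  rewrite /cshift cv_rz.
  have E := divz_eq (cv b i + - n i) D%:Z.
  have -> : ((cv b i + - n i) %% D%:Z)%Z = - (n i - cv b i) - ((cv b i + - n i) %/ D%:Z)%Z * D%:Z by rewrite [in RHS]opprB {2}E; ring.
  by rewrite rpredB ?rpredN ?h //; apply: dvdz_mull; apply: d_dvd_D.
rewrite !inE => /andP[hc /forallP h].
have [g gK Kg] := cshift_bij (fun i => - n i).
exists (cshift n c).
  rewrite !inE Gm_cshift // hc; apply/forallP => i; rewrite /cshift cv_rz.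
  have E := divz_eq (cv c i + n i) D%:Z.
  have -> : n i - ((cv c i + n i) %% D%:Z)%Z = ((cv c i + n i) %/ D%:Z)%Z * D%:Z - cv c i.
    by apply/eqP; rewrite subr_eq; apply/eqP; rewrite addrAC -E; ring.
  by rewrite rpredB ?h //; apply: dvdz_mull; apply: d_dvd_D.
by rewrite cshiftK.
Qed.

Section Poisson.
Variables (R : rcfType) (T : Type).
Notation CC := (R[i]).
Variables (a K : T -> CC) (Wq : T -> R -> CC) (expi : R -> CC).
Definition W (x : T) (d : nat) (n : int) : CC := Wq x (n%:~R ^+ 2 / d%:R).
Definition ec (c d : nat) (n : int) : CC := expi (c%:R * n%:~R / d%:R).
Definition num (b : bool) (n : int) : CC := if b then n%:~R else 1.
Definition indc (d c : nat) (l : int) : CC := ((d%:Z %| l - c%:Z)%Z)%:R.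
Hypothesis expiD : forall s t, expi (s + t) = expi s * expi t.
Hypothesis expi1 : forall n : int, expi n%:~R = 1.
Hypothesis expi_eq1 : forall t, expi t = 1 -> exists k : int, t = k%:~R.
Hypothesis pois : forall b d c, (c < d)%N -> exists tl tr : T -> CC,
  [/\ ucv (fun B x => SB B (fun n => num b n * (W x d n * ec c d n))) tl,
      ucv (fun B x => SB B (fun l => num b l * (indc d c l * (W x d l)^*))) tr &
      forall x, tl x = (Num.sqrt d%:R)%:C%C * (if b then 'i * (a x)^* else 1) * K x * tr x].

Definition box (B : nat) := {ffun 'I_r -> 'I_B.*2.+1}.
Definition bv B (n : box B) (i : 'I_r) : int := (n i)%:Z - B%:Z.

Lemma prod_SB (F : 'I_r -> int -> CC) B : \prod_i SB B (F i) = \sum_(n : box B) \prod_i F i (bv n i).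
Proof. by rewrite bigA_distr_bigA. Qed.

Lemma expi_mod (x y : int) : (D%:Z %| x - y)%Z -> expi (x%:~R / D%:R) = expi (y%:~R / D%:R).
Proof.
move=> /dvdzP[k hk]; have -> : x = y + k * D%:Z by rewrite -hk; ring.
rewrite rmorphD rmorphM /= mulrDl mulfK; last by rewrite pnatr_eq0.
by rewrite expiD expi1 mulr1.
Qed.

(** By [chrE] this is [exp (2 pi i (x, y))] for the vectors coded by [c] and [n], already split over
    the coordinates. The remainder modulo [d i] is what the one-dimensional formula, stated for
    [c < d], accepts. *)
Definition chr (c : cidx) (n : 'I_r -> int) : CC := \prod_i ec (c i %% d i)%N (d i) (n i).

Lemma chrE c n : chr c n = expi ((pr (cv c) n)%:~R / D%:R).
Proof.
rewrite /pr rmorph_sum /= mulr_suml (big_morph expi expiD (expi1 0)); apply: eq_bigr => i _.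
have dn0 : ((d i)%:R : R) != 0 by rewrite pnatr_eq0 -lt0n d_gt0.
have en0 : ((e i)%:R : R) != 0 by rewrite pnatr_eq0 -lt0n e_gt0.
have -> : (cv c i * n i * (e i)%:Z)%:~R / D%:R = ((c i %/ d i)%N%:Z * n i)%:~R + (c i %% d i)%N%:R * (n i)%:~R / (d i)%:R :> R.
  have cE : (cv c i)%:~R = (c i %/ d i)%N%:R * (d i)%:R + (c i %% d i)%N%:R :> R.
    by rewrite /cv {1}(divn_eq (c i) (d i)) -pmulrn natrD natrM.
  have DE : D%:R = (d i)%:R * (e i)%:R :> R by rewrite -(hd i) natrM.
  rewrite !rmorphM /= cE DE -!pmulrn.
  by field; rewrite dn0 en0.
by rewrite expiD expi1 mul1r.
Qed.

Lemma prD c n m : pr (fun i => c i + n i) m = pr c m + pr n m.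
Proof. by rewrite /pr -big_split /=; apply: eq_bigr => i _; ring. Qed.

Lemma chr_shift g c n : chr (cshift g c) n = expi ((pr g n)%:~R / D%:R) * chr c n.
Proof.
rewrite !chrE -expiD -mulrDl -rmorphD /= addrC -prD; apply: expi_mod.
rewrite /pr -sumrB; apply: rpred_sum => i _; rewrite cv_rz.
rewrite -mulrBl -mulrBl; apply: dvdz_mulr; apply: dvdz_mulr.
have {2}-> := divz_eq (cv c i + g i) D%:Z.
by rewrite opprD addrCA subrr addr0 rpredN dvdz_mull.
Qed.

(** Orthogonality of characters. For [n] outside the lattice, [Gdual2] provides a lattice element
    [g] pairing nontrivially with [n], and translation by [g] multiplies the sum by a number other
    than 1. *)
Lemma sum_chr n : \sum_(c in CX) chr c n = (#|CX| * Gm n)%:R.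
Proof.
case hn : (Gm n).
  rewrite muln1 -sumr_const; apply: eq_bigr => c; rewrite inE => hc.
  have /dvdzP[k hk] := Gdual1 hc hn.
  by rewrite chrE hk rmorphM /= mulfK ?pnatr_eq0 // expi1.
rewrite muln0; have [g /andP[hg ng]] : exists g, Gm g && ~~ (D%:Z %| pr g n)%Z.
  apply: boolp.contrapT => H; move/negP: hn; apply; apply: Gdual2 => m hm.
  by apply/negPn/negP => h; apply: H; exists m; rewrite hm.
set S := LHS; have E : S = expi ((pr g n)%:~R / D%:R) * S.
  rewrite {1}/S (reindex (cshift g)) /=; last by apply: onW_bij; exact: cshift_bij.
  rewrite mulr_sumr; apply: eq_big => [c|c _]; last exact: chr_shift.
  by rewrite !inE Gm_cshift.
apply/eqP; apply: contraT => S0.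
have : expi ((pr g n)%:~R / D%:R) = 1 by apply: (mulIf S0); rewrite mul1r.
move/expi_eq1 => [k hk]; case/negP: ng; apply/dvdzP; exists k.
apply: (@intr_inj R); rewrite rmorphM /= -hk mulfVK //.
by rewrite pnatr_eq0.
Qed.

Variable b : 'I_r -> bool.
Definition fB (B : nat) (x : T) : CC := \sum_(n : box B | Gm (bv n)) \prod_i (num (b i) (bv n i) * W x (d i) (bv n i)).

Lemma num_conj s n : (num s n)^* = num s n.
Proof. by rewrite /num; case: s; rewrite ?rmorph_int ?rmorph1. Qed.

(** The character sum replaces the lattice condition; what is left is a sum over a full box, which
    factors over the coordinates. *)
Lemma fB_L B x : #|CX|%:R * fB B x =
  \sum_(c in CX) \prod_i SB B (fun n => num (b i) n * (W x (d i) n * ec (c i %% d i)%N (d i) n)).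
Proof.
under eq_bigr => c _ do rewrite prod_SB.
rewrite exchange_big /= /fB mulr_sumr [LHS]big_mkcond /=; apply: eq_bigr => n _.
have E (c : cidx) : \prod_i (num (b i) (bv n i) * (W x (d i) (bv n i) * ec (c i %% d i)%N (d i) (bv n i))) =
   (\prod_i (num (b i) (bv n i) * W x (d i) (bv n i))) * chr c (bv n).
  by rewrite -big_split; apply: eq_bigr => i _; rewrite mulrA.
rewrite (eq_bigr _ (fun (c : cidx) _ => E c)).
by rewrite -mulr_sumr sum_chr; case: (Gm _); rewrite ?muln1 ?muln0 ?mulr0 // mulrC.
Qed.

Lemma indc_mod dd c l : indc dd (c %% dd)%N l = ((dd%:Z %| l - c%:Z)%Z)%:R.
Proof.
rewrite /indc; congr ((_ : bool)%:R).
have -> : l - (c %% dd)%N%:Z = (l - c%:Z) + (c %/ dd)%N%:Z * dd%:Z.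
  have h : c%:Z = (c %/ dd)%N%:Z * dd%:Z + (c %% dd)%N%:Z by rewrite {1}(divn_eq c dd) PoszD PoszM.
  by rewrite h; ring.
by rewrite rpredDr // dvdz_mull.
Qed.

(** A point of the box satisfies all congruences for [kap] of the indices in [CX] if it lies in the
    lattice, and for none otherwise. *)
Lemma fB_R B x : kap%:R * (fB B x)^* =
  \sum_(c in CX) \prod_i SB B (fun l => num (b i) l * (indc (d i) (c i %% d i)%N l * (W x (d i) l)^*)).
Proof.
under eq_bigr => c _ do rewrite prod_SB.
rewrite exchange_big /= /fB rmorph_sum /= mulr_sumr [LHS]big_mkcond /=; apply: eq_bigr => n _.
have E (c : cidx) : \prod_i (num (b i) (bv n i) * (indc (d i) (c i %% d i)%N (bv n i) * (W x (d i) (bv n i))^*)) =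
   (\prod_i indc (d i) (c i %% d i)%N (bv n i)) * \prod_i (num (b i) (bv n i) * (W x (d i) (bv n i))^*).
  by rewrite -big_split; apply: eq_bigr => i _; rewrite mulrCA.
rewrite (eq_bigr _ (fun (c : cidx) _ => E c)).
rewrite -mulr_suml rmorph_prod /=.
under [in LHS]eq_bigr => i _ do rewrite rmorphM /= num_conj.
have -> : \sum_(c in CX) \prod_i indc (d i) (c i %% d i)%N (bv n i) =
          #|[set c in CX | [forall i, ((d i)%:Z %| bv n i - cv c i)%Z]]|%:R.
  rewrite -sum1_card natr_sum [LHS]big_mkcond [RHS]big_mkcond /=; apply: eq_bigr => c _.
  rewrite !inE; case: (Gm (cv c)) => //=; case: forallP => [h|h].
    by apply: big1 => i _; rewrite indc_mod h.
  have /existsP[i hi] : [exists i, ~~ ((d i)%:Z %| bv n i - cv c i)%Z].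
    by rewrite -negb_forall; apply/negP => /forallP.
  by rewrite (bigD1 i) //= indc_mod (negbTE hi) mul0r.
case hn : (Gm (bv n)); first by rewrite card_cong.
suff -> : [set c in CX | [forall i, ((d i)%:Z %| bv n i - cv c i)%Z]] = set0 by rewrite cards0 mul0r.
apply/setP => c; rewrite !inE; apply/negP => /andP[hc /forallP h].
by rewrite (Gper h) hc in hn.
Qed.

(** Coordinate by coordinate, Poisson summation turns the factors in [fB_L] into those in [fB_R].
    The constant [k] collects the [sqrt (d i)] and the two multiplicities; the statement retains its
    positivity. *)
Lemma fB_limit : exists f : T -> CC, ucv fB f /\ exists2 k : R, 0 < k & forall x,
  f x = k%:C%C * (\prod_i (if b i then 'i * (a x)^* else 1)) * K x ^+ r * (f x)^*.
Proof.
have cd c i : (c %% d i < d i)%N by rewrite ltn_mod d_gt0.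
pose tl (c : cidx) i := projT1 (boolp.cid (pois (b i) (cd (c i) i))).
have tlP (c : cidx) i : exists tr : T -> CC,
  [/\ ucv (fun B x => SB B (fun n => num (b i) n * (W x (d i) n * ec (c i %% d i)%N (d i) n))) (tl c i),
      ucv (fun B x => SB B (fun l => num (b i) l * (indc (d i) (c i %% d i)%N l * (W x (d i) l)^*))) tr &
      forall x, tl c i x = (Num.sqrt (d i)%:R)%:C%C * (if b i then 'i * (a x)^* else 1) * K x * tr x].
  exact: (projT2 (boolp.cid (pois (b i) (cd (c i) i)))).
pose tr (c : cidx) i := projT1 (boolp.cid (tlP c i)).
have trP (c : cidx) i := projT2 (boolp.cid (tlP c i)).
have trL (c : cidx) i : ucv (fun B x => SB B (fun n => num (b i) n * (W x (d i) n * ec (c i %% d i)%N (d i) n))) (tl c i) by case: (trP c i).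
have trR (c : cidx) i : ucv (fun B x => SB B (fun l => num (b i) l * (indc (d i) (c i %% d i)%N l * (W x (d i) l)^*))) (tr c i) by case: (trP c i).
have trE (c : cidx) i x : tl c i x = (Num.sqrt (d i)%:R)%:C%C * (if b i then 'i * (a x)^* else 1) * K x * tr c i x by case: (trP c i).
pose S (x : T) := \sum_(c in CX) \prod_i tr c i x.
have n1 : (#|CX|%:R : CC) != 0 by rewrite pnatr_eq0 -lt0n CX_gt0.
have n2 : (kap%:R : CC) != 0 by rewrite pnatr_eq0 -lt0n kap_gt0.
have h2 : ucv (fun B x => (fB B x)^*) (fun x => kap%:R^-1 * S x).
  have := ucv_scal kap%:R^-1 (ucv_sum (index_enum cidx) (mem CX) (fun c => ucv_prod (index_enum _) xpredT (trR c))).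
  by apply: ucv_ext => // B x; rewrite -fB_R mulKf.
have h1 : ucv fB (fun x => #|CX|%:R^-1 * \sum_(c in CX) \prod_i tl c i x).
  have := ucv_scal #|CX|%:R^-1 (ucv_sum (index_enum cidx) (mem CX) (fun c => ucv_prod (index_enum _) xpredT (trL c))).
  by apply: ucv_ext => // B x; rewrite -fB_L mulKf.
exists (fun x => #|CX|%:R^-1 * \sum_(c in CX) \prod_i tl c i x); split=> //.
exists ((\prod_i Num.sqrt (d i)%:R) * kap%:R / #|CX|%:R).
  rewrite divr_gt0 ?ltr0n ?CX_gt0 // mulr_gt0 ?ltr0n ?kap_gt0 // prodr_gt0 // => i _.
  by rewrite sqrtr_gt0 ltr0n d_gt0.
move=> x; have -> := ucv_unique x (ucv_conj h1) h2.
have E c : \prod_i tl c i x = (\prod_i (Num.sqrt (d i)%:R)%:C%C) * (\prod_i (if b i then 'i * (a x)^* else 1)) * K x ^+ r * \prod_i tr c i x.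
  have -> : K x ^+ r = \prod_(i < r) K x by rewrite prodr_const card_ord.
  rewrite -!big_split /=; apply: eq_bigr => i _.
  exact: trE.
rewrite (eq_bigr _ (fun (c : cidx) _ => E c)).
rewrite -mulr_sumr -/(S x) !rmorphM /= rmorph_prod fmorphV /= !rmorph_nat.
by field; rewrite n1 n2.
Qed.

End Poisson.
End NDim.
End LatticePoisson.

(** * Eta on the arc: its inversion formula and polynomial approximations of its inverse *)

Module EtaInversion.
From HB Require Import structures.
From mathcomp Require Import all_boot all_order all_algebra.
From mathcomp Require Import complex zify ring lra boolp.
Import UniformLimits LatticePoisson.
Set Implicit Arguments. Unset Strict Implicit. Unset Printing Implicit Defensive.
Import Order.TTheory GRing.Theory Num.Theory.
Local Open Scope ring_scope.

Lemma big_sym_rec (V : zmodType) (f : int -> V) B :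
  \sum_(k < B.+1.*2.+1) f (k%:Z - B.+1%:Z) = \sum_(k < B.*2.+1) f (k%:Z - B%:Z) + (f B.+1%:Z + f (- B.+1%:Z)).
Proof.
rewrite doubleS big_ord_recl big_ord_recr /= /bump /=.
have -> : 0%:Z - B.+1%:Z = - B.+1%:Z by lia.
have -> : (1 + B.*2.+1)%N%:Z - B.+1%:Z = B.+1%:Z by lia.
have -> : \sum_(i < B.*2.+1) f ((1 + i)%N%:Z - B.+1%:Z) = \sum_(k < B.*2.+1) f (k%:Z - B%:Z).
  by apply: eq_bigr => i _; congr f; lia.
by rewrite [LHS]addrC -[LHS]addrA.
Qed.

Section Eta.
Variables (R : rcfType) (T : Type).
Notation CC := (R[i]).
Variables (a K q : T -> CC) (Wq : T -> R -> CC) (expi : R -> CC) (chi : int -> R) (Mq Mw c0 : R).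
Let W := W Wq.
Let ec := ec expi.
Let num := @num R.
Let indc := @indc R.
Hypothesis pois : forall b d c, (c < d)%N -> exists tl tr : T -> CC,
  [/\ ucv (fun B x => SB B (fun n => num b n * (W x d n * ec c d n))) tl,
      ucv (fun B x => SB B (fun l => num b l * (indc d c l * (W x d l)^*))) tr &
      forall x, tl x = (Num.sqrt d%:R)%:C%C * (if b then 'i * (a x)^* else 1) * K x * tr x].
Hypothesis WqD : forall x s t, Wq x (s + t) = Wq x s * Wq x t.
Hypothesis Wq2 : forall x, Wq x 2 = q x.
Hypothesis q9 : forall x k, cabs (q x ^+ k) <= 2 / 9 ^+ k.
Hypothesis qn0 : forall x, q x != 0.
Hypothesis qinv : forall x, cabs (q x)^-1 <= Mq.
Hypothesis w1inv : forall x, cabs (2 * Wq x (12^-1))^-1 <= Mw.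
Hypothesis chi_bd : forall n, `|chi n| <= 6 / 5.
Hypothesis chi_supp : forall n, chi n != 0 -> exists k : nat, n * n = (24 * k + 1)%N%:Z.
Hypothesis chi_1 : chi 1 = 1 /\ chi (-1) = 1.
Hypothesis chi_gauss : forall n, ec 1 12 n - ec 5 12 n - ec 7 12 n + ec 11 12 n = (Num.sqrt 12 * chi n)%:C%C.
Hypothesis chi_ind : forall n, (chi n)%:C%C = indc 12 1 n - indc 12 5 n - indc 12 7 n + indc 12 11 n.

(** A truncation of [2 eta]: [W x 12 n] is [q^(n^2 / 24)] because [Wq x 2 = q x]. *)
Definition eB (B : nat) (x : T) : CC := SB B (fun n => (chi n)%:C%C * W x 12 n).

Lemma conjR (y : R) : (y%:C%C : CC)^* = y%:C%C.
Proof. by apply/eqP; rewrite eq_complex /= oppr0 !eqxx. Qed.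

Lemma SBD B (f g : int -> CC) : SB B (fun n => f n + g n) = SB B f + SB B g.
Proof. by rewrite /SB big_split. Qed.
Lemma SBN B (f : int -> CC) : SB B (fun n => - f n) = - SB B f.
Proof. by rewrite /SB sumrN. Qed.
Lemma SBZ B c (f : int -> CC) : SB B (fun n => c * f n) = c * SB B f.
Proof. by rewrite /SB mulr_sumr. Qed.
Lemma SB_ext B (f g : int -> CC) : (forall n, f n = g n) -> SB B f = SB B g.
Proof. by move=> E; apply: eq_bigr => i _; exact: E. Qed.

(** Add the Poisson formulas for the classes 1, 5, 7, 11 modulo 12 with the signs of [chi]. The left
    sides combine by [chi_gauss], the right sides by [chi_ind], both to sums weighted by [chi], and
    [sqrt 12] cancels. *)
Lemma eta_inv : exists e, ucv eB e /\ forall x, e x = K x * (e x)^*.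
Proof.
have [l1 [r1 [hl1 hr1 E1]]] := @pois false 12 1 isT.
have [l5 [r5 [hl5 hr5 E5]]] := @pois false 12 5 isT.
have [l7 [r7 [hl7 hr7 E7]]] := @pois false 12 7 isT.
have [l11 [r11 [hl11 hr11 E11]]] := @pois false 12 11 isT.
have s12 : ((Num.sqrt 12%:R : R)%:C%C : CC) != 0.
  by rewrite fmorph_eq0 sqrtr_eq0 -ltNge ltr0n.
have hL := ucv_scal ((Num.sqrt 12%:R)%:C%C)^-1 (ucvD (ucvB (ucvB hl1 hl5) hl7) hl11).
have hR := ucvD (ucvB (ucvB hr1 hr5) hr7) hr11.
set l := (fun x : T => _ * (l1 x - l5 x - l7 x + l11 x)) in hL.
set r := (fun x : T => r1 x - r5 x - r7 x + r11 x) in hR.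
have uL : ucv eB l.
  apply: (ucv_ext _ _ hL) => // B x; rewrite /eB -!SBN -!SBD -SBZ; apply: SB_ext => n.
  rewrite /num /LatticePoisson.num !mul1r.
  have -> : W x 12 n * ec 1 12 n + - (W x 12 n * ec 5 12 n) + - (W x 12 n * ec 7 12 n) + W x 12 n * ec 11 12 n = W x 12 n * (ec 1 12 n - ec 5 12 n - ec 7 12 n + ec 11 12 n) by ring.
  by rewrite chi_gauss rmorphM /= mulrCA mulKf // mulrC.
have uR : ucv (fun B x => (eB B x)^*) r.
  apply: (ucv_ext _ _ hR) => // B x; rewrite /eB -!SBN -!SBD /SB rmorph_sum; apply: eq_bigr => i _.
  rewrite /num /LatticePoisson.num !mul1r rmorphM /= conjR chi_ind; ring.
exists l; split=> // x.
rewrite (ucv_unique x (ucv_conj uL) uR) /l /r E1 E5 E7 E11 !mulr1.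
by field; rewrite s12.
Qed.

(** The exponent of [q] that remains when [q^(1/24)] is split off; on the support of [chi] these are
    the generalised pentagonal numbers, so [EP] truncates Euler's product of the [1 - q^n]. *)
Definition ke (n : int) : nat := ((`|n| ^ 2).-1 %/ 24)%N.
Definition EP (B : nat) : {poly R} := \sum_(k < B.*2.+1) (fun n => (chi n / 2) *: 'X^(ke n)) (k%:Z - B%:Z).

Lemma ke_supp n : chi n != 0 -> (`|n| ^ 2 = 24 * ke n + 1)%N.
Proof.
case/chi_supp => k hk; have : (`|n| ^ 2 = 24 * k + 1)%N by nia.
by move=> h; rewrite /ke h addn1 /= mulKn // addn1.
Qed.

Definition hq (p : {poly R}) (x : T) : CC := (map_poly (real_complex R) p).[q x].

Lemma hqD p p' x : hq (p + p') x = hq p x + hq p' x. Proof. by rewrite /hq rmorphD hornerD. Qed.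
Lemma hqM p p' x : hq (p * p') x = hq p x * hq p' x. Proof. by rewrite /hq rmorphM hornerM. Qed.
Lemma hqXn c k x : hq (c *: 'X^k) x = c%:C%C * q x ^+ k.
Proof. by rewrite /hq map_polyZ map_polyXn hornerZ hornerXn. Qed.
Lemma hq1 x : hq 1 x = 1. Proof. by rewrite /hq rmorph1 hornerC. Qed.
Lemma hq_sum I (s : seq I) P (F : I -> {poly R}) x : hq (\sum_(i <- s | P i) F i) x = \sum_(i <- s | P i) hq (F i) x.
Proof. by rewrite /hq rmorph_sum horner_sum. Qed.
Lemma hqX p n x : hq (p ^+ n) x = hq p x ^+ n. Proof. by rewrite /hq rmorphXn horner_exp. Qed.

Lemma Wq0 x : Wq x 0 = 1.
Proof.
have h : Wq x 0 * Wq x 2 = 1 * Wq x 2 by rewrite -WqD add0r mul1r.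
by apply: (mulIf _ h); rewrite Wq2.
Qed.

Lemma Wq_mulrn x t n : Wq x (t *+ n) = Wq x t ^+ n.
Proof. by elim: n => [|n IH]; rewrite ?mulr0n ?Wq0 ?expr0 // mulrS WqD IH exprS. Qed.

(** This is [2 q^(1/24)]; the factor 2 compensates the halves in [EP]. *)
Definition w1 (x : T) : CC := 2 * Wq x (12^-1).

Lemma w1X x : w1 x ^+ 24 = 2 ^+ 24 * q x.
Proof. by rewrite /w1 exprMn -Wq_mulrn -Wq2; congr (_ * Wq _ _); rewrite -mulr_natr; field. Qed.

Lemma w1n0 x : w1 x != 0.
Proof.
have := w1X x; apply: contra_eqN => /eqP ->; rewrite expr0n /= eq_sym mulf_neq0 ?expf_neq0 ?pnatr_eq0 //.
Qed.

Lemma eB_EP B x : eB B x = w1 x * hq (EP B) x.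
Proof.
rewrite /EP hq_sum mulr_sumr; apply: eq_bigr => k _ /=; set n := (_ - _).
rewrite hqXn; have [->|c0'] := eqVneq (chi n) 0; first by rewrite !mul0r mulr0.
have E : (n%:~R : R) ^+ 2 / 12 = 12^-1 + 2 *+ ke n.
  have : (n ^+ 2) = (24 * ke n + 1)%N%:Z by have := ke_supp c0'; rewrite expr2; nia.
  move/(congr1 (fun z : int => z%:~R : R)); rewrite rmorphXn /= => ->.
  by rewrite -pmulrn natrD natrM -mulr_natr; field.
rewrite /W /LatticePoisson.W E WqD Wq_mulrn Wq2 /w1 rmorphM fmorphV /= rmorph_nat.
by field.
Qed.

Lemma chi0_eq0 : chi 0 = 0.
Proof. by apply/eqP/negPn/negP => /chi_supp[k]; lia. Qed.

Lemma EPS B : EP B.+1 = EP B + ((chi B.+1%:Z / 2) *: 'X^(ke B.+1%:Z) + (chi (- B.+1%:Z) / 2) *: 'X^(ke (- B.+1%:Z))).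
Proof. exact: (big_sym_rec (fun n : int => (chi n / 2) *: 'X^(ke n))). Qed.

Lemma EP1 : EP 1 = 1.
Proof.
rewrite EPS /EP big_ord1 /= subrr chi0_eq0 mul0r scale0r add0r (proj1 chi_1) (proj2 chi_1).
rewrite /ke /= !expr0 -scalerDl -splitr scale1r //.
Qed.

Lemma EPE B : (0 < B)%N -> (EP B).[0] = 1.
Proof.
case: B => // B _; elim: B => [|B IH]; first by rewrite EP1 hornerC.
rewrite EPS !hornerD IH !hornerZ !hornerXn.
have z (n : int) : (1 < `|n|)%N -> chi n / 2 * 0 ^+ ke n = 0.
  move=> n1; have [->|h] := eqVneq (chi n) 0; first by rewrite !mul0r.
  have := ke_supp h; case: (ke n) => [|k _]; first by move=> h1; nia.
  by rewrite expr0n mulr0.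
by rewrite !z ?addr0.
Qed.

(** From [n^2 = 24 k + 1] follows [|n| <= 2 k + 3], which amounts to [(k - 1) (k - 2) >= 0]. Hence
    [9^(- k)] is at most [27 / 3^|n|]. *)
Lemma term_bd n x : (4 < `|n|)%N -> cabs ((chi n / 2)%:C%C * q x ^+ ke n) <= (6 / 5) * 27 / 3 ^+ `|n|%N.
Proof.
move=> n4; have [->|h] := eqVneq (chi n) 0.
  by rewrite mul0r rmorph0 mul0r /cabs /= !normr0 addr0 divr_ge0 // ?exprn_ge0 //; lra.
have hk : (`|n| <= (ke n).*2 + 3)%N by have := ke_supp h; nia.
apply: le_trans (cabsM _ _) _.
have c1 : cabs (chi n / 2)%:C%C <= 3 / 5.
  by rewrite /cabs /= normr0 addr0 normrM normfV (ger0_norm (ler0n _ 2)); have := chi_bd n; lra.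
have c2 := q9 x (ke n).
have c3 : (9 ^+ ke n)^-1 <= 27 / 3 ^+ `|n|%N :> R.
  rewrite ler_pdivlMr ?exprn_gt0 // mulrC ler_pdivrMr ?exprn_gt0 //.
  have -> : 9 ^+ ke n = 3 ^+ (ke n).*2 :> R by rewrite -muln2 mulnC exprM; congr (_ ^+ _); ring.
  have -> : 27 = 3 ^+ 3 :> R by ring.
  by rewrite -exprD; apply: ler_weXn2l; [lra|rewrite addnC].
apply: le_trans (_ : 3 / 5 * (2 / 9 ^+ ke n) <= _); first by apply: ler_pM => //; exact: cabs_ge0.
have := c3; lra.
Qed.

(** The terms at [n] and [- n] with [n > 4] are dominated by a geometric series of ratio 1/3, whose
    partial sum is the right-hand side. It is 0 at [B = 4], where [EP B] is still 1. *)
Lemma EP_bd B x : (3 < B)%N -> cabs (1 - hq (EP B) x) <= 2 / 5 - 162 / 5 / 3 ^+ B.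
Proof.
move=> h3; have [m ->] : exists m, B = (m + 4)%N by exists (B - 4)%N; lia.
elim: m {B h3} => [|m IH].
  have z (n : int) : `|n|%N \in [:: 2; 3; 4]%N -> chi n = 0.
    move=> hn; apply/eqP/negPn/negP => /chi_supp[k hk].
    by move: hn; rewrite !inE => /or3P[] /eqP h; nia.
  rewrite add0n (EPS 3) (EPS 2) (EPS 1) EP1 !z // !mul0r !scale0r !addr0 hq1 subrr /cabs /= !normr0 addr0; lra.
rewrite addSn EPS !hqD !hqXn.
have -> A u v : 1 - (A + (u + v)) = (1 - A) + - u + - v :> CC by ring.
have t1 := @term_bd (m + 4).+1%:Z x; have t2 := @term_bd (- (m + 4).+1%:Z) x.
have {t1}t1 := t1 _; have {t2}t2 := t2 _.
apply: le_trans (cabsD _ _) _; rewrite cabsN; apply: le_trans (lerD (cabsD _ _) (lexx _)) _; rewrite cabsN.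
have {}t1 := t1 ltac:(lia); have {}t2 := t2 ltac:(lia).
rewrite abszN in t2; rewrite !absz_nat in t1 t2.
rewrite exprS invfM; rewrite exprS invfM in t1 t2.
set y := (3 ^+ (m + 4))^-1 in IH t1 t2 *; lra.
Qed.

Lemma EP_half B x : (3 < B)%N -> cabs (1 - hq (EP B) x) <= 2 / 5.
Proof.
move=> /EP_bd => /(_ x) h; apply: le_trans h _.
have : 0 <= 162 / 5 / 3 ^+ B :> R by rewrite divr_ge0 ?exprn_ge0 //; lra.
lra.
Qed.

(** A geometric series for the inverse of [EP B], cut off so that it stays a polynomial in [q]: the
    mean value argument on the arc applies to polynomials. *)
Definition GP (B : nat) : {poly R} := \sum_(l < B) (1 - EP B) ^+ l.

Lemma GPE B : (0 < B)%N -> (GP B).[0] = 1.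
Proof.
move=> B0; rewrite /GP horner_sum.
under eq_bigr => l _ do rewrite horner_exp hornerD hornerC hornerN EPE // subrr expr0n.
case: B B0 => // B _; rewrite big_ord_recl /= big1 ?addr0 // => i _.
Qed.

Lemma geom_half (z : CC) B : cabs z <= 2 / 5 -> cabs (\sum_(l < B) z ^+ l) <= 2.
Proof.
move=> hz; have : cabs (\sum_(l < B) z ^+ l) <= \sum_(l < B) (1 / 2) ^+ l.
  elim: B => [|B IH]; first by rewrite !big_ord0 /cabs /= !normr0 addr0.
  rewrite !big_ord_recr /=; apply: le_trans (cabsD _ _) _; apply: lerD IH _.
  apply: le_trans (cabsX _ _) _; apply: lerXn2r; rewrite ?nnegrE ?cabs_ge0 //; lra.
move/le_trans; apply.
have -> : \sum_(l < B) (1 / 2) ^+ l = 2 - 2 * (1 / 2) ^+ B :> R.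
  elim: B => [|B IH]; first by rewrite big_ord0 expr0; ring.
  by rewrite big_ord_recr /= IH exprS; field.
have : 0 <= (1 / 2) ^+ B :> R by rewrite exprn_ge0 //; lra.
lra.
Qed.

Hypothesis pow_half : forall eps : R, 0 < eps -> exists N, forall n, (N <= n)%N -> (1 / 2) ^+ n <= eps :> R.

(** The limit [E] of [EP B] stays within 1/2 of 1, so it has no zero on the arc and its inverse is
    bounded by 2. For the truncations, [EP B * GP B = 1 - (1 - EP B) ^ B], with a remainder that is
    uniformly small. *)
Lemma GP_lim (e : T -> CC) : ucv eB e ->
  exists E : T -> CC, [/\ forall x, e x = w1 x * E x, forall x, E x != 0 & ucv (fun B x => hq (GP B) x) (fun x => (E x)^-1)].
Proof.
move=> he; pose E x := (w1 x)^-1 * e x; exists E.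
have eE x : e x = w1 x * E x by rewrite /E mulVKf // w1n0.
have uE : ucv (fun B x => hq (EP B) x) E.
  have uw := @ucv_const R T (fun x => (w1 x)^-1) Mw w1inv.
  by apply: (ucv_ext _ _ (ucvM uw he)) => // B x; rewrite eB_EP mulKf // w1n0.
have half x : cabs (1 - E x) <= 1 / 2.
  have [_ /(_ (1 / 10))[|N hN]] := uE; first by lra.
  have h1 := hN (maxn N 4) x (leq_maxl _ _).
  have h2 : cabs (1 - hq (EP (maxn N 4)) x) <= 2 / 5 by apply: EP_half; rewrite leq_max orbT.
  have -> : 1 - E x = (1 - hq (EP (maxn N 4)) x) + (hq (EP (maxn N 4)) x - E x) by ring.
  apply: le_trans (cabsD _ _) _; lra.
have En0 x : E x != 0.
  apply/negP => /eqP E0; have := half x; rewrite E0 subr0 cabs1; lra.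
have Einv x : cabs (E x)^-1 <= 2.
  have E1 : (E x)^-1 = 1 + (1 - E x) * (E x)^-1 by field.
  have := cabsD 1 ((1 - E x) * (E x)^-1); rewrite -E1 cabs1.
  have := cabsM (1 - E x) (E x)^-1; have := half x; have := cabs_ge0 (E x)^-1.
  set u := cabs (E x)^-1; set v := cabs (1 - E x) => u0 v2 h1 h2.
  have : v * u <= 1 / 2 * u by apply: ler_wpM2r.
  lra.
split=> //; split; first by exists 2.
move=> eps e0.
have [_ /(_ (eps / 8))[|N1 hN1]] := uE; first by lra.
have [|N2 hN2] := @pow_half (eps / 4); first by lra.
exists (maxn (maxn N1 N2) 4) => B x; rewrite !geq_max -andbA => /and3P[B1 B2 B4].
have a1 := hN1 B x B1; have a2 := hN2 B B2; have a3 := @EP_half B x B4.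
set z := hq (EP B) x in a1 a3; set G := hq (GP B) x.
have GE : z * G = 1 - (1 - z) ^+ B.
  have zE : hq (1 - EP B) x = 1 - z by rewrite /z /hq rmorphB rmorph1 hornerD hornerN hornerC.
  have GS : G = \sum_(l < B) (1 - z) ^+ l.
    by rewrite /G /GP hq_sum; apply: eq_bigr => l _; rewrite hqX zE.
  have := subrX1 (1 - z) B; rewrite -GS => h.
  have -> : z * G = - ((1 - z - 1) * G) by ring.
  by rewrite -h opprB.
have Gb : cabs G <= 2.
  rewrite /G /GP hq_sum.
  have -> : \sum_(l < B) hq ((1 - EP B) ^+ l) x = \sum_(l < B) (1 - z) ^+ l.
    by apply: eq_bigr => l _; rewrite hqX /z /hq rmorphB rmorph1 hornerD hornerN hornerC.
  exact: geom_half.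
(* The error of [G] splits into the error of [z] as an approximation of [E x] and the remainder of
   the geometric series. *)
have -> : G - (E x)^-1 = (E x)^-1 * ((E x - z) * G + (z * G - 1)) by field.
have b1 : cabs ((E x - z) * G) <= eps / 8 * 2.
  apply: le_trans (cabsM _ _) _; apply: ler_pM; rewrite ?cabs_ge0 //.
  by rewrite -cabsN opprB.
have b2 : cabs (z * G - 1) <= eps / 4.
  rewrite GE addrAC subrr add0r cabsN; apply: le_trans (cabsX _ _) _.
  apply: le_trans a2; apply: lerXn2r; rewrite ?nnegrE ?cabs_ge0 //; lra.
apply: le_trans (cabsM _ _) _.
have b3 := cabsD ((E x - z) * G) (z * G - 1).
have b4 : cabs (E x)^-1 * cabs ((E x - z) * G + (z * G - 1)) <= 2 * (eps / 2).
  apply: ler_pM; rewrite ?cabs_ge0 //; lra.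
lra.
Qed.

End Eta.
End EtaInversion.

(** * A cusp form of weight 14: its coefficient at norm 2 is zero *)

Module CuspVanishing.
From HB Require Import structures.
From mathcomp Require Import all_boot all_order all_algebra.
From mathcomp Require Import complex zify ring lra boolp.
Import UniformLimits LatticePoisson EtaInversion.
Set Implicit Arguments. Unset Strict Implicit. Unset Printing Implicit Defensive.
Import Order.TTheory GRing.Theory Num.Theory.
Local Open Scope ring_scope.

(** Here [y] stands for [a], [z] for the theta value, [w] and [t] for [eta ^ 24] up to the factor
    [2 ^ 24], and [L] for [K ^ 24]. In the quotient [L] cancels; of the two conjugates of [y], one
    is absorbed by [y * y^* = 1] and the other joins the conjugate side. *)
Lemma anti_self (R : rcfType) (y z t L w : R[i]) (k : R) : y * y^* = 1 -> z = k%:C%C * (- y^* ^+ 2) * L * z^* ->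
  w = L * w^* -> L != 0 -> w != 0 -> t^* = t -> y * (t * z / w) = - (k%:C%C * (y * (t * z / w))^*).
Proof.
move=> y1 zE wE L0 w0 tE.
have kE : (k%:C%C : R[i])^* = k%:C%C by apply/eqP; rewrite eq_complex /= oppr0 !eqxx.
have w1 : w^* != 0 by rewrite fmorph_eq0.
rewrite {1}zE {1}wE !rmorphM fmorphV /= tE.
move: (z^*) (w^*) w1 y1 => z' w' w1 y1; move: (y^*) y1 => y' y1.
transitivity (- ((y * y') * (k%:C%C * (y' * (t * z' / w'))))); last by rewrite y1 mul1r.
by field; rewrite L0 w1.
Qed.

Section Core.
Variables (R : rcfType) (T : Type).
Notation CC := (R[i]).
Variables (a K q : T -> CC) (Wq : T -> R -> CC) (expi : R -> CC) (chi : int -> R) (Mq Mw c0 : R).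
Let W := W Wq.
Let ec := ec expi.
Let num := @num R.
Let indc := @indc R.
Hypothesis expiD : forall s t, expi (s + t) = expi s * expi t.
Hypothesis expi1 : forall n : int, expi n%:~R = 1.
Hypothesis expi_eq1 : forall t, expi t = 1 -> exists k : int, t = k%:~R.
Hypothesis pois : forall b d c, (c < d)%N -> exists tl tr : T -> CC,
  [/\ ucv (fun B x => SB B (fun n => num b n * (W x d n * ec c d n))) tl,
      ucv (fun B x => SB B (fun l => num b l * (indc d c l * (W x d l)^*))) tr &
      forall x, tl x = (Num.sqrt d%:R)%:C%C * (if b then 'i * (a x)^* else 1) * K x * tr x].
Hypothesis aa : forall x, a x * (a x)^* = 1.
Hypothesis ab : forall x, cabs (a x) <= 2.
Hypothesis WqD : forall x s t, Wq x (s + t) = Wq x s * Wq x t.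
Hypothesis Wq2 : forall x, Wq x 2 = q x.
Hypothesis q9 : forall x k, cabs (q x ^+ k) <= 2 / 9 ^+ k.
Hypothesis qn0 : forall x, q x != 0.
Hypothesis qinv : forall x, cabs (q x)^-1 <= Mq.
Hypothesis w1inv : forall x, cabs (2 * Wq x (12^-1))^-1 <= Mw.
Hypothesis chi_bd : forall n, `|chi n| <= 6 / 5.
Hypothesis chi_supp : forall n, chi n != 0 -> exists k : nat, n * n = (24 * k + 1)%N%:Z.
Hypothesis chi_1 : chi 1 = 1 /\ chi (-1) = 1.
Hypothesis chi_gauss : forall n, ec 1 12 n - ec 5 12 n - ec 7 12 n + ec 11 12 n = (Num.sqrt 12 * chi n)%:C%C.
Hypothesis chi_ind : forall n, (chi n)%:C%C = indc 12 1 n - indc 12 5 n - indc 12 7 n + indc 12 11 n.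
Hypothesis pow_half : forall eps : R, 0 < eps -> exists N, forall n, (N <= n)%N -> (1 / 2) ^+ n <= eps :> R.
Hypothesis c0n0 : c0 != 0.
Hypothesis mvt : forall p : {poly R}, exists x, p`_0 * c0 = complex.Re (a x * hq q p x).

Variables (d e : 'I_24 -> nat) (D' : nat).
Let D := D'.+1.
Hypothesis hd : forall i, (d i * e i = D)%N.
Variable Gm : ('I_24 -> int) -> bool.
Let pr := pr e.
Hypothesis Gper : forall n m, (forall i, ((d i)%:Z %| n i - m i)%Z) -> Gm n = Gm m.
Hypothesis Gsub : forall n m, Gm n -> Gm m -> Gm (fun i => n i - m i).
Hypothesis Gdual1 : forall n m, Gm n -> Gm m -> (D%:Z %| pr n m)%Z.
Hypothesis Gdual2 : forall n, (forall m, Gm m -> (D%:Z %| pr m n)%Z) -> Gm n.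
Hypothesis Geven : forall n, Gm n -> ((D.*2)%:Z %| pr n n)%Z.
Variables (i0 j0 : 'I_24).
Hypothesis ij : i0 != j0.

Let b (i : 'I_24) := (i == i0) || (i == j0).
Let fB := fB d Gm Wq b.
Let bv := @bv 24.
Let box := box 24.

Lemma prod_b (V : comPzRingType) (F : 'I_24 -> V) : \prod_i (if b i then F i else 1) = F i0 * F j0.
Proof.
rewrite (bigD1 i0) //= (bigD1 j0) /=; last by rewrite eq_sym.
rewrite /b !eqxx orbT big1 ?mulr1 // => i /andP[/negbTE -> /negbTE ->]; by [].
Qed.

Lemma pr_ge0 n : 0 <= pr n n.
Proof. by apply: sumr_ge0 => i _; rewrite mulr_ge0 // -expr2 sqr_ge0. Qed.

Lemma pr_eq0 n i : pr n n = 0 -> n i = 0.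
Proof.
move/eqP; rewrite psumr_eq0 => [|j _]; last by rewrite mulr_ge0 // -expr2 sqr_ge0.
move/allP => /(_ i (mem_index_enum _)); rewrite !mulf_eq0 orbb => /orP[/eqP //|].
by have := e_gt0 hd i; case: (e i).
Qed.

(** Half the norm, less the one power of [q] that is split off in [fB_PP]. The vector 0 also gets
    exponent 0 because of [.-1], but its coefficient is 0. *)
Definition kq (n : 'I_24 -> int) : nat := (`|pr n n| %/ D.*2).-1.
Definition PP (B : nat) : {poly R} :=
  \sum_(n : box B | Gm (bv n)) (bv n i0 * bv n j0)%:~R *: 'X^(kq (bv n)).

Lemma W_prod x n : \prod_i W x (d i) (n i) = Wq x ((pr n n)%:~R / D%:R).
Proof.
rewrite /pr /LatticePoisson.pr rmorph_sum /= mulr_suml (big_morph (Wq x) (WqD x) (Wq0 WqD Wq2 qn0 x)).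
apply: eq_bigr => i _; rewrite /W /LatticePoisson.W; congr (Wq _ _).
have dn0 : ((d i)%:R : R) != 0 by rewrite pnatr_eq0 -lt0n (d_gt0 hd).
have en0 : ((e i)%:R : R) != 0 by rewrite pnatr_eq0 -lt0n (e_gt0 hd).
have DE : D%:R = (d i)%:R * (e i)%:R :> R by rewrite -(hd i) natrM.
by rewrite DE !rmorphM /= -pmulrn; field; rewrite dn0 en0.
Qed.

Lemma fB_PP B x : fB B x = q x * hq q (PP B) x.
Proof.
rewrite /fB /LatticePoisson.fB /PP hq_sum mulr_sumr; apply: eq_bigr => n hn.
rewrite big_split /= -/W W_prod hqXn.
have -> : \prod_i LatticePoisson.num R (b i) (LatticePoisson.bv n i) = (bv n i0 * bv n j0)%:~R.
  by rewrite /LatticePoisson.num (prod_b (fun i => (LatticePoisson.bv n i)%:~R)) rmorphM.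
have -> : ((bv n i0 * bv n j0)%:~R : R)%:C%C = (bv n i0 * bv n j0)%:~R by rewrite rmorph_int.
have /dvdzP[k hk] := Geven hn; have k0 : 0 <= k by have := pr_ge0 (bv n); rewrite hk; nia.
have [z|kn0] := eqVneq k 0.
  by rewrite (@pr_eq0 (bv n) i0) ?mul0r ?rmorph0 ?mul0r ?mulr0 // hk z mul0r.
have E : (pr (bv n) (bv n))%:~R / D%:R = 2 *+ (kq (bv n)).+1 :> R.
  have kE : k = (kq (bv n)).+1%:Z.
    by rewrite /kq hk abszM absz_nat mulnK // prednK ?absz_gt0 // gez0_abs.
  have D0 : (D%:R : R) != 0 by rewrite pnatr_eq0.
  rewrite hk rmorphM /= kE -!pmulrn -mul2n natrM -[RHS]mulr_natr; field; exact: D0.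
rewrite [Wq x _](congr1 (Wq x) E) (Wq_mulrn WqD Wq2 qn0) Wq2 exprS.
exact: mulrCA.
Qed.

(** The condition [pr = 2 D] says that the norm is 2. Keeping the coefficient an integer is what
    lets a bound below 1 decide. *)
Definition c1 (B : nat) : int := \sum_(n : box B | Gm (bv n) && (pr (bv n) (bv n) == (D.*2)%:Z)) bv n i0 * bv n j0.

Lemma PP0 B : (PP B).[0] = (c1 B)%:~R.
Proof.
rewrite /PP horner_sum /c1 rmorph_sum /= big_mkcondr /=; apply: eq_bigr => n hn.
rewrite hornerZ hornerXn; have /dvdzP[k hk] := Geven hn.
have k0 : 0 <= k by have := pr_ge0 (bv n); rewrite hk; nia.
have [z|kn0] := eqVneq k 0.
  have h0 : bv n i0 = 0 by apply: pr_eq0; rewrite hk z mul0r.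
  by rewrite h0 mul0r !mul0r; case: ifP.
have kE : k = (kq (bv n)).+1%:Z.
  by rewrite /kq hk abszM absz_nat mulnK // prednK ?absz_gt0 // gez0_abs.
case: eqVneq => [hp|kq0].
  by rewrite /kq hp absz_nat divnn double_gt0 /= expr0 mulr1.
suff : kq (bv n) != 0%N by case: (kq _) => // j _; rewrite expr0n mulr0.
by apply: contraNneq kq0 => k00; rewrite hk kE k00 mul1r.
Qed.

(** [h] is [f / eta ^ 24], the uniform limit of polynomials in [q] with constant coefficient [c1 B].
    On the arc [a h] has real part 0, while [mvt] supplies a point where [a] times the polynomial
    has real part [c1 B * c0]. *)
Theorem core : exists N, forall B, (N <= B)%N -> c1 B = 0.
Proof.
have [f [uf [kk kk0 fE]]] := fB_limit hd Gper Gsub Gdual1 Gdual2 expiD expi1 expi_eq1 pois b.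
have [et [ue eE]] := eta_inv pois chi_gauss chi_ind.
have [E [wE En0 uG]] := GP_lim WqD Wq2 q9 qn0 w1inv chi_bd chi_supp chi_1 pow_half ue.
pose h x := (q x)^-1 * f x * (E x)^-1 ^+ 24.
have uh : ucv (fun B x => hq q (PP B * GP chi B ^+ 24) x) h.
  have uq := @ucv_const R T (fun x => (q x)^-1) Mq qinv.
  apply: (ucv_ext _ _ (ucvM (ucvM uq uf) (ucv_exp 24 uG))) => // B x.
  by rewrite hqM hqX -/fB fB_PP mulKf.
have etn0 x : et x != 0 by rewrite wE mulf_neq0 // (w1n0 WqD Wq2 qn0).
have Kn0 x : K x != 0 by have := etn0 x; rewrite eE mulf_eq0 negb_or => /andP[].
have ecn0 x : (et x)^* != 0 by rewrite fmorph_eq0.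
have hE x : h x = 2 ^+ 24 * f x / et x ^+ 24.
  rewrite /h (exprVn (E x)) wE exprMn (w1X WqD Wq2 qn0).
  have : E x ^+ 24 != 0 by rewrite expf_neq0.
  move: (E x ^+ 24) => A An0.
  have : (2 : CC) ^+ 24 != 0 by rewrite expf_neq0 ?pnatr_eq0.
  move: (2 ^+ 24) => t t0; have q0 := qn0 x.
  by field; rewrite t0 q0 An0.
have hE2 x : a x * h x = - (kk%:C%C * (a x * h x)^*).
  have fE' : f x = kk%:C%C * ('i * (a x)^*) ^+ 2 * K x ^+ 24 * (f x)^*.
    by rewrite {1}fE (prod_b (fun=> 'i * (a x)^*)) expr2.
  rewrite hE; apply: (@anti_self _ _ _ _ (K x ^+ 24)) => //.
  - by rewrite {1}fE' exprMn sqrCi mulN1r.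
  - by rewrite rmorphXn /= -exprMn -eE.
  - by rewrite expf_neq0.
  - by rewrite expf_neq0.
  - by rewrite rmorphXn /= rmorph_nat.
have Re0 x : complex.Re (a x * h x) = 0.
  have := hE2 x; case: (a x * h x) => u v /eqP; rewrite eq_complex /= => /andP[/eqP hu _].
  have : u * (1 + kk) = 0 by rewrite mulrDr mulr1 {1}hu; ring.
  move/eqP; rewrite mulf_eq0 => /orP[/eqP //|/eqP]; lra.
have [_ hN] := uh.
(* With [cabs (a x) <= 2] this tolerance bounds the integer [c1 B] by 1/2. *)
have ep : 0 < `|c0| / 4 by rewrite divr_gt0 ?normr_gt0.
have [N hN1] := hN _ ep; exists (maxn N 1) => B; rewrite geq_max => /andP[NB B1].
have [x hx] := mvt (PP B * GP chi B ^+ 24).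
have c1E : (PP B * GP chi B ^+ 24)`_0 = (c1 B)%:~R.
  by rewrite -horner_coef0 hornerM horner_exp (GPE chi_supp chi_1) // expr1n mulr1 PP0.
rewrite c1E in hx.
have hd1 := hN1 B x NB.
have : `|(c1 B)%:~R * c0| <= 2 * (`|c0| / 4).
  rewrite hx; have -> : complex.Re (a x * hq q (PP B * GP chi B ^+ 24) x) = complex.Re (a x * (hq q (PP B * GP chi B ^+ 24) x - h x)).
    rewrite mulrBr; have := Re0 x; case: (a x * h x) => u v /=; case: (a x * _) => u' v' /= ->; by rewrite subr0.
  apply: le_trans (cabs_Re _) _; apply: le_trans (cabsM _ _) _.
  by apply: ler_pM; rewrite ?cabs_ge0.
rewrite normrM => hh.
have c0p : 0 < `|c0| by rewrite normr_gt0.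
have h1 : `|(c1 B)%:~R| < 1 :> R.
  rewrite -(ltr_pM2r c0p) mul1r; lra.
move: h1; rewrite -intr_norm -[1]/(1%:~R) ltr_int => h1.
by apply/eqP; rewrite -normr_eq0; lia.
Qed.

End Core.
End CuspVanishing.

(** * Complex identities in real and imaginary parts *)

Module ComplexLemmas.
From HB Require Import structures.
From mathcomp Require Import all_boot all_order all_algebra.
From mathcomp Require Import complex zify ring lra boolp.
Import UniformLimits.
Set Implicit Arguments. Unset Strict Implicit. Unset Printing Implicit Defensive.
Import Order.TTheory GRing.Theory Num.Theory.
Local Open Scope ring_scope.

Section Abstract.
Variable R : rcfType.
Local Open Scope complex_scope.
Lemma cmulE (u v w z : R) : (u +i* v) * (w +i* z) = (u * w - v * z) +i* (u * z + v * w).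
Proof. by []. Qed.
Lemma crmulE (u w z : R) : u%:C * (w +i* z) = (u * w) +i* (u * z).
Proof.
have -> : u%:C = u +i* 0 by [].
by rewrite cmulE !mul0r subr0 addr0.
Qed.
Lemma ceq (u v w z : R) : u = w -> v = z -> u +i* v = w +i* z. Proof. by move=> -> ->. Qed.
Lemma cabs2 (u v : R) : cabs (u +i* v) = `|u| + `|v|. Proof. by []. Qed.
Lemma cabsB (u v w z : R) : cabs ((u +i* v) - (w +i* z)) = `|u - w| + `|v - z|. Proof. by []. Qed.
Lemma conj2 (u v : R) : (u +i* v)^*%R = u +i* (- v). Proof. by []. Qed.
Lemma comp_false (s k1 k2 u v : R) :
  s%:C * 1 * (k1 +i* k2) * (u +i* (- v)) = (s * (k1 * u + k2 * v)) +i* (s * (k2 * u - k1 * v)).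
Proof. rewrite mulr1 crmulE cmulE; apply: ceq; ring. Qed.
Lemma comp_true (s c sn k1 k2 u v : R) :
  let ZR := s * (k1 * u + k2 * v) in let ZI := s * (k2 * u - k1 * v) in
  s%:C * ('i%R * (c +i* sn)^*%R) * (k1 +i* k2) * (u +i* (- v)) = (sn * ZR - c * ZI) +i* (sn * ZI + c * ZR).
Proof.
move=> ZR ZI; rewrite /ZR /ZI conj2 (_ : 'i%R = 0 +i* 1) // [(0 +i* 1) * _]cmulE crmulE !cmulE; apply: ceq; ring.
Qed.
Lemma wq_bd (e c s : R) : 0 <= e -> `|c| <= 1 -> `|s| <= 1 -> cabs ((e * c) +i* (- e * s)) <= 2 * e.
Proof.
move=> e0 hc hs; rewrite cabs2 mulNr normrN !normrM (ger0_norm e0).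
have : e * `|c| <= e * 1 by apply: ler_wpM2l.
have : e * `|s| <= e * 1 by apply: ler_wpM2l.
lra.
Qed.
Lemma unit_cs (c s : R) : c * c + s * s = 1 -> (c +i* s) * (c +i* s)^*%R = 1.
Proof. by move=> h; rewrite conj2 cmulE; apply: ceq; rewrite -?h; ring. Qed.
Lemma Re_sumc I (r : seq I) (F : I -> R[i]) : complex.Re (\sum_(i <- r) F i) = \sum_(i <- r) complex.Re (F i).
Proof. by elim/big_rec2: _ => // i u v _ <-; case: (F i); case: v. Qed.
Lemma cint (n : int) : (n%:~R : R[i]) = (n%:~R : R)%:C.
Proof. by rewrite rmorph_int. Qed.
Lemma cnat (n : nat) : (n%:R : R[i]) = (n%:R : R)%:C.
Proof. by rewrite rmorph_nat. Qed.
Lemma tail_comb (A u u' v v' : R) : `|u - u'| <= A -> `|v - v'| <= A -> cabs ((u' +i* v') - (u +i* v)) <= 2 * A.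
Proof. by rewrite cabsB distrC [X in _ -> X <= _ -> _]distrC => h1 h2; lra. Qed.
Lemma bd_comb (A u v : R) : `|u| <= A -> `|v| <= A -> cabs (u +i* v) <= 2 * A.
Proof. by rewrite cabs2 => h1 h2; lra. Qed.
Lemma Re_a_q (e c s x y p : R) : complex.Re ((c +i* s) * (p%:C * ((e * x) +i* (- e * y)))) = p * (e * (x * c + y * s)).
Proof. by rewrite crmulE cmulE /=; ring. Qed.
End Abstract.
End ComplexLemmas.

(** * The abstract argument carried out over the standard real numbers *)

Module RealInstance.
From Stdlib Require Import Reals Lra Lia ZArith.
From HB Require Import structures.
From mathcomp Require Import all_boot all_order all_algebra.
From mathcomp Require Import complex zify boolp Rstruct ssrZ.
Import PoissonSummation GaussianTransform ThetaSeries ThetaInversion ArcMeanValue UniformLimits LatticePoisson EtaInversion CuspVanishing ComplexLemmas.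
Set Implicit Arguments. Unset Strict Implicit. Unset Printing Implicit Defensive.
Import Order.TTheory GRing.Theory Num.Theory.
Delimit Scope R_scope with Re.
Local Open Scope ring_scope.
Bind Scope ring_scope with Rdefinitions.R.

Notation RR := Rdefinitions.R.
Notation CC := (RR[i]).
Definition arc (x : RR) : Prop := (- (PI / 6) <= x <= PI / 6)%Re.
Definition TT := {x : RR | arc x}.
Notation ang t := (proj1_sig (t : TT)).

Lemma cos_half (t : TT) : (/ 2 <= cos (ang t))%Re.
Proof. by apply: arc_cos; case: t. Qed.

Definition Wc (t : TT) (s : RR) : CC := (wqr (ang t) s +i* wqi (ang t) s)%C.
Definition ac (t : TT) : CC := (cos (ang t) +i* sin (ang t))%C.
Definition Kc (t : TT) : CC := (KR (ang t) +i* KI (ang t))%C.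
Definition qc (t : TT) : CC := Wc t 2.
Definition expic (s : RR) : CC := (cos (2 * PI * s)%Re +i* sin (2 * PI * s)%Re)%C.
Definition chic (n : int) : RR := chi (Z_of_int n).

Lemma two_R : (2 : RR) = 2%Re. Proof. by rewrite -[2%Re]/(IZR 2) IZRposE INRE. Qed.

Lemma IZR_int (n : int) : IZR (Z_of_int n) = n%:~R.
Proof.
case: n => m; first by rewrite -pmulrn -INRE INR_IZR_INZ.
rewrite NegzE mulrNz -pmulrn -INRE INR_IZR_INZ -RoppE -opp_IZR; congr IZR; lia.
Qed.

Lemma natR (n : nat) : IZR (Z.of_nat n) = n%:R.
Proof. by rewrite -INR_IZR_INZ INRE.
Qed.

Lemma expicD s t : expic (s + t) = expic s * expic t.
Proof.
have E : (2 * PI * (s + t) = 2 * PI * s + 2 * PI * t)%Re by lra.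
rewrite /expic cmulE; apply: ceq.
  have := cos_plus (2 * PI * s) (2 * PI * t); rewrite -E => ->; by [].
have := sin_plus (2 * PI * s) (2 * PI * t); rewrite -E => ->.
by rewrite addrC.
Qed.

Lemma expic1 n : expic n%:~R = 1.
Proof.
rewrite /expic -IZR_int.
have E : (2 * PI * IZR (Z_of_int n) = 0 + 2 * IZR (Z_of_int n) * PI)%Re by lra.
rewrite E cos_period_Z sin_period_Z cos_0 sin_0; by apply: ceq.
Qed.

Lemma expic_eq1 t : expic t = 1 -> exists k : int, t = k%:~R.
Proof.
move=> [h1 _].
have hs : (sin (PI * t) = 0)%Re.
  have E : (2 * PI * t = 2 * (PI * t))%Re by lra.
  rewrite E cos_2a_sin in h1.
  have h1' : (1 - 2 * sin (PI * t) * sin (PI * t) = 1)%Re by exact: h1.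
  have : (sin (PI * t) * sin (PI * t) = 0)%Re by lra.
  by move/Rmult_integral => [].
have [k hk] := sin_eq_0_0 _ hs.
exists (int_of_Z k); rewrite -IZR_int.
have -> : Z_of_int (int_of_Z k) = k by lia.
have := PI_RGT_0 => p0; apply: (Rmult_eq_reg_l PI); last by lra.
transitivity (IZR k * PI)%Re; [exact: hk|exact: Rmult_comm].
Qed.

Lemma WcD t s u : Wc t (s + u) = Wc t s * Wc t u.
Proof. by rewrite /Wc cmulE; apply: ceq; [exact: wqr_plus|exact: wqi_plus]. Qed.

Lemma Wc0 t : Wc t 0 = 1.
Proof. by have [h1 h2] := wq_0 (ang t); apply: ceq; [exact: h1|exact: h2]. Qed.

Lemma Wc_inv t s : (Wc t s)^-1 = Wc t (- s).
Proof.
have h : Wc t s * Wc t (- s) = 1 by rewrite -WcD subrr Wc0.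
have n0 : Wc t s != 0 by apply/negP => /eqP E; move: h; rewrite E mul0r => /eqP; rewrite eq_sym oner_eq0.
by apply: (mulfI n0); rewrite h mulfV.
Qed.

Lemma Wc_n0 t s : Wc t s != 0.
Proof.
apply/negP => /eqP E; have := WcD t s (- s); rewrite subrr Wc0 E mul0r => /eqP; by rewrite oner_eq0.
Qed.

Lemma Wc_bd t s : cabs (Wc t s) <= 2 * exp (- PI * cos (ang t) * s)%Re.
Proof.
rewrite /Wc /wqr /wqi; apply: wq_bd.
- by apply/RleP; apply: Rlt_le; apply: exp_pos.
- rewrite -RabsE; apply/RleP; apply: Rabs_le; have := COS_bound (PI * sin (ang t) * s); by [].
- rewrite -RabsE; apply/RleP; apply: Rabs_le; have := SIN_bound (PI * sin (ang t) * s); by [].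
Qed.

Lemma Wc_bd2 t s : (0 <= s)%Re -> cabs (Wc t (- s)) <= 2 * exp (PI * s)%Re.
Proof.
move=> s0; apply: le_trans (Wc_bd _ _) _; apply: ler_wpM2l => //; apply/RleP; exact: exp_neg_bd.
Qed.

Lemma q9c t k : cabs (qc t ^+ k) <= 2 / 9 ^+ k.
Proof.
have -> : qc t ^+ k = Wc t (2 *+ k).
  by elim: k => [|k IH]; rewrite ?expr0 ?mulr0n ?Wc0 // exprS IH (mulrS (2 : RR)) WcD.
apply: le_trans (Wc_bd _ _) _; apply: ler_wpM2l => //.
have -> : exp (- PI * cos (ang t) * (2 *+ k))%Re = exp (- 2 * PI * cos (ang t))%Re ^+ k.
  elim: k => [|k IH]; first by rewrite mulr0n expr0 -R0E Rmult_0_r exp_0.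
  rewrite (mulrS (2 : RR)) exprS -IH -RmultE -exp_plus -RplusE Rmult_plus_distr_l.
  congr (exp (Rplus _ _)); rewrite two_R; lra.
rewrite -exprVn; apply: lerXn2r; rewrite ?nnegrE.
- by apply/RleP; apply: Rlt_le; apply: exp_pos.
- by rewrite invr_ge0.
- apply/RleP; have := exp_arc _ (cos_half t).
  by rewrite -RinvE; have -> : (9 : RR) = 9%Re by rewrite -[9%Re]/(IZR 9) IZRposE INRE.
Qed.

Lemma qinvc t : cabs (qc t)^-1 <= 2 * exp (PI * 2)%Re.
Proof. by rewrite /qc Wc_inv two_R; apply: Wc_bd2; lra. Qed.

Lemma w1invc t : cabs (2 * Wc t (12^-1))^-1 <= cabs (2^-1 : CC) * (2 * exp (PI * / 12)%Re).
Proof.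
rewrite invfM Wc_inv; apply: le_trans (cabsM _ _) _; apply: ler_wpM2l; first exact: cabs_ge0.
have -> : (12^-1 : RR) = (/ 12)%Re by rewrite RinvE; congr (_^-1); rewrite -[12%Re]/(IZR 12) IZRposE INRE.
by apply: Wc_bd2; lra.
Qed.

Lemma chic_bd n : `|chic n| <= 6 / 5.
Proof.
have := chi_bd (Z_of_int n); rewrite -RabsE => h; apply/RleP; move: h.
rewrite -RdivE; have -> : (6 : RR) = 6%Re by rewrite -[6%Re]/(IZR 6) IZRposE INRE.
by have -> : (5 : RR) = 5%Re by rewrite -[5%Re]/(IZR 5) IZRposE INRE.
Qed.

Lemma chic_supp n : chic n != 0 -> exists k : nat, n * n = (24 * k + 1)%N%:Z.
Proof.
move=> h; have [|k hk] := @chi_supp (Z_of_int n); first by move=> E; case/eqP: h.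
exists k; lia.
Qed.

Lemma chic_1 : chic 1 = 1 /\ chic (-1) = 1.
Proof. exact: chi_1. Qed.

Lemma ind_indc d c n : (0 < d)%N -> indc RR d c n = (ind d c (Z_of_int n))%:C%C.
Proof.
move=> d0; rewrite /indc; case: (boolP (_ %| _)%Z) => [/dvdzP[k hk]|h].
  have -> : Z_of_int n = (Z.of_nat c + Z.of_nat d * Z_of_int k)%Z by nia.
  by rewrite ind_1 //; lia.
rewrite ind_0 //; first by lia.
move=> k hk; case/negP: h; apply/dvdzP; exists (int_of_Z k); nia.
Qed.

Lemma chic_ind n : (chic n)%:C%C = indc RR 12 1 n - indc RR 12 5 n - indc RR 12 7 n + indc RR 12 11 n.
Proof. by rewrite !ind_indc // -!rmorphB -rmorphD /chic chi_ind. Qed.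

Lemma ec12 (c : nat) n : ec expic c 12 n = (cos (2 * PI * IZR (Z.of_nat c) * IZR (Z_of_int n) / 12)%Re +i* sin (2 * PI * IZR (Z.of_nat c) * IZR (Z_of_int n) / 12)%Re)%C.
Proof.
rewrite /ec /expic.
have -> : (c%:R * n%:~R / 12%:R : RR) = (IZR (Z.of_nat c) * IZR (Z_of_int n) / 12)%Re.
  by rewrite RdivE RmultE -[12%Re]/(IZR (Z.of_nat 12)) !natR IZR_int.
have -> : (2 * PI * (IZR (Z.of_nat c) * IZR (Z_of_int n) / 12) = 2 * PI * IZR (Z.of_nat c) * IZR (Z_of_int n) / 12)%Re by lra.
by [].
Qed.

Lemma chic_gauss n : ec expic 1 12 n - ec expic 5 12 n - ec expic 7 12 n + ec expic 11 12 n = (Num.sqrt 12 * chic n)%:C%C.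
Proof.
have [h1 h2] := chi_gauss (Z_of_int n).
rewrite !ec12; apply: ceq; last exact: h2.
have -> : (12 : RR) = 12%Re by rewrite -[12%Re]/(IZR 12) IZRposE INRE.
rewrite -RsqrtE; first exact: h1.
Qed.

Lemma pow_halfc (eps : RR) : 0 < eps -> exists N, forall n, (N <= n)%N -> (1 / 2) ^+ n <= eps.
Proof.
move/RltP => e0.
have [|N hN] := pow_lt_1_zero (/ 2) _ eps e0; first by rewrite Rabs_right; lra.
exists N => n Nn; have := hN n ltac:(lia) => h.
apply/RleP; apply: Rlt_le; apply: Rle_lt_trans h.
rewrite div1r two_R -RinvE -RpowE; exact: Rle_abs.
Qed.

Lemma aac t : ac t * (ac t)^* = 1.
Proof. apply: unit_cs; have := sin2_cos2 (ang t); rewrite /Rsqr Rplus_comm => h; exact: h. Qed.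

Lemma abc t : cabs (ac t) <= 2.
Proof.
rewrite /ac -[2]mulr1; apply: bd_comb; rewrite -RabsE; apply/RleP; apply: Rabs_le.
- have := COS_bound (ang t); by [].
- have := SIN_bound (ang t); by [].
Qed.

Lemma rsumE (f : nat -> RR) n : rsum f n = \sum_(k < n) f k.
Proof. by elim: n => [|n IH]; rewrite ?big_ord0 // big_ord_recr /= -IH. Qed.

Lemma mvtc (p : {poly RR}) : exists t, p`_0 * (3 / PI)%Re = complex.Re (ac t * hq qc p t).
Proof.
have [x [ax hx]] := arc_mvt (fun k => p`_k) (size p).
exists (exist _ x ax); set t : TT := exist _ x ax.
have -> : p`_0 * (3 / PI)%Re = (p`_0 * 3 / PI)%Re by rewrite -RmultE; lra.
rewrite hx rsumE /hq (@horner_coef_wide _ (size p).+1); last first.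
  by rewrite (leq_trans (size_poly _ _)).
rewrite mulr_sumr Re_sumc; apply: eq_bigr => k _.
rewrite coef_map.
have -> : qc t ^+ k = Wc t (2 *+ k).
  by elim: (nat_of_ord k) => [|j IH]; rewrite ?expr0 ?mulr0n ?Wc0 // exprS IH (mulrS (2 : RR)) WcD.
rewrite /Wc /wqr /wqi /ac [RHS]Re_a_q.
have -> : (2 *+ k : RR) = (2 * INR k)%Re by rewrite -(mulr_natr (2 : RR) k) two_R -INRE RmultE.
have -> : ang t = x by [].
rewrite cos_minus.
have -> : (- PI * cos x * (2 * INR k) = - 2 * PI * INR k * cos x)%Re by lra.
have -> : (PI * sin x * (2 * INR k) = 2 * PI * INR k * sin x)%Re by lra.
by [].
Qed.

Lemma ssumE (f : Z -> RR) B : \sum_(k < B.*2.+1) f (Z_of_int (k%:Z - B%:Z)) = ssum f B.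
Proof.
elim: B => [|B IH]; first by rewrite big_ord1 subrr.
rewrite (big_sym_rec (fun n => f (Z_of_int n))) IH.
have -> : Z_of_int (- B.+1%:Z) = (- Z.of_nat B.+1)%Z by lia.
by have -> : Z_of_int B.+1%:Z = Z.of_nat B.+1 by lia.
Qed.

Lemma SBc (g h : Z -> RR) B : SB B (fun n => (g (Z_of_int n) +i* h (Z_of_int n))%C) = (ssum g B +i* ssum h B)%C.
Proof. by rewrite SB_ReIm -!ssumE. Qed.

(** The constants [C] and [r] are the same for all points of the arc, so the geometric tails are
    uniform. *)
Lemma ucv_SBc (g h : TT -> Z -> RR) (C r : RR) :
  (forall t, geom_bd (g t) C r /\ geom_bd (h t) C r) ->
  ucv (fun B t => SB B (fun n => (g t (Z_of_int n) +i* h t (Z_of_int n))%C)) (fun t => (Ssum (g t) +i* Ssum (h t))%C).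
Proof.
move=> H.
have t0 : TT by exists 0%Re; split; have := PI_RGT_0; lra.
have [[C0 [r01 _]] _] := H t0.
pose A : RR := (2 * C / (1 - r))%Re.
have A0 : (0 <= A)%Re.
  by apply: Rmult_le_pos; [lra|apply: Rlt_le; apply: Rinv_0_lt_compat; lra].
have tl (f : Z -> RR) n : geom_bd f C r -> `|Ssum f - ssum f n| <= A * r ^+ n.
  by move=> hb; apply/RleP; rewrite -RabsE -RpowE; exact: (Ssum_tail f C r hb n).
have bd (f : Z -> RR) : geom_bd f C r -> `|Ssum f| <= (C + A)%Re.
  move=> hb; rewrite -RabsE; apply/RleP.
  have h1 := Ssum_tail f C r hb 0%N.
  have [_ [_ hk]] := hb; have [h2 _] := hk 0%N.
  rewrite [(r ^ 0)%Re]/(1%Re) Rmult_1_r in h1; rewrite [(r ^ 0)%Re]/(1%Re) Rmult_1_r in h2.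
  have h3 := Rabs_triang (Ssum f - f Z0) (f Z0).
  have E : (Ssum f - f Z0 + f Z0 = Ssum f)%Re by ring.
  rewrite E in h3; change (ssum f 0%N) with (f Z0) in h1; change (Z.of_nat 0%N) with Z0 in h2.
  apply: (Rle_trans _ _ _ h3); rewrite (Rplus_comm C); exact: (Rplus_le_compat _ _ _ _ h1 h2).
apply: (@ucv_bound _ _ _ _ (2 * A) r (2 * (C + A)%Re)).
- by apply: mulr_ge0 => //; apply/RleP.
- move=> eps /RltP e0.
  have := geom_lim0 (2 * A)%Re r r01.
  move/Lim_seq.is_lim_seq_spec => /(_ (mkposreal eps e0)) [N hN]; exists N => n Nn.
  have := hN n ltac:(lia) => hh; apply/RleP; apply: Rlt_le; apply: Rle_lt_trans hh.
  rewrite Rminus_0_r -RpowE two_R; exact: Rle_abs.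
- by move=> t; have [h1 h2] := H t; apply: bd_comb; exact: bd.
- move=> B t; have [h1 h2] := H t; rewrite SBc -mulrA; apply: tail_comb; exact: tl.
Qed.

Lemma W_wr t d n : W Wc t d n = (wr (ang t) d (Z_of_int n) +i* wi (ang t) d (Z_of_int n))%C.
Proof.
rewrite /W /Wc /wqr /wqi /wr /wi.
have -> : (n%:~R ^+ 2 / d%:R : RR) = (IZR (Z_of_int n) * IZR (Z_of_int n) / INR d)%Re.
  by rewrite RdivE RmultE INRE IZR_int expr2.
have E u v : (u * (v / INR d) = u * v / INR d)%Re by move=> *; rewrite /Rdiv; ring.
by rewrite !E.
Qed.

Lemma ec_cs c d n : ec expic c d n = (ecr d c (Z_of_int n) +i* ecs d c (Z_of_int n))%C.
Proof.
rewrite /ec /expic /ecr /ecs.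
have -> : (c%:R * n%:~R / d%:R : RR) = (INR c * IZR (Z_of_int n) / INR d)%Re.
  by rewrite RdivE RmultE !INRE IZR_int.
have -> : (2 * PI * (INR c * IZR (Z_of_int n) / INR d) = 2 * PI * INR c * IZR (Z_of_int n) / INR d)%Re by rewrite /Rdiv; ring.
by [].
Qed.

Lemma num_vb b n : num RR b n = (vb b (Z_of_int n))%:C%C.
Proof. by rewrite /num /vb; case: b => //; rewrite cint IZR_int. Qed.

Lemma poisc b d c : (c < d)%N -> exists tl tr : TT -> CC,
  [/\ ucv (fun B x => SB B (fun n => num RR b n * (W Wc x d n * ec expic c d n))) tl,
      ucv (fun B x => SB B (fun l => num RR b l * (indc RR d c l * (W Wc x d l)^*))) tr &
      forall x, tl x = (Num.sqrt d%:R)%:C%C * (if b then 'i * (ac x)^* else 1) * Kc x * tr x].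
Proof.
move=> cd; have d0 : (0 < d)%coq_nat by lia.
have d0' : (0 < d)%N by lia.
have cd' : (c < d)%coq_nat by lia.
exists (fun t => (Ssum (sgr (ang t) d c b) +i* Ssum (sgi (ang t) d c b))%C).
exists (fun t => (Ssum (shr (ang t) d c b) +i* Ssum (shi (ang t) d c b))%C).
split.
- apply: ucv_ext (ucv_SBc (g := fun t => sgr (ang t) d c b) (h := fun t => sgi (ang t) d c b) (C := (Cw d + Cw d)%Re) (r := exp (- 1)%Re) _) => // [B t|t].
    by apply: eq_bigr => k _; rewrite num_vb W_wr ec_cs [X in _ * X]cmulE crmulE.
  exact: (sg_bd _ d c b (cos_half t) d0).
- apply: ucv_ext (ucv_SBc (g := fun t => shr (ang t) d c b) (h := fun t => shi (ang t) d c b) (C := Cw d) (r := exp (- 1)%Re) _) => // [B t|t].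
    apply: eq_bigr => k _; rewrite num_vb W_wr ind_indc // conj2 [X in _ * X]crmulE crmulE; apply: ceq.
      have E (u v w : RR) : u * (v * w) = v * (u * w) by rewrite mulrCA.
      rewrite /shr; exact: E.
    have E (u v w : RR) : - (u * (v * w)) = v * (u * - w) by rewrite !mulrN mulrCA.
    rewrite /shi; exact: E.
  exact: (sh_bd _ d c b (cos_half t) d0).
- move=> t; have [hf ht] := poisson_sums _ _ _ (cos_half t) cd'.
  have s : Num.sqrt d%:R = sqrt (INR d) by rewrite RsqrtE ?INRE //; apply/RleP; rewrite ler0n.
  have sE : Ssum (shi (ang t) d c b) = - - Ssum (shi (ang t) d c b) by rewrite opprK.
  case: b hf ht sE => hf ht sE.
    rewrite s [in RHS]sE /Kc /ac comp_true; move: ht => /= [h1 h2]; apply: ceq; [exact: h1|exact: h2].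
  rewrite s [in RHS]sE /Kc comp_false; move: hf => [h1 h2]; apply: ceq; [exact: h1|exact: h2].
Qed.

(** Hypotheses and conclusion speak of integers only. This carries the result from one model of the
    reals to lattices over any [realType]. *)
Theorem core24 (d e : 'I_24 -> nat) (D' : nat) (Gm : ('I_24 -> int) -> bool) (i0 j0 : 'I_24) :
  (forall i, (d i * e i = D'.+1)%N) ->
  (forall n m, (forall i, ((d i)%:Z %| n i - m i)%Z) -> Gm n = Gm m) ->
  (forall n m, Gm n -> Gm m -> Gm (fun i => n i - m i)) ->
  (forall n m, Gm n -> Gm m -> (D'.+1%:Z %| pr e n m)%Z) ->
  (forall n, (forall m, Gm m -> (D'.+1%:Z %| pr e m n)%Z) -> Gm n) ->
  (forall n, Gm n -> ((D'.+1.*2)%:Z %| pr e n n)%Z) ->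
  i0 != j0 ->
  exists N, forall B, (N <= B)%N -> c1 e D' Gm i0 j0 B = 0.
Proof.
move=> hd h1 h2 h3 h4 h5 ij.
have c0 : ((3 / PI)%Re : RR) != 0.
  apply/eqP => h; have := PI_RGT_0 => p0; have : (3 / PI * PI = 0)%Re by rewrite h -R0E; ring.
  by rewrite /Rdiv Rmult_assoc Rinv_l; lra.
exact: (core expicD expic1 expic_eq1 poisc aac abc WcD (fun=> erefl) q9c (fun t => Wc_n0 t _) qinvc w1invc chic_bd chic_supp chic_1 chic_gauss chic_ind pow_halfc c0 mvtc hd h1 h2 h3 h4 h5 ij).
Qed.
End RealInstance.

(** * Inner products, orthogonal frames, finiteness of shells *)

Module LatticeBasics.
Require Import Defs.
From HB Require Import structures.
From mathcomp Require Import all_boot all_order all_algebra.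
From mathcomp Require Import boolp classical_sets cardinality fsbigop reals.
From mathcomp Require Import zify ring lra.
Import LatticePoisson CuspVanishing RealInstance.
Set Implicit Arguments. Unset Strict Implicit. Unset Printing Implicit Defensive.
Import Order.TTheory GRing.Theory Num.Theory.
Local Open Scope classical_set_scope.
Local Open Scope ring_scope.

Section Basics.
Variables (R : realType) (n : nat).
Notation vec := 'rV[R]_n.
Implicit Types (x y z : vec) (M : set vec).

Lemma dotC x y : dot x y = dot y x.
Proof. by apply: eq_bigr => i _; rewrite mulrC. Qed.
Lemma dotDl x y z : dot (x + y) z = dot x z + dot y z.
Proof. by rewrite /dot -big_split; apply: eq_bigr => i _; rewrite mxE mulrDl. Qed.
Lemma dotZl c x y : dot (c *: x) y = c * dot x y.
Proof. by rewrite /dot mulr_sumr; apply: eq_bigr => i _; rewrite mxE mulrA. Qed.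
Lemma dotDr x y z : dot z (x + y) = dot z x + dot z y.
Proof. by rewrite dotC dotDl !(dotC z). Qed.
Lemma dotZr c x y : dot y (c *: x) = c * dot y x.
Proof. by rewrite dotC dotZl dotC. Qed.
Lemma dotNl x y : dot (- x) y = - dot x y. Proof. by rewrite -scaleN1r dotZl mulN1r. Qed.
Lemma dotNr x y : dot y (- x) = - dot y x. Proof. by rewrite dotC dotNl dotC. Qed.
Lemma dotBl x y z : dot (x - y) z = dot x z - dot y z. Proof. by rewrite dotDl dotNl. Qed.
Lemma dotBr x y z : dot z (x - y) = dot z x - dot z y. Proof. by rewrite dotDr dotNr. Qed.
Lemma dot0l y : dot 0 y = 0. Proof. by rewrite -(scale0r 0) dotZl mul0r. Qed.
Lemma dot0r y : dot y 0 = 0. Proof. by rewrite dotC dot0l. Qed.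
Lemma dot_suml I (s : seq I) (F : I -> vec) y : dot (\sum_(i <- s) F i) y = \sum_(i <- s) dot (F i) y.
Proof. by apply: (big_morph (fun x => dot x y)) => [u v|]; rewrite ?dotDl ?dot0l. Qed.
Lemma dot_ge0 x : 0 <= dot x x.
Proof. by apply: sumr_ge0 => i _; rewrite -expr2 sqr_ge0. Qed.
Lemma dot_eq0 x : dot x x = 0 -> x = 0.
Proof.
move/eqP; rewrite psumr_eq0 => [/allP h|i _]; last by rewrite -expr2 sqr_ge0.
apply/rowP => i; rewrite mxE; have := h i (mem_index_enum _).
by rewrite mulf_eq0 orbb (ord1 0) => /eqP.
Qed.
Lemma dot_gt0 x : x != 0 -> 0 < dot x x.
Proof. by move=> h; rewrite lt_neqAle dot_ge0 andbT eq_sym; apply: contra_neq h => /dot_eq0. Qed.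
Lemma dot_CS x y : dot x y ^+ 2 <= dot x x * dot y y.
Proof.
have [->|y0] := eqVneq y 0; first by rewrite dot0r dot0l mulr0 expr0n.
have yy := dot_gt0 y0.
have h := dot_ge0 (dot y y *: x - dot x y *: y).
rewrite !(dotBl, dotBr, dotZl, dotZr) (dotC y x) in h.
have : 0 <= dot y y * (dot x x * dot y y - dot x y ^+ 2) by rewrite expr2; lra.
by rewrite pmulr_rge0 // subr_ge0.
Qed.
Lemma dot_mx x y : dot x y = (x *m y^T) 0 0.
Proof. by rewrite mxE; apply: eq_bigr => i _; rewrite mxE. Qed.

Definition grp M := M 0 /\ forall x y, M x -> M y -> M (x - y).
Lemma grpN M x : grp M -> M x -> M (- x).
Proof. by move=> [h0 hB] hx; rewrite -[- x]add0r; apply: hB. Qed.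
Lemma grpD M x y : grp M -> M x -> M y -> M (x + y).
Proof. by move=> hM hx hy; rewrite -[y]opprK; apply: hM.2 => //; exact: grpN. Qed.
Lemma grpZn M x k : grp M -> M x -> M (k%:R *: x).
Proof.
move=> hM hx; elim: k => [|k IH]; first by rewrite scale0r; exact: hM.1.
by rewrite -natr1 scalerDl scale1r; exact: grpD.
Qed.
Lemma grpZ M x (k : int) : grp M -> M x -> M (k%:~R *: x).
Proof.
move=> hM hx; case: k => k; first exact: grpZn.
by rewrite NegzE mulrNz scaleNr; apply: grpN => //; exact: grpZn.
Qed.
Lemma grp_sum M I (s : seq I) (F : I -> vec) : grp M -> (forall i, M (F i)) -> M (\sum_(i <- s) F i).
Proof. by move=> hM hF; elim/big_rec: _ => [|i x _]; [exact: hM.1|exact: grpD]. Qed.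

Definition orthf (a : 'I_n -> vec) := (forall i, a i != 0) /\ (forall i j, i != j -> dot (a i) (a j) = 0).

Section Frame.
Variable a : 'I_n -> vec.
Hypothesis oa : orthf a.
Lemma fn_gt0 i : 0 < dot (a i) (a i). Proof. exact: dot_gt0 (oa.1 i). Qed.
Lemma fn_n0 i : dot (a i) (a i) != 0. Proof. by rewrite gt_eqF // fn_gt0. Qed.

(** For the matrix [A] with rows [a i] and the diagonal matrix of inverse norms, orthogonality says
    that [A^T] times this diagonal is a right inverse of [A]; for square matrices it is also a left
    inverse. *)
Lemma frame_id : \sum_i (dot (a i) (a i))^-1 *: ((a i)^T *m a i) = 1%:M.
Proof.
pose A : 'M[R]_n := \matrix_i a i.
pose Dv : 'rV[R]_n := \row_i (dot (a i) (a i))^-1.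
have E : A *m (A^T *m diag_mx Dv) = 1%:M.
  apply/matrixP => i j; rewrite mulmxA mul_mx_diag !mxE.
  have -> : \sum_k A i k * A^T k j = dot (a i) (a j) by apply: eq_bigr => k _; rewrite !mxE.
  have [->|ij] := eqVneq i j; first by rewrite mulfV // fn_n0.
  by rewrite (oa.2 _ _ ij) mul0r.
rewrite -(mulmx1C E); apply/matrixP => i j; rewrite summxE mul_mx_diag !mxE.
by apply: eq_bigr => k _; rewrite !mxE big_ord1 !mxE (mulrC _ (dot _ _)^-1) -mulrA.
Qed.

Lemma frame_decomp x : x = \sum_i (dot x (a i) / dot (a i) (a i)) *: a i.
Proof.
rewrite -{1}[x]mulmx1 -frame_id mulmx_sumr; apply: eq_bigr => i _.
rewrite -scalemxAr mulmxA.
have -> : x *m (a i)^T = (dot x (a i))%:M by rewrite dot_mx; apply/matrixP => u v; rewrite !ord1 !mxE.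
by rewrite mul_scalar_mx scalerA mulrC.
Qed.

Lemma frame_dot x y : dot x y = \sum_i dot x (a i) * dot y (a i) / dot (a i) (a i).
Proof.
rewrite {1}(frame_decomp x) dot_suml; apply: eq_bigr => i _.
by rewrite dotZl (dotC _ y); ring.
Qed.
End Frame.

(** Even selfdual lattices given by an orthogonal frame inside instead of a basis: the analysis
    works in frame coordinates, and a neighbour inherits a frame simply by doubling. *)
Record evsd M : Prop := Evsd {
  ev_grp : grp M;
  ev_dual : M = dual M;
  ev_even : forall x, M x -> even_norm x;
  ev_frame : exists2 a : 'I_n -> vec, orthf a & forall i, M (a i)
}.

Lemma intN (u : R) : u \is a Num.int -> - u \is a Num.int. Proof. by rewrite rpredN. Qed.

Lemma dual_grp M : grp (dual M).
Proof.
split=> [x _|x y hx hy z hz]; first by rewrite dot0r.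
by rewrite dotBr rpredB ?hx ?hy.
Qed.

Lemma fsumE (X : set vec) (s : seq vec) (F : vec -> R) : uniq s -> (forall x, X x -> x \in s) ->
  \sum_(x \in X) F x = \sum_(x <- s) (if `[< X x >] then F x else 0).
Proof.
move=> us h; have E : X = [set` s] `&` X by apply/seteqP; split=> [x hx|x []//]; split=> //; exact: h.
rewrite [X in \big[_/_]_(_ \in X) _]E fsbig_mkcondr -fsbig_seq //; apply: eq_big_seq => x xs.
Qed.

Lemma fin_seq (X : set vec) : finite_set X -> exists2 s : seq vec, uniq s & forall x, X x <-> x \in s.
Proof.
move=> /finite_seqP[s hs]; exists (undup s); first exact: undup_uniq.
by move=> x; rewrite mem_undup hs.
Qed.

Lemma fsum_seq (X : set vec) (s : seq vec) (F : vec -> R) : uniq s -> (forall x, X x <-> x \in s) ->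
  \sum_(x \in X) F x = \sum_(x <- s) F x.
Proof.
move=> us h; rewrite (fsumE _ us) => [|x /h//]; apply: eq_big_seq => x /h hx.
by case: asboolP.
Qed.

(** By Cauchy-Schwarz the integers [(x, a i)] are bounded in terms of [m], and by [frame_decomp]
    they determine [x]. *)
Lemma finite_frame (a : 'I_n -> vec) m (X : set vec) : orthf a ->
  (forall x, X x -> dot x x = m /\ forall i, dot x (a i) \is a Num.int) -> finite_set X.
Proof.
move=> oa hX.
pose B : nat := \max_i `|Num.ceil (m * dot (a i) (a i) + 1)|%N.
pose f (c : {ffun 'I_n -> 'I_(B.*2.+1)}) : vec := \sum_i (((c i)%:Z - B%:Z)%:~R / dot (a i) (a i)) *: a i.
apply: (@sub_finite_set _ _ (range f)); last exact: finite_image.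
move=> x /hX[hm hi].
pose k i := Num.floor (dot x (a i)).
have kE i : dot x (a i) = (k i)%:~R by rewrite floorK.
have kB i : (`|k i| <= B)%N.
  have h1 : (k i)%:~R ^+ 2 <= m * dot (a i) (a i) by rewrite -kE -hm dot_CS.
  have h2 : (`|k i|%N%:Z)%:~R <= m * dot (a i) (a i) + 1 :> R.
    have h3 : (`|k i|%N%:Z)%:~R <= (k i)%:~R ^+ 2 + 1 :> R.
      by rewrite -rmorphXn -[1]/(1%:~R) -rmorphD ler_int; nia.
    lra.
  have h4 : (`|k i|%N%:Z <= Num.ceil (m * dot (a i) (a i) + 1)) by rewrite -(ler_int R); apply: le_trans h2 (ceil_ge _).
  apply: leq_trans (leq_bigmax i); lia.
exists [ffun i => inord `|(k i + B%:Z)%R|%N] => //.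
rewrite [RHS](frame_decomp oa x); apply: eq_bigr => i _; rewrite ffunE inordK; last by have := kB i; lia.
by rewrite kE; congr (_%:~R / _ *: _); have := kB i; lia.
Qed.
End Basics.
End LatticeBasics.

(** * Second moments of the shell of norm 2 *)

Module NormTwoMoments.
Require Import Defs.
From HB Require Import structures.
From mathcomp Require Import all_boot all_order all_algebra.
From mathcomp Require Import boolp classical_sets cardinality fsbigop reals.
From mathcomp Require Import zify ring lra.
Import LatticePoisson CuspVanishing RealInstance LatticeBasics.
Set Implicit Arguments. Unset Strict Implicit. Unset Printing Implicit Defensive.
Import Order.TTheory GRing.Theory Num.Theory.
Local Open Scope classical_set_scope.
Local Open Scope ring_scope.

Section Coord.
Variables (R : realType) (n : nat).
Notation vec := 'rV[R]_n.
Variable a : 'I_n -> vec.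
Hypothesis oa : orthf a.
Definition vz (k : 'I_n -> int) : vec := \sum_i ((k i)%:~R / dot (a i) (a i)) *: a i.

Lemma dot_vz k i : dot (vz k) (a i) = (k i)%:~R.
Proof.
rewrite /vz dot_suml (bigD1 i) //= big1 => [|j ji]; last by rewrite dotZl (oa.2 _ _ ji) mulr0.
by rewrite dotZl addr0 divfK // fn_n0.
Qed.
Lemma vzB k l : vz (fun i => k i - l i) = vz k - vz l.
Proof. by rewrite /vz -sumrB; apply: eq_bigr => i _; rewrite rmorphB mulrBl scalerBl. Qed.
Lemma vz_floor x : (forall i, dot x (a i) \is a Num.int) -> vz (fun i => Num.floor (dot x (a i))) = x.
Proof. by move=> h; rewrite [RHS](frame_decomp oa x); apply: eq_bigr => i _; rewrite floorK. Qed.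
Lemma frame_inj x y : (forall i, dot x (a i) = dot y (a i)) -> x = y.
Proof. by move=> h; rewrite (frame_decomp oa x) (frame_decomp oa y); apply: eq_bigr => i _; rewrite h. Qed.

Variable d : 'I_n -> nat.
Hypothesis hd : forall i, dot (a i) (a i) = (d i)%:R.
Variables (D' : nat) (e : 'I_n -> nat).
Hypothesis de : forall i, (d i * e i = D'.+1)%N.

Lemma dot_vzvz k l : dot (vz k) (vz l) = (pr e k l)%:~R / D'.+1%:R.
Proof.
rewrite (frame_dot oa) /pr rmorph_sum mulr_suml; apply: eq_bigr => i _; rewrite !dot_vz hd !rmorphM /=.
have d0 : (d i)%:R != 0 :> R by rewrite -hd fn_n0.
have e0 : (e i)%:R != 0 :> R by rewrite pnatr_eq0; apply/eqP => h0; have := de i; rewrite h0 muln0.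
by rewrite -(de i) natrM -pmulrn; move: d0 e0; move: (d i)%:R (e i)%:R => d1 e1 d0 e0; field; rewrite ?d0 ?e0.
Qed.

Lemma int_frac (z : int) : (z%:~R / D'.+1%:R : R) \is a Num.int = (D'.+1%:Z %| z)%Z.
Proof.
apply/idP/idP => [/intrP[k hk]|/dvdzP[k ->]]; last by rewrite rmorphM mulfK ?pnatr_eq0 //; exact: intr_int.
apply/dvdzP; exists k; apply/eqP; rewrite -(eqr_int R) rmorphM /= -hk divfK // pnatr_eq0 //.
Qed.

Lemma bound_exists (X : set vec) : finite_set X -> exists B0, forall x, X x -> forall i, `|dot x (a i)| <= B0%:R.
Proof.
move=> /finite_setP[N]; elim: N X => [|N IH] X.
  by rewrite II0 card_eq0 => /eqP ->; exists 0%N => x [].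
move/eq_cardSP => -[x0 hx0 /IH[B0 h]].
exists (maxn B0 (\max_i `|Num.ceil `|dot x0 (a i)| |)%N) => x hx i.
have [->|xx] := pselect (x = x0).
  apply: le_trans (ceil_ge _) _.
  have : (Num.ceil `|dot x0 (a i)| <= (`|Num.ceil `|dot x0 (a i)| |%N)%:Z) by lia.
  rewrite -(ler_int R) => h1; apply: le_trans h1 _; rewrite -pmulrn ler_nat.
  by apply: leq_trans (leq_maxr _ _); exact: (leq_bigmax i).
apply: le_trans (h x _ i) _; first by split.
by rewrite ler_nat leq_maxl.
Qed.
End Coord.

Section CoreLattice.
Variable R : realType.
Notation vec := 'rV[R]_24.

Lemma dual_int n (M : set 'rV[R]_n) x y : M = dual M -> M x -> M y -> dot x y \is a Num.int.
Proof. by move=> E hx hy; rewrite E in hy; exact: hy. Qed.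

Lemma shell_finite n (M : set 'rV[R]_n) m : evsd M -> finite_set (shell M m).
Proof.
move=> hM; have [a oa ha] := ev_frame hM; apply: (finite_frame (m := m) oa) => x [hx hm]; split=> // i.
exact: (dual_int (ev_dual hM)).
Qed.

Lemma norm_nat n (M : set 'rV[R]_n) x : M = dual M -> M x -> exists d : nat, dot x x = d%:R.
Proof.
move=> E hx; have /intrP[k hk] := dual_int E hx hx; exists `|k|%N.
by rewrite hk pmulrn; congr (_%:~R); have := dot_ge0 x; rewrite hk ler0z; lia.
Qed.

(** The dictionary to [core24]: [d] gives the norms of the frame, [D] is their product, [e k] the
    product of the others. Frame coordinates are bounded on the finite shell, so for large [B] the
    box sum [c1] is the sum over the whole shell. *)
Lemma core_orth (M : set vec) (a : 'I_24 -> vec) i j : evsd M -> orthf a -> (forall i, M (a i)) -> i != j ->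
  \sum_(x \in shell M 2) dot x (a i) * dot x (a j) = 0.
Proof.
move=> hM oa ha ij.
have [d hd] := boolp.choice (fun i => norm_nat (ev_dual hM) (ha i)).
have d0 k : (0 < d k)%N by have := fn_gt0 oa k; rewrite hd ltr0n.
pose e k := (\prod_(l | l != k) d l)%N.
have P0 : (0 < \prod_k d k)%N by apply: prodn_gt0.
pose D' := (\prod_k d k).-1.
have de k : (d k * e k = D'.+1)%N by rewrite /D' prednK // (bigD1 k).
have gM := ev_grp hM; have dM := ev_dual hM.
pose Gm k := `[< M (vz a k) >].
have [N hN] : exists N, forall B, (N <= B)%N -> c1 e D' Gm i j B = 0.
  apply: (core24 (d := d)) => //.
  - move=> k l h; have h1 : M (vz a k - vz a l).
      rewrite -vzB /vz; apply: grp_sum => // u; have /dvdzP[t ->] := h u.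
      by rewrite hd rmorphM /= mulfK ?pnatr_eq0 -?lt0n //; exact: grpZ.
    apply/asboolP/asboolP => h2; first by rewrite -(subKr (vz a k) (vz a l)); exact: gM.2.
    by rewrite -(subrK (vz a l) (vz a k)); exact: grpD.
  - by move=> k l /asboolP hk /asboolP hl; apply/asboolP; rewrite vzB; exact: gM.2.
  - move=> k l /asboolP hk /asboolP hl; rewrite -(int_frac R) -(dot_vzvz oa hd de).
    exact: (dual_int dM).
  - move=> k h; apply/asboolP; rewrite dM => x hx.
    have hx' u : dot x (a u) \is a Num.int by apply: (dual_int dM).
    rewrite -(vz_floor oa hx') (dot_vzvz oa hd de) int_frac; apply: h.
    by apply/asboolP; rewrite vz_floor.
  - move=> k /asboolP hk; have := ev_even hM hk; rewrite /even_norm (dot_vzvz oa hd de).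
    move=> /intrP[t ht]; apply/dvdzP; exists t; apply/eqP; rewrite -(eqr_int R) rmorphM /= -ht -muln2 PoszM rmorphM /=.
    rewrite -pmulrn; have : (D'.+1%:R : R) != 0 by rewrite pnatr_eq0.
    by have -> : (2%:Z)%:~R = 2 :> R by []; move: (D'.+1%:R : R) => u u0; apply/eqP; field; rewrite u0.
have [B0 hB0] := bound_exists a (shell_finite 2 hM).
pose B := maxn N B0.
have := hN B (leq_maxl _ _); rewrite /c1 => h.
pose s := [seq vz a (bv b) | b : box 24 B].
have us : uniq s.
  rewrite map_inj_uniq ?enum_uniq // => b c hbc; apply/ffunP => k; apply: val_inj.
  have := dot_vz oa (bv b) k; rewrite hbc dot_vz // => /eqP; rewrite eqr_int /bv => /eqP /= E.
  by move: (addIr _ E) => -[].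
have xs x : shell M 2 x -> x \in s.
  move=> hx; have hi k : dot x (a k) \is a Num.int by apply: (dual_int dM) => //; exact: hx.1.
  have hb k : `|Num.floor (dot x (a k))| <= B%:Z.
    have := hB0 _ hx k; rewrite -{1}(floorK (hi k)) -intr_norm pmulrn ler_int => h1.
    by apply: le_trans h1 _; rewrite lez_nat leq_maxr.
  apply/mapP; exists [ffun k => inord `|(Num.floor (dot x (a k)) + B%:Z)%R|%N]; first by rewrite mem_enum.
  rewrite -[LHS](vz_floor oa hi); congr vz; apply: funext => k; rewrite /bv ffunE inordK; have := hb k; lia.
rewrite (fsumE _ us xs) big_map -big_mkcond /= big_enum_cond /=.
transitivity (((0:int)%:~R : R)); last by [].
rewrite -h rmorph_sum; apply: eq_big => [b|b _]; last by rewrite !dot_vz // rmorphM.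
rewrite /= /shell /=; apply/asboolP/andP => -[h1 h2]; split.
- exact/asboolP.
- move: h2; rewrite (dot_vzvz oa hd de) => h2; rewrite -(eqr_int R) -muln2 PoszM rmorphM /= -pmulrn.
  by rewrite -(divfK (_ : D'.+1%:R != 0) (pr e (bv b) (bv b))%:~R) ?pnatr_eq0 // h2 mulrC.
- exact/asboolP.
by rewrite (dot_vzvz oa hd de) (eqP h2) -muln2 PoszM rmorphM /= -pmulrn mulrAC divff ?mul1r // pnatr_eq0.
Qed.

(** The moment form [t] is diagonal in every orthogonal frame contained in [M]. Replacing [a i],
    [a j] by [a i + a j] and [|a j|^2 a i - |a i|^2 a j] gives another such frame, and the vanishing
    of [t] on the new pair says that [t (a i) (a i) / |a i|^2] does not depend on [i]. *)
Lemma moment_scalar (M : set vec) : evsd M -> exists c : R, forall u w,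
  \sum_(x \in shell M 2) dot x u * dot x w = c * dot u w.
Proof.
move=> hM; have [a oa ha] := ev_frame hM; have gM := ev_grp hM.
have fin := shell_finite 2 hM.
have [s us xs] := fin_seq fin.
pose t u w : R := \sum_(x <- s) dot x u * dot x w.
have tE u w : \sum_(x \in shell M 2) dot x u * dot x w = t u w by exact: fsum_seq.
have tC u w : t u w = t w u by apply: eq_bigr => x _; rewrite mulrC.
have tD u v w : t u (v + w) = t u v + t u w by rewrite /t -big_split; apply: eq_bigr => x _; rewrite dotDr mulrDr.
have tZ c u v : t u (c *: v) = c * t u v by rewrite /t mulr_sumr; apply: eq_bigr => x _; rewrite dotZr mulrCA.
have tB u v w : t u (v - w) = t u v - t u w by rewrite tD -scaleN1r tZ mulN1r.
have t0 i j : i != j -> t (a i) (a j) = 0 by move=> ij; rewrite -tE; exact: core_orth ij.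
have td i j : i != j -> dot (a j) (a j) * t (a i) (a i) = dot (a i) (a i) * t (a j) (a j).
  move=> ij; pose b k := if k == i then a i + a j else if k == j then dot (a j) (a j) *: a i - dot (a i) (a i) *: a j else a k.
  have ji : j == i = false by rewrite eq_sym (negbTE ij).
  have dij := oa.2 _ _ ij; have dji : dot (a j) (a i) = 0 by rewrite dotC.
  have pi_ := fn_gt0 oa i; have pj := fn_gt0 oa j.
  have ob : orthf b.
    have bij : dot (a i + a j) (dot (a j) (a j) *: a i - dot (a i) (a i) *: a j) = 0.
      by rewrite !(dotDl, dotBr, dotZr) dij dji; ring.
    have bk k : k != i -> k != j -> dot (a i + a j) (a k) = 0 /\ dot (dot (a j) (a j) *: a i - dot (a i) (a i) *: a j) (a k) = 0.
      move=> ki kj; rewrite eq_sym in ki; rewrite eq_sym in kj.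
      by rewrite !(dotDl, dotNl, dotZl) (oa.2 _ _ ki) (oa.2 _ _ kj) !mulr0 ?oppr0 !addr0.
    split=> [k|k l kl]; rewrite /b.
      have [_|ki] := eqVneq k i; last have [_|kj] := eqVneq k j; last exact: oa.1.
        apply/eqP => h; have := fn_gt0 oa i; have := dot0l (a i); rewrite -h dotDl dji addr0 => ->; by rewrite ltxx.
      apply/eqP => h; have := dot0l (a i); rewrite -h dotBl !dotZl dji mulr0 subr0 => /eqP.
      by rewrite mulf_eq0 !gt_eqF.
    have [ki|ki] := eqVneq k i; have [li|li] := eqVneq l i.
    - by rewrite ki li eqxx in kl.
    - by have [lj|lj] := eqVneq l j => //; exact: (bk l li lj).1.
    - by have [kj|kj] := eqVneq k j; rewrite dotC //; exact: (bk k ki kj).1.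
    have [kj|kj] := eqVneq k j; have [lj|lj] := eqVneq l j.
    - by rewrite kj lj eqxx in kl.
    - exact: (bk l li lj).2.
    - by rewrite dotC; exact: (bk k ki kj).2.
    exact: oa.2.
  have hb k : M (b k).
    rewrite /b; case: eqP => _; first exact: grpD.
    case: eqP => _ //; have [di hi] := norm_nat (ev_dual hM) (ha i); have [dj hj] := norm_nat (ev_dual hM) (ha j).
    by rewrite hi hj; apply: gM.2; exact: grpZn.
  have := core_orth hM ob hb ij; rewrite tE /b eqxx ji eqxx tB !tZ !(tC (a i + a j)) !tD (tC (a j) (a i)) (t0 _ _ ij).
  by move=> h; apply/eqP; rewrite -subr_eq0 -h; apply/eqP; ring.
exists (t (a ord0) (a ord0) / dot (a ord0) (a ord0)) => u w; rewrite tE.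
set c := _ / _.
have tii i : t (a i) (a i) = c * dot (a i) (a i).
  rewrite /c; have [->|i0] := eqVneq i ord0; first by rewrite divfK // fn_n0.
  by apply: (mulfI (fn_n0 oa ord0)); rewrite (td _ _ i0); field; exact: fn_n0.
have tu v i : t v (a i) = c * dot v (a i).
  rewrite {1}(frame_decomp oa v) tC.
  have -> : t (a i) (\sum_j (dot v (a j) / dot (a j) (a j)) *: a j) = \sum_j (dot v (a j) / dot (a j) (a j)) * t (a i) (a j).
    apply: (big_ind2 (fun x y => t (a i) x = y)) => [|x1 x2 y1 y2 <- <-|j _]; last by rewrite tZ.
      by rewrite -(scale0r 0) tZ mul0r.
    by rewrite tD.
  rewrite (bigD1 i) //= big1 ?addr0 => [|j ji]; last by rewrite t0 1?eq_sym // mulr0.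
  by rewrite tii; field; exact: fn_n0.
have -> : t u w = \sum_j (dot w (a j) / dot (a j) (a j)) * t u (a j).
  rewrite {1}(frame_decomp oa w).
  apply: (big_ind2 (fun x y => t u x = y)) => [|x1 x2 y1 y2 <- <-|j _]; last by rewrite tZ.
    by rewrite -(scale0r 0) tZ mul0r.
  by rewrite tD.
rewrite (frame_dot oa u w) mulr_sumr; apply: eq_bigr => j _; rewrite tu.
by rewrite (mulrC (dot u _)) -!mulrA (mulrC (dot u _)) !mulrA; ring.
Qed.
End CoreLattice.
End NormTwoMoments.

(** * Harmonic polynomials of degree 2 as quadratic forms of trace zero *)

Module HarmonicForms.
Require Import Defs.
From HB Require Import structures.
From mathcomp Require Import all_boot all_order all_algebra.
From mathcomp Require Import boolp classical_sets cardinality fsbigop reals.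
From mathcomp Require Import mpoly.
From mathcomp Require Import zify ring lra.
Import LatticePoisson CuspVanishing RealInstance LatticeBasics NormTwoMoments.
Set Implicit Arguments. Unset Strict Implicit. Unset Printing Implicit Defensive.
Import Order.TTheory GRing.Theory Num.Theory.
Local Open Scope classical_set_scope.
Local Open Scope ring_scope.

Section Harm.
Variables (R : realType) (n : nat).
Implicit Types (P : {mpoly R[n]}).

Definition qform (S : 'M[R]_n) (x : 'rV[R]_n) : R := \sum_k \sum_l S k l * (x 0 k * x 0 l).

Lemma mderiv_var i k : mderiv i ('X_k : {mpoly R[n]}) = ((k == i)%:R)%:MP.
Proof.
rewrite mderivX mnm1E; case: eqP => [->|_]; last by rewrite scale0r mpolyC0.
have -> : (U_(i) - U_(i))%MM = 0%MM by apply/mnmP => j; rewrite mnmBE subnn mnm0E.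
by rewrite scale1r mpolyX0 mpolyC1.
Qed.

Lemma mdeg2P (m : 'X_{1..n}) : mdeg m = 2%N -> exists k l, m = (U_(k) + U_(l))%MM.
Proof.
move=> hm; have /existsP[k hk] : [exists k, m k != 0%N].
  apply: contraT; rewrite negb_exists => /forallP h; move: hm; rewrite mdegE big1 // => i _.
  by apply/eqP; have := h i; rewrite negbK.
have E : m = (U_(k) + (m - U_(k)))%MM by rewrite addmC submK // lep1mP.
have /eqP/mdeg1P[l /eqP hl] : mdeg (m - U_(k)) = 1%N by have := hm; rewrite {1}E mdegD mdeg1; lia.
by exists k, l; rewrite -hl.
Qed.

(** By linearity it is enough to treat [X_k X_l], with a matrix unit as [S]; its Laplacian is 2 if
    [k = l] and 0 otherwise. [S] is not symmetrised, since the trace is all that is read off. *)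
Lemma homog2_form P : P \is 2.-homog -> exists2 S : 'M[R]_n,
  (forall x, peval P x = qform S x) & \sum_i mderiv i (mderiv i P) = (2 * \tr S)%:MP.
Proof.
move=> /dhomogP hP; rewrite [P]mpolyE big_seq.
apply: (big_ind (fun P => exists2 S : 'M[R]_n, (forall x, peval P x = qform S x) & \sum_i mderiv i (mderiv i P) = (2 * \tr S)%:MP)).
- exists 0 => [x|]; last by rewrite mxtrace0 mulr0 mpolyC0 big1 // => i _; rewrite !linear0.
  by rewrite /peval meval0 /qform big1 // => k _; rewrite big1 // => l _; rewrite mxE mul0r.
- move=> P1 P2 [S1 h1 l1] [S2 h2 l2]; exists (S1 + S2) => [x|].
    rewrite /peval mevalD -/(peval _ _) -/(peval _ _) h1 h2 /qform -big_split; apply: eq_bigr => k _.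
    by rewrite -big_split; apply: eq_bigr => l _; rewrite mxE mulrDl.
  by rewrite mxtraceD mulrDr mpolyCD -l1 -l2 -big_split; apply: eq_bigr => i _; rewrite !linearD.
move=> m hm; have [k [l E]] := mdeg2P (hP _ hm); move: (P@_m) => c.
rewrite E mpolyXD; exists (c *: delta_mx k l) => [x|].
  rewrite /peval mevalZ mevalM !mevalXU /qform (bigD1 k) //= (bigD1 l) //= !mxE !eqxx mulr1.
  rewrite big1 ?addr0 => [|j jl]; last by rewrite !mxE eqxx (negbTE jl) mulr0 mul0r.
  by rewrite big1 ?addr0 // => i ik; rewrite big1 // => j _; rewrite !mxE (negbTE ik) mulr0 mul0r.
have -> : \tr (c *: delta_mx k l : 'M[R]_n) = c * (k == l)%:R.
  rewrite mxtraceZ /mxtrace (bigD1 k) //= mxE eqxx /= big1 ?addr0 // => i ik.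
  by rewrite mxE (negbTE ik).
have E2 i : mderiv i (mderiv i (c *: ('X_k * 'X_l) : {mpoly R[n]})) = (c * (2 * (k == i)%:R * (l == i)%:R))%:MP.
  rewrite !mderivZ mderivM !mderiv_var !mul_mpolyC mulrC mul_mpolyC mderivD !mderivZ !mderiv_var.
  rewrite -!mul_mpolyC -!mpolyCM -mpolyCD -mpolyCM; congr (_%:MP); ring.
rewrite (eq_bigr _ (fun i _ => E2 i)) (bigD1 k) //= big1 => [|i ik].
  by rewrite addr0 eqxx (eq_sym l) mulr1 mulrCA.
by rewrite eq_sym (negbTE ik) mulr0 mul0r mulr0 mpolyC0.
Qed.

Lemma harmonic_form P : harmonic2 P -> exists2 S : 'M[R]_n, (forall x, peval P x = qform S x) & \tr S = 0.
Proof.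
move=> [h1 h2]; have [S hS hl] := homog2_form h1; exists S => //.
move: hl; rewrite h2 => /esym/eqP; rewrite -mpolyC0 mpolyC_eq => /eqP/eqP.
by rewrite mulf_eq0 pnatr_eq0 /= => /eqP.
Qed.

Lemma qform2 S x : qform S (2 *: x) = 4 * qform S x.
Proof.
rewrite /qform mulr_sumr; apply: eq_bigr => k _; rewrite mulr_sumr; apply: eq_bigr => l _; rewrite !mxE; ring.
Qed.
End Harm.

(** By [moment_scalar] the moment matrix is [c] times the identity, so the sum equals
    [c * \tr S]. *)
Lemma qform_core (R : realType) (S : 'M[R]_24) M : \tr S = 0 -> evsd M -> \sum_(x \in shell M 2) qform S x = 0.
Proof.
move=> hS hM; have [c hc] := moment_scalar hM.
have [s us xs] := fin_seq (shell_finite 2 hM).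
pose ee k : 'rV[R]_24 := delta_mx 0 k.
have de x k : dot x (ee k) = x 0 k.
  rewrite /dot (bigD1 k) //= big1 => [|i ik]; last by rewrite mxE (negbTE ik) andbF mulr0.
  by rewrite mxE !eqxx mulr1 addr0.
transitivity (c * \tr S); last by rewrite hS mulr0.
rewrite (fsum_seq _ us xs) /qform exchange_big /= /mxtrace mulr_sumr.
apply: eq_bigr => k _; rewrite exchange_big /= (bigD1 k) //= [X in _ + X]big1 ?addr0 => [|l lk].
  rewrite -mulr_sumr mulrC; congr (_ * _).
  have := hc (ee k) (ee k); rewrite (fsum_seq _ us xs) de mxE !eqxx mulr1 => <-.
  by apply: eq_bigr => x _; rewrite !de.
rewrite -mulr_sumr; have := hc (ee k) (ee l); rewrite (fsum_seq _ us xs) de mxE (negbTE lk) andbF mulr0 => h.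
suff -> : \sum_(x <- s) x 0 k * x 0 l = 0 by rewrite mulr0.
by apply: etrans h; apply: eq_bigr => x _; rewrite !de.
Qed.
End HarmonicForms.

(** * Kneser neighbours, and representatives of K modulo 2 N *)

Module Neighbours.
Require Import Defs.
From HB Require Import structures.
From mathcomp Require Import all_boot all_order all_algebra.
From mathcomp Require Import boolp classical_sets cardinality fsbigop reals.
From mathcomp Require Import zify ring lra.
Import LatticePoisson CuspVanishing RealInstance LatticeBasics NormTwoMoments.
Set Implicit Arguments. Unset Strict Implicit. Unset Printing Implicit Defensive.
Import Order.TTheory GRing.Theory Num.Theory.
Local Open Scope classical_set_scope.
Local Open Scope ring_scope.

Section Hecke.
Variables (R : realType) (n : nat).
Notation vec := 'rV[R]_n.
Notation isZ u := (u \is a Num.int).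
Implicit Types (x y z v w : vec) (M N K : set vec).


Lemma half_int (u : R) : isZ (2 * u) -> isZ u \/ isZ (u - 2^-1).
Proof.
move=> /intrP[k hk]; have E : u = k%:~R / 2 by rewrite -hk; field.
have [j [hj|hj]] : exists j : int, k = 2 * j \/ k = 2 * j + 1.
  exists (k %/ 2)%Z; have := divz_eq k 2; have := modz_ge0 k (isT : (2 : int) != 0); have := ltz_pmod k (isT : 0 < (2 : int)); lia.
  left; rewrite E hj rmorphM /= mulrC mulKf ?pnatr_eq0 //; exact: intr_int.
right; rewrite E hj rmorphD rmorphM /= (_ : _ - _ = j%:~R); first exact: intr_int.
by field.
Qed.

Lemma half_sub (u v : R) : isZ (2 * u) -> isZ (2 * v) -> ~~ isZ u -> ~~ isZ v -> isZ (u - v).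
Proof.
move=> /half_int[->//|h1] /half_int[->//|h2] _ _.
have -> : u - v = (u - 2^-1) - (v - 2^-1) by ring.
exact: rpredB.
Qed.

Lemma half_add (u v : R) : isZ (2 * u) -> isZ (2 * v) -> isZ (u + v) = (isZ u == isZ v).
Proof.
move=> hu hv; case: (boolP (isZ u)) => h1; case: (boolP (isZ v)) => h2.
- by rewrite rpredD.
- by apply: negbTE; apply: contra h2 => h; rewrite -(addKr u v) rpredD // rpredN.
- by apply: negbTE; apply: contra h1 => h; rewrite -(addrK v u) rpredB.
- by rewrite -(opprK v) half_sub // ?mulrN rpredN.
Qed.

(** Kneser's construction: the sublattice of [M] pairing integrally with [v] has index 2, because
    pairings with [v] are half-integers, and gluing its translate by [v] restores selfduality.
    Evenness is asked on the sublattice, so the lemma covers both even [M] and an odd [M] with [v]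
    in its shadow. *)
Lemma nbr_evsd M v : grp M -> M = dual M -> (exists2 a : 'I_n -> vec, orthf a & forall i, M (a i)) ->
  M (2 *: v) -> ~ M v -> even_norm v -> (forall x, M x -> isZ (dot x v) -> even_norm x) ->
  evsd [set x | (M x /\ isZ (dot x v)) \/ (M (x - v) /\ isZ (dot (x - v) v))].
Proof.
move=> gM dM [a oa ha] M2v Mv ev hev; rewrite /even_norm in ev hev.
have iM x y : M x -> M y -> isZ (dot x y) by exact: dual_int.
have vv : isZ (dot v v).
  have -> : dot v v = 2 * (dot v v / 2) by field.
  by apply: rpredM => //; exact: rpred_nat.
have i2 x : M x -> isZ (2 * dot x v) by move=> hx; rewrite -dotZr; exact: iM.
split.
- split=> [|x y]; first by left; rewrite dot0l; split=> //; exact: gM.1.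
  have tr (p q : vec) : M p -> isZ (dot p v) -> M q -> isZ (dot q v) -> M (p - q) /\ isZ (dot (p - q) v).
    by move=> ????; rewrite dotBl rpredB //; split => //; exact: gM.2.
  move=> [[hx ix]|[hx ix]] [[hy iy]|[hy iy]].
  + left; exact: tr.
  + right; have [h1 h2] := tr _ _ hx ix hy iy.
    have -> : x - y - v = (x - (y - v)) - 2 *: v by apply/rowP => i; rewrite !mxE; ring.
    by apply: tr => //; rewrite dotZl rpredM ?rpred_nat.
  + right; have -> : x - y - v = (x - v) - y by apply/rowP => i; rewrite !mxE; ring.
    exact: tr.
  + left; have -> : x - y = (x - v) - (y - v) by apply/rowP => i; rewrite !mxE; ring.
    exact: tr.
- apply/seteqP; split=> y.
    have dc (p q : vec) : M p -> isZ (dot p v) -> M q -> isZ (dot q v) -> [/\ isZ (dot p q), isZ (dot p (q + v)) & isZ (dot (p + v) (q + v))].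
      move=> hp ip hq iq; have h := iM _ _ hp hq; split=> //; first by rewrite dotDr rpredD.
      by rewrite dotDl !dotDr (dotC v q) !rpredD.
    move=> [[hy iy]|[hy iy]] x [[hx ix]|[hx ix]].
    + by have [] := dc _ _ hx ix hy iy.
    + by have [_] := dc _ _ hy iy hx ix; rewrite subrK dotC.
    + by have [_] := dc _ _ hx ix hy iy; rewrite subrK.
    + by have [_ _] := dc _ _ hx ix hy iy; rewrite !subrK.
  move=> hy; have yv : isZ (dot v y) by apply: hy; right; rewrite subrr dot0l; split=> //; exact: gM.1.
  have yK x : M x -> isZ (dot x v) -> isZ (dot x y) by move=> hx ix; apply: hy; left.
  (* [z0] represents the nontrivial coset of the sublattice. By [half_sub], membership in [M] can be
     tested on the sublattice and [z0], which is [key]; then either [y] or [y - v] passes the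
     test. *)
  have [z0 [hz0 iz0]] : exists z0, M z0 /\ ~~ isZ (dot z0 v).
    apply: contrapT => h; apply: Mv; rewrite dM => x hx; apply: contrapT => /negP hi; apply: h; by exists x.
  have key w : (forall x, M x -> isZ (dot x v) -> isZ (dot x w)) -> isZ (dot z0 w) -> M w.
    move=> hw hz; rewrite dM => x hx; case: (boolP (isZ (dot x v))) => ix; first exact: hw.
    have := hw (x - z0) (gM.2 _ _ hx hz0); rewrite dotBl half_sub ?i2 // => /(_ isT); rewrite dotBl => h.
    by rewrite -(subrK (dot z0 w) (dot x w)) rpredD.
  have z2 : isZ (2 * dot z0 y).
    by rewrite -dotZl; apply: yK; [exact: (grpZn 2)|rewrite dotZl; exact: i2].
  case: (boolP (isZ (dot z0 y))) => hz.
    by left; rewrite dotC; split=> //; exact: key.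
  right; rewrite dotBl dotC rpredB //; split=> //; apply: key => [x hx ix|].
    by rewrite dotBr rpredB // yK.
  by rewrite dotBr half_sub // i2.
- move=> x [[hx ix]|[hx ix]]; first exact: hev.
  have h := hev _ hx ix; rewrite /even_norm -(subrK v x); move: (x - v) h ix hx => y h ix hx.
  rewrite dotDl !dotDr (dotC v y) (_ : _ / 2 = dot y y / 2 + dot y v + dot v v / 2); last by field.
  by rewrite !rpredD.
exists (fun i => 2 *: a i) => [|i].
  split=> [i|i j ij]; last by rewrite dotZl dotZr (oa.2 _ _ ij) !mulr0.
  by rewrite scaler_eq0 pnatr_eq0 /= oa.1.
by left; rewrite dotZl i2 //; split=> //; exact: (grpZn 2).
Qed.

(** The list consists of the points of [K] in a fundamental box for the vectors [2 e_i a_i], which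
    lie in [2 N]. Classes modulo [2 N] may be repeated; what the sums below require is translation
    invariance for functions periodic modulo [2 N]. *)
Lemma reps N K : evsd N -> grp K -> K `<=` N -> (forall x, N x -> K (2 *: x)) ->
  exists s : seq vec, [/\ forall v, v \in s -> K v, 0 \in s &
    forall (F : vec -> R) w, K w -> (forall v z, K v -> N z -> F (v + 2 *: z) = F v) ->
      \sum_(v <- s) F v = \sum_(v <- s) F (v + w)].
Proof.
move=> hN gK KN K2; have [a oa ha] : exists2 a : 'I_n -> vec, orthf a & forall i, K (a i).
  have [a oa ha] := ev_frame hN; exists (fun i => 2 *: a i) => [|i]; last exact: K2.
  split=> [i|i j ij]; last by rewrite dotZl dotZr (oa.2 _ _ ij) !mulr0.
  by rewrite scaler_eq0 pnatr_eq0 /= oa.1.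
have [d hd] := boolp.choice (fun i => norm_nat (ev_dual hN) (KN _ (ha i))).
have d0 k : (0 < d k)%N by have := fn_gt0 oa k; rewrite hd ltr0n.
pose e k := (\prod_(l | l != k) d l)%N.
have P0 : (0 < 2 * \prod_k d k)%N by rewrite muln_gt0 /=; apply: prodn_gt0.
have [D' de] : exists D', forall k, (d k * e k * 2 = D'.+1)%N.
  by exists (2 * \prod_k d k).-1 => k; rewrite prednK // (bigD1 k) //= mulnC.
pose s := [seq vz a (cv c) | c <- enum {: cidx n D'} & `[< K (vz a (cv c)) >]].
exists s; split.
- by move=> v /mapP[c]; rewrite mem_filter => /andP[/asboolP h _] ->.
- apply/mapP; exists [ffun=> ord0]; last first.
    by rewrite /vz big1 // => i _; rewrite /cv ffunE mul0r scale0r.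
  rewrite mem_filter mem_enum andbT; apply/asboolP.
  by rewrite /vz big1 => [|i _]; [exact: gK.1|rewrite /cv ffunE mul0r scale0r].
move=> F w hw Fi.
have hwi i : isZ (dot w (a i)) by apply: (dual_int (ev_dual hN)); apply: KN.
pose g i := Num.floor (dot w (a i)).
have hg : vz a g = w by apply: vz_floor.
have sh (c : cidx n D') : exists2 z, N z & vz a (cv (cshift g c)) + 2 *: z = vz a (cv c) + w.
  pose t i := ((cv c i + g i) %/ D'.+1%:Z)%Z.
  exists (\sum_i (t i * (e i)%:Z)%:~R *: a i).
    by apply: (grp_sum _ (ev_grp hN)) => i; apply: (grpZ _ (ev_grp hN)); apply: KN.
  rewrite -hg /vz scaler_sumr -!big_split; apply: eq_bigr => i _ /=.
  rewrite scalerA -!scalerDl; congr (_ *: _).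
  have := divz_eq (cv c i + g i) D'.+1%:Z; rewrite -/(t i) cv_rz.
  move: (modz _ _) => m; move: (t i) => ti E.
  have ER : (cv c i)%:~R + (g i)%:~R = ti%:~R * ((d i)%:R * (e i)%:R * 2) + m%:~R :> R.
    by rewrite -rmorphD /= E -(de i) !PoszM rmorphD !rmorphM.
  rewrite -[RHS]mulrDl ER hd rmorphM /= -!pmulrn.
  have : (d i)%:R != 0 :> R by rewrite pnatr_eq0 -lt0n.
  by move: (d i)%:R => u u0; field; rewrite ?u0.
have Ks (c : cidx n D') : `[< K (vz a (cv (cshift g c))) >] = `[< K (vz a (cv c)) >].
  have [z hz E] := sh c; apply/asboolP/asboolP => h.
    rewrite -(addrK w (vz a (cv c))) -E; apply: gK.2 => //; apply: grpD => //; exact: K2.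
  rewrite -(addrK (2 *: z) (vz a (cv (cshift g c)))) E; apply: gK.2; [exact: grpD|exact: K2].
rewrite /s !big_map !big_filter !big_enum_cond /= (reindex _ (onW_bij _ (@cshift_bij n D' g))) /=.
apply: eq_big => [c|c hc]; first by rewrite Ks.
have [z hz <-] := sh c; rewrite Fi //; exact/asboolP.
Qed.
End Hecke.
End Neighbours.

(** * From norm m to norm 4 m by averaging over neighbours *)

Module HeckeStep.
Require Import Defs.
From HB Require Import structures.
From mathcomp Require Import all_boot all_order all_algebra.
From mathcomp Require Import boolp classical_sets cardinality fsbigop reals.
From mathcomp Require Import zify ring lra.
Import LatticePoisson CuspVanishing RealInstance LatticeBasics NormTwoMoments Neighbours.
Set Implicit Arguments. Unset Strict Implicit. Unset Printing Implicit Defensive.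
Import Order.TTheory GRing.Theory Num.Theory.
Local Open Scope classical_set_scope.
Local Open Scope ring_scope.

Section Step.
Variables (R : realType) (n : nat).
Notation vec := 'rV[R]_n.
Notation isZ u := (u \is a Num.int).
Implicit Types (x y z v w : vec) (M N K : set vec).
Variable q : vec -> R.
Hypothesis q2 : forall x, q (2 *: x) = 4 * q x.
Definition fsh (X : set vec) m : R := \sum_(x \in shell X m) q x.
Definition ind (P : Prop) : R := (`[< P >])%:R.
(** For an integer [t] this is [(-1)^t]; it is used as a character on lattices. *)
Definition sg (t : R) : R := if isZ (t / 2) then 1 else -1.

Lemma indT (P : Prop) : P -> ind P = 1. Proof. by move=> h; rewrite /ind asboolT. Qed.
Lemma indF (P : Prop) : ~ P -> ind P = 0. Proof. by move=> h; rewrite /ind asboolF. Qed.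
Lemma ind_ext (P Q : Prop) : (P <-> Q) -> ind P = ind Q. Proof. by move=> /propext ->. Qed.

Lemma sgD (s t : R) : isZ s -> isZ t -> sg (s + t) = sg s * sg t.
Proof.
move=> hs ht; rewrite /sg mulrDl half_add; last 2 first.
- by rewrite mulrC divfK // pnatr_eq0.
- by rewrite mulrC divfK // pnatr_eq0.
by case: (isZ _); case: (isZ _); rewrite /= ?mulr1 ?mul1r ?mulrNN ?mulr1.
Qed.
Lemma sg_even (t : R) : isZ (t / 2) -> sg t = 1. Proof. by rewrite /sg => ->. Qed.
Lemma sg_odd (t : R) : ~~ isZ (t / 2) -> sg t = -1. Proof. by rewrite /sg => /negbTE ->. Qed.
Lemma sg_ind (t : R) : 1 + sg t = 2 * ind (isZ (t / 2)).
Proof. by rewrite /sg /ind; case: ifP => h; [rewrite asboolT|rewrite asboolF ?h]; rewrite ?mulr1 ?mulr0 ?subrr. Qed.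

(** Halving moves the shell of norm [4 m] to norm [m], where the halved vectors lie in [N] or in its
    neighbours. *)
Lemma fsh_double K m : fsh K (4 * m) = 4 * fsh [set x | K (2 *: x)] m.
Proof.
rewrite /fsh; have -> : shell K (4 * m) = (fun x => 2 *: x) @` shell [set x | K (2 *: x)] m.
  apply/seteqP; split=> [x [hx hm]|_ [x [/= hx <-] <-]]; last first.
    by split=> //; rewrite dotZl dotZr; ring.
  exists (2^-1 *: x); last by rewrite scalerA divff ?scale1r // pnatr_eq0.
  split; first by rewrite /= scalerA divff ?scale1r // pnatr_eq0.
  by rewrite dotZl dotZr hm; field.
have inj2 : injective (fun x : vec => 2 *: x).
  by move=> x y /(congr1 (fun y => 2^-1 *: y)); rewrite /= !scalerA mulVf ?pnatr_eq0 // !scale1r.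
rewrite fsbig_image; last by move=> x y _ _; exact: inj2.
rewrite mulr_fsumr //; apply: eq_fsbigr => x _; exact: q2.
Qed.

Section OneStep.
Variables (N K : set vec) (m : R).
Hypotheses (hN : evsd N) (gK : grp K) (KN : K `<=` N) (K2 : forall x, N x -> K (2 *: x)).
Hypothesis em : isZ (m / 2).
Hypothesis Hall : forall M, evsd M -> fsh M m = 0.
Hypothesis Hw : forall x, N x -> ~ K x -> exists2 w, K w &
  ~~ isZ (dot x w / 2) /\ forall v, K v -> isZ ((dot v w + dot w w / 2) / 2).
Hypothesis H1 : fsh K m = 0.
Hypothesis H2 : fsh [set x | N x /\ dual K (2^-1 *: x)] m = 0.

Let iN x y : N x -> N y -> isZ (dot x y). Proof. exact: (dual_int (ev_dual hN)). Qed.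
Let eN x : N x -> isZ (dot x x / 2). Proof. exact: (ev_even hN). Qed.
Let gN := ev_grp hN.
Let hh x : 2 *: (2^-1 *: x) = x. Proof. by rewrite scalerA divff ?scale1r // pnatr_eq0. Qed.
Let hh' x : 2^-1 *: (2 *: x) = x. Proof. by rewrite scalerA mulVf ?scale1r // pnatr_eq0. Qed.

(** The neighbour of [N] at [v / 2]. With the second part expressed by the parity of the norm, the
    set depends on [v] only modulo [2 N]. *)
Definition nb v : set vec := [set x | (N x /\ isZ (dot x v / 2)) \/ (N (x - 2^-1 *: v) /\ even_norm x)].

(** [nbr_evsd] wants [v / 2] of even norm, that is [(v, v)] divisible by 8. If it is divisible by 4
    only, adding [2 z] with [(v, z)] odd corrects this; such a [z] exists because [v / 2] is not in
    the dual of [N]. *)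
Lemma nb_evsd v : N v -> ~ N (2^-1 *: v) -> isZ (dot v v / 4) -> evsd (nb v).
Proof.
move=> hv hv2 h4.
have [z0 hz0 iz0] : exists2 z0, N z0 & ~~ isZ (dot v z0 / 2).
  apply: contrapT => h; apply: hv2; rewrite (ev_dual hN) => x hx; apply: contrapT => /negP hi; apply: h.
  by exists x => //; rewrite dotC mulrC -dotZr.
have [z hz h8] : exists2 z, N z & isZ (dot (v + 2 *: z) (v + 2 *: z) / 8).
  have i1 : isZ (2 * (dot v v / 8)) by rewrite (_ : _ * _ = dot v v / 4) //; field.
  have i2 : isZ (2 * (dot v z0 / 2)) by rewrite (_ : _ * _ = dot v z0); [exact: iN|field].
  have E z : dot (v + 2 *: z) (v + 2 *: z) / 8 = dot v v / 8 + dot v z / 2 + dot z z / 2.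
    by rewrite dotDl !dotDr !(dotZl, dotZr) (dotC z v); field.
  case: (boolP (isZ (dot v v / 8))) => h8.
    by exists 0; [exact: gN.1|rewrite scaler0 addr0].
  exists z0 => //; rewrite E rpredD ?eN // half_add //.
  by rewrite (negbTE h8) (negbTE iz0).
pose u := 2^-1 *: (v + 2 *: z).
have uE : u = 2^-1 *: v + z by rewrite /u scalerDr hh'.
have du x : dot x u = dot x v / 2 + dot x z by rewrite uE dotDr dotZr mulrC.
have vN : N (v + 2 *: z) by apply: grpD => //; exact: (grpZn 2).
have Nu : ~ N u by move=> h; apply: hv2; rewrite -(addrK z (2^-1 *: v)) -uE; exact: gN.2.
have eu : even_norm u by rewrite /even_norm dotZl dotZr (_ : _ / 2 = dot (v + 2 *: z) (v + 2 *: z) / 8) //; field.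
have idu x : N x -> isZ (dot x u) = isZ (dot x v / 2).
  move=> hx; rewrite du; apply/idP/idP => h; last by rewrite rpredD // iN.
  by rewrite -(addrK (dot x z) (dot x v / 2)) rpredB // iN.
have -> : nb v = [set x | (N x /\ isZ (dot x u)) \/ (N (x - u) /\ isZ (dot (x - u) u))].
  apply/seteqP; split=> x.
    move=> [[hx ix]|[hx ix]]; first by left; rewrite idu.
    right; have hxu : N (x - u).
      by rewrite uE opprD addrA; exact: gN.2.
    split=> //; have := ix; rewrite /even_norm -{1 2}(subrK u x); move: (x - u) hxu => y hy.
    rewrite dotDl !dotDr (dotC u y) (_ : _ / 2 = dot y u + (dot y y / 2 + dot u u / 2)); last by field.
    move=> h; rewrite -(addrK (dot y y / 2 + dot u u / 2) (dot y u)); apply: rpredB => //; apply: rpredD => //; exact: eN.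
  move=> [[hx ix]|[hx ix]]; first by left; rewrite -(idu _ hx).
  right; split.
    have -> : x - 2^-1 *: v = (x - u) + z by rewrite uE opprD addrA subrK.
    exact: grpD.
  rewrite /even_norm -(subrK u x); move: (x - u) hx ix => y hy iy.
  rewrite dotDl !dotDr (dotC u y) (_ : _ / 2 = dot y u + (dot y y / 2 + dot u u / 2)); last by field.
  by apply: rpredD => //; apply: rpredD => //; exact: eN.
by apply: nbr_evsd => //; [exact: ev_dual|exact: ev_frame|rewrite /u hh|move=> x hx _; exact: ev_even hx].
Qed.

(** Sum over all [v] in [I] with [(v, v)] divisible by 4: each lattice, [N] or [nb v], contributes 0
    at norm [m]. An [x] outside [N] with [2 x] in [K] is counted [kap] times. The multiplicity of an
    [x] in [N] is a combination of Gauss sums over [K] modulo [2 N], which depends only on whether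
    [x] lies in [K] and in twice the dual of [K]. The sums over [N], [K] and the third set vanish by
    hypothesis, and the sum over [2 x] in [K] remains. *)
Lemma hecke_step : fsh K (4 * m) = 0.
Proof.
rewrite fsh_double.
have [I [IK I0 Ish]] := reps hN gK KN K2.
have [a oa ha] := ev_frame hN.
have fU : finite_set [set x | N (2 *: x) /\ dot x x = m].
  have ob : orthf (fun i => 2 *: a i).
    split=> [i|i j ij]; last by rewrite dotZl dotZr (oa.2 _ _ ij) !mulr0.
    by rewrite scaler_eq0 pnatr_eq0 /= oa.1.
  apply: (finite_frame (m := m) ob) => x [hx hm]; split=> // i.
  by rewrite dotZr -dotZl; exact: iN.
have [U uU hU] := fin_seq fU.
have fE (Y : set vec) : (forall x, Y x -> N (2 *: x)) -> fsh Y m = \sum_(x <- U) ind (Y x) * q x.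
  move=> hY; rewrite /fsh (fsumE _ uU) => [|x [hx hm]]; last by apply/hU; split=> //; exact: hY.
  apply: eq_big_seq => x /hU[_ hm]; case: asboolP => [[h _]|h]; first by rewrite indT ?mul1r.
  by rewrite indF ?mul0r // => hx; apply: h.
have N2 x : N x -> N (2 *: x) by move=> hx; exact: (grpZn 2).
have fN : \sum_(x <- U) ind (N x) * q x = 0 by rewrite -fE // Hall.
have fK : \sum_(x <- U) ind (K x) * q x = 0 by rewrite -fE // => x /KN; exact: N2.
have fD : \sum_(x <- U) ind (N x /\ dual K (2^-1 *: x)) * q x = 0.
  by rewrite -(fE [set x | N x /\ dual K (2^-1 *: x)]) // => x [/N2].
(* How often the zero class modulo [2 N] is repeated in [I]. *)
pose kap : R := \sum_(v <- I) ind (N (2^-1 *: v)).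
pose c4 v := ind (isZ (dot v v / 4)).
have T v : v \in I -> c4 v * \sum_(x <- U) (ind (N x) * ind (isZ (dot x v / 2)) + ind (~ N (2^-1 *: v)) * ind (N (x - 2^-1 *: v))) * q x = 0.
  move=> /IK hv; rewrite /c4; have [h4|h4] := boolP (isZ (dot v v / 4)); last by rewrite indF ?mul0r //; apply/negP.
  rewrite indT // mul1r; have [h2|h2] := pselect (N (2^-1 *: v)).
    rewrite -[RHS]fN; apply: eq_bigr => x _; rewrite (indF (P := ~ _)) ?mul0r ?addr0; last by apply.
    have [hx|hx] := pselect (N x); last by rewrite indF // !mul0r.
    by rewrite (indT hx) (indT (P := isZ _)) ?mulr1 // mulrC -dotZr iN.
  rewrite -[RHS](Hall (nb_evsd (KN hv) h2 h4)) fE; last first.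
    move=> x [[hx _]|[hx _]]; first exact: N2.
    rewrite -(subrK v (2 *: x)); apply: grpD => //; last exact: KN.
    by rewrite -{1}(hh v) -scalerBr; exact: N2.
  apply: eq_big_seq => x /hU[_ hm]; congr (_ * _); rewrite (indT h2) mul1r.
  have ex : even_norm x by rewrite /even_norm hm.
  have [hx|hx] := pselect (N x).
    rewrite (indT hx) mul1r (indF (P := N (x - _))) ?addr0; last first.
      by move=> h; apply: h2; rewrite -(subKr x (2^-1 *: v)); exact: gN.2.
    apply: ind_ext; split=> [h|[[]//|[h _]]]; first by left.
    by case: h2; rewrite -(subKr x (2^-1 *: v)); exact: gN.2.
  rewrite (indF hx) mul0r add0r; apply: ind_ext; split=> [h|[[]//|[]//]]; by right.
have S1 : \sum_(x <- U) (ind (N x) * (\sum_(v <- I) c4 v * ind (isZ (dot x v / 2))) +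
    \sum_(v <- I) c4 v * ind (~ N (2^-1 *: v)) * ind (N (x - 2^-1 *: v))) * q x = 0.
  have : \sum_(v <- I) c4 v * \sum_(x <- U) (ind (N x) * ind (isZ (dot x v / 2)) + ind (~ N (2^-1 *: v)) * ind (N (x - 2^-1 *: v))) * q x = 0.
    by rewrite big_seq big1.
  under eq_bigr do rewrite mulr_sumr.
  rewrite exchange_big /= => E; rewrite -[RHS]E; apply: eq_bigr => x _.
  rewrite mulr_sumr -big_split /= mulr_suml; apply: eq_bigr => v _; ring.
(* If [x - v / 2] is in [N], then [(v, v)] is divisible by 4 because [m] is even, so the factor [c4]
   disappears. Translation by [2 x] identifies the remaining count with [kap]. *)
have inner2 x : x \in U -> \sum_(v <- I) c4 v * ind (~ N (2^-1 *: v)) * ind (N (x - 2^-1 *: v)) = kap * (ind (K (2 *: x)) - ind (N x)).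
  move=> /hU[h2x hm].
  have E : \sum_(v <- I) c4 v * ind (~ N (2^-1 *: v)) * ind (N (x - 2^-1 *: v)) = \sum_(v <- I) ind (~ N x) * ind (N (x - 2^-1 *: v)).
    apply: eq_big_seq => v /IK hv; have [h|h] := pselect (N (x - 2^-1 *: v)); last by rewrite (indF h) !mulr0.
    rewrite (indT h) !mulr1 /c4 indT ?mul1r; last first.
      have -> : v = 2 *: x - 2 *: (x - 2^-1 *: v) by rewrite scalerBr hh subKr.
      move: (x - _) h => z h; rewrite dotBl !dotBr !(dotZl, dotZr) (dotC z x).
      rewrite (_ : _ / 4 = 2 * (m / 2) - dot (2 *: x) z + 2 * (dot z z / 2)); last by rewrite dotZl hm; field.
      by apply: rpredD; [apply: rpredB; [apply: rpredM => //; exact: rpred_nat|exact: iN]|apply: rpredM; [exact: rpred_nat|exact: eN]].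
    apply: ind_ext; split=> h1 h3; apply: h1.
      by rewrite -(subKr x (2^-1 *: v)); exact: gN.2.
    by rewrite -(subrK (2^-1 *: v) x); exact: grpD.
  rewrite {}E -mulr_sumr; have [hK|hK] := pselect (K (2 *: x)); last first.
    rewrite (indF hK) (indF (P := N x)) => [|/K2//].
    rewrite big_seq big1 ?mulr0 ?subrr ?mulr0 // => v /IK hv; apply: indF => h; apply: hK.
    have -> : 2 *: x = 2 *: (x - 2^-1 *: v) + v by rewrite scalerBr hh subrK.
    by apply: grpD => //; exact: K2.
  rewrite (indT hK) (Ish _ (2 *: x)) //; last first.
    move=> v z hv hz; apply: ind_ext; rewrite scalerDr hh' opprD addrA; split=> h; last exact: gN.2.
    by rewrite -(subrK z (_ - _)); exact: grpD.
  have -> : \sum_(v <- I) ind (N (x - 2^-1 *: (v + 2 *: x))) = kap.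
    apply: eq_bigr => v _; apply: ind_ext; rewrite scalerDr hh' opprD addrCA subrr addr0.
    by split=> h; [rewrite -[2^-1 *: v]opprK|]; exact: grpN.
  have [h|h] := pselect (N x); first by rewrite (indT h) indF ?subrr ?mul0r ?mulr0 //; apply.
  by rewrite (indF h) (indT h) subr0 mulr1 mul1r.
pose cI : R := \sum_(v <- I) 1.
pose G0 : R := \sum_(v <- I) sg (dot v v / 2).
(* Written with signs, [4 * c4 v * ind] is [(1 + sg ((v, v) / 2)) (1 + sg (x, v))]. Its expansion
   gives a count, a Gauss sum, a character sum and a shifted Gauss sum. *)
have inner1 x : x \in U -> N x -> 4 * (\sum_(v <- I) c4 v * ind (isZ (dot x v / 2))) =
   cI + G0 + cI * ind (N x /\ dual K (2^-1 *: x)) + sg (m / 2) * G0 * ind (K x).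
  move=> /hU[h2x hm] hx.
  have -> : 4 * (\sum_(v <- I) c4 v * ind (isZ (dot x v / 2))) = \sum_(v <- I) (1 + sg (dot v v / 2) + sg (dot x v) + sg (dot v v / 2 + dot x v)).
    rewrite mulr_sumr; apply: eq_big_seq => v /IK hv.
    rewrite sgD ?eN ?iN //; try exact: KN.
    have -> : 1 + sg (dot v v / 2) + sg (dot x v) + sg (dot v v / 2) * sg (dot x v) = (1 + sg (dot v v / 2)) * (1 + sg (dot x v)) by ring.
    rewrite !sg_ind (_ : dot v v / 2 / 2 = dot v v / 4); last by field.
    by rewrite /c4; ring.
  rewrite !big_split /= -/G0 -/cI; congr (_ + _ + _).
  (* The character [v -> sg (x, v)] of [K] is trivial exactly if [x / 2] lies in the dual of [K];
     otherwise its sum is 0. *)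
  - have [h|h] := pselect (dual K (2^-1 *: x)).
      rewrite indT // mulr1; apply: eq_big_seq => v /IK hv.
      by rewrite sg_even // mulrC -dotZl dotC; exact: h.
    rewrite indF ?mulr0; last by case.
    have [w hw iw] : exists2 w, K w & ~~ isZ (dot x w / 2).
      apply: contrapT => h3; apply: h => w hw; apply: contrapT => /negP hi; apply: h3; exists w => //.
      by rewrite mulrC -dotZl dotC.
    have := Ish (fun v => sg (dot x v)) w hw => E.
    have {E} : \sum_(v <- I) sg (dot x v) = \sum_(v <- I) sg (dot x (v + w)).
      apply: E => v z hv hz; rewrite dotDr sgD ?iN //; [|exact: KN|exact: N2].
      by rewrite [X in _ * X]sg_even ?mulr1 // dotZr mulrC mulKf ?pnatr_eq0 // iN.
    have -> : \sum_(v <- I) sg (dot x (v + w)) = - \sum_(v <- I) sg (dot x v).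
      rewrite -sumrN; apply: eq_big_seq => v /IK hv; rewrite dotDr sgD ?iN //; try exact: KN.
      by rewrite (sg_odd iw) mulrN1.
    by move=> E; lra.
  (* For [x] in [K], completing the square by the translation [v -> v + x] gives [G0] up to sign.
     Otherwise [Hw] supplies a [w] that does not change [(v, v) / 2] modulo 2 but pairs oddly with
     [x], and translation by [w] reverses the sum. *)
  have [hK|hK] := pselect (K x).
    rewrite indT // mulr1.
    have -> : G0 = \sum_(v <- I) sg (dot (v + x) (v + x) / 2).
      apply: (Ish (fun v => sg (dot v v / 2))) => // v z hv hz.
      have -> : dot (v + 2 *: z) (v + 2 *: z) / 2 = dot v v / 2 + 2 * (dot v z + dot z z).
        by rewrite dotDl !dotDr !(dotZl, dotZr) (dotC z v); field.
      have iv : isZ (dot v z + dot z z) by have ? := KN hv; rewrite rpredD ?iN.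
      rewrite sgD ?eN //; [|exact: KN|by rewrite rpredM ?rpred_nat].
      by rewrite [X in _ * X]sg_even ?mulr1 // mulrC mulKf // pnatr_eq0.
    rewrite mulr_sumr; apply: eq_big_seq => v /IK hv.
    have -> : dot (v + x) (v + x) / 2 = (dot v v / 2 + dot x v) + m / 2.
      by rewrite -hm dotDl !dotDr (dotC v x); field.
    rewrite (sgD _ em); last by rewrite rpredD ?eN ?iN //; exact: KN.
    have s1 : sg (m / 2) * sg (m / 2) = 1 by rewrite -sgD // sg_even // (_ : _ / 2 = m / 2) //; field.
    by rewrite mulrCA s1 mulr1.
  rewrite indF // mulr0; have [w hw [iw ew]] := Hw hx hK.
  have E : \sum_(v <- I) sg (dot v v / 2 + dot x v) = \sum_(v <- I) sg (dot (v + w) (v + w) / 2 + dot x (v + w)).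
    apply: (Ish (fun v => sg (dot v v / 2 + dot x v))) => // v z hv hz.
    have -> : dot (v + 2 *: z) (v + 2 *: z) / 2 + dot x (v + 2 *: z) = dot v v / 2 + dot x v + 2 * (dot v z + dot z z + dot x z).
      by rewrite dotDl !dotDr !(dotZl, dotZr) (dotC z v); field.
    have iv : isZ (dot v z + dot z z + dot x z) by have ? := KN hv; rewrite !rpredD ?iN.
    rewrite sgD; [|by rewrite rpredD ?eN ?iN //; exact: KN|by rewrite rpredM ?rpred_nat].
    by rewrite [X in _ * X]sg_even ?mulr1 // mulrC mulKf // pnatr_eq0.
  have : \sum_(v <- I) sg (dot (v + w) (v + w) / 2 + dot x (v + w)) = - \sum_(v <- I) sg (dot v v / 2 + dot x v).
    rewrite -sumrN; apply: eq_big_seq => v /IK hv.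
    have -> : dot (v + w) (v + w) / 2 + dot x (v + w) = (dot v v / 2 + dot x v) + ((dot v w + dot w w / 2) + dot x w).
      by rewrite dotDl !dotDr (dotC w v); field.
    have ivw : isZ (dot v w + dot w w / 2) by rewrite rpredD ?eN ?iN //; exact: KN.
    have ixw : isZ (dot x w) by apply: iN => //; exact: KN.
    rewrite sgD ?rpredD // ?eN ?iN //; try exact: KN.
    by rewrite (sgD ivw ixw) (sg_even (ew _ hv)) (sg_odd iw) mul1r mulrN1.
  rewrite -E => E2; lra.
have {S1} S2 : kap * (\sum_(x <- U) ind (K (2 *: x)) * q x) = 0.
  clearbody cI G0; apply: (@mulfI _ (4 : R)); first by rewrite pnatr_eq0.
  rewrite mulr0; move/(congr1 (fun t => 4 * t)): S1; rewrite mulr0 mulr_sumr => S1; apply: etrans S1.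
  transitivity (\sum_(x <- U) (ind (N x) * q x * (cI + G0 - 4 * kap)) + \sum_(x <- U) cI * (ind (N x /\ dual K (2^-1 *: x)) * q x) +
      \sum_(x <- U) (sg (m / 2) * G0) * (ind (K x) * q x) + \sum_(x <- U) 4 * kap * (ind (K (2 *: x)) * q x)).
    by rewrite -mulr_suml -!mulr_sumr fN fK fD; ring.
  rewrite -!big_split /=; apply: eq_big_seq => x xU; rewrite inner2 //.
  have [hx|hx] := pselect (N x).
    have := inner1 x xU hx; move: (\sum_(v <- I) c4 v * _) => S4 E4.
    by transitivity ((4 * S4 + 4 * kap * (ind (K (2 *: x)) - 1)) * q x); [rewrite E4 (indT hx)|rewrite (indT hx)]; ring.
  rewrite (indF hx) !(indF (P := N x /\ _)) ?(indF (P := K x)) => [||[]//]; last by move/KN.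
  ring.
rewrite fE; last by move=> x /KN.
(* [0] belongs to [I], so [kap] is at least 1. *)
have : kap != 0.
  rewrite gt_eqF // /kap (big_rem 0) //= scaler0 indT; last exact: gN.1.
  by rewrite ltr_pwDl // sumr_ge0 // => v _; rewrite /ind ler0n.
by move=> k0; move/eqP: S2; rewrite mulf_eq0 (negbTE k0) /= => /eqP ->; rewrite mulr0.
Qed.
End OneStep.
End Step.
End HeckeStep.

(** * Part (i): even unimodular lattices, then the lattice and its shadow *)

Module ShadowDesigns.
Require Import Defs.
From HB Require Import structures.
From mathcomp Require Import all_boot all_order all_algebra.
From mathcomp Require Import boolp classical_sets cardinality fsbigop reals.
From mathcomp Require Import mpoly.
From mathcomp Require Import zify ring lra.
Import LatticePoisson CuspVanishing RealInstance LatticeBasics NormTwoMoments HarmonicForms Neighbours HeckeStep.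
Set Implicit Arguments. Unset Strict Implicit. Unset Printing Implicit Defensive.
Import Order.TTheory GRing.Theory Num.Theory.
Local Open Scope classical_set_scope.
Local Open Scope ring_scope.

Section LatticeFrame.
Variables (R : realType) (n : nat).
Notation vec := 'rV[R]_n.
Notation isZ u := (u \is a Num.int).

Lemma lattice_grp (L : set vec) : is_lattice L -> grp L.
Proof.
move=> [B [uB ->]]; split=> [|x y [c ->] [c' ->]].
  by exists 0; rewrite (_ : map_mx _ _ = 0) ?mul0mx //; apply/matrixP => i j; rewrite !mxE.
exists (c - c'); rewrite -mulmxBl; congr (_ *m _); apply/matrixP => i j; rewrite !mxE.
by rewrite rmorphB.
Qed.

(** Gram-Schmidt with cleared denominators: multiplying by the product [D] of the previous norms
    keeps the coefficients integral. The basis row is chosen with nonzero inner product with some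
    [u] orthogonal to the previous vectors, which makes the new vector nonzero. *)
Lemma lattice_frame (L : set vec) : is_lattice L -> integral L ->
  exists2 a : 'I_n -> vec, orthf a & forall i, L (a i).
Proof.
move=> lL iL; have gL := lattice_grp lL; case: lL => B [uB LE].
have hB i : L (row i B).
  rewrite LE; exists (delta_mx 0 i); rewrite (_ : map_mx _ _ = delta_mx 0 i) ?rowE //.
  by apply/matrixP => k l; rewrite !mxE; case: (_ && _).
suff /(_ n (leqnn n))[a [h1 h2]] : forall k, (k <= n)%N -> exists a : nat -> vec,
    (forall i, (i < k)%N -> L (a i) /\ a i != 0) /\ forall i j, (i < j < k)%N -> dot (a i) (a j) = 0.
  exists (fun i : 'I_n => a i); last by move=> i; case: (h1 i (ltn_ord i)).
  split=> [i|i j ij]; first by case: (h1 i (ltn_ord i)).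
  have : (i != j :> nat) by apply: contra_neq ij => /val_inj.
  rewrite neq_ltn => /orP[h|h]; first by apply: h2; rewrite h ltn_ord.
  by rewrite dotC; apply: h2; rewrite h ltn_ord.
elim=> [|k IH] kn; first by exists (fun=> 0); split=> // i j; rewrite ltn0 andbF.
have [a [h1 h2]] := IH (ltnW kn).
pose A : 'M[R]_(n, k) := \matrix_(i, j) a j 0 i.
have [u uA u0] : exists2 u : vec, u *m A = 0 & u != 0.
  have : kermx A != 0.
    rewrite -mxrank_eq0 mxrank_ker subn_eq0 -ltnNge; exact: leq_ltn_trans (rank_leq_col A) kn.
  by case/rowV0Pn => u /sub_kermxP hu u0; exists u.
have ua i : (i < k)%N -> dot u (a i) = 0.
  move=> ik; have := congr1 (fun M : 'M[R]_(1, k) => M 0 (Ordinal ik)) uA; rewrite !mxE /dot => E.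
  by rewrite -[RHS]E; apply: eq_bigr => j _; rewrite mxE.
have [j uj] : exists j, dot (row j B) u != 0.
  apply: contrapT => h; case/negP: u0; apply/eqP.
  suff E : B *m u^T = 0 by apply: trmx_inj; rewrite trmx0 -(mulKmx uB u^T) E mulmx0.
  apply/matrixP => i l; rewrite ord1 !mxE; apply: contrapT => hi; apply: h; exists i; apply/eqP => E; apply: hi.
  by rewrite -[RHS]E; apply: eq_bigr => s _; rewrite !mxE.
have /boolp.choice[d hd] : forall i, exists d : nat, (i < k)%N -> dot (a i) (a i) = d%:R.
  move=> i; case: ltnP => ik; last by exists 0%N.
  have /intrP[z hz] := iL _ _ (h1 i ik).1 (h1 i ik).1; exists `|z|%N => _.
  by rewrite hz pmulrn; congr (_%:~R); have := dot_ge0 (a i); rewrite hz ler0z; lia.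
have d0 i : (i < k)%N -> (0 < d i)%N.
  by move=> ik; rewrite -(ltr0n R) -hd //; apply: dot_gt0; case: (h1 i ik).
pose D := (\prod_(i < k) d i)%N.
have D0 : (0 < D)%N by apply: prodn_gt0 => i; apply: d0.
pose b := row j B.
pose w : vec := D%:R *: b - \sum_(i < k) (D%:R * dot b (a i) / dot (a i) (a i)) *: a i.
have wa i : (i < k)%N -> dot w (a i) = 0.
  move=> ik; rewrite dotBl dotZl dot_suml (bigD1 (Ordinal ik)) //= big1 => [|l li].
    have := d0 i ik; rewrite -(ltr0n R) -hd // => p0.
    by rewrite addr0 dotZl divfK ?subrr // gt_eqF.
  rewrite dotZl; have : (l != i :> nat) by apply: contra_neq li => h; apply: val_inj.
  rewrite neq_ltn => /orP[h|h]; first by rewrite (h2 l i) ?mulr0 //; rewrite h ik.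
  by rewrite (dotC (a l) (a i)) (h2 i l) ?mulr0 //; rewrite h ltn_ord.
have wu : dot w u != 0.
  rewrite dotBl dotZl dot_suml big1 => [|l _]; last by rewrite dotZl (dotC _ u) ua ?mulr0.
  by rewrite subr0 mulf_neq0 // pnatr_eq0 -lt0n.
have wL : L w.
  apply: gL.2; first by apply: (grpZn _ gL); exact: hB.
  apply: (grp_sum _ gL) => i.
  have /intrP[z hz] : isZ (dot b (a i)) by apply: iL; [exact: hB|case: (h1 i (ltn_ord i))].
  have -> : D%:R * dot b (a i) / dot (a i) (a i) = ((\prod_(l < k | l != i) d l)%N%:Z * z)%:~R.
    have di : (d i)%:R != 0 :> R by rewrite pnatr_eq0 -lt0n d0.
    by rewrite hz hd // /D (bigD1 i) //= natrM rmorphM /= -pmulrn; move: di; move: (d i)%:R => t t0; field.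
  by apply: grpZ => //; case: (h1 i (ltn_ord i)).
exists (fun i => if (i < k)%N then a i else w); split=> [i ik|i l /andP[il lk]].
  case: ifP => h; first exact: h1.
  by split=> //; apply: contra_neq wu => ->; rewrite dot0l.
have ik : (i < k)%N by lia.
rewrite ik; case: ifP => h; first by apply: h2; rewrite il h.
by rewrite dotC wa.
Qed.
End LatticeFrame.

Section ShadowPart.
Variables (R : realType) (n : nat).
Notation vec := 'rV[R]_n.
Notation isZ u := (u \is a Num.int).
Variable q : vec -> R.
Hypothesis q2 : forall x, q (2 *: x) = 4 * q x.
Hypothesis Hq : forall M, evsd M -> fsh q M 2 = 0.
Definition ma (a : nat) : R := 2 * 4 ^+ a.

Lemma ma_even a : isZ (ma a / 2).
Proof. by rewrite /ma mulrC mulKf ?pnatr_eq0 // -natrX rpred_nat. Qed.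
Lemma maS a : ma a.+1 = 4 * ma a. Proof. by rewrite /ma exprS mulrCA. Qed.
Lemma maS4 a : ma a.+1 / 4 = ma a. Proof. by rewrite maS mulrC mulKf // pnatr_eq0. Qed.
Lemma ma4 a : ma a = 4 * (ma a / 4). Proof. by rewrite mulrC divfK // pnatr_eq0. Qed.

Lemma half_notint : ~~ isZ (2^-1 : R).
Proof.
apply/negP => /intrP[z hz].
have : 2 * z%:~R = 1 :> R by rewrite -hz mulfV // pnatr_eq0.
by rewrite -(intrM R 2 z) -[1]/(1%:~R) => /intr_inj; lia.
Qed.

Lemma fsh_eq (X Y : set vec) m : shell X m = shell Y m -> fsh q X m = fsh q Y m.
Proof. by rewrite /fsh => ->. Qed.

Lemma fsh_empty (X : set vec) m : (forall x, X x -> dot x x <> m) -> fsh q X m = 0.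
Proof.
move=> h; rewrite /fsh (_ : shell X m = set0) ?fsbig_set0 //.
by apply/seteqP; split=> x // [hx hm]; case: (h x hx).
Qed.

(** The set consists of the doubles of [Y], so the claim is about norm [ma a / 4]. This supplies the
    hypothesis [H2] of [hecke_step]. *)
Lemma fsh_dual_half (K Y : set vec) a : (forall x, Y x -> K (2 *: x)) ->
  fsh q Y (ma a / 4) = 0 -> fsh q [set x | K x /\ Y (2^-1 *: x)] (ma a) = 0.
Proof.
move=> YK h; have E : [set x | [set x | K x /\ Y (2^-1 *: x)] (2 *: x)] = Y; last by rewrite ma4 fsh_double // E h mulr0.
apply/seteqP; split=> x /=; rewrite scalerA mulVf ?pnatr_eq0 // scale1r; first by case.
by move=> hx; split=> //; exact: YK.
Qed.

(** The step from [m] to [4 m] uses [m] and [m / 4], so both are carried along. At the start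
    [m / 4 = 1/2], which is no norm in an even lattice. *)
Lemma evsd_all a : (forall M, evsd M -> fsh q M (ma a) = 0) /\ (forall M, evsd M -> fsh q M (ma a / 4) = 0).
Proof.
elim: a => [|a [IH1 IH2]].
  split=> M hM; first by rewrite /ma expr0 mulr1 Hq.
  apply: fsh_empty => x hx hm; have := ev_even hM hx; rewrite /even_norm hm /ma expr0 mulr1.
  move=> h; have : isZ (2 * (2 / 4 / 2 : R)) by rewrite rpredM ?rpred_nat.
  have -> : 2 * (2 / 4 / 2) = 2^-1 :> R by field.
  by move=> h1; case/negP: half_notint.
split=> M hM; last by rewrite maS4 IH1.
rewrite maS; apply: (hecke_step q2 hM (ev_grp hM)) => //.
- by move=> x hx; exact: (grpZn 2 (ev_grp hM)).
- exact: ma_even.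
- exact: IH1.
rewrite -(ev_dual hM); apply: fsh_dual_half; last exact: IH2.
by move=> x hx; exact: (grpZn 2 (ev_grp hM)).
Qed.

Variable L : set vec.
Hypotheses (sdL : selfdual_lattice L) (sL : sigma_is L 16).
Let L0 := even_sublattice L.
Let gL : grp L. Proof. exact: lattice_grp sdL.1. Qed.
Let iL x y : L x -> L y -> isZ (dot x y). Proof. exact: sdL.2.1. Qed.
Let dL : L = dual L. Proof. exact: sdL.2.2. Qed.
Let fL := lattice_frame sdL.1 sdL.2.1.

(** An even [L] would be its own shadow and contain 0, whereas the minimum of the shadow is
    [16 / 4 = 4]. *)
Let notev : ~ even_lattice L.
Proof.
move=> h; have := sL.2 0; rewrite /shadow asboolT // dot0l mulr0 => /(_ gL.1).
by rewrite lern0.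
Qed.
Lemma shadowE : shadow L = dual L0 `\` L.
Proof. by rewrite /shadow asboolF. Qed.

Lemma evD x y : L x -> L y -> isZ (dot (x + y) (x + y) / 2) = (isZ (dot x x / 2) == isZ (dot y y / 2)).
Proof.
move=> hx hy; rewrite dotDl !dotDr (dotC y x).
have -> : (dot x x + dot x y + (dot x y + dot y y)) / 2 = (dot x x / 2 + dot y y / 2) + dot x y by field.
have h2 z : L z -> isZ (2 * (dot z z / 2)) by move=> hz; rewrite mulrC divfK ?pnatr_eq0 // iL.
rewrite -half_add ?h2 //; apply/idP/idP => h; last by rewrite rpredD // iL.
by rewrite -(addrK (dot x y) (_ + _)) rpredB // iL.
Qed.
Lemma evN (x : vec) : dot (- x) (- x) = dot x x. Proof. by rewrite dotNl dotNr opprK. Qed.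
Lemma L0_2 x : L x -> L0 (2 *: x).
Proof.
move=> hx; split; first exact: (grpZn 2).
by rewrite /even_norm dotZl dotZr mulrC mulKf ?pnatr_eq0 // rpredM ?rpred_nat // iL.
Qed.
Lemma L0_grp : grp L0.
Proof.
split=> [|x y [hx ex] [hy ey]]; first by split; [exact: gL.1|rewrite /even_norm dot0l mul0r].
split; first exact: gL.2.
rewrite /even_norm in ex ey *; rewrite evD //; last exact: grpN.
by rewrite evN ex ey.
Qed.

Lemma L_fin X m : X `<=` dual L0 -> finite_set (shell X m).
Proof.
move=> hX; have [a oa ha] := fL.
have ob : orthf (fun i => 2 *: a i).
  split=> [i|i j ij]; last by rewrite dotZl dotZr (oa.2 _ _ ij) !mulr0.
  by rewrite scaler_eq0 pnatr_eq0 /= oa.1.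
apply: (finite_frame (m := m) ob) => x [/hX hx hm]; split=> // i.
by rewrite dotC; apply: hx; exact: L0_2.
Qed.

(** The dual of [L0] modulo [L0] has the classes of [0], [y1], [x0] and [x1 = x0 + y1], where [y1]
    in [L] has odd norm and [x0] is a shortest shadow vector. Gluing [x0] or [x1] to [L0] gives the
    even unimodular lattices [nb x0] and [nb x1]. The recursion with [N = nb x0] and [K = L0]
    settles [L0]; the shadow is the dual of [L0] without [L]. *)
Lemma shadow_main a : fsh q L (ma a) = 0 /\ fsh q (shadow L) (ma a) = 0.
Proof.
have [[x0 [hs0 n0]] smin] := sL; rewrite shadowE in hs0 smin *.
have {}n0 : dot x0 x0 = 4 by lra.
have [hx0 Lx0] := hs0.
have {}smin x : dual L0 x -> ~ L x -> 4 <= dot x x by move=> h1 h2; have := smin x (conj h1 h2); lra.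
have [y1 hy1 oy1] : exists2 y1, L y1 & ~~ isZ (dot y1 y1 / 2).
  apply: contrapT => h; apply: notev => x hx; apply: contrapT => /negP hi; apply: h; by exists x.
have d2 w : dual L0 w -> L (2 *: w).
  by move=> hw; rewrite dL => x hx; rewrite dotZr -dotZl; apply: hw; exact: L0_2.
have LdL0 : L `<=` dual L0 by move=> x hx y [hy _]; exact: iL.
have evB x : L x -> ~~ isZ (dot x x / 2) -> L0 (x - y1).
  move=> hx ox; split; first exact: gL.2.
  by rewrite /even_norm evD //; [rewrite evN (negbTE ox) (negbTE oy1)|exact: grpN].
have dint w : dual L0 w -> isZ (dot y1 w) -> L w.
  move=> hw h1; rewrite dL => x hx; case: (boolP (isZ (dot x x / 2))) => ex; first by apply: hw; split.
  by rewrite -(subrK y1 x) dotDl rpredD //; apply: hw; exact: evB.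
have o01 : ~~ isZ (dot y1 x0) by apply/negP => h; apply: Lx0; exact: dint.
have i01 : isZ (2 * dot y1 x0) by rewrite -dotZr iL //; exact: d2.
have dcos w : dual L0 w -> ~ L w -> L (w - x0).
  move=> hw Lw; apply: (dint); first exact: (dual_grp _).2.
  rewrite dotBr half_sub //; first by rewrite -dotZr iL //; exact: d2.
  by apply/negP => h; apply: Lw; exact: dint.
(* In other words, [2 x0] is a characteristic vector of [L]. *)
have ev0 x : L x -> isZ (dot x x0) = isZ (dot x x / 2).
  move=> hx; case: (boolP (isZ (dot x x / 2))) => ex; first by apply: hx0; split.
  apply: negbTE; apply: contra o01 => h; rewrite -(subKr x y1) dotBl rpredB //.
  by apply: hx0; exact: evB.
pose x1 := x0 + y1.
have dx1 : dual L0 x1 by apply: (grpD (dual_grp _)) => //; exact: LdL0.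
have Lx1 : ~ L x1 by move=> h; apply: Lx0; rewrite -(addrK y1 x0); exact: gL.2.
have e0 : even_norm x0 by rewrite /even_norm n0 (_ : 4 / 2 = 2); [exact: rpred_nat|field].
have e1 : even_norm x1.
  rewrite /even_norm dotDl !dotDr (dotC x0 y1) n0 (_ : _ / 2 = 2 + (dot y1 x0 + dot y1 y1 / 2)); last by field.
  rewrite rpredD ?rpred_nat // half_add //; first by rewrite (negbTE o01) (negbTE oy1).
  by rewrite mulrC divfK ?pnatr_eq0 // iL.
have ev1 x : L x -> isZ (dot x x1) = isZ (dot x x / 2).
  move=> hx; rewrite -ev0 // dotDr; apply/idP/idP => h; last by rewrite rpredD // iL.
  by rewrite -(addrK (dot x y1) (dot x x0)) rpredB // iL.
pose nb v := [set x | (L x /\ isZ (dot x v)) \/ (L (x - v) /\ isZ (dot (x - v) v))].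
have hN : evsd (nb x0).
  by apply: nbr_evsd => //; [exact: d2|move=> x hx; rewrite ev0].
have hN' : evsd (nb x1).
  by apply: nbr_evsd => //; [exact: d2|move=> x hx; rewrite ev1].
have L0N : L0 `<=` nb x0 by move=> x [hx ex]; left; rewrite ev0.
have L0_2x0 : L0 (2 *: x0).
  by split; [exact: d2|rewrite /even_norm dotZl dotZr n0 (_ : _ / 2 = 8); [exact: rpred_nat|field]].
have d2L0 x : dual L0 x -> L0 (2 *: x).
  move=> hx; have [h|h] := pselect (L x); first exact: L0_2.
  rewrite -(subrK x0 x) scalerDr; apply: grpD => //; first exact: L0_grp.
  exact/L0_2/dcos.
have Nd : nb x0 `<=` dual L0.
  move=> x [[hx _]|[hx _]]; first exact: LdL0.
  by rewrite -(subrK x0 x); apply: (grpD (dual_grp _)) => //; exact: LdL0.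
have fE (Y : set vec) m s : uniq s -> (forall x, shell (dual L0) m x <-> x \in s) -> Y `<=` dual L0 -> fsh q Y m = \sum_(x <- s) ind R (Y x) * q x.
  move=> us hs hY; rewrite /fsh (fsumE _ us) => [|x [hx hm]]; last by apply/hs; split=> //; exact: hY.
  apply: eq_big_seq => x /hs[_ hm]; case: asboolP => [[h _]|h]; first by rewrite indT ?mul1r.
  by rewrite indF ?mul0r // => hx; apply: h.
(* At an even norm the class of [y1] contributes nothing, and the two neighbours overlap exactly in
   [L0]. *)
have split3 k : fsh q (dual L0) (ma k) = fsh q (nb x0) (ma k) + fsh q (nb x1) (ma k) - fsh q L0 (ma k).
  have [s us hs] := fin_seq (L_fin (ma k) (fun x h => h)).
  rewrite !(fE _ _ _ us hs) // => [|x [hx _]|x [[hx _]|[hx _]]]; try exact: LdL0; last first.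
    by rewrite -(subrK x1 x); apply: (grpD (dual_grp _)) => //; exact: LdL0.
  rewrite -big_split -sumrB; apply: eq_big_seq => x /hs[hx hm].
  rewrite /= -mulrDl -mulrBl indT //; congr (_ * _).
  have em : isZ (dot x x / 2) by rewrite hm ma_even.
  have [Lx|Lx] := pselect (L x).
    have hn0 : nb x0 x by left; rewrite ev0.
    have hn1 : nb x1 x by left; rewrite ev1.
    have h0 : L0 x by split.
    by rewrite (indT _ hn0) (indT _ hn1) (indT _ h0) addrK.
  rewrite (indF _ (P := L0 x)); last by case.
  have Lk := dcos _ hx Lx.
  have x1E : x - x1 = (x - x0) - y1 by rewrite /x1 opprD addrA.
  have Lk1 : L (x - x1) by rewrite x1E; exact: gL.2.
  have E1 : isZ (dot (x - x1) (x - x1) / 2) = ~~ isZ (dot (x - x0) (x - x0) / 2).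
    by rewrite x1E evD //; [rewrite evN (negbTE oy1) eqbF_neg|exact: grpN].
  case: (boolP (isZ (dot (x - x0) (x - x0) / 2))) => ek.
    rewrite (indT _ (P := nb x0 x)); last by right; rewrite ev0.
    rewrite indF ?addr0 ?subr0 //; case=> -[] // _; by rewrite ev1 // E1 ek.
  rewrite (indT _ (P := nb x1 x)); last by right; rewrite ev1 // E1.
  rewrite indF ?add0r ?subr0 //; case=> -[] // _; by rewrite ev0 // (negbTE ek).
(* The base case uses [smin]: there are no shadow vectors of norm 2 or 1/2. Hence [L0] and [nb x0]
   have the same shell of norm 2, and the dual of [L0] has no vector of norm 1/2. *)
have main k : fsh q L0 (ma k) = 0 /\ fsh q (dual L0) (ma k / 4) = 0.
  elim: k => [|k [IH1 IH2]].
    split.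
      rewrite -[RHS]((evsd_all 0).1 _ hN); apply: fsh_eq; apply/seteqP; split=> x [hx hm]; split=> //; first exact: L0N.
      have dx := Nd _ hx; have [Lx|Lx] := pselect (L x); first by split=> //; rewrite /even_norm hm ma_even.
      by have := smin _ dx Lx; rewrite hm /ma expr0; lra.
    apply: fsh_empty => x hx hm; have [Lx|Lx] := pselect (L x).
      have := iL Lx Lx; rewrite hm /ma expr0 mulr1; have -> : 2 / 4 = 2^-1 :> R by field.
      by move=> h1; case/negP: half_notint.
    by have := smin _ hx Lx; rewrite hm /ma expr0; lra.
  split; last by rewrite maS4 split3 ((evsd_all k).1 _ hN) ((evsd_all k).1 _ hN') IH1 addr0 subr0.
  rewrite maS; apply: (hecke_step q2 hN L0_grp L0N) => //.
  - by move=> x /Nd; exact: d2L0.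
  - exact: ma_even.
  - exact: (evsd_all k).1.
  - move=> x [[hx ex]|[hx ex]] nx; first by case: nx; split=> //; rewrite /even_norm -ev0.
    (* Against [x] in [L0 + x0] the vector [x1] pairs to a half-odd number, because [(y1, x0)] is
       one; against [v] in [L0] it pairs integrally, and [(x1, x1)] is an integer. *)
    exists (2 *: x1); first exact: d2L0.
    have n1 : isZ (dot x1 x1).
      by rewrite -[dot x1 x1](divfK (_ : 2 != 0)) ?pnatr_eq0 // rpredM ?rpred_nat.
    split.
      rewrite dotZr mulrC mulKf ?pnatr_eq0 // -(subrK x0 x) dotDl [X in _ + X]dotDr n0 (dotC x0 y1).
      apply: contra o01 => h; have h1 : isZ (dot (x - x0) x1) by rewrite ev1 // -ev0.
      have -> : dot y1 x0 = (dot (x - x0) x1 + (4 + dot y1 x0)) - dot (x - x0) x1 - 4 by ring.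
      by rewrite rpredB ?rpred_nat // rpredB.
    move=> v hv; rewrite !(dotZl, dotZr) (_ : _ / 2 = dot v x1 + dot x1 x1); last by field.
    by rewrite rpredD //; apply: dx1.
  - apply: fsh_dual_half => // x hx; apply: L0N; exact: d2L0.
have [h1 _] := main a.
have hL : fsh q L (ma a) = 0.
  rewrite -[RHS]h1; apply: fsh_eq; apply/seteqP; split=> x [hx hm]; split=> //; last by case: hx.
  by split=> //; rewrite /even_norm hm ma_even.
split=> //; have h2 : fsh q (dual L0) (ma a) = 0 by rewrite split3 ((evsd_all a).1 _ hN) ((evsd_all a).1 _ hN') h1 addr0 subr0.
have [s us hs] := fin_seq (L_fin (ma a) (fun x h => h)).
rewrite (fE _ _ _ us hs); last by move=> x [].
rewrite (fE _ _ _ us hs) // in h2; rewrite (fE _ _ _ us hs LdL0) in hL.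
transitivity (\sum_(x <- s) ind R (dual L0 x) * q x - \sum_(x <- s) ind R (L x) * q x); last by rewrite h2 hL subr0.
rewrite -sumrB; apply: eq_big_seq => x /hs[hx _].
rewrite -mulrBl (indT _ hx); congr (_ * _); have [Lx|Lx] := pselect (L x).
  by rewrite (indT _ Lx) indF ?subrr //; case.
by rewrite (indF _ Lx) indT ?subr0.
Qed.
End ShadowPart.

Section PartOne.
Variable R : realType.

Lemma part_one (L : set 'rV[R]_24) : selfdual_lattice L -> sigma_is L 16 -> forall a : nat,
  (shell L (2 * 4 ^ a)%:R !=set0 -> spherical_3design (shell L (2 * 4 ^ a)%:R)) /\
  (shell (shadow L) (2 * 4 ^ a)%:R !=set0 -> spherical_3design (shell (shadow L) (2 * 4 ^ a)%:R)).
Proof.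
move=> sd sg a; have -> : (2 * 4 ^ a)%:R = ma R a by rewrite /ma natrM natrX.
have main (P : {mpoly R[24]}) : harmonic2 P -> fsh (peval P) L (ma R a) = 0 /\ fsh (peval P) (shadow L) (ma R a) = 0.
  move=> /harmonic_form[S hS tS]; have -> : peval P = qform S by apply: funext.
  apply: shadow_main => //; first exact: qform2.
  by move=> M hM; exact: qform_core.
have gL := lattice_grp sd.1.
have des X : X `<=` dual (even_sublattice L) -> (forall x, X x -> X (- x)) ->
    (forall P : {mpoly R[24]}, harmonic2 P -> fsh (peval P) X (ma R a) = 0) -> shell X (ma R a) !=set0 -> spherical_3design (shell X (ma R a)).
  move=> hX aX hP ne; split=> //; split; first exact: L_fin sd _ _ hX.
  split; first by move=> x [hx hm]; split; [exact: aX|rewrite evN].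
  by split=> //; exists (ma R a) => x [].
split; apply: des.
- by move=> x hx y [hy _]; exact: sd.2.1.
- by move=> x; exact: grpN.
- by move=> P /main[].
- by rewrite (shadowE sd sg) => x [].
- rewrite (shadowE sd sg) => x [hx Lx]; split; first exact: (grpN (dual_grp _)).
  by move=> h; apply: Lx; rewrite -[x]opprK; exact: grpN.
by move=> P /main[].
Qed.
End PartOne.
End ShadowDesigns.

(** * Formal power series over the integers, and theta series of squares *)

Module PowerSeries.
From HB Require Import structures.
From mathcomp Require Import all_boot all_order all_algebra.
From mathcomp Require Import boolp classical_sets cardinality fsbigop.
From mathcomp Require Import zify ring lra.
Set Implicit Arguments. Unset Strict Implicit. Unset Printing Implicit Defensive.
Import Order.TTheory GRing.Theory Num.Theory.
Local Open Scope ring_scope.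

(** Series are bare coefficient functions. The product is computed on polynomial truncations, from
    which the ring laws are inherited. *)
Definition fps := nat -> int.
HB.instance Definition _ := gen_eqMixin fps.
HB.instance Definition _ := gen_choiceMixin fps.
Definition trunc (n : nat) (f : fps) : {poly int} := \poly_(i < n.+1) f i.
Definition fadd (f g : fps) : fps := fun n => f n + g n.
Definition fopp (f : fps) : fps := fun n => - f n.
Definition fzero : fps := fun=> 0.
Definition fone : fps := fun n => (n == 0)%:R.
Definition fmul (f g : fps) : fps := fun n => (trunc n f * trunc n g)`_n.

Lemma coef_trunc n f i : (i <= n)%N -> (trunc n f)`_i = f i.
Proof. by move=> h; rewrite coef_poly ltnS h. Qed.

Lemma coefM_agree (P P' Q Q' : {poly int}) n : (forall i, (i <= n)%N -> P`_i = P'`_i) ->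
  (forall i, (i <= n)%N -> Q`_i = Q'`_i) -> (P * Q)`_n = (P' * Q')`_n.
Proof.
move=> h1 h2; rewrite !coefM; apply: eq_bigr => i _; rewrite h1 ?h2 //; first by rewrite leq_subr.
by rewrite -ltnS ltn_ord.
Qed.

Lemma fmul_trunc f g n N (P Q : {poly int}) : (n <= N)%N -> (forall i, (i <= N)%N -> P`_i = f i) ->
  (forall i, (i <= N)%N -> Q`_i = g i) -> fmul f g n = (P * Q)`_n.
Proof. by move=> nN h1 h2; apply: coefM_agree => i hi; rewrite coef_trunc // ?h1 ?h2 //; exact: leq_trans nN. Qed.

Lemma faddA : associative fadd. 
Proof. by move=> f g h; apply: funext => n; rewrite /fadd addrA. Qed.
Lemma faddC : commutative fadd. 
Proof. by move=> f g; apply: funext => n; rewrite /fadd addrC. Qed.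
Lemma fadd0 : left_id fzero fadd. 
Proof. by move=> f; apply: funext => n; rewrite /fadd add0r. Qed.
Lemma faddN : left_inverse fzero fopp fadd. 
Proof. by move=> f; apply: funext => n; rewrite /fadd addNr. Qed.
HB.instance Definition _ := GRing.isZmodule.Build fps faddA faddC fadd0 faddN.

Lemma fmulA : associative fmul.
Proof.
move=> f g h; apply: funext => n.
rewrite (@fmul_trunc f (fmul g h) n n (trunc n f) (trunc n g * trunc n h)) //; last first.
- by move=> i hi; apply/esym; apply: (fmul_trunc hi) => j hj; rewrite coef_trunc.
- by move=> i hi; rewrite coef_trunc.
rewrite mulrA; apply/esym; apply: (fmul_trunc (leqnn n)) => i hi; last by rewrite coef_trunc.
by apply/esym; apply: (fmul_trunc hi) => j hj; rewrite coef_trunc.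
Qed.
Lemma fmulC : commutative fmul. 
Proof. by move=> f g; apply: funext => n; rewrite /fmul mulrC. Qed.
Lemma fmul1 : left_id fone fmul.
Proof.
move=> f; apply: funext => n; rewrite (@fmul_trunc fone f n n 1 (trunc n f)) ?mul1r ?coef_trunc //.
  by move=> i _; rewrite coef1.
by move=> i hi; rewrite coef_trunc.
Qed.
Lemma fmulDl : left_distributive fmul fadd.
Proof.
move=> f g h; apply: funext => n; rewrite /fadd [in RHS]/fmul -coefD -mulrDl.
apply: (fmul_trunc (leqnn n)) => i hi; rewrite ?coefD !coef_trunc //.
Qed.
Lemma fone_neq0 : fone != 0 :> fps.
Proof. by apply/eqP => /(congr1 (fun f : fps => f 0%N)). Qed.
HB.instance Definition _ := GRing.Zmodule_isComNzRing.Build fps fmulA fmulC fmul1 fmulDl fone_neq0.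

Implicit Types f g : fps.
Lemma fpsD f g n : (f + g) n = f n + g n. 
Proof. by []. Qed.
Lemma fpsN f n : (- f) n = - f n. 
Proof. by []. Qed.
Lemma fpsMn f k n : (f *+ k) n = f n *+ k.
Proof. by elim: k => [//|k IH]; rewrite !mulrS fpsD IH. Qed.
Lemma fps_nat k f n : (k%:R * f) n = k%:R * f n. 
Proof. by rewrite !mulr_natl fpsMn. Qed.
Lemma fpsM f g n : (f * g) n = \sum_(i < n.+1) f i * g (n - i)%N.
Proof.
rewrite -[LHS]/(fmul f g n) /fmul coefM; apply: eq_bigr => i _; rewrite !coef_trunc ?leq_subr //.
by rewrite -ltnS ltn_ord.
Qed.
Lemma fps1 n : (1 : fps) n = (n == 0)%:R. 
Proof. by []. Qed.

(** The substitution [f (q^(k+1))]; [Df] below is the derivation [q d/dq]. *)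
Definition sub (k : nat) (f : fps) : fps := fun n => if (k.+1 %| n)%N then f (n %/ k.+1)%N else 0.
Definition Df (f : fps) : fps := fun n => n%:R * f n.

Lemma sub_trunc k f N i : (i <= N)%N -> (trunc N f \Po 'X^(k.+1))`_i = sub k f i.
Proof.
move=> iN; rewrite coef_comp_poly_Xn // /sub; case: ifP => // _; rewrite coef_trunc //.
exact: leq_trans (leq_div _ _) iN.
Qed.
Lemma subM k f g : sub k (f * g) = sub k f * sub k g.
Proof.
apply: funext => n; rewrite -[RHS]/(fmul _ _ n).
rewrite (fmul_trunc (leqnn n) (fun i h => sub_trunc k f h) (fun i h => sub_trunc k g h)).
rewrite -comp_polyM coef_comp_poly_Xn // /sub; case: ifP => // _.
by apply: fmul_trunc (leq_div n k.+1) _ _ => i hi; rewrite coef_trunc.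
Qed.
Lemma subD k f g : sub k (f + g) = sub k f + sub k g.
Proof. by apply: funext => n; rewrite fpsD /sub; case: ifP => // _; rewrite addr0. Qed.
Lemma subN k f : sub k (- f) = - sub k f.
Proof. by apply: funext => n; rewrite fpsN /sub; case: ifP => // _; rewrite oppr0. Qed.
Lemma sub1 k : sub k 1 = 1.
Proof.
apply: funext => -[|n]; rewrite /sub fps1 ?dvdn0 ?div0n //; case: ifP => // h.
by rewrite fps1 /= (_ : _ == 0%N = false) //; apply/negbTE; rewrite -lt0n divn_gt0 // dvdn_leq.
Qed.
Lemma subX k f n : sub k (f ^+ n) = sub k f ^+ n.
Proof. by elim: n => [|n IH]; rewrite ?expr0 ?sub1 // !exprS subM IH. Qed.
Lemma sub_nat k n : sub k n%:R = n%:R.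
Proof. by elim: n => [|n IH]; [apply: funext => n; rewrite /sub; case: ifP|rewrite -natr1 subD IH sub1]. Qed.
Lemma sub_mul k f n : sub k f (k.+1 * n)%N = f n.
Proof. by rewrite /sub dvdn_mulr // mulKn. Qed.
Lemma sub_sub j k f : sub j (sub k f) = sub (j.+1 * k.+1).-1 f.
Proof.
apply: funext => n; rewrite /sub prednK ?muln_gt0 //; case: (boolP (j.+1 %| n)%N) => h1.
  have [m hm] := dvdnP h1; rewrite hm mulnK // (mulnC j.+1) dvdn_pmul2r //.
  by case: ifP => // _; rewrite divnMr.
case: ifP => // h2; case/negP: h1; apply: dvdn_trans h2; exact: dvdn_mulr.
Qed.
Lemma Df_sub k f : Df (sub k f) = k.+1%:R * sub k (Df f).
Proof.
apply: funext => n; rewrite fps_nat /Df /sub; case: ifP => [h|_]; last by rewrite !mulr0.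
by rewrite mulrA -natrM mulnC divnK.
Qed.
Lemma DfD f g : Df (f + g) = Df f + Df g.
Proof. by apply: funext => n; rewrite /Df !fpsD mulrDr. Qed.
Lemma DfN f : Df (- f) = - Df f.
Proof. by apply: funext => n; rewrite /Df !fpsN mulrN. Qed.
Lemma DfM f g : Df (f * g) = Df f * g + f * Df g.
Proof.
apply: funext => n; rewrite /Df fpsD !fpsM mulr_sumr -big_split; apply: eq_bigr => i _ /=.
have : (i <= n)%N by rewrite -ltnS ltn_ord.
move=> h; rewrite -{1}(subnKC h) natrD; ring.
Qed.

Definition supp (r k : nat) f := forall n, f n != 0 -> (n %% k = r %% k)%N.
Lemma suppM r s k f g : supp r k f -> supp s k g -> supp (r + s) k (f * g).
Proof.
move=> hf hg n; rewrite fpsM => h.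
have [i hi] : exists i : 'I_n.+1, f i * g (n - i)%N != 0.
  apply/existsP; apply: contraT; rewrite negb_exists => /forallP h0; case/eqP: h; apply: big1 => i _.
  by apply/eqP; have := h0 i; rewrite negbK.
move: hi; rewrite mulf_eq0 negb_or => /andP[/hf h1 /hg h2].
have hin : (i <= n)%N by rewrite -ltnS ltn_ord.
by rewrite -{1}(subnKC hin) -modnDm h1 h2 modnDm.
Qed.
Lemma suppD r k f g : supp r k f -> supp r k g -> supp r k (f + g).
Proof.
move=> hf hg n; rewrite fpsD => h; have [h0|/hf//] := eqVneq (f n) 0.
by apply: hg; apply: contra_neq h => ->; rewrite h0.
Qed.
Lemma suppN r k f : supp r k f -> supp r k (- f).
Proof. by move=> hf n; rewrite fpsN oppr_eq0; exact: hf. Qed.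
Lemma supp1 k : supp 0 k 1.
Proof. by move=> [|n]; rewrite // fps1 eqxx. Qed.
Lemma supp_nat k n : supp 0 k n%:R.
Proof. by elim: n => [|n IH]; [move=> m; rewrite eqxx|rewrite -natr1; apply: suppD => //; exact: supp1]. Qed.
Lemma suppX r k f n : supp r k f -> supp (n * r) k (f ^+ n).
Proof. by move=> hf; elim: n => [|n IH]; rewrite ?expr0 ?mul0n; [exact: supp1|rewrite exprS mulSn; exact: suppM]. Qed.
Lemma supp_mod r s k f : (r %% k = s %% k)%N -> supp r k f -> supp s k f.
Proof. by move=> h hf n /hf ->. Qed.
Lemma supp0 r k f n : supp r k f -> (n %% k != r %% k)%N -> f n = 0.
Proof. by move=> hf h; apply/eqP; apply: contraNT h => /hf ->. Qed.
Lemma supp_sub r k j f : supp r k f -> supp (j.+1 * r) (j.+1 * k) (sub j f).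
Proof.
move=> hf n; rewrite /sub; case: ifP => [/dvdnP[m ->]|]; last by rewrite eqxx.
by rewrite mulnK // mulnC => /hf h; rewrite -!muln_modr h.
Qed.

Arguments suppX [r k f] n _.
Arguments supp_sub [r k] j [f] _.

Section FsumE.
Variables (R : nmodType) (T : choiceType).
Local Open Scope classical_set_scope.
Lemma fsumEc (X : set T) (s : seq T) (F : T -> R) : uniq s -> (forall x, X x -> x \in s) ->
  \sum_(x \in X) F x = \sum_(x <- s) (if `[< X x >] then F x else 0).
Proof.
move=> us h; have E : X = [set` s] `&` X by apply/seteqP; split=> [x hx|x []//]; split=> //; exact: h.
by rewrite [X in \big[_/_]_(_ \in X) _]E fsbig_mkcondr -fsbig_seq //; apply: eq_big_seq => x xs.
Qed.
End FsumE.

Definition zb (B : nat) (i : 'I_B.*2.+1) : int := (i : nat)%:Z - B%:Z.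
Arguments zb : clear implicits.
Definition zseq B : seq int := [seq zb B i | i : 'I_B.*2.+1].
Lemma zb_inj B : injective (zb B).
Proof. by move=> i j /addIr [] /val_inj. Qed.
Lemma zseq_uniq B : uniq (zseq B). 
Proof. by rewrite map_inj_uniq ?enum_uniq //; exact: zb_inj. Qed.
Lemma mem_zseq B (z : int) : `|z| <= B%:Z -> z \in zseq B.
Proof.
move=> h; apply/mapP; have h2 : (`|(z + B%:Z)%R|%N < B.*2.+1)%N by lia.
by exists (Ordinal h2); rewrite ?mem_enum // /zb /=; lia.
Qed.

(** The theta series with terms [c z * q^(z^2)], [z] over all integers. *)
Definition th (c : int -> int) : fps := fun n => \sum_(z \in [set z : int | z * z = n%:Z]%classic) c z.
Lemma sq_bound (z : int) (n B : nat) : z * z <= n%:Z -> (n <= B)%N -> `|z| <= B%:Z.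
Proof.
move=> h nB; have h2 : `|z| <= z * z by nia.
lia.
Qed.
Lemma int_par (z : int) : exists k, z = 2 * k \/ z = 2 * k + 1.
Proof.
exists (z %/ 2)%Z; have := divz_eq z 2; have := modz_ge0 z (isT : (2 : int) != 0).
have := ltz_pmod z (isT : 0 < (2 : int)); lia.
Qed.
Lemma th_box c n B : (n <= B)%N -> th c n = \sum_(z <- zseq B | z * z == n%:Z) c z.
Proof.
move=> nB; rewrite /th (fsumEc _ (zseq_uniq B)) => [|z /= hz]; last by apply: mem_zseq; apply: (sq_bound (n := n)) => //; rewrite hz.
by rewrite -big_mkcond; apply: eq_bigl => z; apply/asboolP/eqP.
Qed.
Lemma thD c c' : th (fun z => c z + c' z) = th c + th c'.
Proof. by apply: funext => n; rewrite fpsD !(th_box _ (leqnn n)) big_split. Qed.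
Lemma thN c : th (fun z => - c z) = - th c.
Proof. by apply: funext => n; rewrite fpsN !(th_box _ (leqnn n)) sumrN. Qed.
Lemma th_supp r k c : (forall z : int, c z != 0 -> (`|z| * `|z| %% k = r %% k)%N) -> supp r k (th c).
Proof.
move=> h n; rewrite (th_box _ (leqnn n)) => h0; apply: contraNeq h0 => hn; apply/eqP.
rewrite big1 // => z /eqP hz; apply: contraNeq hn => /h <-; apply/eqP; congr (_ %% _)%N; lia.
Qed.

Definition ev (z : int) : bool := (2 %| `|z|)%N.
Definition thE c : fps := th (fun z => if ev z then c (z %/ 2)%Z else 0).
Lemma sub4_th c : sub 3 (th c) = thE c.
Proof.
apply: funext => n; rewrite /sub /thE; case: ifP => [/dvdnP[m ->]|h]; last first.
  rewrite (th_box _ (leqnn n)) big1 // => z /eqP hz; case: ifP => // /dvdnP[k hk].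
  by move/negP: h; case; apply/dvdnP; exists (k * k)%N; lia.
rewrite mulnK // /th.
have -> : [set z : int | z * z = (m * 4)%N%:Z]%classic = [set 2 * z | z in [set z : int | z * z = m%:Z]]%classic.
  apply/seteqP; split=> z /=; last by move=> [y hy <-]; lia.
  by have [k [->|->]] := int_par z => hz; [exists k => //; lia|lia].
rewrite fsbig_image => [|z z' _ _]; last by lia.
by apply: eq_fsbigr => z _; rewrite /ev abszM dvdn_mulr // mulKz.
Qed.

Definition SG (G : int -> int -> int) (n : nat) : int :=
  \sum_(p \in [set p : int * int | p.1 * p.1 + p.2 * p.2 = n%:Z]%classic) G p.1 p.2.

Lemma SG_box G n B : (n <= B)%N -> SG G n =
  \sum_(x <- zseq B) \sum_(y <- zseq B | x * x + y * y == n%:Z) G x y.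
Proof.
move=> nB; rewrite /SG (fsumEc _ (allpairs_uniq (zseq_uniq B) (zseq_uniq B) (f := pair) _)); last 2 first.
- by move=> [x y] [x' y'].
- move=> [x y] /= h; apply/allpairsP; exists (x, y); split=> //=; apply: mem_zseq; apply: (sq_bound (n := n)) => //; nia.
rewrite big_allpairs; apply: eq_bigr => x _; rewrite [RHS]big_mkcond; apply: eq_bigr => y _ /=.
by congr (if _ then _ else _); apply/asboolP/eqP.
Qed.

Lemma th_mul c c' n : (th c * th c') n = SG (fun x y => c x * c' y) n.
Proof.
rewrite (SG_box _ (leqnn n)) fpsM.
transitivity (\sum_(i < n.+1) \sum_(x <- zseq n) \sum_(y <- zseq n) (if (x * x == i%:Z) && (y * y == (n - i)%N%:Z) then c x * c' y else 0)).
  apply: eq_bigr => i _; have hi : (i <= n)%N by rewrite -ltnS ltn_ord.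
  rewrite (th_box c hi) (th_box c' (leq_subr i n)) big_mkcond mulr_suml; apply: eq_bigr => x _.
  case: eqP => hx; last by rewrite mul0r big1.
  by rewrite mulr_sumr big_mkcond; apply: eq_bigr => y _ /=; case: ifP.
rewrite exchange_big; apply: eq_bigr => x _; rewrite exchange_big [RHS]big_mkcond; apply: eq_bigr => y _ /=.
case: eqP => [h|h]; last first.
  by apply: big1 => i _; case: ifP => // /andP[/eqP h1 /eqP h2]; case: h; have := ltn_ord i; lia.
have hi : (`|(x * x)%R|%N < n.+1)%N by nia.
rewrite (bigD1 (Ordinal hi)) //= big1 ?addr0 => [|i hne].
  by rewrite ifT //; apply/andP; split; apply/eqP; nia.
case: ifP => // /andP[/eqP h1 _]; case/eqP: hne; apply: val_inj => /=; lia.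
Qed.

Definition ce (z : int) : int := (ev z)%:R.
Definition co (z : int) : int := (~~ ev z)%:R.
Definition TA := th ce.
Definition TB := th co.

(* Rotation by 45 degrees: (u, v) |-> (u + v, u - v). *)
Lemma SG_rot G n : SG G (2 * n) = SG (fun u v => G (u + v) (u - v)) n.
Proof.
rewrite /SG.
have -> : [set p : int * int | p.1 * p.1 + p.2 * p.2 = (2 * n)%N%:Z]%classic = [set (p.1 + p.2, p.1 - p.2) | p in [set p : int * int | p.1 * p.1 + p.2 * p.2 = n%:Z]]%classic.
  apply/seteqP; split=> -[x y] /=; last by move=> [[u v] /= h [<- <-]]; nia.
  move=> h; have [k hk] : exists k, x = y + 2 * k.
    exists ((x - y) %/ 2)%Z; nia.
  exists (y + k, k) => /=; first by nia.
  by congr (_, _); lia.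
rewrite fsbig_image //= => -[u v] [u' v'] _ _ /= [h1 h2]; congr (_, _); lia.
Qed.
Lemma SG_ext G G' n : (forall x y, G x y = G' x y) -> SG G n = SG G' n.
Proof. by move=> h; apply: eq_fsbigr => p _; exact: h. Qed.
Lemma SG_add G G' n : SG (fun x y => G x y + G' x y) n = SG G n + SG G' n.
Proof. by rewrite !(SG_box _ (leqnn n)) -big_split; apply: eq_bigr => x _; rewrite big_split. Qed.
Lemma SG_0 G n : (forall x y, x * x + y * y = n%:Z -> G x y = 0) -> SG G n = 0.
Proof. by move=> h; rewrite (SG_box _ (leqnn n)) big1 // => x _; rewrite big1 // => y /eqP; exact: h. Qed.

Lemma ev_add u v : ev (u + v) = (ev u == ev v). 
Proof. by rewrite /ev; lia. Qed.
Lemma ev_sub u v : ev (u - v) = (ev u == ev v). 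
Proof. by rewrite /ev; lia. Qed.

(** Both coordinates of a point of norm [2 n] are even exactly if its preimage [(u, v)] under the
    rotation by 45 degrees has equal parities: both even or both odd. *)
Lemma TA_sqr : TA * TA = sub 1 (TA * TA + TB * TB).
Proof.
apply: funext => n; rewrite /sub th_mul; case: ifP => [/dvdnP[m ->]|h]; last first.
  apply: SG_0 => x y hxy; rewrite /ce /ev; case: (boolP (2 %| `|x|)%N) => hx; case: (boolP (2 %| `|y|)%N) => hy //; nia.
rewrite mulnK // mulnC SG_rot fpsD !th_mul -SG_add; apply: SG_ext => u v.
by rewrite /ce /co ev_add ev_sub; case: (ev u); case: (ev v).
Qed.
(** Now [u] and [v] have different parities, in either order; hence the factor 2. *)
Lemma TB_sqr : TB * TB = sub 1 (2%:R * (TA * TB)).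
Proof.
apply: funext => n; rewrite /sub th_mul; case: ifP => [/dvdnP[m ->]|h]; last first.
  apply: SG_0 => x y hxy; rewrite /co /ev; case: (boolP (2 %| `|x|)%N) => hx; case: (boolP (2 %| `|y|)%N) => hy //; nia.
rewrite mulnK // mulnC SG_rot mulr_natl mulr2n {1}mulrC fpsD !th_mul -SG_add; apply: SG_ext => u v.
by rewrite /ce /co ev_add ev_sub; case: (ev u); case: (ev v).
Qed.
Lemma TA_sub4 : TA = sub 3 (TA + TB).
Proof.
rewrite /TA /TB -thD sub4_th /thE; congr th; apply: funext => z; rewrite /ce /co.
by case: (ev z) => //=; case: (ev _).
Qed.
Lemma TA_supp : supp 0 4 TA.
Proof. by apply: th_supp => z; rewrite /ce /ev; case: (boolP (2 %| `|z|)%N) => //; nia. Qed.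
Lemma TB_supp : supp 1 8 TB.
Proof.
apply: th_supp => z; rewrite /co /ev; case: (boolP (2 %| `|z|)%N) => // h _.
suff [t ->] : exists t, (`|z| * `|z| = t * 8 + 1)%N by rewrite modnMDl.
have -> : `|z|%N = (2 * (`|z| %/ 2) + 1)%N by lia.
move: (`|z| %/ 2)%N => k; have [j [->|->]] : exists j, k = (2 * j)%N \/ k = (2 * j + 1)%N by exists (k %/ 2)%N; lia.
  by exists (j * (2 * j + 1))%N; lia.
by exists ((2 * j + 1) * (j + 1))%N; lia.
Qed.
End PowerSeries.

(** * Doubling formulas, the Wronskian of A and B, and vanishing coefficients *)

Module ThetaIdentities.
From HB Require Import structures.
From mathcomp Require Import all_boot all_order all_algebra.
From mathcomp Require Import boolp classical_sets cardinality fsbigop.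
From mathcomp Require Import zify ring lra.
Import PowerSeries.
Set Implicit Arguments. Unset Strict Implicit. Unset Printing Implicit Defensive.
Import Order.TTheory GRing.Theory Num.Theory.
Local Open Scope ring_scope.

(** Pure algebra: the first two hypotheses are the doubling formulas, the last two their
    derivatives, with [a] and [b] for the derivatives of the series taken at [q^2]. The defect of
    the Wronskian identity at [q] is expressed by the defect at [q^2]. *)
Lemma wronskian_doubling (R : comNzRingType) (A B A2 B2 DA DB a b : R) :
  A * A = A2 * A2 + B2 * B2 -> B * B = 2%:R * (A2 * B2) ->
  2%:R * (A * DA) = 4%:R * (A2 * a + B2 * b) -> 2%:R * (B * DB) = 4%:R * (a * B2 + A2 * b) ->
  2%:R * (A * B * (A * DB - B * DA - A * B * (A ^+ 4 - B ^+ 4))) =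
  4%:R * ((A2 ^+ 2 - B2 ^+ 2) * (A2 * b - B2 * a - A2 * B2 * (A2 ^+ 4 - B2 ^+ 4))).
Proof.
move=> h1 h2 h3 h4.
transitivity ((A * A) * (2%:R * (B * DB)) - (B * B) * (2%:R * (A * DA)) - 2%:R * (A * A) * (B * B) * ((A * A) ^+ 2 - (B * B) ^+ 2)).
  by ring.
by rewrite h1 h2 h3 h4; ring.
Qed.

Lemma fps_natK k (f g : fps) : k.+1%:R * f = k.+1%:R * g -> f = g.
Proof.
move=> h; apply: funext => n; have := congr1 (fun f : fps => f n) h; rewrite !fps_nat.
by apply: mulfI; rewrite pnatr_eq0.
Qed.

Notation A := TA.
Notation B := TB.
Definition A2 := sub 1 A.
Definition B2 := sub 1 B.
Definition A4 := sub 3 A.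
Definition B4 := sub 3 B.
Lemma hA2 : A * A = A2 * A2 + B2 * B2.
Proof. by rewrite {1}TA_sqr subD !subM. Qed.
Lemma hB2 : B * B = 2%:R * (A2 * B2).
Proof. by rewrite {1}TB_sqr !subM sub_nat. Qed.
Lemma hA4 : A2 * A2 = A4 * A4 + B4 * B4.
Proof. by rewrite /A2 -subM hA2 /A2 /B2 -!subM -subD sub_sub subD !subM. Qed.
Lemma hB4 : B2 * B2 = 2%:R * (A4 * B4).
Proof. by rewrite /B2 -subM hB2 /A2 /B2 !subM sub_nat !sub_sub. Qed.
Lemma hA : A = A4 + B4.
Proof. by rewrite {1}TA_sub4 subD. Qed.

(** The defect of the identity [wronskian]. *)
Definition Zw : fps := A * Df B - B * Df A - A * B * (A ^+ 4 - B ^+ 4).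

Lemma Zw_doubling : A * B * Zw = 2%:R * ((A2 ^+ 2 - B2 ^+ 2) * sub 1 Zw).
Proof.
apply: (@fps_natK 1); rewrite /Zw.
have d1 : Df A2 = 2%:R * sub 1 (Df A) by exact: Df_sub.
have d2 : Df B2 = 2%:R * sub 1 (Df B) by exact: Df_sub.
rewrite (@wronskian_doubling _ A B A2 B2 (Df A) (Df B) (sub 1 (Df A)) (sub 1 (Df B)) hA2 hB2).
- by rewrite !(subD, subN, subM, subX) -/A2 -/B2; ring.
- have := congr1 Df hA2; rewrite DfD !DfM d1 d2 => h.
  by transitivity (Df A * A + A * Df A); [ring|rewrite h; ring].
have := congr1 Df hB2; rewrite mulr_natl mulr2n DfD !DfM d1 d2 => h.
by transitivity (Df B * B + B * Df B); [ring|rewrite h; ring].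
Qed.

Lemma A_0 : A 0%N = 1.
Proof. by rewrite /TA (th_box _ (leqnn 0)) /zseq big_map big_enum_cond big_mkcond !big_ord_recl big_ord0. Qed.
Lemma B_0 : B 0%N = 0.
Proof. by apply: (supp0 TB_supp). Qed.
Lemma A_1 : A 1%N = 0.
Proof. by apply: (supp0 TA_supp). Qed.
Lemma B_1 : B 1%N = 2.
Proof. by rewrite /TB (th_box _ (leqnn 1)) /zseq big_map big_enum_cond big_mkcond !big_ord_recl big_ord0. Qed.

Lemma AB_0 : (A * B) 0%N = 0.
Proof. by rewrite fpsM big_ord_recl big_ord0 /= B_0 mulr0. Qed.
Lemma AB_1 : (A * B) 1%N = 2.
Proof. by rewrite fpsM !big_ord_recl big_ord0 /= A_0 A_1 B_1 mul1r mul0r. Qed.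
Lemma A4B4_0 : (A ^+ 4 - B ^+ 4) 0%N = 1.
Proof. by rewrite fpsD fpsN !exprS expr0 !mulr1 !(fpsM, big_ord_recl, big_ord0) /= A_0 B_0. Qed.

(** As [A B] begins with [2 q], the coefficient of [A B Zw] at [n + 3] is twice that of [Zw] at
    [n + 2] plus earlier ones. On the other side of [Zw_doubling] only coefficients of [Zw] up to
    half of [n + 3] occur, so strong induction applies. *)
Lemma Zw_0 n : Zw n = 0.
Proof.
elim/ltn_ind: n => -[|[|n]] IH.
- rewrite /Zw !fpsD !fpsN !fpsM !big_ord_recl !big_ord0 /= /Df B_0 AB_0; lia.
- rewrite /Zw !fpsD !fpsN; rewrite (fpsM (A * B)) (fpsM A) (fpsM B) !big_ord_recl !big_ord0 /= /Df subn0 subnn.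
  by rewrite AB_0 AB_1 A4B4_0 A_0 A_1 B_0 B_1; lia.
have := congr1 (fun f : fps => f n.+3) Zw_doubling; rewrite fps_nat !fpsM.
rewrite [RHS](_ : _ = 0); last first.
  rewrite big1 ?mulr0 // => i _; rewrite /sub; case: ifP => _; rewrite ?mulr0 // IH ?mulr0 //.
  by have := leq_subr i n.+3; lia.
rewrite 2!big_ord_recl big1 /= => [|i _]; last by rewrite IH ?mulr0 // /bump /=; lia.
rewrite AB_0 AB_1 mul0r add0r addr0 /bump /= subn1 /= => h.
lia.
Qed.

Lemma wronskian : A * Df B - B * Df A = A * B * (A ^+ 4 - B ^+ 4).
Proof. by apply/eqP; rewrite -subr_eq0; apply/eqP; apply: funext => n; exact: Zw_0. Qed.

Definition F0of (R : comNzRingType) (A B : R) : R :=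
  (A + B) ^+ 3 * (A - B) ^+ 4 * (2%:R * (A - B) ^+ 4 - (A + B) ^+ 4) * (A * B) * (A ^+ 2 + B ^+ 2).
Definition F0 : fps := F0of A B.

(** The terms are grouped by the power of [B] modulo 4. Exponents of [A] are 0 and those of [B] are
    1 modulo 4, so the four summands carry the exponents 0, 1, 2 and 3 modulo 4. *)
Lemma F0_parts (R : comNzRingType) (A B : R) : F0of A B =
  8%:R * A ^+ 3 * B ^+ 4 * (A ^+ 4 - B ^+ 4) * (A ^+ 4 - 2%:R * B ^+ 4)
  + A ^+ 2 * B * ((A ^+ 4) ^+ 3 - 23%:R * (A ^+ 4) ^+ 2 * B ^+ 4 + 35%:R * A ^+ 4 * (B ^+ 4) ^+ 2 - 13%:R * (B ^+ 4) ^+ 3)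
  + A * B ^+ 2 * ((B ^+ 4) ^+ 3 - 23%:R * A ^+ 4 * (B ^+ 4) ^+ 2 + 35%:R * (A ^+ 4) ^+ 2 * B ^+ 4 - 13%:R * (A ^+ 4) ^+ 3)
  + 2%:R * B ^+ 3 * (2%:R * A ^+ 4 - B ^+ 4) * ((2%:R * A ^+ 4 - B ^+ 4) ^+ 2 - B ^+ 8).
Proof. by rewrite /F0of; ring. Qed.

(** The right-hand side shows that all exponents are multiples of 8: those of [A2] are, and those of
    [B2 ^ 4] are 8 modulo 16. *)
Lemma E_eq : 2%:R * A ^+ 4 - B ^+ 4 = 2%:R * A2 ^+ 4 + 2%:R * B2 ^+ 4.
Proof.
transitivity (2%:R * (A * A) ^+ 2 - (B * B) ^+ 2); first by ring.
by rewrite hA2 hB2; ring.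
Qed.

(** Two doublings express [B ^ 4] and [A ^ 4 - B ^ 4] through the series at [q^4], and [A = A4 + B4]
    does the rest. This self-similarity is what carries the vanishing from [n] to [4 n]. *)
Lemma part0 : 8%:R * A ^+ 3 * B ^+ 4 * (A ^+ 4 - B ^+ 4) * (A ^+ 4 - 2%:R * B ^+ 4) = 64%:R * sub 3 F0.
Proof.
have b4 : B ^+ 4 = 8%:R * (A4 * B4) * (A4 ^+ 2 + B4 ^+ 2).
  transitivity ((B * B) ^+ 2); first by ring.
  rewrite hB2; transitivity (4%:R * (A2 * A2) * (B2 * B2)); first by ring.
  by rewrite hA4 hB4; ring.
have a4 : A ^+ 4 - B ^+ 4 = (A4 - B4) ^+ 4.
  transitivity ((A * A) ^+ 2 - (B * B) ^+ 2); first by ring.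
  rewrite hA2 hB2; transitivity ((A2 * A2 - B2 * B2) ^+ 2); first by ring.
  by rewrite hA4 hB4; ring.
have -> : A ^+ 4 - 2%:R * B ^+ 4 = 2%:R * (A ^+ 4 - B ^+ 4) - A ^+ 4 by ring.
have -> : sub 3 F0 = F0of A4 B4 by rewrite /F0 /F0of !(subD, subN, subM, sub1) -/A4 -/B4; ring.
rewrite a4 b4; have -> : A ^+ 3 = (A4 + B4) ^+ 3 by rewrite -hA.
have -> : A ^+ 4 = (A4 + B4) ^+ 4 by rewrite -hA.
by rewrite /F0of; ring.
Qed.

Lemma suppA8 : supp 0 8 A2.
Proof. by refine (supp_mod _ (supp_sub 1 TA_supp)). Qed.
Lemma suppB4 : supp 1 4 B.
Proof. by move=> n /TB_supp h; rewrite -(modn_dvdm n (_ : 4 %| 8)%N) // h. Qed.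
Lemma suppX0 k f n : supp 0 k f -> supp 0 k (f ^+ n).
Proof. by move=> h; refine (supp_mod _ (suppX n h)); rewrite muln0. Qed.
Arguments suppX0 [k f n] _.
Lemma suppA44 : supp 0 4 (A ^+ 4).
Proof. exact (suppX0 TA_supp). Qed.
Lemma suppB44 : supp 0 4 (B ^+ 4).
Proof. by refine (supp_mod _ (suppX 4 suppB4)). Qed.
Lemma suppM0 k f g r : supp 0 k f -> supp r k g -> supp r k (f * g).
Proof. by move=> hf hg; exact: (suppM hf hg). Qed.

Ltac supp_tac := lazymatch goal with
| |- supp _ _ (_ + _) => refine (suppD _ _); supp_tac
| |- supp _ _ (- _) => refine (suppN _); supp_tac
| |- supp _ _ (_ * _) => refine (suppM0 _ _); supp_tac
| |- supp _ _ (_%:R) => exact (@supp_nat _ _)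
| |- supp _ _ (TA ^+ 4) => exact suppA44
| |- supp _ _ (TB ^+ 4) => exact suppB44
| |- supp _ _ (_ ^+ _) => refine (suppX0 _); supp_tac
end.

Lemma part1_supp : supp 1 4 (A ^+ 2 * B * ((A ^+ 4) ^+ 3 - 23%:R * (A ^+ 4) ^+ 2 * B ^+ 4 + 35%:R * A ^+ 4 * (B ^+ 4) ^+ 2 - 13%:R * (B ^+ 4) ^+ 3)).
Proof.
rewrite mulrC; refine (suppM0 _ _); first by supp_tac.
by refine (suppM0 _ _); [refine (suppX0 TA_supp)|exact suppB4].
Qed.
Lemma part2_supp : supp 2 4 (A * B ^+ 2 * ((B ^+ 4) ^+ 3 - 23%:R * A ^+ 4 * (B ^+ 4) ^+ 2 + 35%:R * (A ^+ 4) ^+ 2 * B ^+ 4 - 13%:R * (A ^+ 4) ^+ 3)).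
Proof.
rewrite mulrC; refine (suppM0 _ _); first by supp_tac.
by refine (suppM0 _ _); [exact TA_supp|refine (supp_mod _ (suppX 2 suppB4))].
Qed.
Lemma part3_supp : supp 3 8 (2%:R * B ^+ 3 * (2%:R * A ^+ 4 - B ^+ 4) * ((2%:R * A ^+ 4 - B ^+ 4) ^+ 2 - B ^+ 8)).
Proof.
have hE : supp 0 8 (2%:R * A ^+ 4 - B ^+ 4).
  rewrite E_eq; refine (suppD _ _); refine (suppM0 _ _); try exact (@supp_nat _ _).
    exact (suppX0 suppA8).
  have h : supp (4 * (2 * 1)) (2 * 8) (B2 ^+ 4) := suppX 4 (supp_sub 1 TB_supp).
  by move=> n /h hn; rewrite -(modn_dvdm n (_ : 8 %| 16)%N) // hn.
rewrite mulrC; refine (suppM0 _ _).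
  refine (suppD _ _); first refine (suppX0 hE).
  by refine (suppN _); refine (supp_mod _ (suppX 8 TB_supp)).
rewrite mulrC; refine (suppM0 _ _); first exact hE.
by refine (suppM0 _ _); [exact (@supp_nat _ _)|refine (supp_mod _ (suppX 3 TB_supp))].
Qed.

Lemma F0_4 n : F0 (4 * n)%N = 64 * F0 n.
Proof.
rewrite {1}/F0 F0_parts part0 !fpsD fps_nat sub_mul.
have h4 r : (0 < r < 4)%N -> ((4 * n) %% 4 != r %% 4)%N by rewrite modnMr; case: r => [|[|[|[|]]]].
rewrite (supp0 part1_supp (h4 1%N isT)) (supp0 part2_supp (h4 2%N isT)).
rewrite (supp0 part3_supp) ?addr0 //; have := h4 3%N isT; apply: contraNneq => h.
by rewrite -(modn_dvdm _ (_ : 4 %| 8)%N) // h.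
Qed.

Lemma F0_7 n : F0 (8 * n + 7)%N = 0.
Proof.
rewrite {1}/F0 F0_parts part0 !fpsD fps_nat.
have h4 : ((8 * n + 7) %% 4 = 3)%N by lia.
rewrite (supp0 part1_supp) ?h4 // (supp0 part2_supp) ?h4 // (supp0 part3_supp); last first.
  by rewrite (_ : (8 * n + 7) %% 8 = 7)%N //; lia.
by rewrite /sub ifF ?mulr0 //; apply/negbTE; rewrite /dvdn h4.
Qed.

Lemma F0_van a b : F0 (4 ^ a * (8 * b + 7))%N = 0.
Proof. by elim: a => [|a IH]; rewrite ?mul1n ?F0_7 // expnS -mulnA F0_4 IH. Qed.

Lemma DfX f n : Df (f ^+ n.+1) = n.+1%:R * f ^+ n * Df f.
Proof.
elim: n => [|n IH]; first by rewrite expr1 expr0 !mul1r.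
by rewrite exprS DfM IH (exprS f n) -[n.+2%:R]natr1; ring.
Qed.

(** The theta series of [W8], which is the E8 lattice: half the sum of the eighth powers of the
    theta constants, with [s = A + B], [t = A - B] and [s^4 - t^4] as fourth power of the third
    one. *)
Definition Gs : fps := (A + B) ^+ 8 + (A - B) ^+ 8 - (A + B) ^+ 4 * (A - B) ^+ 4.

(** The first Rankin-Cohen bracket of the theta series of [Z^3], of weight 3/2, and of [W8], of
    weight 4; its coefficients sum [8 |x|^2 - 3 |y|^2] over the shells. Derivatives enter through
    the Wronskian alone. *)
Lemma bracket : 8%:R * Df ((A + B) ^+ 3) * Gs - 3%:R * (A + B) ^+ 3 * Df Gs = 24%:R * F0.
Proof.
rewrite /Gs !DfD !DfN DfM !DfX DfD DfD DfN.
transitivity (24%:R * ((A + B) ^+ 2 * (A - B) ^+ 3 * (2%:R * (A - B) ^+ 4 - (A + B) ^+ 4)) * (A * Df B - B * Df A)); first by ring.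
by rewrite wronskian /F0 /F0of; ring.
Qed.
End ThetaIdentities.

(** * The four-square theorem, for the nonemptiness of shells *)

Module FourSquares.
From HB Require Import structures.
From mathcomp Require Import all_boot all_order all_algebra.
From mathcomp Require Import zify ring lra.
Set Implicit Arguments. Unset Strict Implicit. Unset Printing Implicit Defensive.
Import Order.TTheory GRing.Theory Num.Theory.
Local Open Scope ring_scope.

Definition S4 (n : int) := exists a b c d : int, n = a * a + b * b + c * c + d * d.

Lemma sq_ge0 (y : int) : 0 <= y * y.
Proof. by rewrite -expr2 sqr_ge0. Qed.
Lemma sq_le0 (y : int) : y * y <= 0 -> y = 0.
Proof. by nia. Qed.
Lemma sq_eq4 (y M : int) : 4 * (y * y) = M * M -> 2 * y = M \/ 2 * y = - M.
Proof.
move=> h; have /eqP : (2 * y - M) * (2 * y + M) = 0 by lia.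
by rewrite mulf_eq0 => /orP[] /eqP h2; [left|right]; lia.
Qed.

(** Euler's identity: the norm of quaternions is multiplicative. *)
Lemma S4_mul m n : S4 m -> S4 n -> S4 (m * n).
Proof.
move=> [a [b [c [d ->]]]] [a' [b' [c' [d' ->]]]].
exists (a * a' + b * b' + c * c' + d * d'), (a * b' - b * a' + c * d' - d * c'),
  (a * c' - b * d' - c * a' + d * b'), (a * d' + b * c' - c * b' - d * a'); ring.
Qed.

Lemma near_residue (m : nat) (x : int) : (0 < m)%N -> exists y c : int, x = y + m%:Z * c /\ 2 * `|y| <= m%:Z.
Proof.
move=> m0; have h := divz_eq x m%:Z.
have h1 : 0 <= (x %% m)%Z by apply: modz_ge0; lia.
have h2 : (x %% m)%Z < m%:Z by apply: ltz_pmod; lia.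
move: (x %% m)%Z (x %/ m)%Z h h1 h2 => r k h h1 h2.
have [hr|hr] := lerP (2 * r) m%:Z; first by exists r, k; split; lia.
by exists (r - m%:Z), (k + 1); split; lia.
Qed.

Lemma prime_nodiv (p m : nat) (k : int) : prime p -> (1 < m < p)%N -> p%:Z = m%:Z * k -> False.
Proof.
move=> pp hm h; have : (m %| p)%N by apply/dvdnP; exists `|k|%N; nia.
have m1 : m != 1%N by lia.
by move/(prime_nt_dvdP pp m1); lia.
Qed.

(** Reduce the four numbers to absolutely least residues modulo [m]; their squares sum to [m r] with
    [r <= m]. Euler's identity writes [m p * m r] as four squares whose roots are all divisible by
    [m], so [r p] is a sum of four squares. The cases [r = 0] and [r = m] would make [m] divide
    [p]. *)
Lemma S4_descent (p m : nat) : prime p -> (0 < m < p)%N -> S4 (m%:Z * p%:Z) -> S4 p%:Z.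
Proof.
move=> pp; elim/ltn_ind: m => m IH hm; have [->|m1] := eqVneq m 1%N; first by rewrite mul1r.
have hm1 : (1 < m < p)%N by lia.
have m0 : (0 < m)%N by lia.
move=> [a [b [c [d E]]]].
have [a' [al [ha qa]]] := near_residue a m0; have [b' [be [hb qb]]] := near_residue b m0.
have [c' [ga [hc qc]]] := near_residue c m0; have [d' [de [hd qd]]] := near_residue d m0.
pose M := m%:Z; rewrite -/M in E ha hb hc hd qa qb qc qd.
have M0 : 0 < M by rewrite /M; lia.
pose r := p%:Z - 2 * (a * al + b * be + c * ga + d * de) + M * (al * al + be * be + ga * ga + de * de).
have Er : a' * a' + b' * b' + c' * c' + d' * d' = M * r.
  have -> : M * r = M * p%:Z - 2 * M * (a * al + b * be + c * ga + d * de) + M * M * (al * al + be * be + ga * ga + de * de) by rewrite /r; ring.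
  by rewrite E ha hb hc hd; ring.
have sq (y : int) : 2 * `|y| <= M -> 4 * (y * y) <= M * M by move=> hy; nia.
have := sq _ qa; have := sq _ qb; have := sq _ qc; have := sq _ qd => sd sc sb sa.
have r0 : 0 <= r by rewrite -(pmulr_rge0 _ M0) -Er; have := sq_ge0 a'; have := sq_ge0 b'; have := sq_ge0 c'; have := sq_ge0 d'; lia.
have rM : r <= M by rewrite -(ler_pM2l M0) -Er; lia.
have Mp0 : M != 0 by rewrite gt_eqF.
have [rz|rn] := eqVneq r 0.
  rewrite rz mulr0 in Er; have := sq_ge0 a'; have := sq_ge0 b'; have := sq_ge0 c'; have := sq_ge0 d' => nd nc nb na.
  have za : a' = 0 by apply: sq_le0; lia.
  have zb : b' = 0 by apply: sq_le0; lia.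
  have zc : c' = 0 by apply: sq_le0; lia.
  have zd : d' = 0 by apply: sq_le0; lia.
  exfalso; apply: (@prime_nodiv p m (al * al + be * be + ga * ga + de * de) pp hm1).
  by apply: (mulfI Mp0); rewrite E ha hb hc hd za zb zc zd; ring.
(* For [r = m] every residue is [M / 2] up to sign, so each original square is [M^2 / 4] times a
   number 1 modulo 4, and their sum is divisible by [M^2]. *)
have [rm|rnm] := eqVneq r M.
  rewrite rm in Er.
  have odd_form (x y k : int) : x = y + M * k -> 2 * `|y| <= M -> 4 * (y * y) = M * M -> exists t, 4 * (x * x) = M * M * (1 + 4 * t).
    move=> hx hy hy2; have [h|h] := sq_eq4 hy2.
      exists (k + k * k); rewrite hx; have -> : M = 2 * y by []; ring.
    have hM : M = - (2 * y) by lia.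
    by exists (k * k - k); rewrite hx hM; ring.
  have ea : 4 * (a' * a') = M * M by lia.
  have eb : 4 * (b' * b') = M * M by lia.
  have ec : 4 * (c' * c') = M * M by lia.
  have ed : 4 * (d' * d') = M * M by lia.
  have [ta hta] := odd_form _ _ _ ha qa ea; have [tb htb] := odd_form _ _ _ hb qb eb.
  have [tc htc] := odd_form _ _ _ hc qc ec; have [td htd] := odd_form _ _ _ hd qd ed.
  exfalso; apply: (@prime_nodiv p m (1 + ta + tb + tc + td) pp hm1).
  apply: (mulfI Mp0); apply: (@mulfI _ (4 : int)) => //.
  rewrite E; transitivity (4 * (a * a) + 4 * (b * b) + 4 * (c * c) + 4 * (d * d)); first by ring.
  by rewrite hta htb htc htd; ring.
have rr : (0 < `|r| < m)%N by rewrite /M in rnm rM; lia.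
apply: (IH `|r|%N); [lia|lia|].
have -> : `|r|%N%:Z = r by lia.
exists (p%:Z - (a * al + b * be + c * ga + d * de)), (- a * be + b * al - c * de + d * ga),
  (- a * ga + b * de + c * al - d * be), (- a * de - b * ga + c * be + d * al).
apply: (mulfI Mp0); apply: (mulfI Mp0).
transitivity ((M * p%:Z) * (M * r)); first by ring.
have pM : M * (p%:Z - (a * al + b * be + c * ga + d * de)) = a * a' + b * b' + c * c' + d * d'.
  by rewrite mulrBr E ha hb hc hd; ring.
transitivity ((M * (p%:Z - (a * al + b * be + c * ga + d * de))) ^+ 2 + (M * (- a * be + b * al - c * de + d * ga)) ^+ 2 +
  (M * (- a * ga + b * de + c * al - d * be)) ^+ 2 + (M * (- a * de - b * ga + c * be + d * al)) ^+ 2); last by ring.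
by rewrite pM E -Er ha hb hc hd; ring.
Qed.

Lemma mod_abs (a b p : nat) : (a %% p = b %% p)%N -> (p %| `|a%:Z - b%:Z|)%N.
Proof.
move=> /eqP h; case: (leqP a b) => ab.
  have -> : `|a%:Z - b%:Z|%N = (b - a)%N by lia.
  by rewrite -eqn_mod_dvd // eq_sym.
have -> : `|a%:Z - b%:Z|%N = (a - b)%N by lia.
by rewrite -eqn_mod_dvd // ltnW.
Qed.

Lemma sq_lt_box (h p k : nat) : (k < h.+1)%N -> (0 < p)%N -> (k * k + 1 <= h.+1 * h.+1 * p)%N.
Proof.
move=> kh p0; apply: (@leq_trans (h.+1 * h.+1)%N); last exact: leq_pmulr.
have kk : (k * k <= h * h)%N by apply: leq_mul.
by rewrite mulSn mulnS; lia.
Qed.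

(** Pigeonhole: among the [h + 1] squares and the [h + 1] values [- 1 - j^2] two must agree modulo
    [p = 2 h + 1], and squares of distinct numbers up to [h] differ. *)
Lemma prime_two_squares (p : nat) : prime p -> odd p -> exists x y m : nat, (x * x + y * y + 1 = m * p)%N /\ (0 < m < p)%N.
Proof.
move=> pp po; have [h ph] : exists h, p = (2 * h + 1)%N by exists p./2; lia.
have p0 : (0 < p)%N by lia.
have p2 : (1 < p)%N := prime_gt1 pp.
(* The multiple [h.+1 * h.+1 * p] of [p] keeps the truncated subtraction exact, by [sq_lt_box]. *)
pose f (u : 'I_h.+1 + 'I_h.+1) : 'I_p := match u with
  | inl i => Ordinal (ltn_pmod (i * i) p0) | inr j => Ordinal (ltn_pmod (h.+1 * h.+1 * p - 1 - j * j) p0) end.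
have /injectivePn[u [v uv E]] : ~~ injectiveb f.
  by apply/negP => /injectiveP/leq_card; rewrite card_sum !card_ord; lia.
have inj (i j : nat) : (i <= h)%N -> (j <= h)%N -> (p %| `|(i * i)%:Z - (j * j)%:Z|)%N -> i = j.
  move=> hi hj; have -> : `|(i * i)%:Z - (j * j)%:Z|%N = (`|i%:Z - j%:Z| * (i + j))%N.
    have -> : (i * i)%:Z - (j * j)%:Z = (i%:Z - j%:Z) * (i + j)%:Z by rewrite !PoszM PoszD; ring.
    by rewrite abszM.
  rewrite Euclid_dvdM // => /orP[] /dvdnP[k hk]; case: k hk => [|k]; nia.
have key (i j : 'I_h.+1) : f (inl i) = f (inr j) -> exists m : nat, (i * i + j * j + 1 = m * p)%N /\ (0 < m < p)%N.
  move=> /(congr1 val) /= /eqP Eij.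
  have hi := ltn_ord i; have hj := ltn_ord j.
  have : (p %| i * i + j * j + 1)%N.
    have hb := sq_lt_box hj p0.
    have : (i * i + (j * j + 1) == (h.+1 * h.+1 * p - 1 - j * j) + (j * j + 1) %[mod p])%N by rewrite eqn_modDr.
    have -> : (h.+1 * h.+1 * p - 1 - j * j + (j * j + 1) = h.+1 * h.+1 * p)%N by lia.
    by rewrite modnMl addnA.
  move=> /dvdnP[m hm]; exists m; split=> //.
  have ii : (i * i <= h * h)%N by apply: leq_mul; lia.
  have jj : (j * j <= h * h)%N by apply: leq_mul; lia.
  apply/andP; split; first by case: m hm => [|m]; lia.
  rewrite ltnNge; apply/negP => pm; have : (p * p <= m * p)%N by rewrite leq_mul2r pm orbT.
  rewrite -hm; have -> : (p * p = 4 * (h * h) + 4 * h + 1)%N by rewrite ph; lia.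
  by lia.
case: u v uv E => [i|i] [j|j] uv E.
- case/eqP: uv; congr inl; apply: val_inj; apply: inj; [by rewrite -ltnS; exact: ltn_ord|by rewrite -ltnS; exact: ltn_ord|].
  exact: mod_abs (congr1 val E).
- by have [m hm] := key _ _ E; exists i, j, m.
- by have [m hm] := key _ _ (esym E); exists j, i, m.
case/eqP: uv; congr inr; apply: val_inj; apply: inj; [by rewrite -ltnS; exact: ltn_ord|by rewrite -ltnS; exact: ltn_ord|].
have := congr1 val E; rewrite /= => E2.
have hi := ltn_ord i; have hj := ltn_ord j.
have bi := sq_lt_box hi p0; have bj := sq_lt_box hj p0.
have := mod_abs E2; congr (_ %| _)%N; lia.
Qed.

Lemma four_squares (n : nat) : S4 n%:Z.
Proof.
elim/ltn_ind: n => n IH; have [n1|n1] := leqP n 1.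
  by exists n%:Z, 0, 0, 0; case: n n1 {IH} => [|[|]].
have pp := pdiv_prime n1; have hd := pdiv_dvd n.
have Sp : S4 (pdiv n)%:Z.
  have [p2|p2] := eqVneq (pdiv n) 2%N; first by rewrite p2; exists 1, 1, 0, 0.
  have po : odd (pdiv n) by case: (even_prime pp) => // h; rewrite h in p2.
  have [x [y [m [E hm]]]] := prime_two_squares pp po.
  by apply: (S4_descent pp hm); exists x%:Z, y%:Z, 1, 0; lia.
rewrite -(divnK hd) PoszM; apply: S4_mul => //; apply: IH; apply: ltn_Pdiv; [exact: prime_gt1|lia].
Qed.
End FourSquares.

(** * Counting points of the shells in doubled coordinates *)

Module ShellCounting.
Require Import Defs.
From HB Require Import structures.
From mathcomp Require Import all_boot all_order all_algebra.
From mathcomp Require Import boolp classical_sets cardinality fsbigop reals.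

From mathcomp Require Import zify ring lra.
Import LatticeBasics HarmonicForms PowerSeries ThetaIdentities FourSquares.
Set Implicit Arguments. Unset Strict Implicit. Unset Printing Implicit Defensive.
Import Order.TTheory GRing.Theory Num.Theory.
Local Open Scope classical_set_scope.
Local Open Scope ring_scope.

Lemma fpsX_agree (P : {poly int}) (f : fps) N k : (forall i, (i <= N)%N -> P`_i = f i) ->
  forall i, (i <= N)%N -> (P ^+ k)`_i = (f ^+ k) i.
Proof.
move=> h; elim: k => [|k IH] i hi; first by rewrite !expr0 coef1.
by rewrite !exprS; apply/esym; apply: (@fmul_trunc _ _ _ N).
Qed.

Definition sqz (z : int) : nat := `|(z * z)%R|%N.
Definition fbox (k B : nat) := {ffun 'I_k -> 'I_B.*2.+1}.
Definition fz k B (u : fbox k B) (i : 'I_k) : int := zb B (u i).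
Definition nrm k B (u : fbox k B) : nat := (\sum_i sqz (fz u i))%N.

Lemma pow_box c k B N : (N <= B)%N -> (th c ^+ k) N = \sum_(u : fbox k B | nrm u == N) \prod_i c (fz u i).
Proof.
move=> NB.
pose P : {poly int} := \sum_(i < B.*2.+1) c (zb B i) *: 'X^(sqz (zb B i)).
have hP i : (i <= B)%N -> P`_i = th c i.
  move=> iB; rewrite (th_box _ iB) /zseq big_map big_enum_cond coef_sum [RHS]big_mkcond; apply: eq_bigr => j _ /=.
  rewrite coefZ coefXn; have -> : (i == sqz (zb B j)) = (zb B j * zb B j == i%:Z).
    apply/eqP/eqP => [->|h]; last by rewrite /sqz h.
    by rewrite /sqz; have := sq_ge0 (zb B j); lia.
  by case: ifP => _; rewrite ?mulr1 ?mulr0.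
rewrite -(fpsX_agree k hP NB).
have -> : P ^+ k = \prod_(i < k) P by rewrite prodr_const card_ord.
rewrite bigA_distr_bigA coef_sum [RHS]big_mkcond; apply: eq_bigr => u _ /=.
have -> : \prod_(i < k) (c (zb B (u i)) *: 'X^(sqz (zb B (u i)))) = (\prod_i c (fz u i)) *: 'X^(nrm u) :> {poly int}.
  rewrite /nrm; apply: (big_ind3 (fun x y z => x = y *: 'X^z)); first by rewrite scale1r expr0.
    by move=> x1 x2 x3 y1 y2 y3 -> ->; rewrite -scalerAl -scalerAr scalerA exprD.
  by [].
rewrite coefZ coefXn eq_sym; case: ifP => _; by rewrite ?mulr1 ?mulr0.
Qed.

(** This is [(-1)^z]. In [sig] the exponent is [z / 2] rounded down, so that for eight coordinates
    of equal parity the product of the [sig] tells whether their sum is divisible by 4. *)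
Definition sgn (z : int) : int := if ev z then 1 else -1.
Definition sig (z : int) : int := sgn (z %/ 2)%Z.
Lemma sgnD a b : sgn (a + b) = sgn a * sgn b.
Proof. by rewrite /sgn ev_add; case: (ev a); case: (ev b). Qed.
Lemma sgn_sum (I : finType) (w : I -> int) : \prod_i sgn (w i) = sgn (\sum_i w i).
Proof. by apply/esym; apply: (big_morph sgn sgnD). Qed.

Definition Am := th (fun z => ce z * sig z).
Lemma Am_sub4 : Am = sub 3 (TA - TB).
Proof.
rewrite /TA /TB -thN -thD sub4_th /thE; congr th; apply: funext => z; rewrite /ce /co /sig /sgn.
by case: (ev z); case: (ev (z %/ 2)%Z) => //=; rewrite ?mul1r ?mul0r.
Qed.
(** The reflection [z -> - z] preserves the odd numbers of given square and reverses [sig]. *)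
Lemma co_sig0 : th (fun z => co z * sig z) = 0.
Proof.
apply: funext => n; rewrite -[(0 : fps) n]/(0 : int).
set X := th _ n; suff : X = - X by lia.
rewrite {1}/X /th.
have -> : [set z : int | z * z = n%:Z]%classic = [set - z | z in [set z : int | z * z = n%:Z]]%classic.
  apply/seteqP; split=> z /=; last by move=> [y hy <-]; rewrite mulrNN.
  by move=> hz; exists (- z); rewrite ?opprK ?mulrNN.
rewrite fsbig_image => [|z z' _ _]; last by move/oppr_inj.
rewrite /X -[X in _ = - X]/(th (fun z => co z * sig z) n) -fpsN -thN; apply: eq_fsbigr => z _.
have [k [->|->]] := int_par z; first by rewrite /co /ev (_ : (2 %| _)%N) ?(_ : (2 %| `|2 * k|)%N) //; lia.
have -> : - (2 * k + 1) = 2 * (- k - 1) + 1 by ring.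
have E (j : int) : co (2 * j + 1) = 1 /\ sig (2 * j + 1) = sgn j.
  rewrite /co /sig /ev; split; first by rewrite (_ : (2 %| _)%N = false) //; lia.
  by congr sgn; rewrite mulrC divzMDl // divz_small // addr0.
rewrite !(E _).1 !(E _).2 !mul1r (_ : - k - 1 = - (k + 1)); last by ring.
have E2 : ev (- (k + 1)) = ~~ ev k by rewrite /ev; lia.
by rewrite /sgn E2; case: (ev k).
Qed.

(** Twice the theta series of [W8] in the doubled coordinates [2 y]: the all-even and the all-odd
    vectors, each with and without the sign that detects divisibility of the sum by 4. *)
Definition Wf : fps := TA ^+ 8 + Am ^+ 8 + TB ^+ 8 + th (fun z => co z * sig z) ^+ 8.

Lemma Wf_sub4 : Wf = 2%:R * sub 3 Gs.
Proof.
have b4 : TB ^+ 4 = 8%:R * (A4 * B4) * (A4 ^+ 2 + B4 ^+ 2).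
  transitivity ((TB * TB) ^+ 2); first by ring.
  rewrite hB2; transitivity (4%:R * (A2 * A2) * (B2 * B2)); first by ring.
  by rewrite hA4 hB4; ring.
rewrite /Wf co_sig0 Am_sub4 (_ : TB ^+ 8 = (TB ^+ 4) ^+ 2); last by ring.
rewrite b4 (_ : TA ^+ 8 = (A4 + B4) ^+ 8); last by rewrite -hA.
by rewrite /Gs !(subD, subN, subM, subX) -/A4 -/B4; ring.
Qed.

Lemma sub_bracket (s3 g f : fps) : 8%:R * Df s3 * g - 3%:R * s3 * Df g = 24%:R * f ->
  8%:R * sub 3 (Df s3) * sub 3 g - 3%:R * sub 3 s3 * sub 3 (Df g) = 24%:R * sub 3 f.
Proof. by move/(congr1 (sub 3)); rewrite subD subN !subM !sub_nat. Qed.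

(** Both series are series in [q^4], so each [Df] produces a factor 4, and [Wf] a factor 2: the
    result is 8 times [bracket] at [q^4]. *)
Lemma bracket4 m : F0 m = 0 -> (8%:R * Df (TA ^+ 3) * Wf - 3%:R * TA ^+ 3 * Df Wf) (4 * m)%N = 0.
Proof.
move=> h.
have -> : 8%:R * Df (TA ^+ 3) * Wf - 3%:R * TA ^+ 3 * Df Wf = 8%:R * (24%:R * sub 3 F0).
  have a3 : TA ^+ 3 = sub 3 ((TA + TB) ^+ 3) by rewrite subX -TA_sub4.
  have dW : Df Wf = 2%:R * (4%:R * sub 3 (Df Gs)) by rewrite Wf_sub4 mulr_natl mulr2n DfD Df_sub; ring.
  have dA : Df (TA ^+ 3) = 4%:R * sub 3 (Df ((TA + TB) ^+ 3)) by rewrite {1}a3 Df_sub.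
  have br := sub_bracket bracket.
  by rewrite -br dA dW Wf_sub4 {1}a3; ring.
by rewrite !fps_nat sub_mul h !mulr0.
Qed.

(** Membership in [W8] for half of the vector: integral differences become even ones, and an even
    sum becomes a sum divisible by 4. [condA] is the same for [Z^3]. *)
Definition condW B (w : fbox 8 B) : bool := [forall i, ev (fz w i - fz w ord0)] && (4 %| \sum_i fz w i)%Z.
Definition condA B (u : fbox 3 B) : bool := [forall i, ev (fz u i)].

Lemma prod_ce k B (u : fbox k B) : \prod_i ce (fz u i) = ([forall i, ev (fz u i)])%:R.
Proof.
case: forallP => h; first by rewrite big1 // => i _; rewrite /ce h.
have [i hi] : exists i, ~~ ev (fz u i) by apply/existsP; rewrite -negb_forall; apply/forallP.
by rewrite (bigD1 i) //= /ce (negbTE hi) mul0r.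
Qed.
Lemma prod_co k B (u : fbox k B) : \prod_i co (fz u i) = ([forall i, ~~ ev (fz u i)])%:R.
Proof.
case: forallP => h; first by rewrite big1 // => i _; rewrite /co h.
have [i hi] : exists i, ~~ ~~ ev (fz u i) by apply/existsP; rewrite -negb_forall; apply/forallP.
by rewrite (bigD1 i) //= /co (negbTE hi) mul0r.
Qed.

(** With [K] the sum of the rounded halves, the sum of the coordinates is [2 K] for all-even and
    [2 K + 8] for all-odd vectors; it is divisible by 4 exactly if [K] is even. *)
Lemma condWE B (w : fbox 8 B) : \prod_i ce (fz w i) + \prod_i (ce (fz w i) * sig (fz w i)) + \prod_i co (fz w i) + \prod_i (co (fz w i) * sig (fz w i)) = 2 * (condW w)%:R.
Proof.
rewrite !big_split /= prod_ce prod_co (sgn_sum (fun i => (fz w i %/ 2)%Z)) /condW.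
set K := \sum_i (fz w i %/ 2)%Z.
case: (boolP (ev (fz w ord0))) => e0.
  have -> : [forall i, ~~ ev (fz w i)] = false by apply/negbTE; rewrite negb_forall; apply/existsP; exists ord0; rewrite negbK.
  have -> : [forall i, ev (fz w i - fz w ord0)] = [forall i, ev (fz w i)] by apply: eq_forallb => i; rewrite ev_sub e0 eqb_id.
  case: forallP => h; last by rewrite /= !mul0r mulr0 !addr0.
  have -> : \sum_i fz w i = 2 * K.
    by rewrite /K mulr_sumr; apply: eq_bigr => i _; have := h i; rewrite /ev; have [k [->|->]] := int_par (fz w i); [rewrite mulKz|lia].
  by rewrite /sgn (_ : (4 %| 2 * K)%Z = ev K); [case: (ev K)|rewrite /ev; lia].
have -> : [forall i, ev (fz w i)] = false by apply/negbTE; rewrite negb_forall; apply/existsP; exists ord0.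
have -> : [forall i, ev (fz w i - fz w ord0)] = [forall i, ~~ ev (fz w i)] by apply: eq_forallb => i; rewrite ev_sub (negbTE e0) eqbF_neg.
case: forallP => h; last by rewrite /= !mul0r mulr0 !addr0.
have -> : \sum_i fz w i = 2 * K + 8.
  transitivity (\sum_i (2 * (fz w i %/ 2)%Z + 1)); last by rewrite big_split /= -mulr_sumr sumr_const card_ord.
  apply: eq_bigr => i _ /=; have := h i; rewrite /ev; have [k [->|->]] := int_par (fz w i); first by lia.
  by move=> _; rewrite (mulrC 2) divzMDl // divz_small // addr0 mulrC.
by rewrite /sgn (_ : (4 %| 2 * K + 8)%Z = ev K); [case: (ev K)|rewrite /ev; lia].
Qed.

(** The coefficient of [bracket4] at [4 m], expanded over pairs of points of the boxes. The factor 2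
    cancelled at the start is the one built into [Wf]. *)
Lemma count_zero m B : (4 * m <= B)%N -> F0 m = 0 ->
  \sum_(t : fbox 3 B * fbox 8 B | [&& condA t.1, condW t.2 & (nrm t.1 + nrm t.2 == 4 * m)%N]) (8 * (nrm t.1)%:Z - 3 * (nrm t.2)%:Z) = 0.
Proof.
move=> mB h; apply: (@mulfI _ (2 : int)) => //; rewrite mulr0; apply: (etrans _ (bracket4 h)); rewrite fpsD fpsN.
rewrite -(mulrA 8%:R) -(mulrA 3%:R) !fps_nat !fpsM.
have cA i : (i <= B)%N -> (TA ^+ 3) i = \sum_(u : fbox 3 B) (if nrm u == i then (condA u)%:R else 0).
  by move=> hi; rewrite /TA (pow_box _ _ hi) big_mkcond; apply: eq_bigr => u _; rewrite prod_ce.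
have cW j : (j <= B)%N -> Wf j = \sum_(w : fbox 8 B) (if nrm w == j then 2 * (condW w)%:R else 0).
  move=> hj; rewrite /Wf !fpsD /TA /TB /Am !(pow_box _ _ hj) -!big_split big_mkcond; apply: eq_bigr => w _ /=.
  by case: ifP => // _; rewrite condWE.
rewrite !mulr_sumr -sumrB.
transitivity (\sum_(i < (4 * m).+1) \sum_(t : fbox 3 B * fbox 8 B) (if (nrm t.1 == i) && (nrm t.2 == 4 * m - i)%N then (8 * i%:Z - 3 * (4 * m - i)%N%:Z) * ((condA t.1)%:R * (2 * (condW t.2)%:R)) else 0)); last first.
  apply: eq_bigr => i _; have hi : (i <= 4 * m)%N by rewrite -ltnS ltn_ord.
  rewrite /Df (cA i) ?(cW (4 * m - i)%N); [|lia|lia].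
  rewrite -(pair_big_dep xpredT (fun _ => xpredT) (fun u w => if (nrm u == i) && (nrm w == 4 * m - i)%N then (8 * i%:Z - 3 * (4 * m - i)%N%:Z) * ((condA u)%:R * (2 * (condW w)%:R)) else 0)) /=.
  set SA := (X in _ = 8%:R * (i%:R * X * _) - _); set SW := (X in _ = 8%:R * (_ * X) - _).
  transitivity ((8 * i%:Z - 3 * (4 * m - i)%N%:Z) * (SA * SW)); last by rewrite (natz i) (natz (4 * m - i)%N); ring.
  rewrite /SA mulr_suml mulr_sumr; apply: eq_bigr => u _.
  case: (nrm u == i); last by rewrite mul0r mulr0 big1.
  by rewrite /SW !mulr_sumr; apply: eq_bigr => w _ /=; case: ifP => _; rewrite ?mulr0.
rewrite exchange_big /= [in LHS]big_mkcond; apply: eq_bigr => t _.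
case: (boolP (condA t.1)) => /= cA1; last by rewrite big1 // => i _; case: ifP => // _; rewrite mul0r mulr0.
case: (boolP (condW t.2)) => /= cW1; last by rewrite big1 // => i _; case: ifP => // _; rewrite !mulr0.
case: eqP => hn; last first.
  by rewrite big1 // => i _; case: ifP => // /andP[/eqP h1 /eqP h2]; case: hn; rewrite h1 h2; have := ltn_ord i; lia.
have hi : (nrm t.1 < (4 * m).+1)%N by rewrite ltnS -hn leq_addr.
rewrite (bigD1 (Ordinal hi)) //= big1 ?addr0 => [|i hne]; last first.
  by case: ifP => // /andP[/eqP h1 _]; case/eqP: hne; apply: val_inj; rewrite /= h1.
have h2 : (4 * m - nrm t.1)%N = nrm t.2 by rewrite -hn addKn.
by rewrite eqxx h2 eqxx /= mul1r mulr1 mulrC.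
Qed.
End ShellCounting.

(** * Part (ii): symmetries and moments of the shells *)

Module CubicE8Designs.
Require Import Defs.
From HB Require Import structures.
From mathcomp Require Import all_boot all_order all_algebra.
From mathcomp Require Import boolp classical_sets cardinality fsbigop reals.

From mathcomp Require Import mpoly.
From mathcomp Require Import perm.
From mathcomp Require Import zify ring lra.
Import LatticeBasics HarmonicForms Neighbours PowerSeries ThetaIdentities FourSquares ShellCounting.
Set Implicit Arguments. Unset Strict Implicit. Unset Printing Implicit Defensive.
Import Order.TTheory GRing.Theory Num.Theory.
Local Open Scope classical_set_scope.
Local Open Scope ring_scope.

Section PartTwo.
Variable R : realType.
Notation isZ u := (u \is a Num.int).
Notation vec := 'rV[R]_(3 + 8).

Lemma dot_row (x x' : 'rV[R]_3) (y y' : 'rV[R]_8) : dot (row_mx x y) (row_mx x' y') = dot x x' + dot y y'.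
Proof. by rewrite /dot big_split_ord /=; congr (_ + _); apply: eq_bigr => i _; rewrite ?row_mxEl ?row_mxEr. Qed.
Lemma dot_sub (v : vec) : dot v v = dot (lsubmx v) (lsubmx v) + dot (rsubmx v) (rsubmx v).
Proof. by rewrite -{1 2}(hsubmxK v) dot_row. Qed.
Lemma Z3W8_row (x : 'rV[R]_3) y : @Z3W8 R (row_mx x y) <-> @Zlat R 3 x /\ @W8 R y.
Proof. by rewrite /Z3W8 /= row_mxKl row_mxKr. Qed.

(** The symmetries in use are sign changes and transpositions. All are involutions, so their
    bijectivity on a shell comes for free. *)
Definition good n (P : set 'rV[R]_n) (g : 'rV[R]_n -> 'rV[R]_n) :=
  [/\ forall x, P x -> P (g x), forall x, dot (g x) (g x) = dot x x & forall x, g (g x) = x].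
Definition flip n (E : pred 'I_n) (x : 'rV[R]_n) : 'rV[R]_n := \row_i (if E i then - x ord0 i else x ord0 i).
Definition swp n (k l : 'I_n) (x : 'rV[R]_n) : 'rV[R]_n := \row_i x ord0 (tperm k l i).

Lemma good_id n (P : set 'rV[R]_n) : good P id. Proof. by []. Qed.
Lemma good_flip n (P : set 'rV[R]_n) E : (forall x, P x -> P (flip E x)) -> good P (flip E).
Proof.
move=> h; split=> // x; first by apply: eq_bigr => i _; rewrite !mxE; case: ifP => // _; rewrite mulrNN.
by apply/rowP => i; rewrite mxE; case: ifP => hE; rewrite mxE hE ?opprK.
Qed.
Lemma good_swp n (P : set 'rV[R]_n) k l : (forall x, P x -> P (swp k l x)) -> good P (swp k l).
Proof.
move=> h; split=> // x; last by apply/rowP => i; rewrite !mxE tpermK.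
rewrite /dot [RHS](reindex_inj (@perm_inj _ (tperm k l))) /=; apply: eq_bigr => i _; by rewrite !mxE.
Qed.
Lemma Zlat_flip E (x : 'rV[R]_3) : @Zlat R 3 x -> @Zlat R 3 (flip E x).
Proof. by move=> h i; rewrite mxE; case: ifP => _; rewrite ?rpredN; exact: h. Qed.
Lemma Zlat_swp k l (x : 'rV[R]_3) : @Zlat R 3 x -> @Zlat R 3 (swp k l x).
Proof. by move=> h i; rewrite mxE; exact: h. Qed.
Lemma W8_diff (y : 'rV[R]_8) i j : @W8 R y -> isZ (y ord0 i - y ord0 j).
Proof.
move=> [_ [h _]]; have -> : y ord0 i - y ord0 j = (y ord0 i - y ord0 ord0) - (y ord0 j - y ord0 ord0) by ring.
by rewrite rpredB.
Qed.
Lemma W8_swp k l (y : 'rV[R]_8) : @W8 R y -> @W8 R (swp k l y).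
Proof.
move=> hy; have [h1 [h2 h3]] := hy; split; [|split].
- by move=> i; rewrite mxE.
- by move=> i; rewrite !mxE; exact: W8_diff.
move: h3; rewrite (reindex_inj (@perm_inj _ (tperm k l))) /= => h3.
by under eq_bigr do rewrite mxE.
Qed.
(** Two signs change together: half the coordinate sum then moves by [y_j + y_k], which is an
    integer also when the coordinates are half-odd. *)
Lemma W8_flip j k (y : 'rV[R]_8) : j != k -> @W8 R y -> @W8 R (flip (pred2 j k) y).
Proof.
move=> jk hy; have [h1 [h2 h3]] := hy.
have dd i : isZ (flip (pred2 j k) y ord0 i - y ord0 i).
  rewrite mxE; case: ifP => _; last by rewrite subrr.
  have -> : - y ord0 i - y ord0 i = - (2 * y ord0 i) by ring.
  by rewrite rpredN.
split; [|split].
- by move=> i; rewrite mxE; case: ifP => _ //; rewrite mulrN rpredN.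
- move=> i; have -> : flip (pred2 j k) y ord0 i - flip (pred2 j k) y ord0 ord0 = (flip (pred2 j k) y ord0 i - y ord0 i) + (y ord0 i - y ord0 ord0) - (flip (pred2 j k) y ord0 ord0 - y ord0 ord0) by ring.
  by apply: rpredB => //; apply: rpredD.
have -> : \sum_i flip (pred2 j k) y ord0 i = \sum_i y ord0 i - 2 * (y ord0 j + y ord0 k).
  rewrite (bigD1 j) //= (bigD1 k) 1?eq_sym //= [in RHS](bigD1 j) //= [in RHS](bigD1 k) 1?eq_sym //=.
  rewrite !mxE /= !eqxx orbT /= (eq_bigr (fun i => y ord0 i)); first by ring.
  by move=> i /andP[ij ik]; rewrite mxE /= (negbTE ij) (negbTE ik).
have -> : (\sum_i y ord0 i - 2 * (y ord0 j + y ord0 k)) / 2 = (\sum_i y ord0 i) / 2 - ((y ord0 j - y ord0 k) + 2 * y ord0 k) by field.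
by apply: rpredB => //; apply: rpredD => //; exact: W8_diff.
Qed.

Section Shell.
Variable m : nat.
Let X := shell (@Z3W8 R) m%:R.

Lemma Z3W8_int2 (v : vec) i : @Z3W8 R v -> isZ (2 * v ord0 i).
Proof.
move=> [h1 [h2 _]]; case: (split_ordP i) => j ->.
  by have := h1 j; rewrite mxE => h; rewrite rpredM ?rpred_nat.
by have := h2 j; rewrite mxE.
Qed.

Lemma X_finite : finite_set X.
Proof.
pose a (i : 'I_(3 + 8)) : vec := 2 *: delta_mx ord0 i.
have da (x : vec) i : dot x (a i) = 2 * x ord0 i.
  rewrite /a dotZr; congr (_ * _); rewrite /dot (bigD1 i) //= big1 ?addr0 => [|j ji].
    by rewrite mxE !eqxx mulr1.
  by rewrite mxE (negbTE ji) andbF mulr0.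
have oa : orthf a.
  split=> [i|i j ij]; last by rewrite da mxE mxE eq_sym (negbTE ij) andbF !mulr0.
  apply/eqP => h; have := dot0l (a i); rewrite -{1}h da !mxE !eqxx !mulr1 => /eqP.
  by rewrite mulf_eq0 !pnatr_eq0.
apply: (finite_frame (m := m%:R) oa) => x [hx hm]; split=> // i; rewrite da; exact: Z3W8_int2.
Qed.

Lemma sym_sum g3 g8 (F : vec -> R) : good (@Zlat R 3) g3 -> good (@W8 R) g8 ->
  \sum_(v \in X) F v = \sum_(v \in X) F (row_mx (g3 (lsubmx v)) (g8 (rsubmx v))).
Proof.
move=> [s3 d3 i3] [s8 d8 i8]; pose G (v : vec) : vec := row_mx (g3 (lsubmx v)) (g8 (rsubmx v)).
have GG v : G (G v) = v by rewrite /G row_mxKl row_mxKr i3 i8 hsubmxK.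
have GX v : X v -> X (G v).
  move=> [[h1 h2] hm]; split; first by apply/Z3W8_row; split; [exact: s3|exact: s8].
  by rewrite /G dot_row d3 d8 -dot_sub.
have E : X = G @` X.
  apply/seteqP; split=> v; first by move=> hv; exists (G v); [exact: GX|exact: GG].
  by move=> [w hw <-]; exact: GX.
by rewrite {1}E fsbig_image // => v w _ _ h; rewrite -(GG v) h GG.
Qed.

(** [emb] halves coordinates, hence divides norms by 4, and turns [count_zero] into a statement
    about the shell. The cut-off [4 m] suffices since no doubled coordinate exceeds its own
    square. *)
Lemma cross_sum : F0 m = 0 ->
  \sum_(v \in X) (8 * dot (lsubmx v) (lsubmx v) - 3 * dot (rsubmx v) (rsubmx v)) = 0.
Proof.
move=> hF; pose B := (4 * m)%N.
pose hv k (u : fbox k B) : 'rV[R]_k := \row_i ((fz u i)%:~R / 2).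
pose emb (t : fbox 3 B * fbox 8 B) : vec := row_mx (hv 3%N t.1) (hv 8%N t.2).
have hinj k (u u' : fbox k B) : hv k u = hv k u' -> u = u'.
  move=> h; apply/ffunP => i; apply: zb_inj; apply/eqP; rewrite -(eqr_int R); apply/eqP.
  have := congr1 (fun x : 'rV[R]_k => x ord0 i) h; rewrite !mxE => /(congr1 (fun t => t * 2)).
  by rewrite !divfK ?pnatr_eq0.
have einj : injective emb by move=> [u w] [u' w'] /eq_row_mx /= [/hinj -> /hinj ->].
have dh k (u : fbox k B) : dot (hv k u) (hv k u) = (nrm u)%:R / 4.
  rewrite /dot /nrm natr_sum mulr_suml; apply: eq_bigr => i _; rewrite !mxE.
  have -> : (sqz (fz u i))%:R = (fz u i)%:~R * (fz u i)%:~R :> R.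
    by rewrite -intrM pmulrn; congr (_%:~R); rewrite /sqz; have := sq_ge0 (fz u i); lia.
  by field.
have hev (z : int) : isZ (z%:~R / 2 : R) = ev z.
  have [k [->|->]] := int_par z.
    rewrite intrM mulrC mulKf ?pnatr_eq0 // intr_int; apply/esym; rewrite /ev; lia.
  have -> : ev (2 * k + 1) = false by rewrite /ev; lia.
  apply/negbTE/negP => /intrP[j hj]; have : (2 * k + 1)%:~R = (2 * j)%:~R :> R.
    by rewrite (intrM R 2 j) -hj [RHS]mulrC divfK // pnatr_eq0.
  by move/intr_inj; lia.
have h4 (z : int) : isZ (z%:~R / 2 / 2 : R) = (4 %| z)%Z.
  apply/idP/idP => [/intrP[j hj]|/dvdzP[j ->]].
    have hz : z%:~R = j%:~R * 4 :> R by rewrite -hj; field.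
    by apply/dvdzP; exists j; apply: (@intr_inj R); rewrite intrM hz.
  have -> : (j * 4)%:~R / 2 / 2 = j%:~R :> R by rewrite intrM; field.
  exact: intr_int.
have condE t : X (emb t) <-> [&& condA t.1, condW t.2 & (nrm t.1 + nrm t.2 == 4 * m)%N].
  have nE : dot (emb t) (emb t) = m%:R <-> (nrm t.1 + nrm t.2 == 4 * m)%N.
    rewrite dot_row !dh -mulrDl -natrD; split=> [h|/eqP ->]; last by rewrite natrM mulrC mulKf // pnatr_eq0.
    by rewrite -(eqr_nat R) natrM -h mulrC divfK // pnatr_eq0.
  have aE : @Zlat R 3 (hv 3%N t.1) <-> condA t.1.
    split=> [h|/forallP h i]; last by rewrite mxE hev.
    by apply/forallP => i; have := h i; rewrite mxE hev.
  have sE : (\sum_(i < 8) hv 8%N t.2 ord0 i) / 2 = (\sum_i fz t.2 i)%:~R / 2 / 2.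
    by rewrite rmorph_sum /= [in RHS]mulr_suml; congr (_ / _); apply: eq_bigr => i _; rewrite mxE.
  have wE : @W8 R (hv 8%N t.2) <-> condW t.2.
    have dE i : hv 8%N t.2 ord0 i - hv 8%N t.2 ord0 ord0 = (fz t.2 i - fz t.2 ord0)%:~R / 2.
      by first [rewrite !mxE -mulrBl; congr (_ / _); rewrite rmorphB; done | rewrite !mxE rmorphB /= mulrBl; done | rewrite /hv !mxE -mulrBl -rmorphB; done | rewrite /hv !mxE; rewrite rmorphB; ring].
    split=> [[_ [h2 h3]]|/andP[/forallP h2 h3]].
      by apply/andP; split; [apply/forallP => i; rewrite -hev -dE; exact: h2|rewrite -h4 -sE; exact: h3].
    split; first by move=> i; rewrite mxE mulrC divfK ?pnatr_eq0 // intr_int.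
    by split; [move=> i; rewrite dE hev|rewrite sE h4].
  split=> [[/Z3W8_row[/aE -> /wE ->] /nE ->]//|/and3P[/aE h1 /wE h2 /nE h3]].
  by split=> //; apply/Z3W8_row.
pose s := [seq emb t | t : (fbox 3 B * fbox 8 B)%type].
have us : uniq s by rewrite map_inj_uniq ?enum_uniq.
have xs v : X v -> v \in s.
  move=> [hv1 hm].
  have ex (i : 'I_(3 + 8)) : exists j : 'I_B.*2.+1, v ord0 i = (zb B j)%:~R / 2.
    have /intrP[z hz] := Z3W8_int2 i hv1.
    have vi : v ord0 i = z%:~R / 2 by rewrite -hz mulrC mulKf // pnatr_eq0.
    have hz2 : z * z <= (4 * m)%N%:Z.
      rewrite -(ler_int R) intrM -hz -pmulrn natrM -hm.
      have : v ord0 i * v ord0 i <= dot v v.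
        rewrite /dot (bigD1 i) //= lerDl; apply: sumr_ge0 => j _; by rewrite -expr2 sqr_ge0.
      have -> : 2 * v ord0 i * (2 * v ord0 i) = 4 * (v ord0 i * v ord0 i) by ring.
      by move=> h; apply: ler_wpM2l => //; rewrite ler0n.
    by have /mem_zseq/mapP[j _ hj] := sq_bound hz2 (leqnn B); exists j; rewrite vi hj.
  have [f hf] := boolp.choice ex.
  apply/mapP; exists ([ffun i => f (lshift 8 i)], [ffun i => f (rshift 3 i)]); first by rewrite mem_enum.
  apply/rowP => i; rewrite /emb /=; case: (split_ordP i) => j ->.
    by rewrite row_mxEl mxE /fz ffunE -hf.
  by rewrite row_mxEr mxE /fz ffunE -hf.
rewrite (fsumE _ us xs) big_map -big_mkcond /= big_enum_cond /=.
have := count_zero (leqnn B) hF => /(congr1 (fun z : int => z%:~R / 4 : R)); rewrite /= mulr0z mul0r => h0.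
rewrite -[RHS]h0 rmorph_sum mulr_suml; apply: eq_big => [t|t _].
  by apply/asboolP/idP => [/condE|h] //; exact/condE.
rewrite /emb row_mxKl row_mxKr !dh /=.
have -> : (8 * (nrm t.1)%:Z - 3 * (nrm t.2)%:Z)%:~R = 8 * (nrm t.1)%:R - 3 * (nrm t.2)%:R :> R by rewrite rmorphB !rmorphM.
by ring.
Qed.

(** Sign changes kill the mixed moments, transpositions make the diagonal ones constant on each of
    the two blocks, and [cross_sum] equates the two constants [u] and [w]: it reads
    [24 (u - w) = 0], the weights 8 and 3 being the ranks of the opposite blocks. *)
Lemma moment_design : F0 m = 0 -> forall S : 'M[R]_(3 + 8), \tr S = 0 -> \sum_(v \in X) qform S v = 0.
Proof.
move=> hF S hS; have [s us xs] := fin_seq X_finite.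
pose T k l : R := \sum_(v <- s) v ord0 k * v ord0 l.
have TE k l : T k l = \sum_(v \in X) v ord0 k * v ord0 l by rewrite (fsum_seq _ us xs).
have odd0 g3 g8 k l : good (@Zlat R 3) g3 -> good (@W8 R) g8 ->
    (forall v : vec, row_mx (g3 (lsubmx v)) (g8 (rsubmx v)) ord0 k * row_mx (g3 (lsubmx v)) (g8 (rsubmx v)) ord0 l = - (v ord0 k * v ord0 l)) -> T k l = 0.
  move=> h3 h8 h; suff : T k l = - T k l by lra.
  rewrite {1}TE (sym_sum _ h3 h8) (fsum_seq _ us xs) /T -sumrN; apply: eq_bigr => v _; exact: h.
have TC k l : T k l = T l k by apply: eq_bigr => v _; rewrite mulrC.
have TL a l : l != lshift 8 a -> T (lshift 8 a) l = 0.
  move=> hl; apply: (odd0 (flip (pred1 a)) id).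
  - apply: good_flip; exact: Zlat_flip.
  - exact: good_id.
  move=> v; case: (split_ordP l) hl => j -> hj.
    by rewrite !row_mxEl !mxE /= eqxx ifF ?mulNr //; apply/negbTE; apply: contraNneq hj => ->.
  by rewrite row_mxEl row_mxEr !mxE /= eqxx mulNr.
have TR a b : a != b -> T (rshift 3 a) (rshift 3 b) = 0.
  move=> ab; have [j ja jb] : exists2 j : 'I_8, j != a & j != b.
    have : (0 < #|~: [set a; b]|)%N by have := cardsC [set a; b]; rewrite cards2 ab card_ord; lia.
    by case/card_gt0P => j; rewrite !inE negb_or => /andP[ja jb]; exists j.
  have aj : a != j by rewrite eq_sym.
  apply: (odd0 id (flip (pred2 a j))).
  - exact: good_id.
  - by apply: good_flip => y; exact: W8_flip.
  move=> v; rewrite !row_mxEr !mxE /= eqxx /= ifF ?mulNr //.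
  by rewrite (eq_sym b a) (negbTE ab) eq_sym (negbTE jb).
have TLL a : T (lshift 8 a) (lshift 8 a) = T (lshift 8 ord0) (lshift 8 ord0).
  rewrite {1}TE (sym_sum _ (good_swp (@Zlat_swp a ord0)) (@good_id _ _)) (fsum_seq _ us xs); apply: eq_bigr => v _.
  by rewrite !row_mxEl !mxE tpermL.
have TRR a : T (rshift 3 a) (rshift 3 a) = T (rshift 3 ord0) (rshift 3 ord0).
  rewrite {1}TE (sym_sum _ (@good_id _ _) (good_swp (@W8_swp a ord0))) (fsum_seq _ us xs); apply: eq_bigr => v _.
  by rewrite !row_mxEr !mxE tpermL.
have LR : T (lshift 8 ord0) (lshift 8 ord0) = T (rshift 3 ord0) (rshift 3 ord0).
  have := cross_sum hF; rewrite (fsum_seq _ us xs) sumrB -!mulr_sumr /dot.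
  rewrite [X in 8 * X - _]exchange_big [X in _ - 3 * X]exchange_big /=.
  rewrite (eq_bigr (fun=> T (lshift 8 ord0) (lshift 8 ord0))) => [|i _]; last first.
    by rewrite -(TLL i); apply: eq_bigr => v _; rewrite !mxE.
  rewrite [X in _ - 3 * X](eq_bigr (fun=> T (rshift 3 ord0) (rshift 3 ord0))) => [|i _]; last first.
    by rewrite -(TRR i); apply: eq_bigr => v _; rewrite !mxE.
  rewrite !sumr_const !card_ord; move: (T (lshift 8 ord0) _) (T (rshift 3 ord0) _) => u w h.
  have : 24%:R * (u - w) = 0 by rewrite -h; ring.
  by move/eqP; rewrite mulf_eq0 pnatr_eq0 /= subr_eq0 => /eqP.
have Tkk k : T k k = T (rshift 3 ord0) (rshift 3 ord0).
  by case: (split_ordP k) => j ->; rewrite ?TLL ?TRR.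
have Tkl k l : k != l -> T k l = 0.
  move=> kl; case: (split_ordP k) kl => a -> kl; first by rewrite TL // eq_sym.
  case: (split_ordP l) kl => b -> kl; first by rewrite TC TL.
  by rewrite TR //; apply: contraNneq kl => ->.
transitivity (T (rshift 3 ord0) (rshift 3 ord0) * \tr S); last by rewrite hS mulr0.
rewrite (fsum_seq _ us xs) /qform exchange_big /= /mxtrace mulr_sumr.
apply: eq_bigr => k _; rewrite exchange_big /= (bigD1 k) //= [X in _ + X]big1 ?addr0 => [|l lk].
  by rewrite -mulr_sumr -(Tkk k) mulrC.
by rewrite -mulr_sumr -[X in _ * X]/(T k l) Tkl ?mulr0 // eq_sym.
Qed.
End Shell.

(** Split [8 b + 7] as [1 + (8 b + 6)]: the vector is [2 ^ a] times [(1, 0, 0)] together with an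
    integral vector made of four squares. Its coordinate sum is even because a number and its square
    have the same parity. *)
Lemma shell_nonempty a b : shell (@Z3W8 R) (4 ^ a * (8 * b + 7))%:R !=set0.
Proof.
have [p [q [r [s E]]]] := four_squares (8 * b + 6).
pose x : 'rV[R]_3 := \row_i (if i == ord0 then 2 ^+ a else 0).
pose c (j : 'I_8) : int := nth 0 [:: p; q; r; s] j.
pose y : 'rV[R]_8 := \row_j (2 ^+ a * (c j)%:~R).
exists (row_mx x y); split.
  apply/Z3W8_row; split; first by move=> i; rewrite mxE; case: ifP => _; rewrite -?natrX ?rpred_nat.
  have yi i : isZ (y ord0 i) by rewrite mxE -natrX rpredM ?rpred_nat ?intr_int.
  split; first by move=> i; rewrite rpredM ?rpred_nat.
  split; first by move=> i; rewrite rpredB.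
  have [k hk] : exists k, p + q + r + s = 2 * k.
    have sqp (z : int) : exists t, z * z = z + 2 * t.
      by have [k [->|->]] := int_par z; [exists (2 * k * k - k)|exists (2 * k * k + k)]; ring.
    have [t1 h1] := sqp p; have [t2 h2] := sqp q; have [t3 h3] := sqp r; have [t4 h4] := sqp s.
    by exists ((4 * b + 3)%N%:Z - (t1 + t2 + t3 + t4)); lia.
  have -> : (\sum_i y ord0 i) / 2 = 2 ^+ a * k%:~R.
    have -> : \sum_i y ord0 i = 2 ^+ a * (p + q + r + s)%:~R.
      by rewrite !big_ord_recl big_ord0 !mxE /c /= !rmorphD /=; ring.
    by rewrite hk intrM; field.
  by rewrite -natrX rpredM ?rpred_nat ?intr_int.
rewrite dot_row /dot !big_ord_recl !big_ord0 !mxE /c /= natrM natrX.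
have -> : (8 * b + 7)%:R = 1 + (p * p + q * q + r * r + s * s)%:~R :> R by rewrite -E -[1]/(1%:~R) -rmorphD /= pmulrn; congr (_%:~R); lia.
have -> : 4 = 2 * 2 :> R by ring.
by rewrite exprMn !rmorphD !rmorphM /=; ring.
Qed.

Lemma part_two a b : spherical_3design (shell (@Z3W8 R) (4 ^ a * (8 * b + 7))%:R).
Proof.
split; first exact: shell_nonempty.
split; first exact: X_finite.
split.
  move=> v [[h1 [h2 [h3 h4]]] hm]; split; last by rewrite dotNl dotNr opprK.
  split; first by move=> i; have := h1 i; rewrite !mxE rpredN.
  split; first by move=> i; have := h2 i; rewrite !mxE mulrN rpredN.
  split; first by move=> i; have := h3 i; rewrite !mxE -opprD rpredN.
  have -> : \sum_i rsubmx (- v) ord0 i = - \sum_i rsubmx v ord0 i by rewrite -sumrN; apply: eq_bigr => i _; rewrite !mxE.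
  by rewrite mulNr rpredN.
split; first by exists (4 ^ a * (8 * b + 7))%:R => v [].
move=> P /harmonic_form[S hS tS]; rewrite (eq_fsbigr (qform S)) => [|v _]; last exact: hS.
by apply: moment_design => //; exact: F0_van.
Qed.
End PartTwo.
End CubicE8Designs.

Require Import Defs.
From HB Require Import structures.
From mathcomp Require Import all_boot all_order all_algebra.
From mathcomp Require Import boolp classical_sets cardinality fsbigop reals.
From mathcomp Require Import mpoly.
Local Open Scope classical_set_scope.
Local Open Scope ring_scope.

Theorem theorem12p5 (R : realType) :
  (forall L : set 'rV[R]_24,
     selfdual_lattice L -> sigma_is L 16 ->
     forall a : nat,
       let m : R := (2 * 4 ^ a)%:R in
       (shell L m !=set0 -> spherical_3design (shell L m)) /\
       (shell (shadow L) m !=set0 -> spherical_3design (shell (shadow L) m))) /\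
  (forall a b : nat,
     spherical_3design (shell (@Z3W8 R) (4 ^ a * (8 * b + 7))%:R)).
Proof.
by split; [exact: (@ShadowDesigns.part_one R)|exact: (@CubicE8Designs.part_two R)].
Qed.
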